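(* Let $q$ be a power of a prime number, and let $\mathfrak{p}=(p(T))$ be a nonzero prime ideal of $A=\mathbb{F}_q[T]$ with $p(T)$ monic irreducible of degree $d$ and $p(T)\ne T$. Let $\alpha$ be a root of $p(T)$ and let $\mathbb{F}_{\mathfrak{p}}^{(2)}$ be the quadratic extension of $\mathbb{F}_{\mathfrak{p}}=A/\mathfrak{p}=\mathbb{F}_q(\alpha)$. Let $\mathcal{E}=(E_0,E_1,E_2,\dots)$ be the tower of function fields over $\mathbb{F}_{\mathfrak{p}}^{(2)}$ recursively defined by the equation $$Y(Y+1)^{q-1}=\frac{X^q}{(\alpha(X+1))^{q-1}}.$$ Then the tower $\mathcal{E}/\mathbb{F}_{\mathfrak{p}}^{(2)}$ is asymptotically optimal, that is, $\lambda(\mathcal{E})=q^d-1$.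
   Context: That $\mathcal{E}$ is recursively defined by the equation means: $E_0=\mathbb{F}_{\mathfrak{p}}^{(2)}(x_0)$ is a rational function field, and for each $n\ge0$, $E_{n+1}=E_n(x_{n+1})$ where $x_{n+1}(x_{n+1}+1)^{q-1}=x_n^q/(\alpha(x_n+1))^{q-1}$ and $[E_{n+1}:E_n]=q$; each $E_n$ has full constant field $\mathbb{F}_{\mathfrak{p}}^{(2)}$. $N(E_n/\mathbb{F}_{\mathfrak{p}}^{(2)})$ is the number of places of $E_n$ of degree one, $g(E_n)$ is the genus of $E_n$, and $\lambda(\mathcal{E}):=\lim_{n\to\infty}N(E_n/\mathbb{F}_{\mathfrak{p}}^{(2)})/g(E_n)$. The tower is called asymptotically optimal if $\lambda(\mathcal{E})$ equals Ihara's constant of the constant field, here $q^d-1$ since the constant field has $q^{2d}$ elements. *)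

(* Defs.v *)
From HB Require Import structures.
From mathcomp Require Import all_boot all_order all_algebra all_field finmap.
From mathcomp Require Import all_classical all_reals all_analysis.
Set Implicit Arguments.
Unset Strict Implicit.
Unset Printing Implicit Defensive.
Import Order.TTheory GRing.Theory Num.Theory.
Import numFieldNormedType.Exports.
Local Open Scope classical_set_scope.
Local Open Scope ring_scope.

(* Conventions: a field extension F / k is a ring morphism iota : k -> F.
   Numerical invariants which are only meaningful when some object exists
   (dimension, valuation, genus) are given by [xget], with value 0 in the
   case where no such object exists. *)

Section Dimension.
Variables (k F : fieldType) (iota : {rmorphism k -> F}).

(* For k-subspaces W of V in F: n elements of V form a basis of V / W. *)
Definition has_quotient_basis (V W : set F) (n : nat) : Prop :=
  exists b : 'I_n -> F, (forall i, V (b i)) /\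
    forall y, V y ->
      exists! c : {ffun 'I_n -> k}, W (y - \sum_(i < n) iota (c i) * b i).

Definition quotient_dim (V W : set F) : nat :=
  xget 0%N [set n | has_quotient_basis V W n].

(* [F : k] = n, finite. *)
Definition has_degree (n : nat) : Prop := has_quotient_basis setT [set 0] n.

(* F = k(x): F is its only subfield containing k and x. *)
Definition generated_by (x : F) : Prop :=
  forall S : {pred F}, divring_closed S ->
    (forall c, iota c \in S) -> x \in S -> forall y, y \in S.

Definition full_constant_field : Prop :=
  forall z : F, algebraicOver iota z -> exists c, z = iota c.

End Dimension.

(* A place is represented by its valuation ring O, with k <= O < F; the place
   itself is the maximal ideal [place_ideal] of O, which determines O.
   The type F -> bool of O is convertible to {pred F}, but the latter raises the
   universe of [place] to a level incompatible with the algC library. *)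
Record place (k F : fieldType) (iota : {rmorphism k -> F}) := Place {
  place_ring : F -> bool;
  place_subring : subring_closed place_ring;
  place_const : forall c, iota c \in place_ring;
  place_proper : exists z, z \notin place_ring;
  place_valuation : forall z, (z \in place_ring) || (z^-1 \in place_ring)
}.

HB.instance Definition _ (k F : fieldType) (iota : {rmorphism k -> F}) :=
  gen_eqMixin (place iota).
HB.instance Definition _ (k F : fieldType) (iota : {rmorphism k -> F}) :=
  gen_choiceMixin (place iota).

Section Places.
Variables (k F : fieldType) (iota : {rmorphism k -> F}).
Local Notation place := (place iota).

Definition place_unit (P : place) (u : F) : Prop :=
  [/\ u != 0, u \in place_ring P & u^-1 \in place_ring P].

Definition place_ideal (P : place) : set F :=
  [set z | z \in place_ring P /\ ~ place_unit P z].

(* [O_P / P : k] *)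
Definition place_degree (P : place) : nat :=
  quotient_dim iota [set` place_ring P] (place_ideal P).

(* t O_P = P *)
Definition prime_element (P : place) (t : F) : Prop :=
  place_ideal P = [set t * y | y in [set` place_ring P]].

(* Meaningful for f != 0 only. *)
Definition valuation (P : place) (f : F) : int :=
  xget 0 [set n : int | exists t u,
    [/\ prime_element P t, place_unit P u & f = u * t ^ n]].

Definition divisor := {fsfun place -> int with 0}.

Definition divisor_degree (D : divisor) : int :=
  \sum_(P <- finsupp D) D P * (place_degree P)%:Z.

Definition riemann_roch_space (D : divisor) : set F :=
  [set f | f = 0 \/ forall P : place, - D P <= valuation P f].

(* l(D) = dim_k L(D) *)
Definition riemann_roch_dim (D : divisor) : nat :=
  quotient_dim iota (riemann_roch_space D) [set 0].

(* g = max { deg D - l(D) + 1 : D a divisor of F / k } *)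
Definition genus : nat :=
  xget 0%N [set g : nat |
    (exists D : divisor,
       divisor_degree D - (riemann_roch_dim D)%:Z + 1 = g%:Z) /\
    (forall D : divisor,
       divisor_degree D - (riemann_roch_dim D)%:Z + 1 <= g%:Z)].

Definition num_rational_places : nat :=
  #|` fset_set [set P : place | place_degree P = 1%N] |.

End Places.

(* E_0 <= E_1 <= E_2 <= ... as extensions of k. *)
Record tower (k : fieldType) := Tower {
  tower_field :> nat -> fieldType;
  tower_const : forall n, {rmorphism k -> tower_field n};
  tower_incl : forall n, {rmorphism tower_field n -> tower_field n.+1};
  tower_compat : forall n c,
    tower_incl n (tower_const n c) = tower_const n.+1 c
}.

(* E is recursively defined, with generators x_n, by
   Y (Y + 1)^(q-1) = X^q / (alpha (X + 1))^(q-1). *)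
Record recursively_defined (k : fieldType) (q : nat) (alpha : k) (E : tower k)
    (x : forall n, E n) : Prop := RecursivelyDefined {
  rec_transcendental : ~ algebraicOver (tower_const E 0) (x 0%N);
  rec_rational : generated_by (tower_const E 0) (x 0%N);
  rec_generated : forall n, generated_by (tower_incl E n) (x n.+1);
  rec_equation : forall n,
    x n.+1 * (x n.+1 + 1) ^+ q.-1 =
    tower_incl E n
      (x n ^+ q / (tower_const E n alpha * (x n + 1)) ^+ q.-1);
  rec_degree : forall n, has_degree (tower_incl E n) q;
  rec_full_constants : forall n, full_constant_field (tower_const E n)
}.

(* lambda(E) = l, i.e. N(E_n) / g(E_n) tends to l. *)
Definition tower_limit (R : realType) (k : fieldType) (E : tower k) (l : R)
    : Prop :=
  (fun n => (num_rational_places (tower_const E n))%:R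
            / (genus (tower_const E n))%:R : R) @ \oo --> l.

(* Main.v *)
(* Write [x_i] for the generators. In [E_n] a place is either the common pole of the
   [x_i], the zero of [x_n], a place where exactly one [x_p] equals -1, or a place where all
   [x_i] and [x_i + 1] are units. Ramification is wild, but where [x_p = -1] the elements
   [x_(p-j)] and [1/x_(p+j)] agree to high order, which makes the step unramified there as
   long as [p] is more than half of the length of the chain. Knowing the local integral bases
   in powers of [1/(x_n + 1)], one lifts Riemann's theorem from [E_n] to [E_(n+1)] and finds
   [(q-1) g_n = q^(n+1) + 1 - q^(n/2+1) - q^((n+1)/2)], with integer divisions.

   The equation relates Drinfeld modules of rank 2 under an isogeny, and the supersingular ones
   in characteristic [p(T)] give a set [S] of [q (q^d - 1)/(q - 1)] values in the constant field
   which contains all [q] solutions [Y] for each [X] in it. So the places [x_0 = c], with [c] in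
   [S], split completely and [N_n >= q^n |S|].

   Apart from [O(q^(n/2))] ramified ones, the remaining rational places correspond to walks
   of length [n] in the finite graph of the equation outside [S]. If no vertex set of this
   graph is full, that is, contains [q] successors of each of its elements, their number is
   [o(q^n)]. Now if [S] and [C] were disjoint full sets, the quotient of suitable powers
   of [\prod_(c in S) (X - c)] and [\prod_(c in C) (X - c)] would take the same value at [x_0]
   and [x_1]; this is impossible at the common zero of [x_0] and [x_1], where [x_1]
   vanishes to a higher order. Hence [N_n / q^n -> |S|] and [g_n / q^n -> q/(q-1)]. *)
Require Import Defs.
From mathcomp Require Import all_boot all_order all_algebra all_field finmap.
From mathcomp Require Import all_classical all_reals all_analysis.
From mathcomp Require Import zify ring lra.
Set Implicit Arguments.
Unset Strict Implicit.
Unset Printing Implicit Defensive.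
Import Order.TTheory GRing.Theory Num.Theory.
Import numFieldNormedType.Exports.
Local Open Scope classical_set_scope.
Local Open Scope ring_scope.

(** * Dimensions of quotients *)

(** The genus is never computed through differents. Filtering the functions with poles only at
    infinity by their degree in [Z = 1/(x_(n+1) + 1)] reduces a dimension upstairs to dimensions
    downstairs, so a local basis matters only through the valuations of its leading coefficients.

    The agreement at [x_p = -1] has a cause: for an edge from [x] to [y], the function
    [W = x/(al (x+1) (y+1))] satisfies both [W^q + W/x = 1/(al (x+1))] and
    [W^q + y W = y/(al (y+1))], and these equations coincide when the [y] of one edge is the [1/x]
    of another. So the [W] of an edge before the peak is an approximate root for the mirror edge
    after it, and subtracting it removes the pole that would cause ramification. Each step divides
    the precision by [q]; after [p] steps it is used up.

    The size of [S] comes from a truncated logarithm: the coefficient of [tau^d] in the action of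
    [p(T)] is, up to nonzero factors, a polynomial of degree [(q^d - 1)/(q - 1)] in [u^(q+1)] with
    simple roots, and [u^(q+1)] is a polynomial of degree [q] in [x]. *)

Lemma ex_choice (X Y : Type) (P : X -> Y -> Prop) :
  (forall x, exists y, P x y) -> exists f : X -> Y, forall x, P x (f x).
Proof. by move=> /choice[f ?]; exists f. Qed.

Section QuotientDimension.
Variables (k F : fieldType) (iota : {rmorphism k -> F}).

Definition subspace (V : set F) :=
  V 0 /\ forall c u v, V u -> V v -> V (iota c * u + v).

Definition lin_on (F' : Type) (act : k -> F' -> F') (add : F' -> F' -> F')
    (V : set F) (phi : F -> F') :=
  forall c u v, V u -> V v -> phi (iota c * u + v) = add (act c (phi u)) (phi v).

Definition coord_on n (V : set F) (phi : F -> 'rV[k]_n) :=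
  lin_on (fun c r => c *: r) (fun r s => r + s) V phi.

(** Coordinates instead of a basis: a total function on [F] which need only be linear on [V], so
    that comparisons of dimensions become ranks of matrices. [qdimP] shows that this agrees with
    [has_quotient_basis]. *)
Definition qdim (V W : set F) (n : nat) := exists phi : F -> 'rV[k]_n,
  [/\ coord_on V phi, forall v, V v -> (phi v = 0 <-> W v)
    & forall r, exists2 v, V v & phi v = r].

Lemma subspaceD V u v : subspace V -> V u -> V v -> V (u + v).
Proof. by move=> [_ sV] Vu Vv; rewrite -[u]mul1r -(rmorph1 iota); apply: sV. Qed.

Lemma subspaceZ V c u : subspace V -> V u -> V (iota c * u).
Proof. by move=> [V0 sV] Vu; rewrite -[_ * _]addr0; apply: sV. Qed.

Lemma subspaceN V u : subspace V -> V u -> V (- u).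
Proof.
by move=> sV Vu; rewrite -mulN1r -(rmorphN1 iota); apply: subspaceZ.
Qed.

Lemma subspaceB V u v : subspace V -> V u -> V v -> V (u - v).
Proof. by move=> sV Vu Vv; apply: subspaceD => //; apply: subspaceN. Qed.

Lemma subspace_sum V (I : finType) (c : I -> k) (b : I -> F) : subspace V ->
  (forall i, V (b i)) -> V (\sum_i iota (c i) * b i).
Proof.
move=> sV Vb; apply: (big_ind V) => [|u v|i _]; first by case: sV.
  exact: subspaceD.
exact: subspaceZ.
Qed.

Lemma subspaceI V W : subspace V -> subspace W -> subspace (V `&` W).
Proof.
move=> [V0 sV] [W0 sW]; split=> [|c u v [Vu Wu] [Vv Wv]]; first by split.
by split; [apply: sV | apply: sW].
Qed.

Lemma subspace_set0 : subspace [set 0].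
Proof. by split=> [|c u v /= -> ->]; rewrite ?mulr0 ?addr0. Qed.

Lemma coord0 n V (phi : F -> 'rV[k]_n) : subspace V -> coord_on V phi -> phi 0 = 0.
Proof.
move=> [V0 _] lin; have := lin 1 _ _ V0 V0.
by rewrite mulr0 addr0 scale1r => /eqP; rewrite -subr_eq0 opprD addNKr oppr_eq0 => /eqP.
Qed.

Lemma coord_sum n V (phi : F -> 'rV[k]_n) (I : finType) (c : I -> k) (b : I -> F) :
  subspace V -> coord_on V phi -> (forall i, V (b i)) ->
  phi (\sum_i iota (c i) * b i) = \sum_i c i *: phi (b i).
Proof.
move=> sV lin Vb.
suff /(_ (index_enum I)) [_ ->//] : forall s, V (\sum_(i <- s) iota (c i) * b i) /\
  phi (\sum_(i <- s) iota (c i) * b i) = \sum_(i <- s) c i *: phi (b i).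
elim=> [|i s [Vs IH]]; first by rewrite !big_nil (coord0 sV lin); case: sV.
rewrite !big_cons; split; first by case: sV => _; apply.
by rewrite lin ?IH.
Qed.

Lemma coordB n V (phi : F -> 'rV[k]_n) u v : subspace V -> coord_on V phi ->
  V u -> V v -> phi (u - v) = phi u - phi v.
Proof.
move=> sV lin Vu Vv; have -> : u - v = iota (-1) * v + u.
  by rewrite rmorphN1 mulN1r addrC.
by rewrite lin // scaleN1r addrC.
Qed.

(** A maximal free family among the vectors [phi v] spans the image of [phi]; coordinates in that
    family, obtained with [pinvmx], turn [phi] into a surjection onto a smaller space of rows. *)
Lemma qdim_rank V W n (phi : F -> 'rV[k]_n) : subspace V -> coord_on V phi ->
  (forall v, V v -> (phi v = 0 <-> W v)) -> exists2 m, (m <= n)%N & qdim V W m.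
Proof.
move=> sV lin kerW.
pose good m := exists b : 'I_m -> F, (forall i, V (b i)) /\
  row_free (\matrix_(i < m) phi (b i)).
have good_le m : good m -> (m <= n)%N.
  by move=> [b [_ /eqP <-]]; apply: rank_leq_col.
have g0 : exists m, `[< good m >].
  exists 0; apply/asboolP; exists (fun _ => 0); split; first by case=> [].
  by rewrite /row_free flatmx0 mxrank0.
have bnd m : `[< good m >] -> (m <= n)%N by move=> /asboolP /good_le.
case: (ex_maxnP g0 bnd) => m /asboolP [b [Vb free]] mmax.
exists m; first by apply: good_le; exists b.
set B := \matrix_i phi (b i) in free.
have sub v : V v -> (phi v <= B)%MS.
  move=> Vv; apply: contrapT => /negP nsub.
  have : good m.+1.
    exists (fun i => if unlift ord0 i is Some i' then b i' else v); split.
      by move=> i; case: unliftP.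
    rewrite -row_leq_rank.
    have le : (col_mx (phi v) B <= \matrix_i phi (if unlift (@ord0 m) i is Some i' then b i' else v))%MS.
      rewrite col_mx_sub; apply/andP; split.
        set M := (\matrix_i _); have -> : phi v = row ord0 M.
          by rewrite rowK unlift_none.
        exact: row_sub.
      apply/row_subP => i; rewrite rowK; set M := (\matrix_i _).
      have -> : phi (b i) = row (lift ord0 i) M by rewrite rowK liftK.
      exact: row_sub.
    apply: leq_trans (mxrankS le); rewrite -addsmxE.
    have : (B < phi v + B)%MS.
      by rewrite ltmxE addsmxSr /=; apply: contra nsub; apply: submx_trans (addsmxSl _ _).
    by move/rank_ltmx; move/eqP: free => ->.
  by move=> /asboolP /mmax; rewrite ltnn.
exists (fun v => phi v *m pinvmx B); split.
- by move=> c u v Vu Vv; rewrite lin // mulmxDl scalemxAl.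
- move=> v Vv; rewrite -kerW //; split=> [e|->]; last by rewrite mul0mx.
  by rewrite -(mulmxKpV (sub v Vv)) e mul0mx.
- move=> r; exists (\sum_i iota (r 0 i) * b i); first exact: subspace_sum.
  rewrite (coord_sum _ sV lin) //.
  have -> : \sum_i r 0 i *: phi (b i) = r *m B.
    by rewrite mulmx_sum_row; apply: eq_bigr => i _; rewrite rowK.
  by rewrite -mulmxA mulmxVp // mulmx1.
Qed.

End QuotientDimension.

Lemma qdim_le (k F F' : fieldType) (iota : {rmorphism k -> F}) (iota' : {rmorphism k -> F'})
    (V W : set F) (V' W' : set F') n n' (theta : F -> F') :
  subspace iota V -> subspace iota' V' -> qdim iota V W n -> qdim iota' V' W' n' ->
  (forall c u v, V u -> V v ->
     theta (iota c * u + v) = iota' c * theta u + theta v) ->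
  (forall v, V v -> V' (theta v)) ->
  (forall v, V v -> (W' (theta v) <-> W v)) -> (n <= n')%N.
Proof.
move=> sV sV' [phi [lin ker onto]] [psi [lin' ker' _]] thl th thW.
have [f hf] : exists f : 'I_n -> F, forall i, V (f i) /\ phi (f i) = delta_mx 0 i.
  apply: (ex_choice (P := fun i x => V x /\ phi x = delta_mx 0 i)) => i.
  by have [v] := onto (delta_mx 0 i); exists v.
have Vf i : V (f i) by case: (hf i).
suff : row_free (\matrix_i psi (theta (f i))) by move=> /eqP <-; apply: rank_leq_col.
apply/row_freeP.
apply/row_freeP; rewrite -kermx_eq0; apply/eqP/row_matrixP => i.
rewrite row0; set r := row i _.
have rB : r *m (\matrix_i psi (theta (f i))) = 0.
  by rewrite /r -row_mul mulmx_ker row0.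
have lin2 : coord_on iota V (psi \o theta).
  by move=> c u v Vu Vv /=; rewrite thl // lin' //; apply: th.
have e : psi (theta (\sum_i iota (r 0 i) * f i)) = 0.
  rewrite -[LHS]/((psi \o theta) _) (coord_sum _ sV lin2) // -[RHS]rB mulmx_sum_row.
  by apply: eq_bigr => j _; rewrite rowK.
have Vs : V (\sum_i iota (r 0 i) * f i) by apply: subspace_sum.
have /(ker _ Vs) : W (\sum_i iota (r 0 i) * f i).
  by apply/(thW _ Vs)/ker' => //; apply: th.
rewrite (coord_sum _ sV lin) // => <-.
rewrite [LHS](row_sum_delta r); apply: eq_bigr => j _.
by case: (hf j) => _ ->.
Qed.

Lemma qdim_iso (k F F' : fieldType) (iota : {rmorphism k -> F}) (iota' : {rmorphism k -> F'})
    (V W : set F) (V' W' : set F') n (theta : F -> F') :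
  subspace iota V -> qdim iota' V' W' n ->
  (forall c u v, V u -> V v ->
     theta (iota c * u + v) = iota' c * theta u + theta v) ->
  (forall v, V v -> V' (theta v)) ->
  (forall v, V v -> (W' (theta v) <-> W v)) ->
  (forall v, V' v -> exists2 u, V u & theta u = v) -> qdim iota V W n.
Proof.
move=> sV [phi [lin ker onto]] thl th thW tho; exists (phi \o theta); split.
- by move=> c u v Vu Vv /=; rewrite thl // lin //; apply: th.
- by move=> v Vv /=; rewrite ker ?thW //; apply: th.
- by move=> r; have [v /tho[u Vu <-] <-] := onto r; exists u.
Qed.

Section QuotientDimension2.
Variables (k F : fieldType) (iota : {rmorphism k -> F}).
Local Notation subspace := (subspace iota).
Local Notation qdim := (qdim iota).
Local Notation coord_on := (coord_on iota).

Lemma qdim_sub V V' W n : subspace V -> subspace V' -> V' `<=` V -> qdim V W n ->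
  exists2 m, (m <= n)%N & qdim V' W m.
Proof.
move=> sV sV' VV [phi [lin ker _]]; apply: (@qdim_rank _ _ _ _ _ _ phi) => //.
  by move=> c u v /VV Vu /VV Vv; apply: lin.
by move=> v /VV; apply: ker.
Qed.

Lemma qdim_uniq V W n n' : subspace V -> qdim V W n -> qdim V W n' -> n = n'.
Proof.
move=> sV h h'; apply/eqP; rewrite eqn_leq; apply/andP.
by split; [apply: (@qdim_le _ _ _ iota iota _ _ _ _ _ _ id sV sV h h') | apply: (@qdim_le _ _ _ iota iota _ _ _ _ _ _ id sV sV h' h)].
Qed.

Lemma qdim_add U V W a b : subspace U -> subspace V -> W `<=` V -> V `<=` U ->
  qdim U V a -> qdim V W b -> qdim U W (a + b).
Proof.
move=> sU sV WV VU [p1 [l1 k1 o1]] [p2 [l2 k2 o2]].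
have [s hs] : exists s : 'I_a -> F, forall i, U (s i) /\ p1 (s i) = delta_mx 0 i.
  apply: (ex_choice (P := fun i x => U x /\ p1 x = delta_mx 0 i)) => i.
  by have [v] := o1 (delta_mx 0 i); exists v.
have Us i : U (s i) by case: (hs i).
pose sec (r : 'rV[k]_a) := \sum_i iota (r 0 i) * s i.
have Usec r : U (sec r) by apply: (@subspace_sum _ _ iota).
have p1sec r : p1 (sec r) = r.
  rewrite (coord_sum _ sU l1) // [RHS](row_sum_delta r).
  by apply: eq_bigr => i _; case: (hs i) => _ ->.
have secl c r r' : sec (c *: r + r') = iota c * sec r + sec r'.
  rewrite mulr_sumr -big_split /=; apply: eq_bigr => i _.
  by rewrite !mxE rmorphD rmorphM mulrDl mulrA.
pose rst y := y - sec (p1 y).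
have Vrst y : U y -> V (rst y).
  move=> Uy; apply/k1; first exact: (@subspaceB _ _ iota).
  by rewrite (coordB sU l1) // p1sec subrr.
have rstl c u v : U u -> U v -> rst (iota c * u + v) = iota c * rst u + rst v.
  move=> Uu Uv; rewrite /rst l1 // secl; ring.
exists (fun y => row_mx (p1 y) (p2 (rst y))); split.
- move=> c u v Uu Uv; rewrite l1 // rstl // l2; try exact: Vrst.
  by rewrite scale_row_mx add_row_mx.
- move=> v Uv; split.
    rewrite -[X in _ = X]row_mx0 => /eq_row_mx [e1 e2].
    have : W (rst v) by apply/k2 => //; apply: Vrst.
    have s0 : sec 0 = 0 by apply: big1 => i _; rewrite mxE rmorph0 mul0r.
    by rewrite /rst e1 s0 subr0.
  move=> Wv; have Vv := WV _ Wv.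
  have e1 : p1 v = 0 by apply/k1.
  have s0 : sec 0 = 0 by apply: big1 => i _; rewrite mxE rmorph0 mul0r.
  by rewrite /rst e1 s0 subr0 (k2 _ Vv).2 // row_mx0.
- move=> r; have [w Vw ew] := o2 (rsubmx r).
  exists (sec (lsubmx r) + w); first by apply: (@subspaceD _ _ iota) => //; apply: VU.
  have e1 : p1 (sec (lsubmx r) + w) = lsubmx r.
    have -> : sec (lsubmx r) + w = iota 1 * sec (lsubmx r) + w by rewrite rmorph1 mul1r.
    by rewrite l1 //; [rewrite p1sec scale1r (k1 _ (VU _ Vw)).2 // addr0 | apply: VU].
  by rewrite /rst e1 addrAC subrr add0r ew hsubmxK.
Qed.

Lemma qdim_refl V : subspace V -> qdim V V 0.
Proof.
move=> sV; exists (fun _ => 0); split.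
- by move=> *; rewrite scaler0 addr0.
- by [].
- by move=> r; exists 0; [case: sV | rewrite [r]thinmx0].
Qed.

Lemma qdim_onto V W V' W' n : subspace V -> subspace V' -> V' `<=` V ->
  (forall v, V' v -> (W v <-> W' v)) -> W `<=` V -> qdim V W n -> qdim V' W' n ->
  forall v, V v -> exists2 v', V' v' & W (v - v').
Proof.
move=> sV sV' VV WW WsubV [phi [lin ker onto]] [psi [lin' ker' onto']] v Vv.
have [s hs] : exists s : 'I_n -> F, forall i, V' (s i) /\ psi (s i) = delta_mx 0 i.
  apply: (ex_choice (P := fun i x => V' x /\ psi x = delta_mx 0 i)) => i.
  by have [w] := onto' (delta_mx 0 i); exists w.
have V's i : V' (s i) by case: (hs i).
have Vs i : V (s i) by apply: VV.
pose A := \matrix_i phi (s i).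
have Afree : row_free A.
  rewrite -kermx_eq0; apply/eqP/row_matrixP => i.
  rewrite row0; set r := row i _.
  have rA : r *m A = 0 by rewrite /r -row_mul mulmx_ker row0.
  have V'r : V' (\sum_i iota (r 0 i) * s i) by apply: (@subspace_sum _ _ iota).
  have /(ker' _ V'r) : W' (\sum_i iota (r 0 i) * s i).
    apply/(WW _ V'r)/ker; first exact: VV.
    rewrite (coord_sum _ sV lin) // -[RHS]rA mulmx_sum_row.
    by apply: eq_bigr => j _; rewrite rowK.
  rewrite (coord_sum _ sV' lin') // => <-.
  rewrite [LHS](row_sum_delta r); apply: eq_bigr => j _.
  by case: (hs j) => _ ->.
have Aunit : A \in unitmx by rewrite -row_free_unit.
pose r := phi v *m invmx A.
exists (\sum_i iota (r 0 i) * s i); first exact: (@subspace_sum _ _ iota).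
have Vr : V (\sum_i iota (r 0 i) * s i) by apply: (@subspace_sum _ _ iota).
apply/ker; first exact: (@subspaceB _ _ iota).
rewrite (coordB sV lin) // (coord_sum _ sV lin) //.
have -> : \sum_i r 0 i *: phi (s i) = r *m A.
  by rewrite mulmx_sum_row; apply: eq_bigr => j _; rewrite rowK.
by rewrite /r mulmxKV // subrr.
Qed.

Lemma qdimP V W n : subspace V -> subspace W ->
  has_quotient_basis iota V W n <-> qdim V W n.
Proof.
move=> sV sW; split=> [[b [Vb bas]]|[phi [lin ker onto]]].
  have [c hc] : exists c : F -> {ffun 'I_n -> k}, forall y, V y ->
      W (y - \sum_i iota (c y i) * b i) /\
      forall c' : {ffun 'I_n -> k}, W (y - \sum_i iota (c' i) * b i) -> c y = c'.
    apply: (ex_choice (P := fun y (c : {ffun 'I_n -> k}) => V y -> W (y - \sum_i iota (c i) * b i) /\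
      forall c' : {ffun 'I_n -> k}, W (y - \sum_i iota (c' i) * b i) -> c = c')) => y.
    have [Vy|nVy] := pselect (V y); last by exists [ffun=> 0].
    by have [c hc] := bas y Vy; exists c.
  exists (fun y => \row_i c y i); split.
  - move=> a u v Vu Vv; have [hu _] := hc u Vu; have [hv _] := hc v Vv.
    have Vuv : V (iota a * u + v) by case: sV => _; apply.
    have [_ /(_ [ffun i => a * c u i + c v i]) ->] := hc _ Vuv.
      by apply/rowP => i; rewrite !mxE ffunE.
    have -> : iota a * u + v - \sum_i iota ([ffun i => a * c u i + c v i] i) * b i
      = iota a * (u - \sum_i iota (c u i) * b i) + (v - \sum_i iota (c v i) * b i).
      under eq_bigr do rewrite ffunE rmorphD rmorphM mulrDl -mulrA.
      rewrite big_split /= -mulr_sumr; ring.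
    by case: sW => _; apply.
  - move=> v Vv; have [hv hu] := hc v Vv; split=> [e|Wv].
      have : \sum_i iota (c v i) * b i = 0.
        apply: big1 => i _; have /rowP/(_ i) := e; rewrite !mxE => ->.
        by rewrite rmorph0 mul0r.
      by move=> e0; move: hv; rewrite e0 subr0.
    rewrite (hu [ffun=> 0]); first by apply/rowP => i; rewrite !mxE ffunE.
    by rewrite big1 ?subr0 // => i _; rewrite ffunE rmorph0 mul0r.
  - move=> r; exists (\sum_i iota (r 0 i) * b i); first exact: (@subspace_sum _ _ iota).
    have Vr : V (\sum_i iota (r 0 i) * b i) by apply: (@subspace_sum _ _ iota).
    have [_ /(_ [ffun i => r 0 i]) ->] := hc _ Vr.
      by apply/rowP => i; rewrite mxE ffunE.
    under [X in _ - X]eq_bigr do rewrite ffunE.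
    by rewrite subrr; case: sW.
have [s hs] : exists s : 'I_n -> F, forall i, V (s i) /\ phi (s i) = delta_mx 0 i.
  apply: (ex_choice (P := fun i x => V x /\ phi x = delta_mx 0 i)) => i.
  by have [w] := onto (delta_mx 0 i); exists w.
have Vs i : V (s i) by case: (hs i).
have phis (c : 'I_n -> k) : phi (\sum_i iota (c i) * s i) = \row_i c i.
  rewrite (coord_sum _ sV lin) // [RHS]row_sum_delta; apply: eq_bigr => i _.
  by case: (hs i) => _ ->; rewrite mxE.
exists s; split=> // y Vy; exists [ffun i => phi y 0 i].
have Vsum (c : 'I_n -> k) : V (\sum_i iota (c i) * s i) by apply: (@subspace_sum _ _ iota).
split=> [|c' Wc'].
  apply/ker; first exact: (@subspaceB _ _ iota).
  rewrite (coordB sV lin) // phis; apply/eqP; rewrite subr_eq0; apply/eqP/rowP => i.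
  by rewrite mxE ffunE.
have : phi (y - \sum_i iota (c' i) * s i) = 0 by apply/ker => //; apply: (@subspaceB _ _ iota).
rewrite (coordB sV lin) // phis => /eqP; rewrite subr_eq0 => /eqP/rowP e.
by apply/ffunP => i; rewrite ffunE e mxE.
Qed.

Lemma quotient_dimE V W n : subspace V -> subspace W -> qdim V W n ->
  quotient_dim iota V W = n.
Proof.
move=> sV sW h; rewrite /quotient_dim; apply: xget_unique.
  by apply/qdimP.
by move=> m /= /(qdimP _ sV sW) h'; apply: qdim_uniq h' h.
Qed.

End QuotientDimension2.

(** * Places and valuations *)

Section PlaceTheory.
Variables (k F : fieldType) (iota : {rmorphism k -> F}).
Implicit Types (P Q : place iota) (f g z : F).

Lemma place_eqP P Q : place_ring P =1 place_ring Q -> P = Q.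
Proof.
case: P Q => [r1 a1 b1 c1 d1] [r2 a2 b2 c2 d2] /= /funext e.
by subst r2; congr Place; apply: Prop_irrelevance.
Qed.

Lemma ringB P f g : place_ring P f -> place_ring P g -> place_ring P (f - g).
Proof. by case: (place_subring P) => _ sB _; apply: sB. Qed.
Lemma ringM P f g : place_ring P f -> place_ring P g -> place_ring P (f * g).
Proof. by case: (place_subring P) => _ _ sM; apply: sM. Qed.
Lemma ring1 P : place_ring P 1.
Proof. by case: (place_subring P). Qed.
Lemma ring0 P : place_ring P 0.
Proof. by rewrite -(subrr 1); apply: ringB; apply: ring1. Qed.
Lemma ringN P f : place_ring P f -> place_ring P (- f).
Proof. by move=> Of; rewrite -sub0r; apply: ringB => //; apply: ring0. Qed.
Lemma ringD P f g : place_ring P f -> place_ring P g -> place_ring P (f + g).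
Proof. by move=> Of Og; rewrite -[g]opprK; apply: ringB => //; apply: ringN. Qed.
Lemma ringC P c : place_ring P (iota c).
Proof. exact: place_const. Qed.
Lemma ringX P f n : place_ring P f -> place_ring P (f ^+ n).
Proof.
by move=> Of; elim: n => [|n IH]; rewrite ?expr0 ?exprS; [apply: ring1 | apply: ringM].
Qed.
Lemma ring_sum P (I : Type) (s : seq I) (p : pred I) (h : I -> F) :
  (forall i, p i -> place_ring P (h i)) -> place_ring P (\sum_(i <- s | p i) h i).
Proof.
by move=> H; apply: (big_ind (fun x => place_ring P x)) => // [|? ?]; [apply: ring0 | apply: ringD].
Qed.
Lemma ringVn P f : ~~ place_ring P f -> place_ring P f^-1.
Proof. by move=> nf; case/orP: (place_valuation P f) => // Of; case/negP: nf. Qed.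

Lemma unit1 P : place_unit P 1.
Proof. by split; rewrite ?oner_eq0 ?invr1 //; apply: ring1. Qed.
Lemma unitM P f g : place_unit P f -> place_unit P g -> place_unit P (f * g).
Proof.
move=> [f0 f1 f2] [g0 g1 g2]; split; first by rewrite mulf_neq0.
  exact: ringM.
by rewrite invfM; apply: ringM.
Qed.
Lemma unitV P f : place_unit P f -> place_unit P f^-1.
Proof. by move=> [f0 f1 f2]; split; rewrite ?invr_eq0 ?invrK. Qed.
Lemma unitX P f (n : int) : place_unit P f -> place_unit P (f ^ n).
Proof.
move=> uf; have ux m : place_unit P (f ^+ m).
  by elim: m => [|m IH]; rewrite ?expr0 ?exprS; [apply: unit1 | apply: unitM].
by case: n => m; rewrite -?exprnP ?NegzE -?exprnN //; apply: unitV.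
Qed.
Lemma unitC P c : c != 0 -> place_unit P (iota c).
Proof.
move=> c0; split; first by rewrite fmorph_eq0.
  exact: ringC.
by rewrite -fmorphV; apply: ringC.
Qed.

(** A place is an arbitrary valuation ring over [k]. That its value group is infinite cyclic is
    proved separately, for the rational function field and then through finite extensions. *)
Definition discrete P := exists t, [/\ t != 0, place_ideal P t &
  forall f, f != 0 -> exists n u, place_unit P u /\ f = u * t ^ n].

Definition vge P (n : int) : set F := [set f | f = 0 \/ n <= valuation P f].

Lemma ideal_unit P t u : place_ideal P t -> place_unit P u -> place_ideal P (u * t).
Proof.
move=> [ Ot nt] [u0 Ou Ou']; split; first exact: ringM.
move=> ut; apply: nt; have -> : t = u^-1 * (u * t) by rewrite mulKf.
by apply: unitM => //; apply: unitV.
Qed.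

Section Discrete.
Variables (P : place iota) (dP : discrete P).

Lemma ideal_pow t n u : t != 0 -> place_ideal P t -> place_unit P u ->
  place_ring P (u * t ^ n) = (0 <= n :> int).
Proof.
move=> t0 [ Ot nt] [u0 Ou Ou'].
case: n => n.
  by rewrite -exprnP [RHS]/=; apply: ringM => //; apply: ringX.
rewrite NegzE -exprnN [RHS]/=; apply/negbTE/negP => H; apply: nt; split=> //.
have -> : t^-1 = (u^-1 * (u / t ^+ n.+1)) * t ^+ n.
  by rewrite mulKf // exprS invfM mulfVK // expf_neq0.
by apply: ringM; [apply: ringM | apply: ringX].
Qed.

(** Each of [t], [t'] is a unit times a positive power of the other, and the two exponents multiply
    to 1. Hence [t' / t] is a unit and the exponent of a function does not depend on the
    generator. *)
Lemma prime_generates t n u t' n' u' :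
    t != 0 -> place_ideal P t -> t' != 0 -> place_ideal P t' ->
    (forall f, f != 0 -> exists n u, place_unit P u /\ f = u * t ^ n) ->
    (forall f, f != 0 -> exists n u, place_unit P u /\ f = u * t' ^ n) ->
  place_unit P u -> place_unit P u' -> u * t ^ n = u' * t' ^ n' -> n = n' :> int.
Proof.
move=> t0 It t0' It' gt gt' uu uu' e.
have uneq0 v : place_unit P v -> v != 0 by case.
have pos a v b w : t != 0 -> place_unit P v -> place_unit P w ->
    v * t ^ a = w * t ^ b -> a = b :> int.
  move=> _ uv uw evw; apply/eqP; rewrite eq_le.
  have s0 (z : int) : t ^ z != 0 by rewrite expfz_neq0.
  have e1 : (w^-1 * v) * t ^ (a - b) = 1.
    apply: (mulfI (uneq0 _ uw)); rewrite mulr1 expfzDr // -invr_expz -!mulrA mulVKf ?uneq0 //.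
    by rewrite mulrA evw mulfK.
  have e2 : (v^-1 * w) * t ^ (b - a) = 1.
    apply: (mulfI (uneq0 _ uv)); rewrite mulr1 expfzDr // -invr_expz -!mulrA mulVKf ?uneq0 //.
    by rewrite mulrA -evw mulfK.
  have h1 : place_ring P (w^-1 * v * t ^ (a - b)) by rewrite e1 ring1.
  have h2 : place_ring P (v^-1 * w * t ^ (b - a)) by rewrite e2 ring1.
  move: h1 h2; rewrite !ideal_pow //; try by apply: unitM => //; apply: unitV.
  by rewrite !subr_ge0 => -> ->.
have [m [v [uv ev]]] := gt _ t0'; have [m' [v' [uv' ev']]] := gt' _ t0.
have m1 : 0 < m.
  rewrite lt_neqAle -(ideal_pow m t0 It uv) -ev; case: (It') => h nu.
  apply/andP; split=> //; apply/eqP => m0; apply: nu; rewrite ev -m0 expr0z mulr1 //.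
have m1' : 0 < m'.
  rewrite lt_neqAle -(ideal_pow m' t0' It' uv') -ev'; case: (It) => h nu.
  apply/andP; split=> //; apply/eqP => m0; apply: nu; rewrite ev' -m0 expr0z mulr1 //.
have mm : m * m' = 1.
  symmetry; apply: (pos _ 1 _ (v' * v ^ m')) => //; first exact: unit1.
    by apply: unitM => //; apply: unitX.
  by rewrite mul1r expr1z [LHS]ev' [in LHS]ev expfzMl exprz_exp mulrA.
have m_1 : m = 1 by move: mm m1 m1'; clear; nia.
rewrite m_1 expr1z in ev.
apply: (pos _ u _ (u' * v ^ n')) => //; first by apply: unitM => //; apply: unitX.
by rewrite e ev expfzMl mulrA.
Qed.

Lemma prime_elementP t : t != 0 -> place_ideal P t ->
  (forall f, f != 0 -> exists n u, place_unit P u /\ f = u * t ^ n) ->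
  prime_element P t.
Proof.
move=> t0 It gt; rewrite /prime_element predeqE => f; split.
  move=> [ Of nf]; have [->|f0] := eqVneq f 0.
    by exists 0; rewrite ?mulr0 //= /mkset; apply: ring0.
  have [n [u [uu e]]] := gt f f0.
  exists (f / t); last by rewrite mulrC divfK.
  have e' : f / t = u * t ^ (n - 1) by rewrite [in LHS]e expfzDr // exprN1 mulrA.
  have n0 : 0 <= n by rewrite -(ideal_pow n t0 It uu) -e.
  have n1 : n != 0 by apply/eqP => n1; apply: nf; rewrite e n1 expr0z mulr1.
  suff : place_ring P (f / t) by [].
  by rewrite e' ideal_pow //; move: n0 n1; clear; lia.
move=> [y /= Oy <-].
have [->|y0] := eqVneq y 0.
  by rewrite mulr0; split; [apply: ring0 | case; rewrite eqxx].
have [ Ot nt] := It; split; first exact: ringM.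
move=> [_ _ h]; apply: nt; split=> //.
have -> : t^-1 = y * (t * y)^-1 by rewrite invfM mulrCA mulfV // mulr1.
exact: ringM.
Qed.

Lemma generates_prime t : t != 0 -> prime_element P t ->
  place_ideal P t /\ (forall f, f != 0 -> exists n u, place_unit P u /\ f = u * t ^ n).
Proof.
move=> t0 pt; have It : place_ideal P t.
  by rewrite pt; exists 1; rewrite ?mulr1 //; apply: ring1.
split=> // f f0; have [s [s0 Is gs]] := dP.
have [m [v [uv ev]]] := gs t t0.
have : place_ideal P s by [].
rewrite pt => -[y /= Oy ey].
have y0 : y != 0 by apply: contraNneq s0 => y0; rewrite -ey y0 mulr0.
have [m' [v' [uv' ev']]] := gs y y0.
have m'0 : 0 <= m' by rewrite -(ideal_pow m' s0 Is uv') -ev'.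
have m0 : 0 < m.
  rewrite lt_neqAle -(ideal_pow m s0 Is uv) -ev; case: (It) => h nu.
  by apply/andP; split=> //; apply/eqP => m0; apply: nu; rewrite ev -m0 expr0z mulr1.
have mm : 1 = m + m'.
  apply: (prime_generates (u := 1) (u' := v * v') s0 Is s0 Is gs gs) => //.
  - exact: unit1.
  - exact: unitM.
  - by rewrite mul1r expr1z -[LHS]ey ev' {1}ev expfzDr // mulrACA.
have m_1 : m = 1 by move: mm m0 m'0; clear; lia.
rewrite m_1 expr1z in ev.
have [n [u [uu e]]] := gs f f0.
exists n, (u * v^-1 ^ n); split.
  by apply: unitM => //; apply: unitX; apply: unitV.
have [v0 _ _] := uv.
by rewrite ev expfzMl exprz_inv -invr_expz mulrA mulfVK ?expfz_neq0.
Qed.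

Lemma valuation_spec : exists t, [/\ t != 0, place_ideal P t,
  forall f, f != 0 -> exists2 u, place_unit P u & f = u * t ^ valuation P f
  & forall n u, place_unit P u -> valuation P (u * t ^ n) = n].
Proof.
have [t [t0 It gt]] := dP; exists t.
have pt := prime_elementP t0 It gt.
have val n u : place_unit P u -> valuation P (u * t ^ n) = n.
  move=> uu; apply: xget_unique; first by exists t, u.
  move=> m [t' [u' [pt' uu' e]]].
  have t0' : t' != 0.
    apply/eqP => t0'; have : place_ideal P t by [].
    by rewrite pt' => -[y _]; rewrite t0' mul0r => /eqP; rewrite eq_sym (negbTE t0).
  have [It' gt'] := generates_prime t0' pt'.
  by symmetry; apply: (prime_generates t0 It t0' It' gt gt' uu uu' e).
split=> // f f0; have [n [u [uu e]]] := gt f f0.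
by exists u => //; rewrite [X in valuation P X]e val.
Qed.

Lemma val_ring f : f != 0 -> place_ring P f = (0 <= valuation P f).
Proof.
move=> f0; have [t [t0 It gt _]] := valuation_spec.
by have [u uu e] := gt f f0; rewrite [in LHS]e ideal_pow.
Qed.

Lemma val_unit u : place_unit P u -> valuation P u = 0.
Proof.
by move=> uu; have [t [_ _ _ /(_ 0 u uu)]] := valuation_spec; rewrite expr0z mulr1.
Qed.

Lemma unit_val f : f != 0 -> valuation P f = 0 -> place_unit P f.
Proof.
move=> f0 v0; have [t [t0 It gt _]] := valuation_spec.
by have [u uu] := gt f f0; rewrite v0 expr0z mulr1 => ->.
Qed.

Lemma valM f g : f != 0 -> g != 0 -> valuation P (f * g) = valuation P f + valuation P g.
Proof.
move=> f0 g0; have [t [t0 It gt val]] := valuation_spec.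
have [u uu e] := gt f f0; have [u' uu' e'] := gt g g0.
by rewrite {1}e {1}e' mulrACA -expfzDr // val //; apply: unitM.
Qed.

Lemma val1 : valuation P 1 = 0.
Proof. by apply: val_unit; apply: unit1. Qed.

Lemma valV f : f != 0 -> valuation P f^-1 = - valuation P f.
Proof.
move=> f0; have := valM (invr_neq0 f0) f0; rewrite mulVf // val1.
by clear; lia.
Qed.

Lemma valF f g : f != 0 -> g != 0 -> valuation P (f / g) = valuation P f - valuation P g.
Proof. by move=> f0 g0; rewrite valM ?invr_eq0 // valV. Qed.

Lemma valN f : valuation P (- f) = valuation P f.
Proof.
have [->|f0] := eqVneq f 0; first by rewrite oppr0.
rewrite -mulN1r -(rmorphN1 iota) valM ?fmorph_eq0 ?oppr_eq0 ?oner_eq0 //.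
by rewrite val_unit ?add0r //; apply: unitC; rewrite oppr_eq0 oner_eq0.
Qed.

Lemma valC c : valuation P (iota c) = 0.
Proof.
have [->|c0] := eqVneq c 0; last by apply: val_unit; apply: unitC.
rewrite rmorph0 /valuation xgetPN // => n [t [u [pt [u0 _ _] /esym/eqP]]].
rewrite mulf_eq0 (negbTE u0) /=.
have [s [s0 Is _]] := dP.
have t0 : t != 0.
  apply/eqP => t0; have : place_ideal P s by [].
  by rewrite pt => -[y _]; rewrite t0 mul0r => /eqP; rewrite eq_sym (negbTE s0).
by rewrite (negbTE (expfz_neq0 _ t0)).
Qed.

Lemma val0 : valuation P 0 = 0.
Proof. by rewrite -(rmorph0 iota) valC. Qed.

Lemma valX f n : valuation P (f ^+ n) = valuation P f *+ n.
Proof.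
have [->|f0] := eqVneq f 0.
  by case: n => [|n]; rewrite ?expr0 ?mulr0n; [exact: val1 | rewrite expr0n /= val0 mul0rn].
elim: n => [|n IH]; first by rewrite expr0 mulr0n val1.
by rewrite exprS valM ?expf_neq0 // IH mulrS.
Qed.

Lemma exists_val n : exists2 f, f != 0 & valuation P f = n.
Proof.
have [t [t0 It gt val]] := valuation_spec; exists (1 * t ^ n).
  by rewrite mul1r expfz_neq0.
by rewrite val //; apply: unit1.
Qed.

Lemma vge0 f : vge P 0 f <-> place_ring P f.
Proof.
have [->|f0] := eqVneq f 0; first by split=> _; [apply: ring0 | left].
rewrite val_ring //; split=> [[e|]|] //; last by right.
by rewrite e eqxx in f0.
Qed.

Lemma vge_val f n : f != 0 -> vge P n f <-> n <= valuation P f.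
Proof. by move=> f0; split=> [[e|]|] //; [rewrite e eqxx in f0 | right]. Qed.

Lemma vgeM m n f g : vge P m f -> vge P n g -> vge P (m + n) (f * g).
Proof.
have [->|f0] := eqVneq f 0; first by rewrite mul0r; left.
have [->|g0] := eqVneq g 0; first by rewrite mulr0; left.
rewrite !vge_val ?mulf_neq0 // valM //; exact: lerD.
Qed.

Lemma vge_shift m n f g : g != 0 -> valuation P g = n -> vge P m f <-> vge P (m + n) (f * g).
Proof.
move=> g0 eg; have [->|f0] := eqVneq f 0; first by rewrite mul0r; split; left.
by rewrite !vge_val ?mulf_neq0 // valM // eg lerD2r.
Qed.

Lemma vgeD n f g : vge P n f -> vge P n g -> vge P n (f + g).
Proof.
have [t t0 et] := exists_val (- n).
rewrite !(@vge_shift n (- n) _ t) // subrr !vge0 mulrDl; exact: ringD.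
Qed.

Lemma vgeN n f : vge P n f -> vge P n (- f).
Proof. by move=> [->|h]; [left; rewrite oppr0 | right; rewrite valN]. Qed.

Lemma vgeB n f g : vge P n f -> vge P n g -> vge P n (f - g).
Proof. by move=> hf hg; apply: vgeD => //; apply: vgeN. Qed.

Lemma vge_0 n : vge P n 0.
Proof. by left. Qed.

Lemma vge_sum n (I : Type) (s : seq I) (p : pred I) (h : I -> F) :
  (forall i, p i -> vge P n (h i)) -> vge P n (\sum_(i <- s | p i) h i).
Proof.
by move=> H; apply: (big_ind (vge P n)) => //; [apply: vge_0 | apply: vgeD].
Qed.

Lemma vge_le m n f : m <= n -> vge P n f -> vge P m f.
Proof. by move=> mn [->|h]; [left | right; apply: le_trans h]. Qed.

Lemma vgeC c : vge P 0 (iota c).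
Proof. by right; rewrite valC. Qed.

Lemma subspace_vge n : subspace iota (vge P n).
Proof.
split=> [|c u v hu hv]; first exact: vge_0.
by apply: vgeD => //; rewrite -[n]add0r; apply: vgeM => //; apply: vgeC.
Qed.

Lemma val_addl f g : f != 0 -> vge P (valuation P f + 1) g ->
  f + g != 0 /\ valuation P (f + g) = valuation P f.
Proof.
move=> f0 hg; have nz : f + g != 0.
  apply/eqP => /eqP; rewrite addr_eq0 => /eqP e.
  case: hg => [g0|]; first by rewrite e g0 oppr0 eqxx in f0.
  by rewrite e valN; clear; lia.
split=> //; apply/eqP; rewrite eq_le; apply/andP; split.
  rewrite leNgt; apply/negP => lt.
  have : vge P (valuation P f + 1) ((f + g) - g).
    by apply: vgeB => //; right; move: lt; clear; lia.
  by rewrite addrK => /(vge_val _ f0); clear; lia.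
apply/(vge_val _ nz); apply: vgeD; first by right.
by apply: vge_le hg; clear; lia.
Qed.

Lemma val_addr f g : f != 0 -> vge P (valuation P f + 1) g ->
  g + f != 0 /\ valuation P (g + f) = valuation P f.
Proof. by rewrite [g + f]addrC; apply: val_addl. Qed.

Lemma vge_ideal f : vge P 1 f <-> place_ideal P f.
Proof.
have [->|f0] := eqVneq f 0.
  split=> _; last by left.
  by split; [apply: ring0 | case; rewrite eqxx].
rewrite vge_val //; split=> [h|[]].
  split.
    by suff : place_ring P f by []; rewrite val_ring //; move: h; clear; lia.
  by move/val_unit => e; rewrite e in h.
rewrite -[f \in _]/(place_ring P f) val_ring // => h nu.
have : valuation P f <> 0 by move=> e; apply: nu; apply: unit_val.
by move: h; clear; lia.
Qed.

Definition finite_degree := exists n, has_quotient_basis iota [set` place_ring P] (place_ideal P) n.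

Lemma set_ring : [set` place_ring P] = vge P 0.
Proof. by rewrite predeqE => f; rewrite vge0. Qed.

Lemma set_ideal : place_ideal P = vge P 1.
Proof. by rewrite predeqE => f; rewrite vge_ideal. Qed.

Lemma qdim_residue : finite_degree -> qdim iota (vge P 0) (vge P 1) (place_degree P).
Proof.
move=> [n]; rewrite /place_degree set_ring set_ideal => /(qdimP _ (subspace_vge 0) (subspace_vge 1)) h.
by rewrite (quotient_dimE _ _ h) //; apply: subspace_vge.
Qed.

Lemma place_degreeE n : qdim iota (vge P 0) (vge P 1) n -> place_degree P = n.
Proof.
move=> h; rewrite /place_degree set_ring set_ideal.
by rewrite (quotient_dimE _ _ h) //; apply: subspace_vge.
Qed.

Lemma qdim_vge1 n : finite_degree -> qdim iota (vge P n) (vge P (n + 1)) (place_degree P).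
Proof.
move=> fd; have [t t0 et] := exists_val (- n).
apply: (qdim_iso (theta := fun z => z * t) (subspace_vge n) (qdim_residue fd)).
- by move=> c u v _ _; rewrite mulrDl mulrA.
- by move=> v /(@vge_shift n _ v t t0 et); rewrite subrr.
- by move=> v hv; rewrite (@vge_shift (n + 1) _ v t t0 et) addrAC subrr add0r.
- move=> v hv; exists (v / t); last by rewrite divfK.
  by rewrite (@vge_shift n _ _ t t0 et) subrr divfK.
Qed.

Lemma qdim_vge n m : finite_degree -> qdim iota (vge P n) (vge P (n + m%:Z)) (m * place_degree P).
Proof.
move=> fd; elim: m => [|m IH]; first by rewrite addr0 mul0n; apply: qdim_refl; apply: subspace_vge.
rewrite mulSn addnC; apply: (qdim_add (V := vge P (n + m%:Z))) => //; try exact: subspace_vge.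
- by move=> f; apply: vge_le; clear; lia.
- by move=> f; apply: vge_le; clear; lia.
- by have := qdim_vge1 (n + m%:Z) fd; congr qdim; congr vge; clear; lia.
Qed.

End Discrete.
End PlaceTheory.

(** * Existence of places: maximal subrings avoiding an element *)

Section PlaceExistence.
Variables (k F : fieldType) (iota : {rmorphism k -> F}).

Definition is_subring (A : set F) :=
  [/\ forall c, A (iota c), forall f g, A f -> A g -> A (f - g)
    & forall f g, A f -> A g -> A (f * g)].

Section Maximal.
Variables (M : set F) (w : F).
Hypotheses (Msub : is_subring M) (Mw : ~ M w) (Mwi : M w^-1) (w0 : w != 0).
Hypothesis (Mmax : forall B, is_subring B -> M `<=` B -> ~ B w -> B `<=` M).

Local Lemma M1 : M 1. Proof. by case: Msub => /(_ 1); rewrite rmorph1. Qed.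
Local Lemma M0 : M 0. Proof. by case: Msub => /(_ 0); rewrite rmorph0. Qed.
Local Lemma MM f g : M f -> M g -> M (f * g). Proof. by case: Msub => _ _; apply. Qed.
Local Lemma MB f g : M f -> M g -> M (f - g). Proof. by case: Msub => _ h _; apply: h. Qed.
Local Lemma MD f g : M f -> M g -> M (f + g).
Proof. by move=> Mf Mg; rewrite -[g]opprK -[- g]sub0r; do 2!apply: MB => //; apply: M0. Qed.
Local Lemma MX f n : M f -> M (f ^+ n).
Proof. by move=> Mf; elim: n => [|n IH]; rewrite ?expr0 ?exprS; [apply: M1 | apply: MM]. Qed.
Local Lemma Msum (I : Type) (s : seq I) (p : pred I) (h : I -> F) :
  (forall i, p i -> M (h i)) -> M (\sum_(i <- s | p i) h i).
Proof. by move=> H; apply: (big_ind M) => //; [apply: M0 | apply: MD]. Qed.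

Local Definition Mp (p : {poly F}) := forall i, M p`_i.

Local Lemma adjoin_subring z : is_subring [set f | exists2 p, Mp p & f = p.[z]].
Proof.
split=> [c|_ _ [p Mp1 ->] [r Mr ->]|_ _ [p Mp1 ->] [r Mr ->]].
- exists (iota c)%:P; last by rewrite hornerC.
  by move=> i; rewrite coefC; case: eqP => _; [case: Msub | apply: M0].
- by exists (p - r); [move=> i; rewrite coefB; apply: MB | rewrite !hornerE].
- exists (p * r); last by rewrite hornerM.
  by move=> i; rewrite coefM; apply: Msum => j _; apply: MM.
Qed.

Local Lemma adjoin_sub z : M `<=` [set f | exists2 p, Mp p & f = p.[z]].
Proof.
move=> f Mf; exists f%:P; last by rewrite hornerC.
by move=> i; rewrite coefC; case: eqP => _ //; apply: M0.
Qed.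

Local Lemma adjoin_w z : ~ M z -> exists2 p, Mp p & w = p.[z].
Proof.
move=> Mz; apply: contrapT => nw; apply: Mz.
apply: (Mmax (adjoin_subring z) (adjoin_sub z) nw).
exists 'X; last by rewrite hornerX.
by move=> i; rewrite coefX; case: eqP => _; [apply: M1 | apply: M0].
Qed.

(** If [u = 1 - w^-1 r] had no inverse in [M], then by maximality [w] would be a polynomial in
    [u^-1], so [w u^N] would lie in [M]; since [u^N] is 1 modulo [w^-1 M], so would [w]. *)
Local Lemma one_sub_unit r : M r -> M (1 - w^-1 * r)^-1.
Proof.
move=> Mr; set u := 1 - _; apply: contrapT => Mu.
have Mu' : M u by apply: MB; [apply: M1 | apply: MM].
have [u0|u0] := eqVneq u 0; first by apply: Mu; rewrite u0 invr0; apply: M0.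
have [p Mp1 ew] := adjoin_w Mu; apply: Mw.
pose N := size p; pose c := \sum_(i < N) p`_i * u ^+ (N - i).
have Mc : M c by apply: Msum => i _; apply: MM => //; apply: MX.
have ec : w * u ^+ N = c.
  rewrite ew horner_coef mulr_suml; apply: eq_bigr => i _.
  by rewrite -mulrA; congr (_ * _); rewrite exprVn expfB_cond ?(negbTE u0) ?add0n 1?mulrC 1?ltnW.
have [e Me ee] : exists2 e, M e & u ^+ N = 1 + w^-1 * e.
  elim: N {c Mc ec} => [|n [e Me IH]]; first by exists 0; [apply: M0 | rewrite mulr0 addr0 expr0].
  exists (e - r - w^-1 * r * e); last by rewrite exprS IH /u; ring.
  by apply: MB; [apply: MB | do 2!apply: MM => //].
have -> : w = c - e by rewrite -ec ee mulrDr mulr1 mulVKf // addrK.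
exact: MB.
Qed.

Local Definition inp z n := exists p, [/\ Mp p, (size p <= n.+1)%N & w = p.[z]].

(** In the relation for [z^-1] the constant term is moved to the side of [w], where [w - r_0] is [w]
    times a unit of [M]. Multiplying by [z^n] then expresses [z^n] by lower powers of [z], which
    removes the leading term of the relation for [z]. *)
Local Lemma inp_dec z n m : z != 0 -> inp z n -> inp z^-1 m -> (m <= n)%N ->
  exists2 n', (n' < n)%N & inp z n'.
Proof.
move=> z0 [p [Mp1 sp ep]] [r [Mr sr er]] mn.
have n0 : (0 < n)%N.
  rewrite lt0n; apply/eqP => n0; apply: Mw; rewrite ep (size1_polyC (_ : size p <= 1)%N).
    by rewrite hornerC.
  by rewrite n0 in sp.
set u := 1 - w^-1 * r`_0; have Mu : M u^-1 by apply: one_sub_unit.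
have u0 : u != 0.
  apply/eqP => u0; apply: Mw; have -> : w = r`_0; last exact: Mr.
  move/eqP: u0; rewrite subr_eq0 => /eqP e.
  by rewrite -[LHS]mulr1 e mulVKf.
pose s := \poly_(l < n) (w^-1 / u * r`_(n - l)).
have Ms : Mp s.
  move=> i; rewrite coef_poly; case: ifP => _; last exact: M0.
  by apply: MM => //; apply: MM.
have es : z ^+ n = s.[z].
  rewrite horner_poly.
  have eu : u = w^-1 * \sum_(1 <= i < n.+1) r`_i * z^-1 ^+ i.
    have := er; rewrite (horner_coef_wide _ (leq_trans sr (_ : m.+1 <= n.+1)%N)) //.
    rewrite -(big_mkord xpredT (fun i => r`_i * z^-1 ^+ i)) big_nat_recl // expr0 mulr1 => e.
    rewrite big_add1 /=.
    by apply: (mulfI w0); rewrite mulVKf // /u mulrBr mulr1 mulVKf // {1}e addrAC subrr add0r.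
  have e2 : u * z ^+ n = w^-1 * \sum_(i < n) r`_(n - i) * z ^+ i.
    rewrite [in LHS]eu -mulrA mulr_suml; congr (_ * _).
    rewrite big_add1 /= big_mkord (reindex_inj rev_ord_inj) /=.
    apply: eq_bigr => i _; rewrite -mulrA subnSK // exprVn; congr (_ * _).
    by rewrite mulrC -expfB_cond ?(negbTE z0) ?add0n ?leq_subr // subKn // ltnW.
  apply: (mulfI u0); rewrite e2 !mulr_sumr; apply: eq_bigr => i _.
  by rewrite -[w^-1 / u * _ * _]mulrA [w^-1 / u]mulrC -[u^-1 * _ * _]mulrA mulVKf.
exists n.-1; first by rewrite prednK.
exists (\poly_(i < n) p`_i + p`_n *: s); split.
- move=> i; rewrite coefD coefZ; apply: MD; last exact: MM.
  by rewrite coef_poly; case: ifP => _; [apply: Mp1 | apply: M0].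
- rewrite prednK // (leq_trans (size_polyD _ _)) // geq_max size_poly /=.
  by rewrite (leq_trans (size_scale_leq _ _)) ?size_poly.
- rewrite hornerD hornerZ -es horner_poly ep (horner_coef_wide _ sp) big_ord_recr /=.
  by [].
Qed.

(** Otherwise [w] is a polynomial over [M] in [z] and also one in [z^-1], and [inp_dec] lowers the
    sum of the two degrees forever. *)
Lemma maximal_valuation z : M z \/ M z^-1.
Proof.
have [-> |z0] := eqVneq z 0; first by left; apply: M0.
apply: contrapT => /not_orP [Mz Mzi].
have [n [m [hn hm]]] : exists n m, inp z n /\ inp z^-1 m.
  have [p Mp1 ep] := adjoin_w Mz; have [r Mr er] := adjoin_w Mzi.
  by exists (size p), (size r); split; [exists p | exists r].
have [N le] := ubnP (n + m); elim: N n m le hn hm => // N IH n m le hn hm.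
have [mn|nm] := leqP m n.
  have [n' lt h'] := inp_dec z0 hn hm mn.
  by apply: (IH n' m) => //; move: le lt; clear; lia.
have hz : inp (z^-1)^-1 n by rewrite invrK.
have [m' lt h'] := inp_dec (invr_neq0 z0) hm hz (ltnW nm).
by apply: (IH n m') => //; move: le lt; clear; lia.
Qed.
End Maximal.

(** The usual source of places: prescribe a ring which the place must contain and an element which
    it must omit. *)
Lemma exists_place (A : set F) w : is_subring A -> A w^-1 -> ~ A w ->
  exists P : place iota, (forall z, A z -> place_ring P z) /\ ~~ place_ring P w.
Proof.
move=> As Awi Aw.
have A0 : A 0 by case: As => /(_ 0); rewrite rmorph0.
have w0 : w != 0 by apply: contra_notN Aw => /eqP ->.
pose S : set (set F) := [set B | B = set0 \/ [/\ is_subring B, A `<=` B & ~ B w]].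
have [M [SM Mmax]] : exists M, S M /\ forall B, M `<` B -> ~ S B.
  apply: Zorn_bigcup => C CS Ctot.
  have [[X0 [CX0 [x0 X0x0]]]|none] := pselect (exists X, C X /\ X !=set0); last first.
    left; rewrite -subset0 => x [X CX Xx]; apply: none; exists X; split=> //.
    by exists x.
  have Cne X : C X -> X !=set0 -> [/\ is_subring X, A `<=` X & ~ X w].
    by move=> CX [x Xx]; case: (CS _ CX) => // X0e; rewrite X0e in Xx.
  have two f g : (\bigcup_(X in C) X) f -> (\bigcup_(X in C) X) g ->
      exists X, [/\ C X, X f & X g].
    move=> [X CX Xf] [Y CY Yg]; have [XY|YX] := Ctot _ _ CX CY.
      by exists Y; split=> //; apply: XY.
    by exists X; split=> //; apply: YX.
  right; split.
  - split=> [c|f g Uf Ug|f g Uf Ug].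
    + exists X0 => //; have [|[h _ _] _ _] := Cne _ CX0; first by exists x0.
      exact: h.
    + have [X [CX Xf Xg]] := two _ _ Uf Ug; exists X => //.
      by have [|[_ h _] _ _] := Cne _ CX; [exists f | apply: h].
    + have [X [CX Xf Xg]] := two _ _ Uf Ug; exists X => //.
      by have [|[_ _ h] _ _] := Cne _ CX; [exists f | apply: h].
  - move=> z Az; exists X0 => //; have [|_ h _] := Cne _ CX0; first by exists x0.
    exact: h.
  - by move=> [X CX Xw]; have [|_ _] := Cne _ CX; [exists w | apply].
have SA : S A by right; split.
have [Me|[Ms AM Mw]] := SM.
  exfalso; apply: (Mmax A) => //; rewrite Me; split; first exact: sub0set.
  by move=> /(_ 0 A0).
have mx B : is_subring B -> M `<=` B -> ~ B w -> B `<=` M.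
  move=> Bs MB Bw; apply: contrapT => nBM; apply: (Mmax B); first by split.
  by right; split=> // z /AM /MB.
have val := maximal_valuation Ms Mw (AM _ Awi) w0 mx.
pose O z := `[< M z >].
have Osub : subring_closed (O : F -> bool).
  case: Ms => m1 m2 m3; split.
  - by apply/asboolP; rewrite -(rmorph1 iota).
  - by move=> f g /asboolP Mf /asboolP Mg; apply/asboolP; apply: m2.
  - by move=> f g /asboolP Mf /asboolP Mg; apply/asboolP; apply: m3.
have Oc c : iota c \in (O : F -> bool) by apply/asboolP; case: Ms.
have Op : exists z, z \notin (O : F -> bool) by exists w; apply/asboolPn.
have Ov z : (z \in (O : F -> bool)) || (z^-1 \in (O : F -> bool)).
  by case: (val z) => h; apply/orP; [left | right]; apply/asboolP.
exists (Place Osub Oc Op Ov); split=> [z Az|]; first by apply/asboolP; apply: AM.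
exact/asboolPn.
Qed.

End PlaceExistence.

(** * Riemann's theorem *)

Section RiemannTheory.
Variables (k F : fieldType) (iota : {rmorphism k -> F}).
Implicit Types (P Q : place iota) (f g z : F) (h : place iota -> int) (s : seq (place iota)).

Definition Lf h : set F := [set f | forall P, vge P (- h P) f].
Definition dg s h : int := \sum_(P <- s) h P * (place_degree P)%:Z.
Definition single P0 (r : int) P : int := if P == P0 then r else 0.

(* Riemann's theorem with genus [g], where [Pinf] is a rational place. *)
Record riemann (Pinf : place iota) (g : nat) : Prop := Riemann {
  riemann_disc : forall P, discrete P;
  riemann_deg : forall P, finite_degree P;
  riemann_inf : place_degree Pinf = 1%N;
  riemann_fin : forall f, exists s, uniq s /\ forall P, P \notin s -> valuation P f = 0;
  riemann_ineq : forall s h, uniq s -> (forall P, P \notin s -> h P = 0) ->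
    exists2 n, qdim iota (Lf h) [set 0] n & dg s h + 1 - n%:Z <= g%:Z;
  riemann_eq : exists r n : nat, qdim iota (Lf (single Pinf r%:Z)) [set 0] n /\
    r%:Z + 1 - n%:Z = g%:Z
}.

Section Places.
Hypotheses (dP : forall P, discrete P) (fP : forall P, finite_degree P).

Lemma subspace_Lf h : subspace iota (Lf h).
Proof.
split=> [P|c u v hu hv P]; first exact: vge_0.
by have [_] := subspace_vge (dP P) (- h P); apply.
Qed.

Lemma Lf_sub h h' : (forall P, h P <= h' P) -> Lf h `<=` Lf h'.
Proof. by move=> hh f hf P; apply: vge_le (hf P); rewrite lerN2. Qed.

Lemma Lf0 h : Lf h 0. Proof. by move=> P; apply: vge_0. Qed.

Lemma Lf_step h h' P (m : nat) : h' P = h P + m%:Z -> (forall Q, Q != P -> h' Q = h Q) ->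
  exists2 a, (a <= m * place_degree P)%N & qdim iota (Lf h') (Lf h) a.
Proof.
move=> e1 e2; have [phi [lin ker onto]] := qdim_vge (dP P) (- h' P) m (fP P).
apply: (@qdim_rank _ _ _ _ _ _ phi); first exact: subspace_Lf.
  by move=> c u v hu hv; apply: lin.
move=> v hv; rewrite ker //; have -> : - h' P + m%:Z = - h P by rewrite e1; clear; lia.
split=> [h1 Q|]; last exact.
have [->//|QP] := eqVneq Q P.
by rewrite -e2.
Qed.

Lemma dgD s h h' : dg s (fun P => h P + h' P) = dg s h + dg s h'.
Proof. by rewrite -big_split /=; apply: eq_bigr => P _; rewrite mulrDl. Qed.

Lemma dgN s h : dg s (fun P => - h P) = - dg s h.
Proof. by rewrite -sumrN; apply: eq_bigr => P _; rewrite mulNr. Qed.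

Lemma dgB s h h' : dg s (fun P => h P - h' P) = dg s h - dg s h'.
Proof. by rewrite -dgN -dgD. Qed.

Lemma dg_eq s s' h : uniq s -> uniq s' -> (forall P, P \notin s -> h P = 0) ->
  (forall P, P \notin s' -> h P = 0) -> dg s h = dg s' h.
Proof.
have aux s1 s2 : uniq s1 -> uniq s2 -> (forall P, P \notin s1 -> h P = 0) ->
    dg [seq P <- s2 | P \in s1] h = dg s2 h.
  move=> u1 u2 h1; rewrite /dg big_filter [RHS](bigID (mem s1)) /=.
  by rewrite [X in _ + X]big1 ?addr0 // => P /h1 ->; rewrite mul0r.
move=> u u' h0 h0'; rewrite -(aux s' s) // -(aux s s') //; apply: perm_big.
apply: uniq_perm; rewrite ?filter_uniq // => P.
by rewrite !mem_filter andbC.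
Qed.

Lemma dg_single s P r : uniq s -> P \in s -> dg s (single P r) = r * (place_degree P)%:Z.
Proof.
move=> us Ps; rewrite /dg (bigD1_seq P) //= /single eqxx big1 ?addr0 // => Q QP.
by rewrite (negbTE QP) mul0r.
Qed.

Lemma Lf_mono s h h' : uniq s -> (forall P, P \notin s -> h' P = h P) ->
  (forall P, h P <= h' P) ->
  exists2 a : nat, a%:Z <= dg s h' - dg s h & qdim iota (Lf h') (Lf h) a.
Proof.
elim: s h => [|P s IH] h.
  move=> _ e _; exists 0%N; first by rewrite /dg !big_nil.
  by rewrite (_ : h' = h); [apply: qdim_refl; apply: subspace_Lf | apply/funext => P; apply: e].
rewrite cons_uniq => /andP[Ps us] e le.
pose h1 Q := if Q == P then h' P else h Q.
have h1P Q : Q \in s -> h1 Q = h Q.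
  by move=> Qs; rewrite /h1; case: eqP => // QP; rewrite -QP Qs in Ps.
have [|Q|a le1 q1] := IH h1 us.
- move=> Q Qs; rewrite /h1; case: eqP => [->//|/eqP QP].
  by apply: e; rewrite inE negb_or QP.
- by rewrite /h1; case: eqP => [->|].
have [b le2 q2] : exists2 b, (b <= `|h' P - h P|%N * place_degree P)%N & qdim iota (Lf h1) (Lf h) b.
  apply: Lf_step => [|Q QP]; rewrite /h1 ?eqxx ?(negbTE QP) //.
  by have := le P; clear; lia.
exists (a + b)%N; last first.
  apply: (qdim_add (V := Lf h1)) => //; try exact: subspace_Lf.
    by apply: Lf_sub => Q; rewrite /h1; case: eqP => [->|].
  by apply: Lf_sub => Q; rewrite /h1; case: eqP => [->|].
have e1 : dg s h1 = dg s h.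
  by apply: eq_big_seq => Q Qs; rewrite h1P.
move: le1 le2; rewrite e1 /dg !big_cons -/(dg s h) -/(dg s h').
have := le P; move: (h' P) (h P) (place_degree P) => x y n; clear => xy.
move=> le1 le2; have : b%:Z <= (x - y) * n%:Z.
  by rewrite -[x - y]gez0_abs ?subr_ge0 // -PoszM lez_nat.
by rewrite mulrBl PoszD; move: le1; lia.
Qed.

Lemma Lf_mul h f : f != 0 -> forall n,
  qdim iota (Lf h) [set 0] n -> qdim iota (Lf (fun P => h P + valuation P f)) [set 0] n.
Proof.
move=> f0 n q; apply: (qdim_iso (theta := fun z => z * f) (subspace_Lf _) q).
- by move=> c u v _ _; rewrite mulrDl mulrA.
- move=> v hv P; have := hv P; rewrite (@vge_shift _ _ _ P (dP P) _ _ v f f0 (erefl _)).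
  by rewrite opprD subrK.
- by move=> v _; split=> [/eqP|->]; rewrite /= ?mul0r // mulf_eq0 (negbTE f0) orbF => /eqP.
- move=> v hv; exists (v / f); last by rewrite divfK.
  move=> P; rewrite opprD -(valV (dP P)) //; apply: vgeM => //; right.
  by [].
Qed.
End Places.

Section Consequences.
Variables (Pinf : place iota) (g : nat) (rg : riemann Pinf g).
Let dP := riemann_disc rg.
Let fP := riemann_deg rg.
Let sL := subspace_Lf dP.
Local Notation L0 h := (qdim iota (Lf h) [set 0]).

(** The defect, degree plus 1 minus dimension, does not decrease when the divisor grows, by
    [Lf_mono]. It already equals [g] at the multiple of [Pinf] provided by [riemann_eq], and
    [riemann_ineq] bounds it by [g] everywhere. *)
Lemma riemann_large : exists r0 : nat, forall s h, uniq s ->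
  (forall P, P \notin s -> h P = 0) -> (forall P, single Pinf r0%:Z P <= h P) ->
  exists2 n, L0 h n & n%:Z = dg s h + 1 - g%:Z.
Proof.
have [r [n [qn en]]] := riemann_eq rg; exists r => s h us h0 le.
have [n' qn' len'] := riemann_ineq rg us h0.
exists n' => //; apply/eqP; rewrite eq_le; apply/andP; split; last first.
  by move: len'; clear; lia.
pose s' := undup (Pinf :: s).
have us' : uniq s' by apply: undup_uniq.
have Ps' P : (P \notin s') = (P != Pinf) && (P \notin s) by rewrite mem_undup inE negb_or.
have [P|a lea qa] := Lf_mono dP fP (h' := h) us' _ le.
  by rewrite Ps' /single => /andP[/negbTE -> /h0].
have en' : n' = (a + n)%N.
  apply: (qdim_uniq (sL _) qn'); apply: (qdim_add (V := Lf (single Pinf r))) => //.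
  - by move=> _ ->; apply: Lf0.
  - exact: Lf_sub.
rewrite dg_single ?mem_undup ?inE ?eqxx // (riemann_inf rg) mulr1 in lea.
rewrite (dg_eq (s' := s) us') // in lea; last by move=> P; rewrite Ps' => /andP[_ /h0].
by move: lea en en'; clear; lia.
Qed.

(** Multiplication by [f] identifies the spaces of [r Pinf] and of [r Pinf + (f)]. As the first
    attains the bound in Riemann's inequality, the degree of [(f)] cannot be positive; the same
    holds for [f^-1]. *)
Lemma dg_val0 f s : f != 0 -> uniq s -> (forall P, P \notin s -> valuation P f = 0) ->
  dg s (fun P => valuation P f) = 0.
Proof.
suff le f' s' : f' != 0 -> uniq s' -> (forall P, P \notin s' -> valuation P f' = 0) ->
    dg s' (fun P => valuation P f') <= 0.
  move=> f0 us h; apply/eqP; rewrite eq_le le //=.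
  have := le f^-1 s (invr_neq0 f0) us.
  rewrite /dg (eq_bigr (fun P => - (valuation P f * (place_degree P)%:Z))).
    rewrite sumrN oppr_le0; apply => P /h; rewrite valV // => ->; exact: oppr0.
  by move=> P _; rewrite valV // mulNr.
move=> f0 us h; have [r [n [qn en]]] := riemann_eq rg.
have q := Lf_mul dP f0 qn.
pose s1 := undup (Pinf :: s').
have us1 : uniq s1 by apply: undup_uniq.
have Ps1 P : (P \notin s1) = (P != Pinf) && (P \notin s') by rewrite mem_undup inE negb_or.
have [P|n' qn' len'] := riemann_ineq rg (h := fun P => single Pinf r P + valuation P f') us1.
  by rewrite Ps1 /single => /andP[/negbTE -> /h ->].
rewrite (qdim_uniq (sL _) qn' q) dgD dg_single ?mem_undup ?inE ?eqxx // (riemann_inf rg) mulr1 in len'.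
rewrite (dg_eq (s' := s') us1) // in len'; last by move=> P; rewrite Ps1 => /andP[_ /h].
by move: len' en; clear; lia.
Qed.

Lemma L0_pos h n : L0 h n -> (0 < n)%N -> exists2 f, f != 0 & Lf h f.
Proof.
move=> [phi [lin ker onto]] n0; have [v hv ev] := onto (const_mx 1).
exists v => //; apply/eqP => v0; have := ker v hv; rewrite ev => -[_ /(_ v0)].
by move=> /rowP/(_ (Ordinal n0)); rewrite !mxE => /eqP; rewrite oner_eq0.
Qed.

(** If the degree of [h] is at least [r0 + g], Riemann's inequality gives a nonzero [f] in the space
    of [h - r0 Pinf]. Then [h + (f)] lies above [r0 Pinf], where [riemann_large] applies, and both
    degree and dimension are unchanged by adding [(f)]. *)
Lemma riemann_dim : exists c : nat, forall s h, uniq s ->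
  (forall P, P \notin s -> h P = 0) -> c%:Z <= dg s h ->
  exists2 n, L0 h n & n%:Z = dg s h + 1 - g%:Z.
Proof.
have [r0 large] := riemann_large; exists (r0 + g)%N => s h us h0 le.
pose s1 := undup (Pinf :: s).
have us1 : uniq s1 by apply: undup_uniq.
have Ps1 P : (P \notin s1) = (P != Pinf) && (P \notin s) by rewrite mem_undup inE negb_or.
have [P|n qn len] := riemann_ineq rg (h := fun P => h P - single Pinf r0 P) us1.
  by rewrite Ps1 /single => /andP[/negbTE -> /h0 ->].
rewrite dgB dg_single ?mem_undup ?inE ?eqxx // (riemann_inf rg) mulr1 in len.
rewrite (dg_eq (s' := s) us1) // in len; last by move=> P; rewrite Ps1 => /andP[_ /h0].
have [|f f0 hf] := L0_pos qn; first by move: len le; clear; lia.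
have [sf [usf hsf]] := riemann_fin rg f.
pose s2 := undup (sf ++ s).
have us2 : uniq s2 by apply: undup_uniq.
have Ps2 P : (P \notin s2) = (P \notin sf) && (P \notin s) by rewrite mem_undup mem_cat negb_or.
have [||m qm em] := large s2 (fun P => h P + valuation P f) us2.
- by move=> P; rewrite Ps2 => /andP[/hsf -> /h0 ->].
- by move=> P; have /(vge_val _ _ f0) := hf P; clear; lia.
exists m.
  have := Lf_mul dP (invr_neq0 f0) qm; congr qdim; congr Lf; apply/funext => P.
  by rewrite valV // addrK.
rewrite em dgD (dg_val0 f0 us2) ?addr0; last by move=> P; rewrite Ps2 => /andP[/hsf].
by rewrite (dg_eq (s' := s) us2) // => P; rewrite Ps2 => /andP[_ /h0].
Qed.

(** One more order of precision at [P] is gained at a time. With a large pole allowed at [Pinf] the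
    dimensions for two consecutive orders at [P] are both exact and differ by the full
    [place_degree P], so by [qdim_onto] every class of that order is reached. The bound [r] is fixed
    before [c], as [step_surj] requires. *)
Lemma strong_approx P (h : place iota -> int) s (E : int) (n : nat) :
  P != Pinf -> (forall Q, Q \notin s -> h Q = 0) ->
  exists r : nat, forall c, vge P E c -> exists m, [/\ vge P (E + n%:Z) (m - c),
    forall Q, Q != P -> Q != Pinf -> vge Q (- h Q) m & vge Pinf (- r%:Z) m].
Proof.
move=> PPinf h0; elim: n => [|n [r IH]].
  exists 0%N => c hc; exists 0; split; rewrite ?addr0 ?sub0r //.
  - exact: vgeN.
  - by move=> *; apply: vge_0.
  - exact: vge_0.
have [c0 dims] := riemann_dim.
pose D (e r : int) Q := if Q == P then - e else if Q == Pinf then r else h Q.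
pose s1 := undup (Pinf :: P :: s).
have us1 : uniq s1 by apply: undup_uniq.
have D0 e r' Q : Q \notin s1 -> D e r' Q = 0.
  move=> hQ; have a : Q != Pinf by apply: contraNneq hQ => ->; rewrite mem_undup mem_head.
  have b : Q != P by apply: contraNneq hQ => ->; rewrite mem_undup !in_cons eqxx orbT.
  have /h0 c : Q \notin s by apply: contra hQ => hQ; rewrite mem_undup !in_cons hQ !orbT.
  by rewrite /D (negbTE a) (negbTE b) c.
have dgr e : exists r' : nat, (r <= r')%N /\ c0%:Z <= dg s1 (D e r'%:Z).
  exists (r + c0 + `|dg s1 (D e 0)|)%N; split; first by clear; lia.
  have -> : dg s1 (D e (r + c0 + `|dg s1 (D e 0)|)%N%:Z) =
     dg s1 (fun Q => D e 0 Q + single Pinf (r + c0 + `|dg s1 (D e 0)|)%N%:Z Q).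
    apply: eq_bigr => Q _; congr (_ * _); rewrite /D /single.
    have [->|QP] := eqVneq Q P; first by rewrite (negbTE PPinf) addr0.
    by case: eqP => _; rewrite ?add0r ?addr0.
  rewrite dgD dg_single ?mem_undup ?inE ?eqxx // (riemann_inf rg) mulr1.
  change (dg s1 (fun Q => D e 0 Q)) with (dg s1 (D e 0)).
  by move: (dg s1 (D e 0)) => x; clear; lia.
have [r1 [rr1 le1]] := dgr (E + n%:Z); have [r2 [rr2 le2]] := dgr (E + n%:Z + 1).
pose r' := maxn r1 r2.
have mono e (a b : nat) : (a <= b)%N -> dg s1 (D e a%:Z) <= dg s1 (D e b%:Z).
  move=> ab; apply: ler_sum => Q _; apply: ler_wpM2r => //; rewrite /D.
  by case: eqP => // _; case: eqP.
have [n1 q1 en1] := dims s1 (D (E + n%:Z) r'%:Z) us1 (D0 _ _) (le_trans le1 (mono _ _ _ (leq_maxl _ _))).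
have [n2 q2 en2] := dims s1 (D (E + n%:Z + 1) r'%:Z) us1 (D0 _ _) (le_trans le2 (mono _ _ _ (leq_maxr _ _))).
have PD Q : Q != P -> D (E + n%:Z) r' Q = D (E + n%:Z + 1) r' Q.
  by move=> /negbTE QP; rewrite /D QP.
have [||a lea qa] := @Lf_step dP fP (D (E + n%:Z + 1) r') (D (E + n%:Z) r') P 1.
- by rewrite /D eqxx; clear; lia.
- exact: PD.
have dd : dg s1 (D (E + n%:Z) r') = dg s1 (D (E + n%:Z + 1) r') + (place_degree P)%:Z.
  rewrite -[(place_degree P)%:Z]mul1r -(dg_single (s := s1)) ?mem_undup ?in_cons ?eqxx ?orbT // -dgD.
  apply: eq_bigr => Q _; congr (_ * _); rewrite /D /single; case: eqP => _; last by rewrite addr0.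
  by clear; lia.
have subD : Lf (D (E + n%:Z + 1) r') `<=` Lf (D (E + n%:Z) r').
  apply: Lf_sub => Q; have [->|/PD ->//] := eqVneq Q P; rewrite /D eqxx; clear; lia.
have ea : a = place_degree P.
  have : n1 = (a + n2)%N.
    apply: (qdim_uniq (sL _) q1); apply: (qdim_add _ _ _ _ qa) => //.
    by move=> _ ->; apply: Lf0.
  by move: en1 en2 dd; clear; lia.
rewrite ea in qa; exists r' => c hc; have [m [m1 m2 m3]] := IH c hc.
have Vc : vge P (E + n%:Z) (c - m) by rewrite -opprB; apply: vgeN.
have onto := @qdim_onto _ _ iota (vge P (E + n%:Z)) (vge P (E + n%:Z + 1))
  (Lf (D (E + n%:Z) r')) (Lf (D (E + n%:Z + 1) r')) _ (subspace_vge (dP P) _) (sL _) _ _ _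
  (qdim_vge1 (dP P) _ (fP P)) qa (c - m) Vc.
have {onto} [|||v hv ev] := onto.
- by move=> v /(_ P); rewrite /D eqxx opprK.
- move=> v hv; split=> [h1 Q|/(_ P)]; last by rewrite /D eqxx opprK.
  by have [->|QP] := eqVneq Q P; [rewrite /D eqxx opprK | rewrite -PD].
- by move=> v; apply: vge_le; clear; lia.
exists (m + v); split.
- have -> : E + n.+1%:Z = E + n%:Z + 1 by clear; lia.
  have -> : m + v - c = - (c - m - v) by ring.
  exact: vgeN.
- move=> Q QP QI; apply: vgeD => //; first exact: m2.
  by have := hv Q; rewrite /D (negbTE QP) (negbTE QI).
- apply: vgeD => //.
    by apply: vge_le m3; move: rr1 rr2; rewrite /r'; clear; lia.
  by have := hv Pinf; rewrite /D eq_sym (negbTE PPinf) eqxx.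
Qed.

Lemma genusE : genus iota = g.
Proof.
have Lfe (D : divisor iota) : riemann_roch_space D = Lf D.
  rewrite predeqE => f; split=> [[->|h] P|h]; [exact: vge_0 | by right; apply: h|].
  have [->|f0] := eqVneq f 0; first by left.
  by right=> P; apply/(vge_val _ _ f0).
have dge (D : divisor iota) : divisor_degree D = dg (finsupp D) D by [].
have dime (D : divisor iota) n : L0 D n -> riemann_roch_dim D = n.
  by move=> q; rewrite /riemann_roch_dim Lfe (quotient_dimE (sL _) _ q) //; apply: subspace_set0.
have le (D : divisor iota) : divisor_degree D - (riemann_roch_dim D)%:Z + 1 <= g%:Z.
  have [||n qn] := riemann_ineq rg (s := finsupp D) (h := D).
  - exact: fset_uniq.
  - by move=> P; rewrite memNfinsupp => /eqP.
  by rewrite (dime _ _ qn) dge; clear; lia.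
have ex : exists D : divisor iota, divisor_degree D - (riemann_roch_dim D)%:Z + 1 = g%:Z.
  have [r [n [qn en]]] := riemann_eq rg.
  pose D : divisor iota := [fsfun P in [fset Pinf]%fset => r%:Z].
  have eD : D = single Pinf r :> (_ -> _).
    by apply/funext => P; rewrite fsfunE inE /single.
  exists D; rewrite (dime D n) ?eD // dge (dg_eq (s' := [:: Pinf])) ?fset_uniq //.
  - by rewrite /dg big_seq1 eD /single eqxx (riemann_inf rg); move: en; clear; lia.
  - by move=> P; rewrite memNfinsupp => /eqP.
  - by move=> P; rewrite inE eD /single => /negbTE ->.
rewrite /genus; apply: xget_unique; first by split.
move=> g' [[D eD] le']; have [D' eD'] := ex.
by have := le' D'; have := le D; rewrite eD eD'; clear; lia.
Qed.

End Consequences.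
End RiemannTheory.

Section MoreDimension.
Variables (k F : fieldType) (iota : {rmorphism k -> F}).

Lemma qdim_iso_mod (V W V' W' : set F) n : subspace iota V -> subspace iota V' ->
  W' `<=` V' -> V `<=` V' ->
  qdim iota V' W' n -> (forall v, V v -> (W' v <-> W v)) ->
  (forall v, V' v -> exists2 u, V u & W' (v - u)) -> qdim iota V W n.
Proof.
move=> sV sV' WV VV [phi [lin ker onto]] WW app; exists phi; split.
- by move=> c u v /VV hu /VV hv; apply: lin.
- by move=> v hv; rewrite ker ?WW //; apply: VV.
- move=> r; have [v hv <-] := onto r; have [u hu e] := app v hv.
  exists u => //; have /eqP := (ker _ (WV _ e)).2 e.
  by rewrite (coordB sV' lin) //; [rewrite subr_eq0 => /eqP | apply: VV].
Qed.

Lemma qdim_quotient (U V W : set F) n : subspace iota U -> subspace iota V ->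
  V `<=` U -> W `<=` V -> qdim iota U W n -> exists2 m, (m <= n)%N & qdim iota U V m.
Proof.
move=> sU sV VU WV q; have [m' _ [psi [lin' ker' onto']]] := qdim_sub sU sV VU q.
have [phi [lin ker _]] := q.
have [s hs] : exists s : 'I_m' -> F, forall i, V (s i) /\ psi (s i) = delta_mx 0 i.
  apply: (ex_choice (P := fun i x => V x /\ psi x = delta_mx 0 i)) => i.
  by have [w] := onto' (delta_mx 0 i); exists w.
have Vs i : V (s i) by case: (hs i).
pose A := \matrix_i phi (s i).
apply: (@qdim_rank _ _ _ _ _ _ (fun v => phi v *m cokermx A)) => //.
  by move=> c u v hu hv; rewrite lin // mulmxDl scalemxAl.
have sumA (r : 'rV_m') : phi (\sum_i iota (r 0 i) * s i) = r *m A.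
  rewrite (coord_sum _ sU lin) ?mulmx_sum_row; last by move=> i; apply: VU.
  by apply: eq_bigr => i _; rewrite rowK.
move=> v Uv; split=> [/eqP|Vv].
  rewrite -submxE => /submxP[r er].
  pose u := \sum_i iota (r 0 i) * s i.
  have Vu : V u by apply: subspace_sum.
  have Wvu : W (v - u).
    apply/ker; first by apply: (subspaceB sU) => //; apply: VU.
    have eu : phi u = phi v by rewrite er; apply: sumA.
    by rewrite (coordB sU lin) ?eu ?subrr //; apply: VU.
  by rewrite -[v](subrK u); apply: (subspaceD sV) => //; apply: WV.
pose u := \sum_i iota (psi v 0 i) * s i.
have Vu : V u by apply: subspace_sum.
have : W (v - u).
  apply/ker'; first exact: (subspaceB sV).
  rewrite (coordB sV lin') // (coord_sum _ sV lin') //.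
  apply/eqP; rewrite subr_eq0; apply/eqP; rewrite [LHS]row_sum_delta.
  by apply: eq_bigr => i _; case: (hs i) => _ ->.
move=> /(ker _ (VU _ (subspaceB sV Vv Vu))); rewrite (coordB sU lin); try exact: VU.
move=> /eqP; rewrite subr_eq0 sumA => /eqP ->.
by rewrite -mulmxA mulmx_coker mulmx0.
Qed.
End MoreDimension.

(** * Weak approximation *)

Section Approximation.
Variables (k F : fieldType) (iota : {rmorphism k -> F}).
Implicit Types (P Q R : place iota) (f g z : F) (s : seq (place iota)).
(** A larger ring contains some [z] with a pole at [P], and dividing any element by a high power of
    [z] brings it into the ring of [P]; the larger ring would be the whole field. *)
Lemma place_maximal P Q : discrete P -> (forall z, place_ring P z -> place_ring Q z) -> P = Q.
Proof.
move=> dP PQ; apply: place_eqP => z; apply/idP/idP => [/PQ //|Qz].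
apply: contraT => nPz; exfalso.
have z0 : z != 0 by apply: contraNneq nPz => ->; apply: ring0.
have vz : valuation P z < 0 by rewrite ltNge -(val_ring dP z0).
have [w [nw]] : exists w, ~~ place_ring Q w.
  by have [w] := place_proper Q; exists w.
have w0 : w != 0 by apply: contraNneq nw => ->; apply: ring0.
case/negP: nw; have -> : w = (w / z ^+ `|valuation P w|) * z ^+ `|valuation P w|.
  by rewrite divfK // expf_neq0.
apply: ringM; last exact: ringX.
apply: PQ; rewrite (val_ring dP) ?mulf_neq0 ?invr_eq0 ?expf_neq0 //.
rewrite valF ?expf_neq0 // valX // -mulr_natr natz.
by move: (valuation P w) (valuation P z) vz; clear => x y; nia.
Qed.

Hypothesis dP : forall P, discrete P.

Lemma separate2 P Q : P <> Q -> exists z, [/\ z != 0, 0 < valuation Q z & valuation P z < 0].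
Proof.
move=> PQ.
have sep P1 P2 : P1 <> P2 -> exists a, place_ring P1 a /\ ~~ place_ring P2 a.
  move=> ne; apply: contrapT => nex; apply: ne; apply: (place_maximal (dP _)) => z Pz.
  by apply: contraT => nz; exfalso; apply: nex; exists z.
have [a [Pa Qa]] := sep _ _ PQ; have [b [Qb Pb]] := sep _ _ (nesym PQ).
have a0 : a != 0 by apply: contraNneq Qa => ->; apply: ring0.
have b0 : b != 0 by apply: contraNneq Pb => ->; apply: ring0.
exists (b / a); rewrite mulf_neq0 ?invr_eq0 // !valF //.
move: Pa Qa Pb Qb; rewrite !val_ring //; clear; split=> //; lia.
Qed.

Lemma separate s Q : Q \notin s ->
  exists z, [/\ z != 0, 0 < valuation Q z & forall P, P \in s -> valuation P z < 0].
Proof.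
elim: s => [_|P s IH].
  by have [z z0 vz] := exists_val (dP Q) 1; exists z; split=> //; rewrite vz.
move=> nQ; have nQs : Q \notin s by apply: contra nQ => h; rewrite in_cons h orbT.
have [z [z0 Qz sz]] := IH nQs.
have [|y [y0 Qy Py]] := @separate2 P Q; first by move=> e; rewrite e mem_head in nQ.
have [M hM] : exists M : nat, (forall R, R \in P :: s -> `|valuation R z| < M%:Z).
  elim: (P :: s) => [|R l [M hM]]; first by exists 0%N.
  exists (M + `|valuation R z|.+1)%N => R'; rewrite in_cons => /orP[/eqP ->|/hM]; clear; lia.
(* The exponent exceeds all valuations of [z] in absolute value, so in [z + Y] the term [Y]
   dominates wherever [y] has a pole, and [z] dominates at the other places of [s]. *)
pose Y := y ^+ M.+1.
have Y0 : Y != 0 by rewrite expf_neq0.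
have vY R : valuation R Y = M.+1%:Z * valuation R y.
  by rewrite /Y (valX (dP R)) -mulr_natr natz mulrC.
have sum_neg R : R \in P :: s -> (R = P \/ valuation R z < 0) ->
    (R = P -> valuation R y < 0) -> z + Y != 0 /\ valuation R (z + Y) < 0.
  move=> Rs h1 h2; have := hM R Rs; have := vY R.
  have [vy|vy] := ltP (valuation R y) 0 => eY lt.
    have hz : vge R (valuation R Y + 1) z.
      by right; rewrite eY; move: (valuation R z) (valuation R y) lt vy; clear; nia.
    have [nz ->] := val_addr (dP R) Y0 hz; split=> //.
    by rewrite eY; move: (valuation R y) vy; clear; nia.
  have vz : valuation R z < 0.
    by case: h1 => // e; have := h2 e; move: vy; clear; lia.
  have hY : vge R (valuation R z + 1) Y.
    by right; rewrite eY; move: (valuation R z) (valuation R y) vz vy; clear; nia.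
  by have [nz ->] := val_addl (dP R) z0 hY.
have nz : z + Y != 0.
  by have [|||//] := sum_neg P; rewrite ?mem_head //; left.
exists (z + Y); split=> //.
  suff : vge Q 1 (z + Y) by move/(vge_val _ _ nz); clear; lia.
  apply: vgeD => //; right=> //; rewrite vY.
  by move: (valuation Q y) Qy; clear; nia.
move=> R Rs; have [||//] := sum_neg R Rs.
  by move: Rs; rewrite in_cons => /orP[/eqP ->|/sz]; [left | right].
by move=> ->.
Qed.

(** [t / (1 + t)] is close to 0 where [t] has a high zero and close to 1 where [t] has a high
    pole. *)
Lemma approx1 s Q (M : nat) : Q \notin s ->
  exists w, vge Q M%:Z w /\ forall P, P \in s -> vge P M%:Z (w - 1).
Proof.
move=> /separate [z [z0 Qz sz]]; pose t := z ^+ M.+1.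
have t0 : t != 0 by rewrite expf_neq0.
have vt R : valuation R t = M.+1%:Z * valuation R z.
  by rewrite /t (valX (dP R)) -mulr_natr natz mulrC.
have Qt : vge Q (valuation Q 1 + 1) t.
  by right; rewrite (val1 (dP Q)) vt; move: (valuation Q z) Qz; clear; nia.
have [n1 v1] := val_addl (dP Q) (oner_neq0 F) Qt.
exists (t / (1 + t)); split.
  right; rewrite valF // v1 (val1 (dP Q)) vt; move: (valuation Q z) Qz; clear; nia.
move=> P /sz Pz.
have -> : t / (1 + t) - 1 = - (1 + t)^-1 by field.
apply: vgeN => //; right; rewrite valV //.
have Pt : vge P (valuation P t + 1) 1.
  by right; rewrite (val1 (dP P)) vt; move: (valuation P z) Pz; clear; nia.
have [_ ->] := val_addr (dP P) t0 Pt.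
by rewrite vt; move: (valuation P z) Pz; clear; nia.
Qed.

Lemma approx2 s Q (M : nat) : Q \notin s ->
  exists w, vge Q M%:Z (w - 1) /\ forall P, P \in s -> vge P M%:Z w.
Proof.
move=> /(approx1 M)[w [w1 w2]]; exists (1 - w); split.
  by rewrite addrAC subrr add0r; apply: vgeN.
by move=> P /w2 h; rewrite -opprB; apply: vgeN.
Qed.

Definition Bv s (c : place iota -> int) : set F := [set z | forall P, P \in s -> vge P (c P) z].

Lemma subspace_Bv s c : subspace iota (Bv s c).
Proof.
split=> [P _|a u v hu hv P Ps]; first exact: vge_0.
by have [_] := subspace_vge (dP P) (c P); apply; [apply: hu | apply: hv].
Qed.

Lemma bound_val s z (c : place iota -> int) : exists M : nat, forall P, P \in s ->
  c P - valuation P z <= M%:Z.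
Proof.
elim: s => [|R l [M hM]]; first by exists 0%N.
exists (M + `|c R - valuation R z|)%N => R'; rewrite in_cons => /orP[/eqP ->|/hM]; clear; lia.
Qed.

Lemma vge_mul_large P z c (M : nat) w : vge P M%:Z w -> c - valuation P z <= M%:Z -> vge P c (z * w).
Proof.
move=> hw le; have [->|z0] := eqVneq z 0; first by rewrite mul0r; apply: vge_0.
apply: (vge_le (n := valuation P z + M%:Z)); first by move: le; clear; lia.
by apply: vgeM => //; right.
Qed.

(** The Chinese remainder theorem as a statement on dimensions. The condition is sharpened first at
    [P] and then on [s]; multiplying by an element close to 1 on one side and to 0 on the other
    shows that each quotient is the local one. *)
Lemma qdim_Bv s c (m : place iota -> nat) : (forall P, P \in s -> finite_degree P) -> uniq s ->
  qdim iota (Bv s c) (Bv s (fun P => c P + (m P)%:Z)) (\sum_(P <- s) m P * place_degree P).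
Proof.
elim: s => [_ _|P s IH fd].
  have -> : Bv [::] (fun P => c P + (m P)%:Z) = Bv [::] c by rewrite predeqE => z; split=> _ P.
  by rewrite big_nil; apply: (qdim_refl (subspace_Bv [::] c)).
rewrite cons_uniq => /andP[Ps us]; rewrite big_cons.
have fds R : R \in s -> finite_degree R by move=> h; apply: fd; rewrite in_cons h orbT.
have {}IH := IH fds us.
pose c' R := c R + (m R)%:Z.
pose V := vge P (c' P) `&` Bv s c.
have sV : subspace iota V by apply: subspaceI; [apply: subspace_vge | apply: subspace_Bv].
have lec R : c R <= c' R by rewrite /c'; clear; lia.
have BP b : Bv (P :: s) b = vge P (b P) `&` Bv s b.
  rewrite predeqE => z; split=> [h|[h1 h2] R].
    split; first by apply: h; rewrite mem_head.
    by move=> R Rs; apply: h; rewrite in_cons Rs orbT.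
  by rewrite in_cons => /orP[/eqP ->|/h2].
rewrite !BP -/c'; apply: (qdim_add (V := V)) => //.
- by apply: subspaceI; [apply: subspace_vge | apply: subspace_Bv].
- by move=> z [h1 h2]; split=> // R Rs; apply: vge_le (h2 R Rs); apply: lec.
- by move=> z [h1 h2]; split=> //; apply: vge_le h1; apply: lec.
- apply: (qdim_iso_mod _ _ _ _ (qdim_vge (dP P) (c P) (m P) (fd P (mem_head _ _)))).
  + by apply: subspaceI; [apply: subspace_vge | apply: subspace_Bv].
  + exact: subspace_vge.
  + by move=> z; apply: vge_le; apply: lec.
  + by move=> z [].
  + by move=> z [h1 h2]; split=> [h|[]].
  + move=> z hz; have [M hM] := bound_val s z c.
    have [w [w1 w2]] := approx2 (M + m P) Ps.
    exists (z * w); first split.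
    * have -> : z * w = z + z * (w - 1) by ring.
      apply: vgeD => //; rewrite -[c P]addr0; apply: vgeM => //.
      by apply: vge_le w1.
    * move=> R Rs; apply: vge_mul_large (w2 R Rs) _; have := hM R Rs; clear; lia.
    * have -> : z - z * w = z * - (w - 1) by ring.
      apply: vgeM => //; apply: vgeN => //; apply: vge_le w1; clear; lia.
- apply: (qdim_iso_mod _ _ _ _ IH) => //.
  + exact: subspace_Bv.
  + by move=> z h R Rs; apply: vge_le (h R Rs); apply: lec.
  + by move=> z [].
  + by move=> z [h1 h2]; split=> [h|[]].
  + move=> z hz; have [M hM] := bound_val (P :: s) z c'.
    have [M' hM'] := bound_val s z (fun R => c' R).
    have [w [w1 w2]] := approx1 (M + M' + \sum_(R <- s) m R) Ps.
    have wm R : R \in s -> vge R (m R)%:Z (w - 1).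
      move=> Rs; apply: vge_le (w2 R Rs); rewrite lez_nat.
      by rewrite (big_rem R) //=; clear; lia.
    exists (z * w); first split.
    * apply: vge_mul_large w1 _; have := hM P (mem_head _ _); clear; lia.
    * move=> R Rs; have -> : z * w = z + z * (w - 1) by ring.
      apply: vgeD => //; first exact: hz.
      rewrite -[c R]addr0; apply: vgeM => //; first exact: hz.
      by apply: vge_le (wm R Rs).
    * move=> R Rs; have -> : z - z * w = z * - (w - 1) by ring.
      by apply: vgeM => //; [apply: hz | apply: vgeN => //; apply: wm].
Qed.
End Approximation.

(** * Places in extensions *)

Lemma int_pow_unit (k F : fieldType) (iota : {rmorphism k -> F}) (P : place iota) z n :
  (0 < n)%N -> place_unit P (z ^+ n) -> place_unit P z.
Proof.
move=> n0 [zn0 Oz Oz'].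
have z0 : z != 0 by apply: contraNneq zn0 => ->; rewrite expr0n gtn_eqF.
have aux f : f != 0 -> place_ring P (f ^+ n) -> place_ring P f.
  move=> f0 h; apply: contraT => nf; case/negP: (nf); have h' := ringVn nf.
  have -> : f = f ^+ n * f^-1 ^+ n.-1.
    by rewrite -{1}(prednK n0) exprS -mulrA -exprMn mulfV // expr1n mulr1.
  by apply: ringM => //; apply: ringX.
split=> //; first exact: aux.
by apply: aux; rewrite ?invr_eq0 // exprVn.
Qed.

Lemma max_value (k F : fieldType) (iota : {rmorphism k -> F}) (P : place iota)
    (I : finType) (t : I -> F) : (exists i, t i != 0) ->
  exists2 i, t i != 0 & forall l, place_ring P (t l / t i).
Proof.
move=> [i0 ti0].
suff [i ti h] : exists2 i, t i != 0 & forall l, l \in enum I -> place_ring P (t l / t i).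
  by exists i => // l; apply: h; rewrite mem_enum.
elim: (enum I) => [|l s [i ti IH]]; first by exists i0.
have [h|nh] := boolP (place_ring P (t l / t i)).
  by exists i => // l'; rewrite in_cons => /orP[/eqP ->|/IH].
have tl : t l != 0.
  by apply: contraNneq nh => ->; rewrite mul0r; apply: ring0.
have h := ringVn nh.
exists l => // l'; rewrite in_cons => /orP[/eqP ->|/IH h'].
  by rewrite mulfV //; apply: ring1.
have -> : t l' / t l = (t l' / t i) * (t l / t i)^-1 by rewrite invf_div mulrA divfK.
exact: ringM.
Qed.

Section Extension.
Variables (k F F' : fieldType) (iota : {rmorphism k -> F}) (iota' : {rmorphism k -> F'}).
Variable (j : {rmorphism F -> F'}).
Hypothesis (jc : forall c, j (iota c) = iota' c).
Variable n : nat.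
(* [F' : F] <= n *)
Hypothesis (dep : forall b : 'I_n.+1 -> F', exists a : 'I_n.+1 -> F,
  (exists i, a i != 0) /\ \sum_i j (a i) * b i = 0).

Definition over (P : place iota') (P' : place iota) :=
  forall z, place_ring P (j z) = place_ring P' z.

(** Only properness needs an argument. If all of [F] were mapped into the ring of [P], an element
    [z] outside it would satisfy an equation over that ring, and dividing by a power of [z] would
    express [z] by nonpositive powers of itself. *)
Lemma exists_rest (P : place iota') : exists P', over P P'.
Proof.
pose O z := place_ring P (j z).
have Osub : subring_closed (O : F -> bool).
  split=> [|f g hf hg|f g hf hg].
  - by rewrite unfold_in /O rmorph1; apply: ring1.
  - by rewrite unfold_in /O rmorphB; apply: ringB.
  - by rewrite unfold_in /O rmorphM; apply: ringM.
have Oc c : iota c \in (O : F -> bool) by rewrite unfold_in /O jc; apply: ringC.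
have Ov z : (z \in (O : F -> bool)) || (z^-1 \in (O : F -> bool)).
  by rewrite !unfold_in /O fmorphV; apply: place_valuation.
have Op : exists z, z \notin (O : F -> bool).
  apply: contrapT => nex; have all z : place_ring P (j z).
    by apply: contraT => h; exfalso; apply: nex; exists z.
  have [z nz] := place_proper P.
  have z0 : z != 0 by apply: contraNneq nz => ->; apply: ring0.
  have [a [[i0 ai0] e]] := dep (fun i : 'I_n.+1 => z ^+ i).
  have [i ai imax] : exists2 i, a i != 0 & forall l : 'I_n.+1, a l != 0 -> (l <= i)%N.
    case: (arg_maxnP (P := fun i => a i != 0) (fun i : 'I_n.+1 => i : nat) ai0) => i ai imax.
    by exists i.
  have zi : z ^+ i = \sum_(l < n.+1 | l != i) j (- a l / a i) * z ^+ l.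
    have jai : j (a i) != 0 by rewrite fmorph_eq0.
    apply: (mulfI jai); rewrite mulr_sumr; apply/eqP.
    rewrite -subr_eq0 -sumrN -[X in _ == X]e [X in _ == X](bigD1 i) //=; apply/eqP; congr (_ + _).
    apply: eq_bigr => l _; rewrite mulrA -rmorphM mulrCA mulfV // mulr1 rmorphN mulNr.
    by rewrite opprK.
  case/negP: (nz); suff -> : z = \sum_(l < n.+1 | l != i) j (- a l / a i) * z^-1 ^+ (i.-1 - l).
    apply: ring_sum => l _; apply: ringM; first exact: all.
    by apply: ringX; apply: ringVn.
  have i0' : (0 < i)%N.
    rewrite lt0n; apply/eqP => i0'; have := zi; rewrite i0' expr0 big1 => [/eqP|l li].
      by rewrite oner_eq0.
    have [->|al] := eqVneq (a l) 0; first by rewrite oppr0 mul0r rmorph0 mul0r.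
    have := imax _ al; rewrite i0' leqn0 => /eqP l0.
    by case/eqP: li; apply/val_inj; rewrite /= l0 i0'.
  apply: (mulIf (expf_neq0 i.-1 z0)); rewrite -exprS prednK // zi mulr_suml.
  apply: eq_bigr => l li; have [->|al] := eqVneq (a l) 0.
    by rewrite oppr0 mul0r rmorph0 !mul0r.
  have li' : (l <= i.-1)%N.
    have := imax _ al; rewrite leq_eqVlt => /orP[/eqP e'|]; last by rewrite -{1}(prednK i0') ltnS.
    by case/eqP: li; apply/val_inj.
  rewrite -mulrA; congr (_ * _).
  by rewrite exprVn mulrC -expfB_cond ?(negbTE z0) ?add0n ?leq_subr // subKn.
by exists (Place Osub Oc Op Ov).
Qed.

Section OverDiscrete.
Variables (P : place iota') (P' : place iota).
Hypotheses (PP : over P P') (dP' : discrete P').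

Lemma over_unit z : place_unit P (j z) <-> place_unit P' z.
Proof.
rewrite /place_unit -fmorphV fmorph_eq0.
have e1 : (j z \in place_ring P) = (z \in place_ring P') := PP z.
have e2 : (j z^-1 \in place_ring P) = (z^-1 \in place_ring P') := PP z^-1.
by rewrite e1 e2.
Qed.

(** A strictly largest term cannot be cancelled, so the largest value occurs twice. The place above
    is not yet known to be discrete, hence values are compared by membership of quotients in the
    ring only. *)
Lemma equal_values (I : finType) (t : I -> F') : \sum_i t i = 0 -> (exists i, t i != 0) ->
  exists i1 i2, [/\ i1 != i2, t i1 != 0, t i2 != 0 & place_unit P (t i1 / t i2)].
Proof.
move=> e ex0; have [i ti imax] := max_value P ex0.
apply: contrapT => nex.
have id l : l != i -> place_ideal P (t l / t i).
  move=> li; split; first exact: imax.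
  by move=> u; apply: nex; exists l, i; split=> //; case: u; rewrite mulf_eq0 negb_or => /andP[].
have e1 : - 1 = \sum_(l | l != i) t l / t i.
  have := congr1 (fun x => x / t i) e; rewrite /= mul0r mulr_suml (bigD1 i) //= mulfV //.
  by move/eqP; rewrite addrC addr_eq0 => /eqP ->.
have dom z : ~ (place_ring P z^-1) -> z != 0.
  by move=> h; apply/eqP => z0; apply: h; rewrite z0 invr0; apply: ring0.
have idD x y : place_ideal P x -> place_ideal P y -> place_ideal P (x + y).
  move=> [hx ux] [hy uy]; split; first exact: ringD.
  move=> [s0 hs hs'].
  have idM a b : place_ring P a -> place_ring P b -> ~ place_unit P a -> ~ place_unit P (a * b).
    move=> ha hb na [ab0 _ hab]; apply: na; split=> //.
      by apply: contraNneq ab0 => ->; rewrite mul0r.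
    have [a0 b0] : a != 0 /\ b != 0 by move: ab0; rewrite mulf_eq0 negb_or => /andP.
    have -> : a^-1 = b * (a * b)^-1 by rewrite invfM mulrCA mulfV // mulr1.
    exact: ringM.
  have [x0|x0] := eqVneq x 0; first by apply: uy; rewrite x0 add0r in s0 hs hs'.
  have [y0|y0] := eqVneq y 0; first by apply: ux; rewrite y0 addr0 in s0 hs hs'.
  have [h|/ringVn h] := boolP (place_ring P (x / y)).
    apply: (idM y (1 + x / y)) => //; first by apply: ringD => //; apply: ring1.
    by have -> : y * (1 + x / y) = x + y by field.
  rewrite invf_div in h.
  apply: (idM x (1 + y / x)) => //; first by apply: ringD => //; apply: ring1.
  by have -> : x * (1 + y / x) = x + y by field.
have : place_ideal P (- 1).
  rewrite e1; apply: (big_ind (place_ideal P)) => //.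
  by split; [apply: ring0 | case; rewrite eqxx].
move=> [_]; apply; split; rewrite ?oppr_eq0 ?oner_eq0 ?invrN1 //; apply: ringN; exact: ring1.
Qed.

(** The powers [1, z, ..., z^n] are dependent over [F], and two terms of the relation differ by a
    unit. *)
Lemma power_value z : z != 0 -> exists m a, [/\ (0 < m <= n)%N, a != 0 & place_unit P (z ^+ m * j a)].
Proof.
move=> z0; have [a [[i0 ai0] e]] := dep (fun i : 'I_n.+1 => z ^+ i).
have [|i1 [i2 [ne t1 t2 u]]] := equal_values e.
  by exists i0; rewrite mulf_neq0 ?fmorph_eq0 ?expf_neq0.
wlog lt : i1 i2 ne t1 t2 u / (i2 < i1)%N.
  move=> H; have [lt|lt|/val_inj e'] := ltngtP i2 i1; first exact: (H i1 i2).
    apply: (H i2 i1) => //; first by rewrite eq_sym.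
    by rewrite -invf_div; apply: unitV.
  by rewrite e' eqxx in ne.
have [a1 a2] : a i1 != 0 /\ a i2 != 0.
  by move: t1 t2; rewrite !mulf_eq0 !negb_or !fmorph_eq0 => /andP[-> _] /andP[-> _].
exists (i1 - i2)%N, (a i1 / a i2); split.
- by rewrite subn_gt0 lt (leq_trans (leq_subr _ _)) // -ltnS.
- by rewrite mulf_neq0 ?invr_eq0.
- suff -> : z ^+ (i1 - i2) * j (a i1 / a i2) = (j (a i1) * z ^+ i1) / (j (a i2) * z ^+ i2) by [].
  rewrite rmorphM fmorphV -{2}(subnK (ltnW lt)) exprD invfM.
  have z2 : z ^+ i2 != 0 by rewrite expf_neq0.
  have ja2 : j (a i2) != 0 by rewrite fmorph_eq0.
  by field; rewrite z2.
Qed.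

(** By [power_value] some power [z^m] with [m <= n] has the value of an element of [F], so the
    single exponent [N = n!] serves all [z]: up to a unit [z^N] is [t^(w z)]. The map [w] is a
    homomorphism to the integers, and an element with the least positive [w] is a uniformizer. *)
Lemma over_discrete : discrete P.
Proof.
have [t [t0 It gt val]] := valuation_spec dP'.
have jt0 : j t != 0 by rewrite fmorph_eq0.
have Ijt : place_ideal P (j t).
  by case: It => h1 h2; split; [rewrite -[_ \in _]/(place_ring P _) PP | move/over_unit].
pose N := n`!.
have N0 : (0 < N)%N by apply: fact_gt0.
have wP z : z != 0 -> exists l : int, place_unit P (z ^+ N * j t ^ (- l)).
  move=> z0; have [m [a [/andP[m0 mn] a0 u]]] := power_value z0.
  have /dvdnP[c eN] : (m %| N)%N by apply: dvdn_fact; rewrite m0.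
  have [v uv ea] := gt a a0; exists (- (valuation P' a *+ c)).
  have uc : place_unit P ((z ^+ m * j a) ^+ c) := unitX c%:Z u.
  have uvc : place_unit P (j v ^+ c) by apply: (unitX c%:Z); apply/over_unit.
  have e : z ^+ N * j t ^ (- - (valuation P' a *+ c)) = (z ^+ m * j a) ^+ c * (j v ^+ c)^-1.
    have ea' : j a ^+ c = j v ^+ c * j t ^ (valuation P' a *+ c).
      rewrite [in LHS]ea rmorphM exprMn; congr (_ * _).
      rewrite -mulr_natr natz -exprz_exp -exprnP; congr (_ ^+ _).
      by case: (valuation P' a) => l; rewrite ?NegzE -?exprnN -?exprnP ?fmorphV rmorphXn.
    have v0 : j v ^+ c != 0 by case: uvc.
    by rewrite exprMn -exprM mulnC -eN ea' opprK mulrCA [in RHS]mulrC mulKf.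
  by rewrite e; apply: unitM => //; apply: unitV.
have t_unit (l : int) : place_unit P (j t ^ l) -> l = 0.
  move=> [_ h1 h2].
  have := ideal_pow l jt0 Ijt (unit1 P); have := ideal_pow (- l) jt0 Ijt (unit1 P).
  rewrite !mul1r -invr_expz => e2 e1.
  have p1 : 0 <= l by rewrite -e1.
  have p2 : 0 <= - l by rewrite -e2.
  by move: p1 p2; clear; lia.
have [w hw] : exists w : F' -> int, forall z, z != 0 -> place_unit P (z ^+ N * j t ^ (- w z)).
  apply: (ex_choice (P := fun z l => z != 0 -> place_unit P (z ^+ N * j t ^ (- l)))) => z.
  have [->|z0] := eqVneq z 0; first by exists 0.
  by have [l] := wP z z0; exists l.
have w_uniq z l : z != 0 -> place_unit P (z ^+ N * j t ^ (- l)) -> w z = l.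
  move=> z0 u; suff : - w z + l = 0 by clear; lia.
  apply: t_unit.
  have -> : j t ^ (- w z + l) = (z ^+ N * j t ^ (- w z)) * (z ^+ N * j t ^ (- l))^-1.
    have a0 : z ^+ N != 0 by rewrite expf_neq0.
    have b0 : j t ^ l != 0 by rewrite expfz_neq0.
    by rewrite expfzDr // -[j t ^ (- l)]invr_expz invfM invrK mulrACA mulfV // mul1r.
  by apply: unitM; [apply: hw | apply: unitV].
have wM z z' : z != 0 -> z' != 0 -> w (z * z') = w z + w z'.
  move=> z0 z0'; apply: w_uniq; first by rewrite mulf_neq0.
  have -> : (z * z') ^+ N * j t ^ (- (w z + w z')) = (z ^+ N * j t ^ (- w z)) * (z' ^+ N * j t ^ (- w z')).
    by rewrite exprMn opprD expfzDr // mulrACA.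
  by apply: unitM; apply: hw.
have w1 : w 1 = 0.
  by apply: w_uniq; rewrite ?oner_eq0 // expr1n mul1r oppr0 expr0z; apply: unit1.
have wV z : z != 0 -> w z^-1 = - w z.
  move=> z0; have := wM z z^-1 z0 (invr_neq0 z0); rewrite mulfV // w1; clear; lia.
have wX z (l : int) : z != 0 -> w (z ^ l) = w z * l.
  move=> z0; have wXn m : w (z ^+ m) = w z * m%:Z.
    elim: m => [|m IH]; first by rewrite expr0 w1 mulr0.
    by rewrite exprS wM ?expf_neq0 // IH; clear; lia.
  case: l => l; first exact: wXn.
  rewrite NegzE -exprnN wV ?expf_neq0 // wXn; clear; lia.
have wt : w (j t) = N%:Z.
  by apply: w_uniq => //; rewrite exprnP -expfzDr // subrr expr0z; apply: unit1.
have w_unit z : z != 0 -> w z = 0 -> place_unit P z.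
  move=> z0 wz; apply: (int_pow_unit N0); have := hw z z0.
  by rewrite wz oppr0 expr0z mulr1.
have ex : exists d : nat, `[< (0 < d)%N /\ exists2 z, z != 0 & w z = d%:Z >].
  by exists N; apply/asboolP; split=> //; exists (j t).
case: (ex_minnP ex) => d /asboolP [d0 [s s0 ws]] dmin.
have sI : place_ideal P s.
  have Ps : place_ring P (s ^+ N).
    have -> : s ^+ N = (s ^+ N * j t ^ (- w s)) * j t ^ w s.
      by rewrite -mulrA -expfzDr // addrC subrr expr0z mulr1.
    by rewrite ideal_pow ?ws //; rewrite -ws; apply: hw.
  split.
    apply: contraT => /ringVn h; exfalso.
    have us : place_unit P (s ^+ N).
      by split=> //; [rewrite expf_neq0 | rewrite -exprVn; apply: ringX].
    have := w_uniq s 0 s0; rewrite oppr0 expr0z mulr1 => /(_ us).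
    by rewrite ws; move: d0; clear; lia.
  move=> us; have := w_uniq s 0 s0; rewrite oppr0 expr0z mulr1.
  by move=> /(_ (unitX N%:Z us)); rewrite ws; move: d0; clear; lia.
exists s; split=> // z z0.
pose l := (w z %/ d%:Z)%Z; pose r := (w z %% d%:Z)%Z.
exists l, (z * s ^ (- l)); split; last first.
  by rewrite -mulrA -expfzDr // addrC subrr expr0z mulr1.
have nz : z * s ^ (- l) != 0 by rewrite mulf_neq0 ?expfz_neq0.
apply: w_unit => //.
have er : w (z * s ^ (- l)) = r.
  by rewrite wM ?expfz_neq0 // wX // ws /r /l; have := divz_eq (w z) d%:Z; clear; lia.
have r0 : 0 <= r by apply: modz_ge0; move: d0; clear; lia.
have rd : r < d%:Z by apply: ltz_pmod; move: d0; clear; lia.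
rewrite er; apply/eqP; apply: contraT => rn0.
have : (d <= `|r|)%N.
  apply: dmin; apply/asboolP; split; first by move: rn0; clear; lia.
  by exists (z * s ^ (- l)) => //; rewrite er; move: r0; clear; lia.
by move: r0 rd; clear; lia.
Qed.

Lemma ram_exists : exists e : nat, (0 < e)%N /\ forall z, valuation P (j z) = valuation P' z * e%:Z.
Proof.
have dP := over_discrete; have [t [t0 It gt val]] := valuation_spec dP'.
have jt0 : j t != 0 by rewrite fmorph_eq0.
have pos : 0 < valuation P (j t).
  suff /(vge_ideal dP)/(vge_val _ _ jt0) : place_ideal P (j t) by clear; lia.
  by case: It => h1 h2; split; [rewrite -[_ \in _]/(place_ring P _) PP | move/over_unit].
exists `|valuation P (j t)|%N; split; first by move: pos; clear; lia.
move=> z; have [->|z0] := eqVneq z 0; first by rewrite rmorph0 !val0 ?mul0r.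
have [u uu e] := gt z z0.
have eX (l : int) : valuation P (j (t ^ l)) = l * valuation P (j t).
  have eXn m : valuation P (j (t ^+ m)) = m%:Z * valuation P (j t).
    by rewrite rmorphXn valX // -mulr_natr natz mulrC.
  case: l => l; first exact: eXn.
  by rewrite NegzE -exprnN fmorphV valV ?fmorph_eq0 ?expf_neq0 // eXn mulNr.
rewrite {1}e rmorphM valM ?fmorph_eq0 ?expfz_neq0 //; last by case: uu.
by rewrite (val_unit dP) ?add0r ?eX ?gtz0_abs //; apply/over_unit.
Qed.
End OverDiscrete.

Definition ram (P : place iota') (P' : place iota) : nat :=
  xget 0%N [set e | (0 < e)%N /\ forall z, valuation P (j z) = valuation P' z * e%:Z].

Lemma ramP P P' : over P P' -> discrete P' ->
  (0 < ram P P')%N /\ forall z, valuation P (j z) = valuation P' z * (ram P P')%:Z.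
Proof.
move=> PP dP'; have [e he] := ram_exists PP dP'.
by rewrite /ram; case: xgetP => [e' _ //|/(_ e)]; case.
Qed.

Lemma over_intro (P : place iota') P' : discrete P' ->
  (forall z, place_ring P' z -> place_ring P (j z)) ->
  forall t, t != 0 -> valuation P' t = 1 -> ~~ place_ring P (j t)^-1 -> over P P'.
Proof.
move=> dP' sub t t0 vt nt z; apply/idP/idP => [h|]; last exact: sub.
apply: contraT => nz; case/negP: nt.
have z0 : z != 0 by apply: contraNneq nz => ->; apply: ring0.
have -> : (j t)^-1 = j z * j (z^-1 / t) by rewrite -rmorphM mulVKf // fmorphV.
apply: ringM => //; apply: sub; rewrite (val_ring dP') ?mulf_neq0 ?invr_eq0 //.
by rewrite valF ?invr_eq0 // valV // vt; move: nz; rewrite (val_ring dP') //; clear; lia.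
Qed.

Lemma exists_over_sub P' (A : set F') : discrete P' -> is_subring iota' A ->
  (forall z, place_ring P' z -> A (j z)) ->
  forall t, t != 0 -> valuation P' t = 1 -> ~ A (j t)^-1 ->
  exists P, over P P' /\ forall z, A z -> place_ring P z.
Proof.
move=> dP' As sub t t0 vt At.
have At' : A ((j t)^-1)^-1.
  by rewrite invrK; apply: sub; rewrite (val_ring dP') // vt.
have [P [h1 h2]] := exists_place As At' At; exists P; split=> //.
by apply: (over_intro dP' _ t0 vt h2) => z /sub /h1.
Qed.

Lemma exists_over P' : discrete P' -> exists P, over P P'.
Proof.
move=> dP'; have [t t0 vt] := exists_val dP' 1.
have [|||P [PP _]] := @exists_over_sub P' [set j z | z in place_ring P'] dP' _ _ t t0 vt.
- split=> [c|_ _ [f hf <-] [g hg <-]|_ _ [f hf <-] [g hg <-]].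
  + by exists (iota c); [apply: ringC | apply: jc].
  + by exists (f - g); [apply: ringB | rewrite rmorphB].
  + by exists (f * g); [apply: ringM | rewrite rmorphM].
- by move=> z hz; exists z.
- move=> [z hz]; rewrite -fmorphV => /fmorph_inj e; move: hz; rewrite e /mkset.
  by rewrite -[X in X -> _]/(is_true (place_ring P' t^-1)) (val_ring dP') ?invr_eq0 // valV // vt.
by exists P.
Qed.
End Extension.

(** * The fundamental inequality for ramification indices and degrees *)

Section FundamentalInequality.
Variables (k F F' : fieldType) (iota : {rmorphism k -> F}) (iota' : {rmorphism k -> F'}).
Variable (j : {rmorphism F -> F'}).
Hypothesis (jc : forall c, j (iota c) = iota' c).
Variable n : nat.
Hypothesis (dep : forall b : 'I_n.+1 -> F', exists a : 'I_n.+1 -> F,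
  (exists i, a i != 0) /\ \sum_i j (a i) * b i = 0).

Section Local.
Variables (P' : place iota) (dP' : discrete P') (fP' : finite_degree P') (t : F).
Hypotheses (t0 : t != 0) (vt : valuation P' t = 1).

Section Module.
Variables (B : set F').
Hypotheses (sB : subspace iota' B)
  (BM : forall a b, place_ring P' a -> B b -> B (j a * b)).
Let pB : set F' := [set z | B (z / j t)].

Local Lemma subspace_pB : subspace iota' pB.
Proof.
split=> [|c u v hu hv]; first by rewrite /pB /= mul0r; case: sB.
by rewrite /pB /= mulrDl -mulrA; case: sB => _; apply.
Qed.

Local Lemma pB_ideal a b : vge P' 1 a -> B b -> pB (j a * b).
Proof.
move=> ha hb; have -> : pB (j a * b) = B (j (a / t) * b).
  by congr B; rewrite rmorphM fmorphV -!mulrA; congr (_ * _); rewrite mulrC.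
apply: BM => //; apply/(vge0 dP'); apply/(vge_shift dP' (n := 1) _ _ t0 vt).
by rewrite add0r divfK.
Qed.

Local Lemma pB_M a b : place_ring P' a -> pB b -> pB (j a * b).
Proof. by rewrite /pB /= -mulrA; apply: BM. Qed.

(** Independence over the residue field of the classes in [B / t B], written with representatives of
    the coefficients in the local ring; [pB] is [t B]. *)
Local Definition kindep s (b : nat -> F') := (forall i, B (b i)) /\
  forall a : nat -> F, (forall i, place_ring P' (a i)) ->
    pB (\sum_(i < s) j (a i) * b i) -> forall i, (i < s)%N -> vge P' 1 (a i).

(** A relation over [F], divided by its largest coefficient, has coefficients in the local ring, one
    of which is 1. Hence independence modulo [t] implies independence over [F]. *)
Local Lemma kindep_le s b : kindep s b -> (s <= n)%N.
Proof.
move=> [Bb ind]; rewrite leqNgt; apply/negP => lt.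
have [a [a0 e]] := dep (fun i : 'I_n.+1 => b i).
have [i0 ai0 imax] := max_value P' a0.
pose a' (i : nat) := if (i < n.+1)%N then a (inord i) / a i0 else 0.
have Oa i : place_ring P' (a' i) by rewrite /a'; case: ifP => _ //; apply: ring0.
have s0 : \sum_(i < s) j (a' i) * b i = 0.
  have -> : \sum_(i < s) j (a' i) * b i = \sum_(i < n.+1) j (a' i) * b i.
    rewrite [RHS](big_ord_widen s (fun i => j (a' i) * b i)) // [RHS]big_mkcond.
    by apply: eq_bigr => i _; rewrite /a'; case: ifP => //; rewrite rmorph0 mul0r.
  transitivity (j (a i0)^-1 * \sum_(i < n.+1) j (a i) * b i); last by rewrite e mulr0.
  rewrite mulr_sumr; apply: eq_bigr => i _; rewrite /a' ltn_ord inord_val rmorphM.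
  by rewrite mulrAC mulrC mulrA.
have := ind a' Oa; rewrite s0 => /(_ (subspace_pB).1 i0 (leq_trans (ltn_ord i0) lt)).
rewrite /a' ltn_ord inord_val mulfV // => /(vge_val _ _ (oner_neq0 _)).
by rewrite val1.
Qed.

(** A maximal independent family generates [B] modulo [t B]; reducing the coefficients by [rho] then
    gives coordinates over [k]. Nothing like finite generation of [B] is presupposed. *)
Lemma loc_dim : exists2 N, (N <= n * place_degree P')%N & qdim iota' B pB N.
Proof.
have g0 : exists s, `[< exists b, kindep s b >].
  exists 0%N; apply/asboolP; exists (fun _ => 0); split=> // i; by case: sB.
have bnd s : `[< exists b, kindep s b >] -> (s <= n)%N.
  by move=> /asboolP [b]; apply: kindep_le.
case: (ex_maxnP g0 bnd) => s /asboolP [b hb] smax.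
have sn := kindep_le hb; have [Bb ind] := hb.
have BS (a : nat -> F) : (forall i, place_ring P' (a i)) -> B (\sum_(i < s) j (a i) * b i).
  move=> Oa; apply: (big_ind B); first by case: sB.
    by move=> x y; apply: (subspaceD sB).
  by move=> i _; apply: BM.
have gen z : B z -> exists a : nat -> F, (forall i, place_ring P' (a i)) /\
    pB (z - \sum_(i < s) j (a i) * b i).
  move=> Bz; pose b' i := if (i < s)%N then b i else z.
  have nk : ~ kindep s.+1 b'.
    by move=> h; have := smax s.+1; rewrite ltnn => /(_ (introT (asboolP _) (ex_intro _ b' h))).
  have [a [Oa [pa [i [lis ni]]]]] : exists a : nat -> F, (forall i, place_ring P' (a i)) /\
      pB (\sum_(i < s.+1) j (a i) * b' i) /\ exists i, (i < s.+1)%N /\ ~ vge P' 1 (a i).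
    apply: contrapT => nex; apply: nk; split; first by move=> i; rewrite /b'; case: ifP.
    move=> a Oa pa i lis; apply: contrapT => ni; apply: nex; exists a; split=> //.
    by split=> //; exists i.
  have e : \sum_(i < s.+1) j (a i) * b' i = \sum_(i < s) j (a i) * b i + j (a s) * z.
    rewrite big_ord_recr /= /b' ltnn; congr (_ + _).
    by apply: eq_bigr => l _; rewrite ltn_ord.
  rewrite e in pa.
  have nas : ~ vge P' 1 (a s).
    move=> as1; have ps : pB (\sum_(i < s) j (a i) * b i).
      rewrite -[X in pB X](addrK (j (a s) * z)); apply: (subspaceB subspace_pB) => //.
      exact: pB_ideal.
    move: lis; rewrite ltnS leq_eqVlt => /orP[/eqP ei|lis]; first by rewrite ei in ni.
    by apply: ni; apply: ind lis.
  have as0 : a s != 0 by apply/eqP => as0; apply: nas; rewrite as0; apply: vge_0.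
  have us : place_ring P' (a s)^-1.
    rewrite (val_ring dP') ?invr_eq0 // valV //.
    have : 0 <= valuation P' (a s) by rewrite -(val_ring dP').
    by move/(vge_val _ _ as0): nas; clear; lia.
  exists (fun i => - (a s)^-1 * a i); split; first by move=> l; apply: ringM => //; apply: ringN.
  have -> : z - \sum_(i < s) j (- (a s)^-1 * a i) * b i =
     j (a s)^-1 * (\sum_(i < s) j (a i) * b i + j (a s) * z).
    rewrite mulrDr mulrA -rmorphM mulVf // rmorph1 mul1r addrC mulr_sumr; congr (_ + _).
    by rewrite -sumrN; apply: eq_bigr => l _; rewrite rmorphM rmorphN !mulNr opprK mulrA.
  exact: pB_M.
have [A hA] := ex_choice (P := fun z (a : nat -> F) => B z -> (forall i, place_ring P' (a i)) /\
    pB (z - \sum_(i < s) j (a i) * b i))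
   (fun z => match pselect (B z) with
             | left Bz => let: ex_intro a ha := gen z Bz in ex_intro _ a (fun _ => ha)
             | right nBz => ex_intro _ (fun _ => 0) (fun Bz => False_ind _ (nBz Bz)) end).
have [rho [lin ker _]] := qdim_residue dP' fP'.
have sv := subspace_vge dP' 0.
have toV x : place_ring P' x -> vge P' 0 x by move/(vge0 dP').
have rho_eq x y : place_ring P' x -> place_ring P' y -> vge P' 1 (x - y) -> rho x = rho y.
  move=> hx hy h; apply/eqP; rewrite -subr_eq0 -(coordB sv lin); try exact: toV.
  by apply/eqP/ker => //; apply: toV; apply: ringB.
pose phi z : 'rV[k]_(s * place_degree P') := mxvec (\matrix_(i < s) rho (A z i)).
have lphi : coord_on iota' B phi.
  move=> c u v Bu Bv; have [Ou pu] := hA u Bu; have [Ov pv] := hA v Bv.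
  have Bw : B (iota' c * u + v) by case: sB => _; apply.
  have [Ow pw] := hA _ Bw.
  rewrite /phi -linearZ /= -linearD /=; congr mxvec; apply/row_matrixP => i.
  rewrite linearD linearZ /= !rowK -lin; try exact: toV.
  have Oc l : place_ring P' (iota c * A u l + A v l).
    by apply: ringD => //; apply: ringM => //; apply: ringC.
  apply: rho_eq => //.
  apply: (ind (fun l => A (iota' c * u + v) l - (iota c * A u l + A v l)) _ _ i (ltn_ord i)).
    by move=> l; apply: ringB.
  have -> : \sum_(l < s) j (A (iota' c * u + v) l - (iota c * A u l + A v l)) * b l =
    (iota' c * (u - \sum_(l < s) j (A u l) * b l) + (v - \sum_(l < s) j (A v l) * b l))
    - (iota' c * u + v - \sum_(l < s) j (A (iota' c * u + v) l) * b l).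
    under eq_bigr do rewrite rmorphB rmorphD rmorphM jc mulrBl mulrDl -mulrA.
    by rewrite sumrB big_split /= -mulr_sumr; ring.
  by apply: (subspaceB subspace_pB) => //; case: subspace_pB => _; apply.
have [|N le q] := @qdim_rank _ _ iota' B pB _ phi sB lphi; last first.
  by exists N => //; apply: leq_trans le _; rewrite leq_mul2r sn orbT.
move=> z Bz; have [Oz pz] := hA z Bz; split=> [e|pBz].
  have rz i : (i < s)%N -> vge P' 1 (A z i).
    move=> lis; apply/ker; first exact: toV.
    have /eqP := e; rewrite mxvec_eq0 => /eqP/row_matrixP/(_ (Ordinal lis)).
    by rewrite rowK row0.
  rewrite -[z](subrK (\sum_(i < s) j (A z i) * b i)).
  apply: (subspaceD subspace_pB) => //.
  apply: (big_ind pB); first by case: subspace_pB.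
    by move=> x y; apply: (subspaceD subspace_pB).
  by move=> i _; apply: pB_ideal => //; apply: rz.
apply/eqP; rewrite mxvec_eq0; apply/eqP/row_matrixP => i.
rewrite rowK row0; apply/ker; first exact: toV.
apply: (ind (A z) Oz _ i (ltn_ord i)).
rewrite -[X in pB X](subKr z); exact: (subspaceB subspace_pB).
Qed.
End Module.

Lemma over_finite_degree (P : place iota') : over j P P' -> finite_degree P.
Proof.
move=> PP; have dP := over_discrete dep PP dP'.
have [e0 ve] := ramP dep PP dP'.
have sv := subspace_vge dP 0.
have [|N _ q] := loc_dim sv.
  move=> a b Oa Ob; rewrite -[0 : int]addr0; apply: vgeM => //.
  by apply/(vge0 dP); rewrite PP.
have jt0 : j t != 0 by rewrite fmorph_eq0.
have e : [set z | vge P 0 (z / j t)] = vge P (ram j P P')%:Z.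
  rewrite predeqE => z; rewrite /mkset.
  rewrite (@vge_shift _ _ _ P dP 0 (ram j P P')%:Z (z / j t) (j t)) //.
    by rewrite add0r divfK.
  by rewrite ve vt mul1r.
rewrite e in q.
have [||m _ qm] := @qdim_quotient _ _ iota' _ (vge P 1) _ _ sv (subspace_vge dP 1) _ _ q.
- by move=> z; apply: vge_le.
- by move=> z; apply: vge_le; move: e0; clear; lia.
exists m; rewrite (set_ring dP) (set_ideal dP); apply/qdimP => //; exact: subspace_vge.
Qed.

(** Take for [B] the functions integral at all places of [s]. Weak approximation computes the
    dimension of [B / t B] as the left-hand sum, and [loc_dim] bounds it. *)
Lemma fund_ineq (s : seq (place iota')) : uniq s -> (forall P : place iota', discrete P) ->
  (forall P, P \in s -> over j P P') ->
  (\sum_(P <- s) ram j P P' * place_degree P <= n * place_degree P')%N.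
Proof.
move=> us dP so; have fd P : P \in s -> finite_degree P by move=> /so; apply: over_finite_degree.
have sB := subspace_Bv dP s (fun _ => 0).
have [|N le q] := loc_dim sB.
  move=> a b Oa Ob P Ps; rewrite -[0 : int]addr0; apply: vgeM => //; last exact: Ob.
  by apply/(vge0 (dP P)); rewrite (so P Ps).
apply: leq_trans le.
have q' := qdim_Bv dP (fun _ => 0) (fun P => ram j P P') fd us.
have jt0 : j t != 0 by rewrite fmorph_eq0.
have e : [set z | Bv s (fun _ => 0) (z / j t)] = Bv s (fun P => 0 + (ram j P P')%:Z).
  rewrite predeqE => z; rewrite /mkset /Bv /=.
  have key P : P \in s -> vge P 0 (z / j t) <-> vge P (0 + (ram j P P')%:Z) z.
    move=> Ps; have [e0 ve] := ramP dep (so P Ps) dP'.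
    rewrite (@vge_shift _ _ _ P (dP P) 0 (ram j P P')%:Z (z / j t) (j t)) //.
      by rewrite add0r divfK.
    by rewrite ve vt mul1r.
  by split=> h P Ps; apply/key => //; apply: h.
by rewrite e in q; rewrite (qdim_uniq sB q' q).
Qed.
End Local.

Lemma degree_pos (P : place iota') : discrete P -> finite_degree P -> (0 < place_degree P)%N.
Proof.
move=> dP fP; rewrite lt0n; apply/eqP => e0.
have := qdim_residue dP fP; rewrite e0 => -[phi [_ ker _]].
have h1 : vge P 0 (1 : F') by right; rewrite val1.
have /(vge_val _ _ (oner_neq0 _)) : vge P 1 (1 : F') by apply/ker => //; apply/rowP => -[].
by rewrite val1.
Qed.

Lemma finite_over (P' : place iota) : discrete P' -> finite_degree P' -> (forall P : place iota', discrete P) ->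
  exists s : seq (place iota'), uniq s /\ forall P, P \in s <-> over j P P'.
Proof.
move=> dP' fP' dP; have [t t0 vt] := exists_val dP' 1.
pose good m := exists s : seq (place iota'), [/\ uniq s, size s = m & forall P, P \in s -> over j P P'].
have bnd m : `[< good m >] -> (m <= n * place_degree P')%N.
  move=> /asboolP [s [us <- so]].
  apply: leq_trans (fund_ineq dP' fP' t0 vt us dP so).
  rewrite -sum1_size; rewrite big_seq [leqRHS]big_seq; apply: leq_sum => P Ps.
  have [e0 _] := ramP dep (so P Ps) dP'.
  by rewrite muln_gt0 e0 degree_pos //; apply: (over_finite_degree dP' fP' t0 vt); apply: so.
have g0 : exists m, `[< good m >] by exists 0%N; apply/asboolP; exists [::].
case: (ex_maxnP g0 bnd) => m /asboolP [s [us sm so]] smax.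
exists s; split=> // P; split; first exact: so.
move=> PP; apply: contraT => nPs.
have : `[< good m.+1 >].
  apply/asboolP; exists (P :: s); split; rewrite /= ?nPs ?sm //.
  by move=> Q; rewrite in_cons => /orP[/eqP ->|/so].
by move=> /smax; rewrite ltnn.
Qed.

End FundamentalInequality.

(** * Lifting Riemann's theorem through an extension with known local bases *)

Section StepTheorem.
Variables (k F F' : fieldType) (iota : {rmorphism k -> F}) (iota' : {rmorphism k -> F'}).
Variable (j : {rmorphism F -> F'}).
Hypothesis (jc : forall c, j (iota c) = iota' c).
Variables (q : nat) (Z : F').
Implicit Types p : {poly F}.

Definition ev (p : {poly F}) : F' := (map_poly j p).[Z].

Hypothesis (ev_onto : forall z, exists2 p : {poly F}, (size p <= q)%N & ev p = z).
Hypothesis (ev_inj : forall p : {poly F}, (size p <= q)%N -> ev p = 0 -> p = 0).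

Lemma evE (p : {poly F}) m : (size p <= m)%N -> ev p = \sum_(i < m) j p`_i * Z ^+ i.
Proof.
move=> sp; rewrite /ev (horner_coef_wide (n := m)); last first.
  by rewrite (leq_trans (size_poly _ _)).
by apply: eq_bigr => i _; rewrite coef_map.
Qed.

Lemma evD (p r : {poly F}) : ev (p + r) = ev p + ev r.
Proof. by rewrite /ev rmorphD hornerD. Qed.

Lemma evB (p r : {poly F}) : ev (p - r) = ev p - ev r.
Proof. by rewrite /ev rmorphB /= !hornerE. Qed.

Lemma evZ a p : ev (a *: p) = j a * ev p.
Proof. by rewrite /ev map_polyZ hornerZ. Qed.

Lemma ev_inj2 (p r : {poly F}) : (size p <= q)%N -> (size r <= q)%N -> ev p = ev r -> p = r.
Proof.
move=> sp sr e; apply/eqP; rewrite -subr_eq0; apply/eqP; apply: ev_inj; last by rewrite evB e subrr.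
by rewrite (leq_trans (size_polyD _ _)) // size_polyN geq_max sp.
Qed.

Lemma ev_dep (b : 'I_q.+1 -> F') : exists a : 'I_q.+1 -> F,
  (exists i, a i != 0) /\ \sum_i j (a i) * b i = 0.
Proof.
have [p hp] := ex_choice (P := fun (i : 'I_q.+1) (p : {poly F}) => (size p <= q)%N /\ ev p = b i)
  (fun i => let: ex_intro2 p h1 h2 := ev_onto (b i) in ex_intro _ p (conj h1 h2)).
pose A : 'M[F]_(q.+1, q) := \matrix_(i, l) (p i)`_l.
have : kermx A != 0.
  rewrite kermx_eq0 /row_free; apply/eqP => e.
  by have := rank_leq_col A; rewrite e ltnn.
move=> /rowV0Pn[v /sub_kermxP vA v0].
exists (fun i => v 0 i); split.
  apply: contrapT => nex; case/eqP: v0; apply/rowP => i; rewrite mxE; apply/eqP.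
  by apply: contraT => h; exfalso; apply: nex; exists i.
have -> : \sum_i j (v 0 i) * b i = \sum_i \sum_(l < q) j (v 0 i * (p i)`_l) * Z ^+ l.
  apply: eq_bigr => i _; have [sp <-] := hp i; rewrite (evE sp) mulr_sumr.
  by apply: eq_bigr => l _; rewrite rmorphM mulrA.
rewrite exchange_big /= big1 // => l _; rewrite -mulr_suml -rmorph_sum.
have := congr1 (fun M : 'rV_q => M 0 l) vA; rewrite !mxE => e.
by rewrite (eq_bigr (fun i => v 0 i * A i l)) ?e ?rmorph0 ?mul0r // => i _; rewrite mxE.
Qed.

Definition integral_at (P' : place iota) z := forall P : place iota', over j P P' -> place_ring P z.

(** What remains of a local integral basis that is triangular in [Z]: the leading coefficients, in
    degree [i], of the integral polynomials of degree at most [i] form the fractional ideal of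
    valuation [tau i]. *)
Definition top_values (P' : place iota) (tau : nat -> int) :=
  (forall p : {poly F}, (size p <= q)%N -> integral_at P' (ev p) ->
     forall i, (size p <= i.+1)%N -> vge P' (tau i) p`_i) /\
  (forall i, (i < q)%N -> exists b : {poly F}, [/\ (size b <= i.+1)%N, integral_at P' (ev b),
     b`_i != 0 & valuation P' b`_i = tau i]).

Variables (Pinf : place iota) (g : nat) (rg : riemann Pinf g) (Pinf' : place iota').
Let dP := riemann_disc rg.
Let fP := riemann_deg rg.
Hypothesis (inf_over : forall P, over j P Pinf <-> P = Pinf').
Hypothesis (inf_ram : ram j Pinf' Pinf = q).
Hypothesis (q0 : (0 < q)%N).
Hypothesis (inf_val : forall p : {poly F}, (size p <= q)%N -> forall r : nat,
  vge Pinf' (- (q * r)%:Z) (ev p) <-> forall i, vge Pinf (- r%:Z) p`_i).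
Variables (s0 : seq (place iota)) (us0 : uniq s0) (inf_s0 : Pinf \notin s0).
Variable (tau : place iota -> nat -> int).
Hypothesis (top_tau : forall P', P' != Pinf -> top_values P' (tau P')).
Hypothesis (good : forall P', P' \notin s0 -> P' != Pinf -> (forall i, tau P' i = 0) /\ integral_at P' Z).

Lemma step_disc (P : place iota') : discrete P.
Proof.
have [P' PP] := exists_rest jc ev_dep P.
exact: (over_discrete ev_dep PP (dP P')).
Qed.

Lemma step_deg (P : place iota') : finite_degree P.
Proof.
have [P' PP] := exists_rest jc ev_dep P; have [t t0 vt] := exists_val (dP P') 1.
exact: (over_finite_degree jc ev_dep (dP P') (fP P') t0 vt).
Qed.

Lemma step_fund (P' : place iota) (s : seq (place iota')) : uniq s ->
  (forall P, P \in s -> over j P P') ->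
  (\sum_(P <- s) ram j P P' * place_degree P <= q * place_degree P')%N.
Proof.
have [t t0 vt] := exists_val (dP P') 1 => us.
exact: (fund_ineq jc ev_dep (dP P') (fP P') t0 vt us step_disc).
Qed.

Lemma step_inf : place_degree Pinf' = 1%N.
Proof.
apply/eqP; rewrite eqn_leq (degree_pos (step_disc _) (step_deg _)) andbT.
have := @step_fund Pinf [:: Pinf'] isT; rewrite big_seq1 inf_ram (riemann_inf rg) leq_pmul2l //.
by apply=> P; rewrite in_cons in_nil orbF => /eqP ->; apply/inf_over.
Qed.

Lemma step_rest : exists R : place iota' -> place iota, forall P, over j P (R P).
Proof.
exact: (ex_choice (P := fun P P' => over j P P') (fun P => exists_rest jc ev_dep P)).
Qed.

Lemma step_overs : exists L : place iota -> seq (place iota'),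
  forall P', uniq (L P') /\ forall P, P \in L P' <-> over j P P'.
Proof.
apply: (ex_choice (P := fun P' s => uniq s /\ forall P, P \in s <-> over j P P')) => P'.
exact: (finite_over jc ev_dep (dP P') (fP P') step_disc).
Qed.

Lemma integral_poly P' (p : {poly F}) : integral_at P' Z -> (forall i, vge P' 0 p`_i) -> integral_at P' (ev p).
Proof.
move=> iZ ip P PP; rewrite (evE (leqnn _)); apply: ring_sum => i _; apply: ringM.
  by rewrite PP; apply/(vge0 (dP P')).
by apply: ringX; apply: iZ.
Qed.

(** Outside the finitely many places below where [Z] is not integral or a coefficient of [f] or of
    [f^-1] has a pole, both [f] and [f^-1] are integral. *)
Lemma step_fin f : exists s : seq (place iota'), uniq s /\ forall P, P \notin s -> valuation P f = 0.
Proof.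
have [->|f0] := eqVneq f 0.
  by exists [::]; split=> // P _; apply: val0; apply: step_disc.
have [R hR] := step_rest; have [L hL] := step_overs.
have coefs (p : {poly F}) : exists s : seq (place iota), forall P', P' \notin s -> forall i, vge P' 0 p`_i.
  have fin (c : seq F) : exists s : seq (place iota), forall P', P' \notin s -> forall i, vge P' 0 (nth 0 c i).
    elim: c => [|x c [s hs]]; first by exists [::] => P' _ i; rewrite nth_nil; apply: vge_0.
    have [sx [_ hx]] := riemann_fin rg x.
    exists (sx ++ s) => P'; rewrite mem_cat negb_or => /andP[/hx vx /hs h].
    by case=> [|i] /=; [right; rewrite vx | apply: h].
  exact: fin.
have [p sp ep] := ev_onto f; have [p' sp' ep'] := ev_onto f^-1.
have [s1 h1] := coefs p; have [s2 h2] := coefs p'.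
exists (undup (flatten (map L (Pinf :: s0 ++ s1 ++ s2)))); split; first exact: undup_uniq.
move=> P; rewrite mem_undup => nP.
have out P' : P' \in Pinf :: s0 ++ s1 ++ s2 -> R P != P'.
  move=> h; apply: contra nP => /eqP e; apply/flattenP; exists (L P'); first exact: map_f.
  by apply/(hL P').2; rewrite -e; apply: hR.
have Rinf : R P != Pinf by apply: out; rewrite mem_head.
have ns (s : seq (place iota)) : {subset s <= Pinf :: s0 ++ s1 ++ s2} -> R P \notin s.
  by move=> sub; apply/negP => /sub /out; rewrite eqxx.
have [_ iZ] : (forall i, tau (R P) i = 0) /\ integral_at (R P) Z.
  by apply: good => //; apply: ns => Q h; rewrite in_cons mem_cat h orbT.
have i1 : place_ring P f.
  rewrite -ep; apply: (integral_poly iZ) (hR P); apply: h1; apply: ns => Q h.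
  by rewrite in_cons !mem_cat h !orbT.
have i2 : place_ring P f^-1.
  rewrite -ep'; apply: (integral_poly iZ) (hR P); apply: h2; apply: ns => Q h.
  by rewrite in_cons !mem_cat h !orbT.
by apply: (val_unit (step_disc P)); split.
Qed.

Lemma step_rep : exists rep : F' -> {poly F}, [/\ forall z, (size (rep z) <= q)%N,
  forall z, ev (rep z) = z & forall c u v, rep (iota' c * u + v) = iota c *: rep u + rep v].
Proof.
have [rep hrep] := ex_choice (P := fun z (p : {poly F}) => (size p <= q)%N /\ ev p = z)
  (fun z => let: ex_intro2 p h1 h2 := ev_onto z in ex_intro _ p (conj h1 h2)).
exists rep; split=> [z|z|c u v]; [by case: (hrep z) | by case: (hrep z) |].
have [s1 e1] := hrep u; have [s2 e2] := hrep v; have [s3 e3] := hrep (iota' c * u + v).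
apply: ev_inj2 => //; last by rewrite e3 evD evZ e1 e2 jc.
rewrite (leq_trans (size_polyD _ _)) // geq_max s2 andbT.
by rewrite (leq_trans (size_scale_leq _ _)).
Qed.

Lemma large_integral (P' : place iota) : exists N : nat, forall l x, (l < q)%N ->
  vge P' N%:Z x -> integral_at P' (j x * Z ^+ l).
Proof.
have [L hL] := step_overs.
have [M hM] : exists M : nat, forall P, P \in L P' -> forall l, (l < q)%N ->
    - valuation P (Z ^+ l) <= M%:Z.
  elim: (L P') => [|P s [M hM]]; first by exists 0%N.
  exists (M + \sum_(l < q) `|valuation P (Z ^+ l)|)%N => Q; rewrite in_cons => /orP[/eqP ->|/hM h] l lq.
    rewrite (bigD1 (Ordinal lq)) //=; clear; lia.
  by have := h l lq; clear; lia.
exists M => l x lq hx P PP.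
have [e0 ve] := ramP ev_dep PP (dP P').
have [->|x0] := eqVneq x 0; first by rewrite rmorph0 mul0r; apply: ring0.
have [->|z0] := eqVneq (Z ^+ l) 0; first by rewrite mulr0; apply: ring0.
rewrite (val_ring (step_disc P)) ?mulf_neq0 ?fmorph_eq0 // valM ?fmorph_eq0 //; last exact: step_disc.
rewrite ve; have /(vge_val _ _ x0) h1 := hx; have h2 := hM P (((hL P').2 P).2 PP) l lq.
by move: h1 h2 e0; move: (valuation P' x) (valuation P _) (ram _ _ _); clear; nia.
Qed.

Definition topdiv (r : nat) (i : nat) (P : place iota) : int :=
  if P == Pinf then r%:Z else if P \in s0 then - tau P i else 0.

(** At each place of [s0] a multiple of the local polynomial [b P] has the prescribed top
    coefficient [a]. Strong approximation replaces all its lower coefficients by global ones, with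
    errors so small that by [large_integral] they do not affect integrality. The bound [r1] on the
    poles at [Pinf] is independent of [a], which makes the graded pieces complete for one and the
    same [r]. *)
Lemma step_surj i : (i < q)%N -> exists r1 : nat, forall r : nat, (r1 <= r)%N ->
  forall a, Lf (topdiv r i) a -> exists p : {poly F}, [/\ (size p <= i.+1)%N, p`_i = a,
    forall l, vge Pinf (- r%:Z) p`_l & forall P', P' != Pinf -> integral_at P' (ev p)].
Proof.
move=> iq; have [N hN] := ex_choice (P := fun P' (N : nat) => forall l x, (l < q)%N ->
  vge P' N%:Z x -> integral_at P' (j x * Z ^+ l)) large_integral.
have [b hb] : exists b : place iota -> {poly F}, forall P, P != Pinf ->
    [/\ (size (b P) <= i.+1)%N, integral_at P (ev (b P)), (b P)`_i != 0
      & valuation P (b P)`_i = tau P i].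
  apply: (ex_choice (P := fun P (b : {poly F}) => P != Pinf -> [/\ (size b <= i.+1)%N,
    integral_at P (ev b), b`_i != 0 & valuation P b`_i = tau P i])) => P.
  have [->|PI] := eqVneq P Pinf; first by exists 0.
  by have [_ /(_ i iq)[b hb]] := top_tau PI; exists b.
pose h Q : int := if Q \in s0 then - (N Q)%:Z else 0.
have h0 Q : Q \notin s0 -> h Q = 0 by rewrite /h => /negbTE ->.
pose E P l := valuation P (b P)`_l.
have [Rf hRf] : exists Rf : place iota * nat -> nat, forall Pl, Pl.1 != Pinf ->
   forall c, vge Pl.1 (E Pl.1 Pl.2) c -> exists m, [/\ vge Pl.1 (N Pl.1)%:Z (m - c),
    forall Q, Q != Pl.1 -> Q != Pinf -> vge Q (- h Q) m & vge Pinf (- (Rf Pl)%:Z) m].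
  apply: (ex_choice (P := fun Pl (r : nat) => Pl.1 != Pinf ->
    forall c, vge Pl.1 (E Pl.1 Pl.2) c -> exists m, [/\ vge Pl.1 (N Pl.1)%:Z (m - c),
    forall Q, Q != Pl.1 -> Q != Pinf -> vge Q (- h Q) m & vge Pinf (- r%:Z) m])) => -[P l] /=.
  have [->|PI] := eqVneq P Pinf; first by exists 0%N.
  have [r hr] := strong_approx rg (E P l) `|(N P)%:Z - E P l|%N PI h0.
  exists r => _ c /hr [m [m1 m2 m3]]; exists m; split=> //.
  by apply: vge_le m1; clear; lia.
exists (\sum_(P <- s0) \sum_(l < i) Rf (P, l : nat))%N => r le a ha.
have aP P : P \in s0 -> P != Pinf -> vge P (tau P i) a.
  by move=> Ps PI; have := ha P; rewrite /topdiv (negbTE PI) Ps opprK.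
have s0I P : P \in s0 -> P != Pinf.
  by move=> Ps; apply: contraNneq inf_s0 => <-.
pose c P l := a / (b P)`_i * (b P)`_l.
have cE P l : P \in s0 -> vge P (E P l) (c P l).
  move=> Ps; have [_ _ bi vbi] := hb P (s0I P Ps).
  rewrite -[E P l]add0r; apply: vgeM => //; last by right.
  apply/(vge_shift (dP P) _ _ bi vbi); rewrite add0r divfK //; apply: aP => //; exact: s0I.
have [m hm] : exists m : place iota * nat -> F, forall Pl, Pl.1 \in s0 ->
   [/\ vge Pl.1 (N Pl.1)%:Z (m Pl - c Pl.1 Pl.2),
    forall Q, Q != Pl.1 -> Q != Pinf -> vge Q (- h Q) (m Pl) & vge Pinf (- (Rf Pl)%:Z) (m Pl)].
  apply: (ex_choice (P := fun Pl m => Pl.1 \in s0 ->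
   [/\ vge Pl.1 (N Pl.1)%:Z (m - c Pl.1 Pl.2),
    forall Q, Q != Pl.1 -> Q != Pinf -> vge Q (- h Q) m & vge Pinf (- (Rf Pl)%:Z) m])) => -[P l] /=.
  have [Ps|] := boolP (P \in s0); last by exists 0.
  by have [m hm] := hRf (P, l) (s0I P Ps) _ (cE P l Ps); exists m.
pose co l := if l == i then a else \sum_(P <- s0) m (P, l).
exists (\poly_(l < i.+1) co l); split.
- exact: size_poly.
- by rewrite coef_poly ltnSn /co eqxx.
- move=> l; rewrite coef_poly; case: ifP => li; last exact: vge_0.
  rewrite /co; case: eqP => [_|/eqP nli].
    by have := ha Pinf; rewrite /topdiv eqxx.
  have li' : (l < i)%N by rewrite ltn_neqAle nli -ltnS.
  rewrite big_seq; apply: vge_sum => // P Ps; have [_ _ hI] := hm (P, l) Ps.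
  apply: vge_le hI; rewrite lerN2 lez_nat; apply: leq_trans le.
  by rewrite (big_rem P) //= (bigD1 (Ordinal li')) //= -addnA leq_addr.
- move=> P' PI.
  have evco : ev (\poly_(l < i.+1) co l) = \sum_(l < i.+1) j (co l) * Z ^+ l.
    rewrite (evE (size_poly _ _)); apply: eq_bigr => l _.
    by rewrite coef_poly ltn_ord.
  have vm P l : P \in s0 -> P != P' -> vge P' (- h P') (m (P, l)).
    by move=> Ps PP'; have [_ h2 _] := hm (P, l) Ps; apply: h2; rewrite // eq_sym.
  have [Ps|nPs] := boolP (P' \in s0); last first.
    have [t0 iZ] := good nPs PI.
    apply: integral_poly => // l; rewrite coef_poly; case: ifP => li; last exact: vge_0.
    rewrite /co; case: eqP => [_|/eqP nli].
      by have := ha P'; rewrite /topdiv (negbTE PI) (negbTE nPs) oppr0.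
    rewrite big_seq; apply: vge_sum => // P Ps.
    have := vm P l Ps; rewrite h0 // oppr0; apply.
    by apply: contraNneq nPs => <-.
  have [sb ib bi vbi] := hb P' PI.
  have -> : ev (\poly_(l < i.+1) co l) = j (a / (b P')`_i) * ev (b P') +
      \sum_(l < i.+1) j (co l - c P' l) * Z ^+ l.
    rewrite evco (evE sb) mulr_sumr -big_split /=; apply: eq_bigr => l _.
    rewrite mulrA -rmorphM -mulrDl -rmorphD; congr (j _ * _).
    by rewrite /c addrC subrK.
  move=> P PP; apply: ringD; last apply: ring_sum => l _.
    apply: ringM; last exact: ib.
    rewrite PP; apply/(vge0 (dP P')); apply/(vge_shift (dP P') _ _ bi vbi).
    by rewrite add0r divfK //; apply: aP.
  apply: hN PP; first by apply: leq_ltn_trans iq; rewrite -ltnS.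
  rewrite /co; case: eqP => [->|/eqP nli]; first by rewrite /c divfK ?subrr //; apply: vge_0.
  rewrite (bigD1_seq P') //= addrAC; apply: vgeD => //.
    by have [h1 _ _] := hm (P', l : nat) Ps.
  rewrite big_seq_cond; apply: vge_sum => // Q /andP[Qs QP].
  by have := vm Q l Qs QP; rewrite /h Ps opprK.
Qed.

Definition loclam i : int := \sum_(P <- s0) tau P i * (place_degree P)%:Z.

Lemma dg_topdiv r i : dg (Pinf :: s0) (topdiv r i) = r%:Z - loclam i.
Proof.
rewrite /dg big_cons /topdiv eqxx (riemann_inf rg) mulr1 /loclam -sumrN; congr (_ + _).
rewrite big_seq [RHS]big_seq; apply: eq_bigr => P Ps.
have /negbTE -> : P != Pinf by apply: contraNneq inf_s0 => <-.
by rewrite Ps mulNr.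
Qed.

Lemma topdiv_supp r i P : P \notin Pinf :: s0 -> topdiv r i P = 0.
Proof.
rewrite in_cons negb_or => /andP[PI Ps].
by rewrite /topdiv (negbTE PI) (negbTE Ps).
Qed.

Definition Vinf (r : nat) : set F' := Lf (single Pinf' (q * r)%:Z).

Lemma VinfP r (p : {poly F}) : (size p <= q)%N -> Vinf r (ev p) <->
  (forall l, vge Pinf (- r%:Z) p`_l) /\ forall P', P' != Pinf -> integral_at P' (ev p).
Proof.
move=> sp; split=> [h|[h1 h2] P].
  split.
    by apply/(inf_val sp); have := h Pinf'; rewrite /single eqxx.
  move=> P' PI P PP; have := h P; rewrite /single; case: eqP => [e|_].
    have := (inf_over P).2 e => PPi.
    suff : P' = Pinf by move/eqP: PI.
    by apply: place_eqP => z; rewrite -PP -PPi.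
  by rewrite oppr0 => /(vge0 (step_disc P)).
rewrite /single; case: eqP => [->|nP]; first by apply/(inf_val sp).
rewrite oppr0; apply/(vge0 (step_disc P)).
have [P' PP] := exists_rest jc ev_dep P; apply: h2 (PP).
by apply/eqP => e; apply: nP; apply/inf_over; rewrite -e.
Qed.

(** The space is filtered by the degree in [Z]. Taking the top coefficient identifies the graded
    piece of degree [i] with [Lf (topdiv r i)] in the field below, whose dimension Riemann's theorem
    gives once [r] is large. *)
Lemma step_dim : exists r1 : nat, forall r : nat, (r1 <= r)%N -> exists2 N,
  qdim iota' (Vinf r) [set 0] N & N%:Z = q%:Z * (r%:Z + 1 - g%:Z) - \sum_(i < q) loclam i.
Proof.
have [c hc] := riemann_dim rg.
have [r1 hr1] := ex_choice (P := fun i (r1 : nat) => (i < q)%N -> forall r : nat, (r1 <= r)%N ->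
  forall a, Lf (topdiv r i) a -> exists p : {poly F}, [/\ (size p <= i.+1)%N, p`_i = a,
    forall l, vge Pinf (- r%:Z) p`_l & forall P', P' != Pinf -> integral_at P' (ev p)])
  (fun i => match boolP (i < q)%N with
     | AltTrue h => let: ex_intro r hr := step_surj h in ex_intro _ r (fun _ => hr)
     | AltFalse h => ex_intro _ 0%N (fun h' => False_ind _ (negP h h')) end).
exists (\sum_(i < q) (r1 i + c + `|loclam i|))%N => r le.
have lei i : (i < q)%N -> (r1 i + c + `|loclam i| <= r)%N.
  by move=> iq; apply: leq_trans le; rewrite (bigD1 (Ordinal iq)) //= leq_addr.
have [rep [srep erep lrep]] := step_rep.
pose W i : set F' := [set z | Vinf r z /\ (size (rep z) <= i)%N].
have sV : subspace iota' (Vinf r) by apply: subspace_Lf; apply: step_disc.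
have sW i : subspace iota' (W i).
  split=> [|d u v [Vu su] [Vv sv]].
    split; first by case: sV.
    by have -> : rep 0 = 0; [apply: ev_inj => //; rewrite erep | rewrite size_poly0].
  split; first by case: sV => _; apply.
  rewrite lrep (leq_trans (size_polyD _ _)) // geq_max sv andbT.
  by rewrite (leq_trans (size_scale_leq _ _)).
have WV : W q = Vinf r by rewrite predeqE => z; split=> [[]//|h]; split.
have W0 : W 0%N = [set 0].
  rewrite predeqE => z; split=> [[_]|->].
    by rewrite leqn0 size_poly_eq0 => /eqP e; rewrite -(erep z) e /ev rmorph0 horner0.
  by case: (sW 0%N).
have step i : (i < q)%N -> exists2 n, qdim iota' (W i.+1) (W i) n & n%:Z = r%:Z + 1 - g%:Z - loclam i.
  move=> iq; have uP : uniq (Pinf :: s0) by rewrite /= inf_s0.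
  have [||n qn en] := hc (Pinf :: s0) (topdiv r i) uP.
  - exact: topdiv_supp.
  - rewrite dg_topdiv; have := lei i iq; move: (loclam i) (r1 i) => y y'; clear; lia.
  exists n; last by rewrite en dg_topdiv; clear; lia.
  apply: (qdim_iso (theta := fun z => (rep z)`_i) (sW i.+1) qn).
  - by move=> d u v _ _; rewrite lrep coefD coefZ.
  - move=> z [Vz sz] P; have := Vz; rewrite -{1}(erep z) => /(VinfP _ (srep z)) [h1 h2].
    rewrite /topdiv; case: eqP => [->//|/eqP PI].
    have [top _] := top_tau PI; have := top _ (srep z) (h2 P PI) i sz.
    by case: ifP => [_|/negbT Ps]; rewrite ?opprK // ; have [-> _] := good Ps PI; rewrite oppr0.
  - move=> z [Vz sz] /=; split=> [e|[_ sz']]; last by rewrite nth_default.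
    split=> //; apply/leq_sizeP => l; rewrite leq_eqVlt => /orP[/eqP <- //|il].
    by rewrite nth_default // (leq_trans sz).
  - move=> a ha; have [p [sp pi h1 h2]] := hr1 i iq r (leq_trans (leq_trans (leq_addr _ _) (leq_addr _ _)) (lei i iq)) a ha.
    have sq : (size p <= q)%N by apply: leq_trans sp iq.
    have rp : rep (ev p) = p by apply: ev_inj2.
    exists (ev p); last by rewrite rp.
    by split; [apply/(VinfP _ sq) | rewrite rp].
have all i : (i <= q)%N -> exists2 N, qdim iota' (W i) (W 0%N) N &
    N%:Z = i%:Z * (r%:Z + 1 - g%:Z) - \sum_(l < i) loclam l.
  elim: i => [_|i IH iq].
    by exists 0%N; [apply: qdim_refl | rewrite mul0r big_ord0].
  have [N qN eN] := IH (ltnW iq); have [n qn en] := step i iq.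
  exists (n + N)%N.
    apply: (qdim_add (sW i.+1) (sW i) _ _ qn qN) => z [Vz sz]; split=> //.
      by move: sz; rewrite leqn0 => /eqP ->.
    exact: leqW.
  rewrite PoszD eN en big_ord_recr /=; move: (loclam i) (\sum_(i0 < i) _) => y y'; clear.
  by rewrite intS; ring.
by have := all q (leqnn q); rewrite WV W0.
Qed.

(** An upper bound on the degree follows from the fundamental inequality alone: it is an equality at
    [Pinf], the only possible pole of [x], and elsewhere the valuations it multiplies are
    nonnegative. *)
Lemma dg_pullback (s : seq (place iota')) x : x != 0 -> uniq s -> Pinf' \in s ->
  (forall P, P \notin s -> valuation P (j x) = 0) ->
  (forall P, P != Pinf -> 0 <= valuation P x) ->
  dg s (fun P => valuation P (j x)) <= 0.
Proof.
move=> x0 us Is hs hx; have [R hR] := step_rest; have [sx [usx hsx]] := riemann_fin rg x.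
pose S := undup (map R s ++ sx).
have uS : uniq S by apply: undup_uniq.
have RS P : P \in s -> R P \in S.
  by move=> Ps; rewrite mem_undup mem_cat map_f.
pose G P : int := (ram j P (R P) * place_degree P)%N%:Z.
have -> : dg s (fun P => valuation P (j x)) = \sum_(P' <- S) valuation P' x * \sum_(P <- s | R P == P') G P.
  under [RHS]eq_bigr do rewrite mulr_sumr big_mkcond /=.
  rewrite exchange_big /= /dg big_seq [RHS]big_seq; apply: eq_bigr => P Ps.
  rewrite (bigD1_seq (R P)) ?RS //= eqxx big1 ?addr0 => [|P' /negbTE e]; last first.
    by rewrite eq_sym e.
  by have [_ ->] := ramP ev_dep (hR P) (dP (R P)); rewrite /G PoszM mulrA.
have sumG P' : \sum_(P <- s | R P == P') G P <= (q * place_degree P')%N%:Z.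
  have := @step_fund P' [seq P <- s | R P == P'] (filter_uniq _ us).
  rewrite big_filter => le; rewrite /G -(big_morph Posz PoszD (erefl 0)) lez_nat.
  rewrite (eq_bigr (fun P => ram j P P' * place_degree P)%N) => [|P /eqP -> //].
  by apply: le => P; rewrite mem_filter => /andP[/eqP <- _].
have sumI : \sum_(P <- s | R P == Pinf) G P = (q * place_degree Pinf)%N%:Z.
  rewrite (eq_bigl (fun P => P == Pinf')) => [|P]; last first.
    apply/eqP/eqP => [e|->]; first by apply/inf_over; rewrite -e.
    apply: place_eqP => z; rewrite -(hR Pinf') //.
    by have /inf_over := erefl Pinf'; apply.
  rewrite big_mkcond (bigD1_seq Pinf') //= eqxx big1 ?addr0 => [|P /negbTE -> //].
  have eR : R Pinf' = Pinf.
    apply: place_eqP => z; rewrite -(hR Pinf') //.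
    by have /inf_over := erefl Pinf'; apply.
  by rewrite /G eR inf_ram step_inf (riemann_inf rg).
apply: (@le_trans _ _ (\sum_(P' <- S) valuation P' x * (q * place_degree P')%N%:Z)).
  apply: ler_sum => P' _; have [->|PI] := eqVneq P' Pinf; first by rewrite sumI.
  by apply: ler_wpM2l; [apply: hx | apply: sumG].
rewrite (eq_bigr (fun P' => q%:Z * (valuation P' x * (place_degree P')%:Z))) ; last first.
  by move=> P' _; rewrite PoszM mulrCA.
rewrite -mulr_sumr -/(dg S (fun P => valuation P x)) (dg_val0 rg x0 uS) ?mulr0 // => P.
by rewrite mem_undup mem_cat negb_or => /andP[_ /hsx].
Qed.

(** The sum of [loclam] plays the role of half the degree of the different in Hurwitz's formula.
    Equality on large multiples of [Pinf'] is [step_dim]. For any other divisor [h], a function [x]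
    of the field below with high zeros and no pole outside [Pinf] gives [h <= q r Pinf' + (x)];
    passing from the larger divisor down to [h] cannot increase the defect. *)
Theorem riemann_step (g' : nat) :
  g'%:Z - 1 = q%:Z * (g%:Z - 1) + \sum_(i < q) loclam i -> riemann Pinf' g'.
Proof.
move=> eg; have [r1 hr1] := step_dim.
have fd := step_deg; have ds := step_disc.
have [c hc] := riemann_dim rg.
split; [exact: step_disc | exact: step_deg | exact: step_inf | exact: step_fin | | ]; last first.
  have [N qN eN] := hr1 r1 (leqnn _); exists (q * r1)%N, N; split=> //.
  by rewrite eN; move: eg; set x := \sum_(i < q) _; clear; lia.
move=> s h us h0; have [R hR] := step_rest.
pose M := (\sum_(P <- s) `|h P|)%N.
have MP P : P \in s -> h P <= M%:Z.
  by move=> Ps; rewrite /M (big_rem P) //=; clear; lia.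
pose S := undup [seq P' <- map R s | P' != Pinf].
pose D (r : nat) P := single Pinf r%:Z P + (if P \in S then - M%:Z else 0).
have IS : Pinf \notin S by rewrite mem_undup mem_filter eqxx.
have uS : uniq (Pinf :: S) by rewrite /= IS undup_uniq.
have DS r P : P \notin Pinf :: S -> D r P = 0.
  by rewrite in_cons negb_or => /andP[PI PS]; rewrite /D /single (negbTE PI) (negbTE PS).
(* The divisor [D r] demands zeros of order [M] at the finite places below the support of [h]; a
   large [r] makes its space nonzero. *)
have [r [n0 [qn0 n0pos]]] : exists r n0 : nat, qdim iota (Lf (D r)) [set 0] n0 /\ (0 < n0)%N.
  pose B := dg (Pinf :: S) (fun P => if P \in S then - M%:Z else 0).
  pose r := (c + g + `|B|)%N.
  have eD : dg (Pinf :: S) (D r) = r%:Z + B.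
    by rewrite dgD dg_single ?mem_head // (riemann_inf rg) mulr1.
  have [||n0 q1 e1] := hc (Pinf :: S) (D r) uS; first exact: DS.
    by rewrite eD /r; move: (B) => y; clear; lia.
  exists r, n0; split=> //; move: e1; rewrite eD /r; move: (B) => y; clear; lia.
have [x x0 hx] := L0_pos qn0 n0pos.
have xpos P : P != Pinf -> 0 <= valuation P x.
  move=> PI; have /(vge_val _ _ x0) := hx P; rewrite /D /single (negbTE PI) add0r.
  by case: ifP => _; rewrite ?oppr0 // opprK; move: (valuation P x); clear; lia.
have xM P : P \in s -> P != Pinf' -> h P <= valuation P (j x).
  move=> Ps PI; have [e0 ->] := ramP ev_dep (hR P) (dP (R P)).
  have RI : R P != Pinf.
    by apply: contra PI => /eqP e; apply/eqP/inf_over; rewrite -e.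
  have RS : R P \in S by rewrite mem_undup mem_filter RI map_f.
  have /(vge_val _ _ x0) := hx (R P); rewrite /D /single (negbTE RI) add0r RS opprK.
  have := MP P Ps; move: e0; move: (h P) (valuation (R P) x) (ram j P (R P)) (M); clear; nia.
have jx0 : j x != 0 by rewrite fmorph_eq0.
have [sx [usx hsx]] := step_fin (j x).
pose s2 := undup (Pinf' :: s ++ sx).
have us2 : uniq s2 by apply: undup_uniq.
have Is2 : Pinf' \in s2 by rewrite mem_undup mem_head.
have out P : P \notin s2 -> [/\ P != Pinf', P \notin s & P \notin sx].
  rewrite mem_undup => nP; split.
  - by apply: contra nP => /eqP ->; apply: mem_head.
  - by apply: contra nP => hP; rewrite in_cons mem_cat hP orbT.
  - by apply: contra nP => hP; rewrite in_cons mem_cat hP !orbT.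
pose r2 := (r1 + `|h Pinf'| + `|valuation Pinf' (j x)|)%N.
have [|N qN eN] := hr1 r2; first by rewrite /r2 -addnA leq_addr.
pose B P := single Pinf' (q * r2)%:Z P + valuation P (j x).
have qB : qdim iota' (Lf B) [set 0] N by apply: Lf_mul.
have hB P : h P <= B P.
  rewrite /B /single; case: eqP => [->|/eqP PI].
    have : (r2 <= q * r2)%N by rewrite leq_pmull.
    by rewrite /r2; clear; lia.
  rewrite add0r; have [Ps|Ps] := boolP (P \in s); first exact: xM.
  rewrite h0 //; have [e0 ->] := ramP ev_dep (hR P) (dP (R P)).
  apply: mulr_ge0 => //; apply: xpos; apply: contra PI => /eqP e.
  by apply/eqP/inf_over; rewrite -e.
have [P|a lea qa] := Lf_mono ds fd us2 _ hB.
  by move=> /out [PI Ps Psx]; rewrite /B /single (negbTE PI) add0r hsx // h0.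
have [m _ qm] := qdim_sub (subspace_Lf ds B) (subspace_Lf ds h) (Lf_sub hB) qB.
exists m => //.
have eNm : N = (a + m)%N.
  apply: (qdim_uniq (subspace_Lf ds B) qB); apply: (qdim_add _ _ _ _ qa qm).
  - exact: subspace_Lf.
  - exact: subspace_Lf.
  - by move=> _ ->; apply: Lf0.
  - exact: Lf_sub.
have edh : dg s h = dg s2 h.
  by apply: dg_eq => // P /out [_ /h0].
have dB : dg s2 B <= (q * r2)%:Z.
  rewrite dgD dg_single // step_inf mulr1 gerDl; apply: dg_pullback => // P /out [_ _].
  exact: hsx.
rewrite edh; move: eg lea dB eN; rewrite eNm; set y := \sum_(i < q) _.
by move: (dg s2 h) (dg s2 B); clear; lia.
Qed.
End StepTheorem.

(** * Polynomials over a valuation ring and local integral bases *)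

Lemma Ocoef_ring (k F : fieldType) (iota : {rmorphism k -> F}) (P : place iota) :
  let C := fun p : {poly F} => forall i, place_ring P p`_i in
  [/\ forall a, place_ring P a -> C a%:P, C 'X, forall p r, C p -> C r -> C (p + r),
      forall p r, C p -> C r -> C (p - r) & forall p r, C p -> C r -> C (p * r)].
Proof.
split=> [a Oa i||p r hp hr i|p r hp hr i|p r hp hr i].
- by rewrite coefC; case: eqP => _ //; apply: ring0.
- by move=> i; rewrite coefX; case: eqP => _; [apply: ring1 | apply: ring0].
- by rewrite coefD; apply: ringD.
- by rewrite coefB; apply: ringB.
- by rewrite coefM; apply: ring_sum => l _; apply: ringM.
Qed.

Section IntegralPolynomials.
Variables (k F : fieldType) (iota : {rmorphism k -> F}) (P : place iota).
Implicit Types p r s : {poly F}.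

Definition Ocoef p := forall i, place_ring P p`_i.

Lemma OcoefC a : place_ring P a -> Ocoef a%:P.
Proof. by have [h _ _ _ _] := Ocoef_ring P; apply: h. Qed.
Lemma OcoefX : Ocoef 'X.
Proof. by have [_ h _ _ _] := Ocoef_ring P. Qed.
Lemma OcoefD p r : Ocoef p -> Ocoef r -> Ocoef (p + r).
Proof. by have [_ _ h _ _] := Ocoef_ring P; apply: h. Qed.
Lemma OcoefB p r : Ocoef p -> Ocoef r -> Ocoef (p - r).
Proof. by have [_ _ _ h _] := Ocoef_ring P; apply: h. Qed.
Lemma OcoefM p r : Ocoef p -> Ocoef r -> Ocoef (p * r).
Proof. by have [_ _ _ _ h] := Ocoef_ring P; apply: h. Qed.
Lemma OcoefZ a p : place_ring P a -> Ocoef p -> Ocoef (a *: p).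
Proof. by move=> Oa Op; rewrite -mul_polyC; apply: OcoefM => //; apply: OcoefC. Qed.
Lemma Ocoef_exp p n : Ocoef p -> Ocoef (p ^+ n).
Proof.
move=> Op; elim: n => [|n IH]; rewrite ?expr0 ?exprS; last exact: OcoefM.
by rewrite -polyC1; apply: OcoefC; apply: ring1.
Qed.
Lemma Ocoef0 : Ocoef 0.
Proof. by rewrite -polyC0; apply: OcoefC; apply: ring0. Qed.
Lemma Ocoef_sum (I : Type) (l : seq I) (c : pred I) (h : I -> {poly F}) :
  (forall i, c i -> Ocoef (h i)) -> Ocoef (\sum_(i <- l | c i) h i).
Proof. by move=> H; apply: (big_ind Ocoef) => //; [apply: Ocoef0 | apply: OcoefD]. Qed.
Lemma Ocoef_comp p r : Ocoef p -> Ocoef r -> Ocoef (p \Po r).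
Proof.
move=> Op Or; rewrite comp_polyE; apply: Ocoef_sum => i _.
by apply: OcoefZ => //; apply: Ocoef_exp.
Qed.
Lemma Ocoef_horner p a : Ocoef p -> place_ring P a -> place_ring P p.[a].
Proof.
move=> Op Oa; rewrite horner_coef; apply: ring_sum => i _.
by apply: ringM => //; apply: ringX.
Qed.

Lemma Ocoef_div (psi : {poly F}) m p : psi \is monic -> size psi = m.+1 -> Ocoef psi -> Ocoef p ->
  exists s r, [/\ Ocoef s, Ocoef r, (size r <= m)%N & p = s * psi + r].
Proof.
move=> mon spsi Opsi; have [N le] := ubnP (size p); elim: N p le => // N IH p le Op.
have [sp|sp] := leqP (size p) m.
  by exists 0, p; split=> //; [apply: Ocoef0 | rewrite mul0r add0r].
pose a := lead_coef p; pose d := (size p - m.+1)%N.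
have Od : Ocoef (a *: 'X^d) by apply: OcoefZ; [apply: Op | apply: Ocoef_exp; apply: OcoefX].
have p0 : p != 0 by rewrite -size_poly_eq0 -lt0n; apply: leq_ltn_trans sp.
have psi0 : psi != 0 by apply: monic_neq0.
pose p' := p - a *: 'X^d * psi.
have sz : (size p' < size p)%N.
  have sd : (d + m.+1 = size p)%N by rewrite subnK.
  have s2 : size (a *: 'X^d * psi) = size p.
    by rewrite -scalerAl size_scale ?lead_coef_eq0 // mulrC size_mulXn // spsi sd.
  rewrite -(prednK (_ : 0 < size p)%N) ?size_poly_gt0 // ltnS.
  apply/leq_sizeP => l; rewrite leq_eqVlt => /orP[/eqP <-|lt].
    rewrite coefB -[X in _ - X]/(_`_(size p).-1) -{2}s2 -!lead_coefE.
    rewrite -scalerAl lead_coefZ mulrC lead_coefM lead_coefXn (eqP (mon : lead_coef psi == 1)).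
    by rewrite ?mulr1 ?mul1r /a subrr.
  have le' : (size p <= l)%N by rewrite -(prednK (_ : 0 < size p)%N) ?size_poly_gt0.
  by rewrite coefB !nth_default ?s2 ?subrr.
have [|s [r [Os Or sr e]]] := IH p' (leq_trans sz (ltnSE le)).
  by apply: OcoefB => //; apply: OcoefM.
exists (a *: 'X^d + s), r; split=> //; first exact: OcoefD.
by rewrite mulrDl -addrA -e addrC subrK.
Qed.
End IntegralPolynomials.

Section DistinctValues.
Variables (k F : fieldType) (iota : {rmorphism k -> F}) (P : place iota) (dP : discrete P).

Lemma distinct_vge m (t : 'I_m -> F) n :
  (forall i l, i != l -> t i != 0 -> t l != 0 -> valuation P (t i) != valuation P (t l)) ->
  vge P n (\sum_i t i) -> forall i, vge P n (t i).
Proof.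
move=> dist h i; have [->|ti] := eqVneq (t i) 0; first exact: vge_0.
have [i0 ti0 imax] := max_value P (ex_intro (fun i => t i != 0) i ti).
have le l : t l != 0 -> valuation P (t i0) <= valuation P (t l).
  move=> tl; have := imax l; rewrite (val_ring dP) ?mulf_neq0 ?invr_eq0 // valF //.
  by clear; lia.
have rest : vge P (valuation P (t i0) + 1) (\sum_(l | l != i0) t l).
  apply: vge_sum => // l li; have [->|tl] := eqVneq (t l) 0; first exact: vge_0.
  right; have := le l tl; have := dist l i0 li tl ti0.
  by move: (valuation P _) (valuation P _); clear; lia.
move: h; rewrite (bigD1 i0) //=; have [nz e] := val_addl dP ti0 rest.
move=> /(vge_val _ _ nz); rewrite e => h; right; apply: le_trans h _; exact: le.
Qed.
End DistinctValues.

Section LocalTypes.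
Variables (k F F' : fieldType) (iota : {rmorphism k -> F}) (iota' : {rmorphism k -> F'}).
Variable (j : {rmorphism F -> F'}).
Hypothesis (jc : forall c, j (iota c) = iota' c).
Variable (q : nat).
Hypothesis (q1 : (1 < q)%N).
Variables (P' : place iota) (dP' : discrete P') (fP' : finite_degree P').
Variable (dP : forall P : place iota', discrete P).

Definition generator (Z : F') := (forall z, exists2 p : {poly F}, (size p <= q)%N & ev j Z p = z) /\
  (forall p : {poly F}, (size p <= q)%N -> ev j Z p = 0 -> p = 0).

Lemma generator_affine Z (eta u : F) : eta != 0 -> generator Z -> generator (j eta * (Z - j u)).
Proof.
move=> eta0 [onto inj].
have je : j eta != 0 by rewrite fmorph_eq0.
have evc y (p r : {poly F}) : ev j y (p \Po r) = ev j (ev j y r) p.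
  by rewrite /ev map_comp_poly horner_comp.
have evY y (a b : F) : ev j y (a *: ('X - b%:P)) = j a * (y - j b).
  by rewrite evZ /ev rmorphB /= map_polyX map_polyC /= !hornerE.
have s2 (a b : F) : a != 0 -> size (a *: ('X - b%:P) : {poly F}) = 2%N.
  by move=> a0; rewrite size_scale // size_XsubC.
have sc (p : {poly F}) (a b : F) : (size p <= q)%N -> a != 0 -> (size (p \Po (a *: ('X - b%:P))) <= q)%N.
  move=> sp a0; rewrite (leq_trans (size_comp_poly_leq _ _)) // s2 //= muln1.
  by case: (size p) sp => [_|m //] /=; apply: ltnW.
set y := j eta * _; have eZ : Z = ev j y (eta^-1 *: ('X - (- (eta * u))%:P)).
  by rewrite evY rmorphN rmorphM fmorphV opprK /y; field.
split=> [z|p sp ep].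
  have [p sp ep] := onto z; exists (p \Po (eta^-1 *: ('X - (- (eta * u))%:P))).
    by apply: sc; rewrite ?invr_eq0.
  by rewrite evc -eZ.
have : ev j Z (p \Po (eta *: ('X - u%:P))) = 0 by rewrite evc evY.
move=> /(inj _ (sc _ _ _ sp eta0))/eqP; rewrite comp_poly2_eq0 ?s2 // => /eqP //.
Qed.

(** All local bases used are scaled powers [s i * y^i] of an affine function [y = eta (Z - u)].
    Since [y^i] has leading coefficient [eta^i] in [Z], the shift [u] disappears from the leading
    exponents. *)
Lemma top_values_pow Z (s : nat -> F) (eta u : F) : eta != 0 -> (forall i, s i != 0) -> generator Z ->
  (forall i, (i < q)%N -> integral_at iota' j P' (j (s i) * (j eta * (Z - j u)) ^+ i)) ->
  (forall c : nat -> F, integral_at iota' j P' (\sum_(i < q) j (c i * s i) * (j eta * (Z - j u)) ^+ i) ->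
     forall i, (i < q)%N -> vge P' 0 (c i)) ->
  top_values iota' j q Z P' (fun i => valuation P' (s i) + i%:Z * valuation P' eta).
Proof.
move=> eta0 s0 [onto inj] int bas.
pose Y : {poly F} := eta *: ('X - u%:P).
have sY : size Y = 2%N by rewrite size_scale // size_XsubC.
have evY : ev j Z Y = j eta * (Z - j u).
  by rewrite evZ /ev rmorphB /= map_polyX map_polyC /= !hornerE.
have evX i : ev j Z (Y ^+ i) = (j eta * (Z - j u)) ^+ i.
  by rewrite -evY /ev rmorphXn /= horner_exp.
have Y0 : Y != 0 by rewrite -size_poly_gt0 sY.
have sX i : size (Y ^+ i) = i.+1.
  by rewrite -(prednK (_ : 0 < size (Y ^+ i))%N) ?size_poly_gt0 ?expf_neq0 // size_exp sY mul1n.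
have topX i : (Y ^+ i)`_i = eta ^+ i.
  have -> : (Y ^+ i)`_i = lead_coef (Y ^+ i) by rewrite lead_coefE sX.
  rewrite lead_coef_exp /Y lead_coefZ; congr (_ ^+ _).
  by rewrite (eqP (monicXsubC u : lead_coef _ == 1)) mulr1.
have valtop i : valuation P' (s i * eta ^+ i) = valuation P' (s i) + i%:Z * valuation P' eta.
  by rewrite valM ?expf_neq0 // valX // -mulr_natr natz mulrC.
split=> [p sp ip i spi|i iq]; last first.
  exists (s i *: Y ^+ i); split.
  - by rewrite size_scale // sX.
  - by rewrite evZ evX; apply: int.
  - by rewrite coefZ topX mulf_neq0 ?expf_neq0.
  - by rewrite coefZ topX valtop.
have tri m : (m <= q)%N -> forall p : {poly F}, (size p <= m)%N -> exists c : nat -> F,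
    [/\ p = \sum_(l < q) (c l * s l) *: Y ^+ l, forall l, (m <= l)%N -> c l = 0
      & forall n, m = n.+1 -> c n * (s n * eta ^+ n) = p`_n].
  elim: m => [|m IH] mq r sr.
    exists (fun _ => 0); split=> //.
    move: sr; rewrite leqn0 size_poly_eq0 => /eqP ->; rewrite big1 // => l _.
    by rewrite mul0r scale0r.
  pose a := r`_m / (s m * eta ^+ m).
  have ea : a * (s m * eta ^+ m) = r`_m by rewrite /a divfK // mulf_neq0 ?expf_neq0.
  have [|c [ec c0 _]] := IH (ltnW mq) (r - (a * s m) *: Y ^+ m).
    apply/leq_sizeP => l; rewrite leq_eqVlt => /orP[/eqP <-|lt].
      by rewrite coefB coefZ topX -mulrA ea subrr.
    by rewrite coefB coefZ !nth_default ?sX ?mulr0 ?subr0 // (leq_trans sr).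
  exists (fun l => if l == m then a else c l); split.
  - rewrite -[r in LHS](subrK ((a * s m) *: Y ^+ m)) ec (bigD1 (Ordinal mq)) //= [RHS](bigD1 (Ordinal mq)) //=.
    rewrite eqxx c0 // mul0r scale0r add0r addrC; congr (_ + _); apply: eq_bigr => l lm.
    by case: eqP => // e; case/eqP: lm; apply/val_inj.
  - by move=> l lm; case: eqP => [e|_]; [rewrite e ltnn in lm | apply: c0; apply: ltnW].
  - by move=> n [<-]; rewrite eqxx.
have [qi|iq] := leqP q i; first by rewrite nth_default ?(leq_trans sp) //; apply: vge_0.
have [c [ec _ cn]] := tri i.+1 iq p spi.
rewrite -(cn i erefl) -[X in vge P' X]add0r; apply: vgeM => //; last first.
  by right; rewrite valtop.
apply: (bas c) iq; suff -> : \sum_(l < q) j (c l * s l) * (j eta * (Z - j u)) ^+ l = ev j Z p by [].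
rewrite ec; elim/big_ind2: _ => [|x1 x2 y1 y2 -> ->|l _]; first by rewrite /ev rmorph0 horner0.
  by rewrite evD.
by rewrite evZ evX.
Qed.
End LocalTypes.

(** * Unramified extensions given by [y^q + c y = delta] *)

Section Unramified.
Variables (k F F' : fieldType) (iota : {rmorphism k -> F}) (iota' : {rmorphism k -> F'}).
Variable (j : {rmorphism F -> F'}).
Hypothesis (jc : forall c, j (iota c) = iota' c).
Variable (q : nat).
Hypothesis (q1 : (1 < q)%N).
Variables (P' : place iota) (dP' : discrete P') (fP' : finite_degree P').
Variable (dP : forall P : place iota', discrete P).
Variables (y : F') (gy : generator j q y).
Let onto := gy.1.
Let inj := gy.2.
Local Notation Oc := (Ocoef P').
Local Notation evy := (ev j y).

Lemma evM (p r : {poly F}) : evy (p * r) = evy p * evy r.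
Proof. by rewrite /ev rmorphM hornerM. Qed.

Lemma evXn (p : {poly F}) n : evy (p ^+ n) = evy p ^+ n.
Proof. by rewrite /ev rmorphXn /= horner_exp. Qed.

Lemma evC a : evy a%:P = j a.
Proof. by rewrite /ev map_polyC hornerC. Qed.

(** The ring of fractions of [O[y]] with denominators [z^n] does not contain [t^-1] as long as no
    power of [z] lies in [t O[y]]; a place above [P'] containing this ring has [z] as a unit. *)
Lemma adjoin_place (z : F') (t : F) : t != 0 -> valuation P' t = 1 -> z != 0 -> (exists2 p, Oc p & z = evy p) ->
  (forall n p, Oc p -> z ^+ n <> j t * evy p) ->
  exists P : place iota', over j P P' /\ place_unit P z.
Proof.
move=> t0 vt z0 [p0 Op0 ez] nz.
have jt0 : j t != 0 by rewrite fmorph_eq0.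
pose A : set F' := [set f | exists n p, Oc p /\ f = evy p / z ^+ n].
have As : is_subring iota' A.
  split=> [c|_ _ [n [p [Op ->]]] [m [r [Or ->]]]|_ _ [n [p [Op ->]]] [m [r [Or ->]]]].
  - exists 0%N, (iota c)%:P; split; first by apply: OcoefC; apply: ringC.
    by rewrite evC jc expr0 divr1.
  - exists (n + m)%N, (p * p0 ^+ m - r * p0 ^+ n); split.
      by apply: OcoefB; apply: OcoefM => //; apply: Ocoef_exp.
    have zn i : z ^+ i != 0 by rewrite expf_neq0.
    have fr (u v a b : F') : a != 0 -> b != 0 -> u / a - v / b = (u * b - v * a) / (a * b).
      by move=> a0 b0; field; rewrite a0 b0.
    by rewrite evB !evM !evXn -ez exprD fr.
  - exists (n + m)%N, (p * r); split; first exact: OcoefM.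
    by rewrite evM exprD invfM mulrACA.
have jA a : place_ring P' a -> A (j a).
  move=> Oa; exists 0%N, a%:P; split; first exact: OcoefC.
  by rewrite evC expr0 divr1.
have [|P [PP AP]] := exists_over_sub (iota' := iota') dP' As jA t0 vt.
  move=> [n [p [Op e]]]; apply: (nz n p Op).
  by apply/(mulfI (invr_neq0 jt0)); rewrite mulKf // e divfK // expf_neq0.
exists P; split=> //; split=> //.
  by apply: AP; exists 0%N, p0; rewrite expr0 divr1.
apply: AP; exists 1%N, 1; split; first by apply: OcoefC; apply: ring1.
by rewrite expr1 /ev rmorph1 hornerC mul1r.
Qed.

(** Sending [y] to the root [a] of [psi] modulo [P'] shows that no power of [h(y)] is divisible by
    [t], since [h(a)] is a unit. With [h] a product of factors of the reduction of [psi], this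
    selects a place lying over the remaining factor. *)
Lemma root_place (psi h : {poly F}) a : psi \is monic -> size psi = q.+1 -> Oc psi -> evy psi = 0 ->
  place_ring P' a -> vge P' 1 psi.[a] -> Oc h -> place_unit P' h.[a] ->
  exists P : place iota', over j P P' /\ place_unit P (evy h).
Proof.
move=> mon sz Opsi epsi Oa va Oh uh; have [t t0 vt] := exists_val dP' 1.
have key f : Oc f -> evy f = 0 -> vge P' 1 f.[a].
  move=> Of ef; have [s [r [Os Or sr e]]] := Ocoef_div mon sz Opsi Of.
  have r0 : r = 0 by apply: inj => //; move: ef; rewrite e evD evM epsi mulr0 add0r.
  rewrite e r0 addr0 hornerM -[1 : int]add0r; apply: vgeM => //.
  by apply/(vge0 dP'); apply: Ocoef_horner.
have nuh n : ~ vge P' 1 (h.[a] ^+ n).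
  have [h0 _ _] := uh; have := unitX n%:Z uh; rewrite -exprnP => u.
  by move=> /(vge_val _ _ (expf_neq0 _ h0)); rewrite (val_unit dP').
apply: (adjoin_place t0 vt).
- by apply/eqP => /(key _ Oh); have := nuh 1%N; rewrite expr1.
- by exists h.
move=> n p Op e; apply: (nuh n).
have Ot : place_ring P' t by rewrite (val_ring dP') // vt.
have : vge P' 1 (h ^+ n - t *: p).[a].
  apply: key; first by apply: OcoefB; [apply: Ocoef_exp | apply: OcoefZ].
  by rewrite evB evXn evZ e subrr.
rewrite !hornerE ?horner_exp => h1; rewrite -[X in vge P' 1 X](subrK (t * p.[a])).
apply: vgeD => //; rewrite -[1 : int]addr0; apply: vgeM => //; first by right; rewrite vt.
by apply/(vge0 dP'); apply: Ocoef_horner.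
Qed.

Hypothesis (Hadd : forall a b : F', (a + b) ^+ q = a ^+ q + b ^+ q).
Variables (c delta : F).
Hypotheses (Occ : place_unit P' c) (Od : place_ring P' delta).
Hypothesis (ey : y ^+ q = j delta - j c * y).

Let psi : {poly F} := 'X^q + (c *: 'X - delta%:P).

Local Lemma psi_props : [/\ psi \is monic, size psi = q.+1, Oc psi & evy psi = 0].
Proof.
have Oc' : place_ring P' c by case: Occ.
have s2 : (size (c *: 'X - delta%:P : {poly F})%R < q.+1)%N.
  rewrite (leq_ltn_trans (size_polyD _ _)) // gtn_max size_polyN.
  rewrite (leq_ltn_trans (size_scale_leq _ _)) ?size_polyX //=.
  by rewrite (leq_ltn_trans (size_polyC_leq1 _)) // ltnS; apply: ltnW.
split.
- by rewrite monicE lead_coefDl ?size_polyXn // lead_coefXn.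
- by rewrite size_polyDl size_polyXn.
- apply: OcoefD; first by apply: Ocoef_exp; apply: OcoefX.
  by apply: OcoefB; [apply: OcoefZ => //; apply: OcoefX | apply: OcoefC].
- rewrite evD evB evZ evC evXn /ev map_polyX hornerX ey; ring.
Qed.

Lemma unram_integral : integral_at iota' j P' y.
Proof.
move=> P PP; have [->|y0] := eqVneq y 0; first exact: ring0.
rewrite (val_ring (dP P)) // leNgt; apply/negP => neg.
have : vge P (valuation P y) (y ^+ q).
  rewrite ey; apply: vgeB => //.
    by apply: (vge_le (n := 0)); [move: neg; clear; lia | apply/(vge0 (dP P)); rewrite PP].
  rewrite -[valuation P y]add0r; apply: vgeM => //; last by right.
  by apply/(vge0 (dP P)); rewrite PP; case: Occ.
move=> /(vge_val _ _ (expf_neq0 _ y0)); rewrite valX // -mulr_natr natz.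
by move: neg q1; clear; nia.
Qed.

Lemma unram_reduce p : Oc p -> exists r, [/\ Oc r, (size r <= q)%N & evy r = evy p].
Proof.
move=> Op; have [mon sz Opsi epsi] := psi_props.
have [s [r [Os Or sr ->]]] := Ocoef_div mon sz Opsi Op.
by exists r; split=> //; rewrite evD evM epsi mulr0 add0r.
Qed.

Lemma frob_sum (I : Type) (l : seq I) (h : I -> F') :
  (\sum_(i <- l) h i) ^+ q = \sum_(i <- l) h i ^+ q.
Proof.
elim: l => [|i l IH]; first by rewrite !big_nil expr0n gtn_eqF // ltnW.
by rewrite !big_cons Hadd IH.
Qed.

Section Uniformizer.
Variables (t : F) (t0 : t != 0) (vt : valuation P' t = 1).

(* [y] is a polynomial in [y ^ q] since [c] is a unit, so Frobenius is
   injective on [O[y] / (t)]. *)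
Lemma unram_reduced z : (exists2 p, Oc p & z = evy p) ->
  (exists2 p, Oc p & z ^+ q = j t * evy p) -> exists2 p, Oc p & z = j t * evy p.
Proof.
move=> [p Op ez] [r Or er].
have [p1 [Op1 sp1 ep1]] := unram_reduce Op; have [r1 [Or1 sr1 er1]] := unram_reduce Or.
have [c0 Oc1 Oc2] := Occ.
pose P0 := \poly_(i < q) (p1`_i ^+ q).
pose L := delta%:P - c *: 'X.
pose L' := c^-1 *: (delta%:P - 'X).
have eL : evy L = y ^+ q by rewrite evB evC evZ /ev map_polyX hornerX ey.
have LL' : L \Po L' = 'X.
  rewrite /L /L' rmorphB /= comp_polyC comp_polyZ comp_polyX scalerA mulfV //.
  by rewrite scale1r; ring.
have e1 : evy (P0 \Po L) = evy (t *: r1).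
  rewrite evZ er1 -er ez -ep1 [in RHS](evE _ _ sp1) frob_sum.
  rewrite /ev map_comp_poly horner_comp -/(ev j y L) eL.
  rewrite -[LHS]/(ev j (y ^+ q) P0) (evE _ _ (size_poly _ _)).
  apply: eq_bigr => i _; rewrite coef_poly ltn_ord rmorphXn exprMn; congr (_ * _).
  by rewrite -!exprM mulnC.
have sL : (size L <= 2)%N.
  rewrite (leq_trans (size_polyD _ _)) // geq_max size_polyN.
  rewrite (leq_trans (size_polyC_leq1 _)) //.
  by rewrite (leq_trans (size_scale_leq _ _)) ?size_polyX.
have e2 : P0 \Po L = t *: r1.
  apply/eqP; rewrite -subr_eq0; apply/eqP; apply: inj; last by rewrite evB e1 subrr.
  rewrite (leq_trans (size_polyD _ _)) // geq_max size_polyN.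
  rewrite (leq_trans (size_scale_leq _ _)) // andbT.
  rewrite (leq_trans (size_comp_poly_leq _ _)) //.
  have : (size P0 <= q)%N by apply: size_poly.
  have : ((size L).-1 <= 1)%N by case: (size L) sL.
  by move: (size P0) ((size L).-1) q1; clear; case=> [|a] [|[|b]] //=; nia.
have e3 : P0 = t *: (r1 \Po L').
  by rewrite -comp_polyZ -e2 -comp_polyA LL' comp_polyXr.
have OL' : Oc (r1 \Po L').
  apply: Ocoef_comp => //; apply: OcoefZ => //; apply: OcoefB; last exact: OcoefX.
  exact: OcoefC.
have p1M i : vge P' 1 p1`_i.
  have [qi|iq] := leqP q i; first by rewrite nth_default ?(leq_trans sp1) //; apply: vge_0.
  have : vge P' 1 (p1`_i ^+ q).
    have := congr1 (fun f : {poly F} => f`_i) e3; rewrite coef_poly iq coefZ => ->.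
    rewrite -[1 : int]addr0; apply: vgeM => //; first by right; rewrite vt.
    by apply/(vge0 dP').
  have [->|a0] := eqVneq p1`_i 0; first by move=> _; apply: vge_0.
  move=> /(vge_val _ _ (expf_neq0 _ a0)); rewrite valX // -mulr_natr natz => h.
  by right; move: h q1; clear; nia.
exists (t^-1 *: p1).
  move=> i; rewrite coefZ; apply/(vge0 dP'); apply/(vge_shift dP' 0 _ t0 vt).
  by rewrite add0r mulrAC mulVf // mul1r.
by rewrite evZ mulrA -rmorphM mulfV // rmorph1 mul1r ep1.
Qed.

(** An exponent [n] can be raised to [q^n], and [unram_reduced] then extracts [q]th roots one by
    one: the ring [O[y] / (t)] is reduced. *)
Lemma unram_nilpotent z n : (0 < n)%N -> (exists2 p, Oc p & z = evy p) ->
  (exists2 p, Oc p & z ^+ n = j t * evy p) -> exists2 p, Oc p & z = j t * evy p.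
Proof.
move=> n0 Az [p Op ep].
have Ot : place_ring P' t by rewrite (val_ring dP') // vt.
have : exists2 p, Oc p & z ^+ (q ^ n) = j t * evy p.
  have [p0 Op0 ez] := Az; exists (p * p0 ^+ (q ^ n - n)).
    by apply: OcoefM => //; apply: Ocoef_exp.
  by rewrite evM evXn -ez mulrA -ep -exprD subnKC // ltnW // ltn_expl.
elim: n {n0 p Op ep} => [[p]|n IH]; first by rewrite expn0 expr1; exists p.
rewrite expnSr exprM => h; apply: IH; apply: unram_reduced => //.
have [p0 Op0 ez] := Az; exists (p0 ^+ (q ^ n)); first exact: Ocoef_exp.
by rewrite evXn ez.
Qed.

(** Dividing by the largest coefficient gives [r] with integral coefficients, one of them 1. As
    [O[y] / (t)] is reduced, no power of [r(y)] lies in [t O[y]], so [r(y)] is a unit at some place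
    above. There the largest coefficient equals [p(y) / r(y)] and is integral. *)
Lemma unram_basis (p : {poly F}) : (size p <= q)%N -> integral_at iota' j P' (evy p) -> Oc p.
Proof.
move=> sp ip i; have [->|pi] := eqVneq p`_i 0; first exact: ring0.
have i_sz : (i < size p)%N.
  by rewrite ltnNge; apply: contra pi => le; rewrite nth_default.
have [i0 pi0 imax] := max_value P' (t := fun i : 'I_(size p) => p`_i)
   (ex_intro (fun i : 'I_(size p) => p`_i != 0) (Ordinal i_sz) pi).
suff Oi0 : place_ring P' p`_i0.
  have := ringM (imax (Ordinal i_sz)) Oi0; rewrite /= divfK //.
apply: contraT => nO.
have neg : valuation P' p`_i0 < 0 by rewrite ltNge -(val_ring dP').
pose r := (p`_i0)^-1 *: p.
have Or : Oc r.
  move=> l; rewrite coefZ mulrC; have [h|h] := ltnP l (size p); first exact: (imax (Ordinal h)).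
  by rewrite nth_default ?mul0r //; apply: ring0.
have sr : (size r <= q)%N by rewrite (leq_trans (size_scale_leq _ _)).
have ri0 : r`_i0 = 1 by rewrite coefZ mulVf.
have z0 : evy r != 0.
  apply/eqP => /(inj sr) r0; have := ri0; rewrite r0 coef0 => /eqP.
  by rewrite eq_sym oner_eq0.
have [n f Of e|P [PP [_ _ ui]]] := adjoin_place t0 vt z0 (ex_intro2 _ _ r Or erefl).
  have [n0|n0] := posnP n.
    have : evy (1 - t *: f) = 0 by rewrite evB evZ -e n0 expr0 /ev rmorph1 hornerC subrr.
    have [f1 [Of1 sf1 ef1]] := unram_reduce Of.
    have -> : evy (1 - t *: f) = evy (1 - t *: f1) by rewrite !evB !evZ ef1.
    have s1 : (size (1 - t *: f1)%R <= q)%N.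
      rewrite (leq_trans (size_polyD _ _)) // geq_max size_polyN size_poly1 ltnW //=.
      by rewrite (leq_trans (size_scale_leq _ _)).
    move=> /(inj s1) /(congr1 (fun g : {poly F} => g`_0)); rewrite coefB coefZ coef1 coef0 /=.
    move=> /eqP; rewrite subr_eq0 => /eqP e1.
    have : vge P' 1 (1 : F).
      rewrite (e1 : 1 = t * f1`_0) -[1 : int]addr0; apply: vgeM => //; first by right; rewrite vt.
      by apply/(vge0 dP').
    by move=> /(vge_val _ _ (oner_neq0 _)); rewrite (val1 dP').
  have [|f1 Of1 e1] := unram_nilpotent n0 (ex_intro2 _ _ r Or erefl); first by exists f.
  have [f2 [Of2 sf2 ef2]] := unram_reduce Of1.
  have : evy (r - t *: f2) = 0 by rewrite evB e1 evZ ef2 subrr.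
  have s1 : (size (r - t *: f2)%R <= q)%N.
    rewrite (leq_trans (size_polyD _ _)) // geq_max size_polyN sr.
    by rewrite (leq_trans (size_scale_leq _ _)).
  move=> /(inj s1) /(congr1 (fun g : {poly F} => g`_i0)); rewrite coefB ri0 coefZ coef0.
  move=> /eqP; rewrite subr_eq0 => /eqP e2.
  have : vge P' 1 (1 : F).
    rewrite e2 -[1 : int]addr0; apply: vgeM => //; first by right; rewrite vt.
    by apply/(vge0 dP').
  by move=> /(vge_val _ _ (oner_neq0 _)); rewrite (val1 dP').
exfalso; have : place_ring P (j p`_i0).
  have -> : j p`_i0 = evy p * (evy r)^-1.
    apply: (mulIf z0); rewrite divfK // /r evZ mulrA -rmorphM mulfV // rmorph1 mul1r //.
  by apply: ringM => //; apply: ip.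
by rewrite PP (negbTE nO).
Qed.

(** Weak approximation gives [w] of valuation 1 at [P] and at least the ramification index at the
    other places above [P']. Then [w^e] is divisible by [t], hence so is [w] because [O[y] / (t)] is
    reduced, and this forces [e = 1]. *)
Lemma unram_ram (P : place iota') : over j P P' -> ram j P P' = 1%N.
Proof.
move=> PP; have dep := ev_dep gy.1.
have [L [uL hL]] := finite_over jc dep dP' fP' dP.
pose s := [seq Q <- L | Q != P].
have nPs : P \notin s by rewrite mem_filter eqxx.
have jt0 : j t != 0 by rewrite fmorph_eq0.
have [e0 ve] := ramP dep PP dP'.
have [w1 w10 vw1] := exists_val (dP P) 1.
pose M := (\sum_(Q <- L) (ram j Q P' + `|valuation Q w1|)).+1%N.
have MQ (Q : place iota') : Q \in L -> (ram j Q P' + `|valuation Q w1| < M)%N.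
  by move=> QL; rewrite /M (big_rem Q) //= ltnS leq_addr.
have [w2 [hw2 sw2]] := approx2 dP M nPs.
pose w := w1 * w2.
have w2P : w2 != 0 /\ valuation P w2 = 0.
  have -> : w2 = 1 + (w2 - 1) by ring.
  rewrite -[0 : int](val1 (dP P)); apply: val_addl; rewrite ?oner_neq0 //.
  by apply: vge_le hw2; rewrite (val1 (dP P)) /M; clear; lia.
have [w20 vw2] := w2P.
have w0 : w != 0 by rewrite mulf_neq0.
have vw : valuation P w = 1 by rewrite valM // vw1 vw2.
have wQ (Q : place iota') : over j Q P' -> Q != P -> vge Q (ram j Q P')%:Z w.
  move=> QP ne; have QL : Q \in L by apply/hL.
  have Qs : Q \in s by rewrite mem_filter ne.
  apply: (vge_le (n := valuation Q w1 + M%:Z)); first by have := MQ Q QL; clear; lia.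
  by apply: vgeM => //; [right | apply: sw2].
have iw (Q : place iota') : over j Q P' -> place_ring Q w.
  move=> QP; apply/(vge0 (dP Q)); have [->|ne] := eqVneq Q P; first by right; rewrite vw.
  by apply: vge_le (wQ Q QP ne).
have toA z : integral_at iota' j P' z -> exists2 p, Oc p & z = evy p.
  move=> iz; have [p sp ep] := gy.1 z; exists p => //.
  by apply: unram_basis => //; rewrite ep.
have [||p Op ep] := @unram_nilpotent w (ram j P P') e0; first exact: toA.
  have [|p Op ep] := toA (w ^+ ram j P P' / j t); last first.
    by exists p => //; rewrite -ep mulrC divfK.
  move=> Q QP; have [eQ0 veQ] := ramP dep QP dP'.
  apply/(vge0 (dP Q)); apply/(vge_shift (dP Q) 0 (n := (ram j Q P')%:Z) _ jt0).
    by rewrite veQ vt mul1r.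
  rewrite add0r divfK //; have [->|ne] := eqVneq Q P.
    by right; rewrite valX // vw -mulr_natr natz mul1r.
  have := wQ Q QP ne; rewrite -(prednK e0) exprS => h.
  rewrite -[(ram j Q P')%:Z]addr0; apply: vgeM => //.
  by apply/(vge0 (dP Q)); apply: ringX; apply: iw.
have : vge P (ram j P P')%:Z w.
  rewrite ep -[(ram _ _ _)%:Z]addr0; apply: vgeM => //; first by right; rewrite ve vt mul1r.
  apply/(vge0 (dP P)); rewrite (evE _ _ (leqnn _)); apply: ring_sum => i _.
  by apply: ringM; [rewrite PP | apply: ringX; apply: unram_integral].
by move=> /(vge_val _ _ w0); rewrite vw; move: e0; clear; lia.
Qed.
End Uniformizer.
End Unramified.

Lemma mod_inj (a b : int) (q l m : nat) : (l < q)%N -> (m < q)%N ->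
  a * q%:Z - l%:Z = b * q%:Z - m%:Z -> l = m.
Proof. by move=> lq mq e; have [ab|ab|ab] := ltgtP a b; nia. Qed.

(** * Totally ramified places *)

Section RamifiedTypes.
Variables (k F F' : fieldType) (iota : {rmorphism k -> F}) (iota' : {rmorphism k -> F'}).
Variable (j : {rmorphism F -> F'}).
Hypothesis (jc : forall c, j (iota c) = iota' c).
Variable (q : nat).
Hypothesis (q1 : (1 < q)%N).
Variables (P' : place iota) (dP' : discrete P') (fP' : finite_degree P').
Variable (dP : forall P : place iota', discrete P).
Variables (Z : F') (gZ : generator j q Z).
Let dep := ev_dep gZ.1.
Implicit Types (P Q : place iota').

Lemma over_deg_fin P : over j P P' -> finite_degree P.
Proof.
have [t t0 vt] := exists_val dP' 1 => PP.
exact: (over_finite_degree jc dep dP' fP' t0 vt).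
Qed.

Lemma over_ineq (s : seq (place iota')) : uniq s -> (forall P, P \in s -> over j P P') ->
  (\sum_(P <- s) ram j P P' * place_degree P <= q * place_degree P')%N.
Proof.
have [t t0 vt] := exists_val dP' 1 => us.
exact: (fund_ineq jc dep dP' fP' t0 vt us dP).
Qed.

(** The residue field below embeds into the residue field above. *)
Lemma over_degree_le P : over j P P' -> (place_degree P' <= place_degree P)%N.
Proof.
move=> PP; have [e0 ve] := ramP dep PP dP'.
have key z n : vge P' n z -> 0 <= n -> vge P n (j z).
  move=> [->|h] n0; first by rewrite rmorph0; apply: vge_0.
  by right; rewrite ve; move: (valuation P' z) (ram _ _ _) h n0 e0; clear; nia.
apply: (qdim_le (theta := j) (subspace_vge dP' 0) (subspace_vge (dP P) 0)
  (qdim_residue dP' fP') (qdim_residue (dP P) (over_deg_fin PP))).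
- by move=> c u v _ _; rewrite rmorphD rmorphM jc.
- by move=> z hz; apply: key.
- move=> z hz; split=> [[/eqP|h]|h]; [|right|exact: key].
    by rewrite fmorph_eq0 => /eqP ->; apply: vge_0.
  rewrite ve in h; case: hz => [e|]; first by move: h; rewrite e val0 // mul0r.
  by move: (valuation P' z) (ram _ _ _) h; clear; nia.
Qed.

(** The hypothesis on [w] makes the ramification index a multiple of [q], and the fundamental
    inequality leaves room for a single place with index exactly [q] and no residue extension. *)
Lemma totram (w : F') (d : F) (eps : int) : eps = 1 \/ eps = -1 -> valuation P' d = eps ->
  (forall P, over j P P' -> valuation P w * q%:Z = valuation P (j d)) ->
  exists P, [/\ over j P P', forall Q, over j Q P' -> Q = P, ram j P P' = q,
    place_degree P = place_degree P' & valuation P w = eps].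
Proof.
move=> he vd hw; have [P PP] := exists_over jc dP'.
have [e0 ve] := ramP dep PP dP'.
have d0 := degree_pos dP' fP'; have dd := over_degree_le PP.
have e_ := hw P PP; rewrite ve vd in e_.
have := @over_ineq [:: P] isT; rewrite big_seq1 => le1.
have {}le1 := le1 (fun Q => fun h => eq_ind_r (fun Q => over j Q P') PP (eqP (etrans (esym (mem_seq1 Q P)) h))).
have eq_ : ram j P P' = q.
  have [m em] : exists m : nat, ram j P P' = (m * q)%N.
    exists `|valuation P w|%N; move: e_ he; move: (valuation P w) (ram _ _ _); clear.
    by move=> x y e [] E; rewrite E in e; nia.
  have m0 : (0 < m)%N by move: e0; rewrite em muln_gt0 => /andP[].
  rewrite em in le1 *; have : (m <= 1)%N.
    move: le1 dd d0 q1; move: (place_degree P) (place_degree P'); clear => a b.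
    move=> le1 dd d0 q1.
    have : (m * q * b <= q * b)%N by apply: leq_trans le1; rewrite leq_mul2l dd orbT.
    by rewrite -mulnA -[X in (_ <= X)%N]mul1n leq_pmul2r // muln_gt0 d0 ltnW.
  by move: m0; clear; case: m => [|[|m]] // _ _; rewrite mul1n.
exists P; split=> //.
- move=> Q QP; apply/eqP; apply: contraT => ne.
  have u2 : uniq [:: P; Q] by rewrite /= mem_seq1 eq_sym ne.
  have := over_ineq u2; rewrite big_cons big_seq1 eq_ => h.
  have {h} : (q * place_degree P + ram j Q P' * place_degree Q <= q * place_degree P')%N.
    by apply: h => R; rewrite in_cons mem_seq1 => /orP[/eqP -> | /eqP ->].
  have [eQ0 _] := ramP dep QP dP'.
  have dQ := degree_pos (dP Q) (over_deg_fin QP).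
  have : (0 < ram j Q P' * place_degree Q)%N by rewrite muln_gt0 eQ0.
  have : (q * place_degree P' <= q * place_degree P)%N by rewrite leq_mul2l dd orbT.
  by clear; lia.
- apply/eqP; rewrite eqn_leq dd andbT.
  by move: le1; rewrite eq_ leq_pmul2l // ltnW.
- move: e_; rewrite eq_ => /(mulIf _) -> //; apply/eqP; move: q1; clear; lia.
Qed.

Lemma unram_type (eta u c delta : F) : (forall a b : F', (a + b) ^+ q = a ^+ q + b ^+ q) ->
  eta != 0 -> place_unit P' c -> place_ring P' delta ->
  (j eta * (Z - j u)) ^+ q = j delta - j c * (j eta * (Z - j u)) ->
  top_values iota' j q Z P' (fun i => i%:Z * valuation P' eta) /\
  forall P, over j P P' -> ram j P P' = 1%N.
Proof.
move=> Hadd eta0 uc Od ey; have gy := generator_affine q1 u eta0 gZ.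
have [t t0 vt] := exists_val dP' 1.
have iy := unram_integral q1 dP uc Od ey.
split; last by move=> P; apply: (unram_ram jc q1 dP' fP' dP gy Hadd uc Od ey t0 vt).
have -> : (fun i : nat => i%:Z * valuation P' eta) =
    (fun i : nat => valuation P' (1 : F) + i%:Z * valuation P' eta).
  by apply/funext => i; rewrite (val1 dP') add0r.
apply: (top_values_pow dP' (s := fun _ => 1) eta0 _ gZ (u := u)) => //.
- by move=> _; rewrite oner_eq0.
- by move=> i iq P PP; rewrite rmorph1 mul1r; apply: ringX; apply: iy.
move=> a ia i iq; set y := j eta * _ in ia gy.
have : Ocoef P' (\poly_(l < q) a l).
  apply: (unram_basis jc q1 dP' gy Hadd uc Od ey t0 vt); first exact: size_poly.
  rewrite (evE _ _ (size_poly _ _)) (eq_bigr (fun l : 'I_q => j (a l * 1) * y ^+ l)) // => l _.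
  by rewrite coef_poly ltn_ord mulr1.
by move=> /(_ i); rewrite coef_poly iq => h; apply/(vge0 dP').
Qed.

(** With a simple pole of [delta], the function [y] has a simple pole at a totally ramified place.
    The local basis is [1, t y, ..., t y^(q-1)]: one factor [t] has valuation [q] there and clears
    every pole of order below [q]. The term [(0 < i)] in the exponents is this factor. Distinct
    residues modulo [q] of the valuations prevent cancellation. *)
Lemma wild_type (eta u c delta : F) : eta != 0 -> place_ring P' c -> valuation P' delta = -1 ->
  (j eta * (Z - j u)) ^+ q = j delta - j c * (j eta * (Z - j u)) ->
  top_values iota' j q Z P' (fun i => (0 < i)%N%:Z + i%:Z * valuation P' eta) /\
  exists P, [/\ over j P P', forall Q, over j Q P' -> Q = P, ram j P P' = q
    & place_degree P = place_degree P'].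
Proof.
move=> eta0 Oc vd ey; set y := j eta * _ in ey.
have d0 : delta != 0 by apply/eqP => e; move: vd; rewrite e val0.
have jd0 : j delta != 0 by rewrite fmorph_eq0.
have hy P : over j P P' -> valuation P y * q%:Z = valuation P (j delta).
  move=> PP; have [e0 ve] := ramP dep PP dP'.
  have Oj : vge P 0 (j c) by apply/(vge0 (dP P)); rewrite PP.
  have vd' : valuation P (j delta) < 0 by rewrite ve vd; move: e0; clear; lia.
  have [y0|y0] := eqVneq y 0.
    by move: ey; rewrite y0 expr0n gtn_eqF ?mulr0 ?subr0 ?(ltnW q1) // => /esym/eqP; rewrite (negbTE jd0).
  have vyq : valuation P (y ^+ q) = valuation P y * q%:Z by rewrite valX // -mulr_natr natz.
  have [vy|vy] := leP 0 (valuation P y).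
    have : vge P 0 (j delta).
      have -> : j delta = y ^+ q + j c * y by rewrite ey subrK.
      apply: vgeD => //; first by right; rewrite vyq; move: vy; clear; nia.
      by rewrite -[0 : int]addr0; apply: vgeM => //; right.
    by move=> /(vge_val _ _ jd0); rewrite leNgt vd'.
  have yq0 : y ^+ q != 0 by rewrite expf_neq0.
  have h : vge P (valuation P (y ^+ q) + 1) (j c * y).
    apply: (vge_le (n := 0 + valuation P y)); first by rewrite vyq; move: vy q1; clear; nia.
    by apply: vgeM => //; right.
  have [_] := val_addl (dP P) yq0 h.
  by rewrite [X in valuation P (X + _)]ey subrK vyq => ->.
have [P [PP uP eP dgP vP]] := totram (or_intror erefl) vd hy.
split; last by exists P.
have [t t0 vt] := exists_val dP' 1.
pose s i : F := if i is 0%N then 1 else t.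
have vs i : valuation P' (s i) = (0 < i)%N%:Z by case: i => [|i] /=; rewrite ?val1.
have s0 i : s i != 0 by case: i => [|i]; rewrite /= ?oner_eq0.
have [e0 ve] := ramP dep PP dP'.
have y0 : y != 0 by apply/eqP => e; move: vP; rewrite e val0.
have -> : (fun i : nat => (0 < i)%N%:Z + i%:Z * valuation P' eta) =
    (fun i : nat => valuation P' (s i) + i%:Z * valuation P' eta).
  by apply/funext => i; rewrite vs.
have vterm (a : F) i : a != 0 -> valuation P (j a * y ^+ i) = valuation P' a * q%:Z - i%:Z.
  move=> a0; rewrite valM ?fmorph_eq0 ?expf_neq0 // ve eP valX // vP -mulr_natr natz mulN1r.
  by [].
apply: (top_values_pow dP' eta0 s0 gZ (u := u)).
- move=> i iq Q /uP ->; rewrite (val_ring (dP P)) ?mulf_neq0 ?fmorph_eq0 ?expf_neq0 //.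
  by rewrite vterm // vs; move: iq; clear; case: i => [|i] iq /=; nia.
- move=> a ia i iq; have [->|ai] := eqVneq (a i) 0; first exact: vge_0.
  have as0 l : a l != 0 -> a l * s l != 0 by move=> al; rewrite mulf_neq0.
  have h0 : vge P 0 (\sum_(i < q) j (a i * s i) * y ^+ i).
    by apply/(vge0 (dP P)); apply: ia.
  have vl (l : nat) : a l != 0 -> valuation P (j (a l * s l) * y ^+ l) =
      (valuation P' (a l) + (0 < l)%N%:Z) * q%:Z - l%:Z.
    by move=> al; rewrite vterm ?as0 // valM // vs.
  have nz (l : nat) : j (a l * s l) * y ^+ l != 0 -> a l != 0.
    by apply: contraNneq => ->; rewrite mul0r rmorph0 mul0r.
  have := distinct_vge (dP P) _ h0 (Ordinal iq).
  have term0 : j (a i * s i) * y ^+ i != 0 by rewrite mulf_neq0 ?fmorph_eq0 ?as0 ?expf_neq0.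
  rewrite (vge_val _ _ term0) /= vl // => h; right.
  have {h} : 0 <= (valuation P' (a i) + (0 < i)%N%:Z) * q%:Z - i%:Z.
    apply: h => l1 l2 ne /nz n1 /nz n2; rewrite !vl //; apply: contra ne => /eqP e.
    by apply/eqP/val_inj => /=; apply: (mod_inj (ltn_ord l1) (ltn_ord l2) e).
  move: iq q1; move: (valuation P' (a i)); clear => v; case: i => [|i] /=; nia.
Qed.

(** Here [Z] becomes a uniformizer at a totally ramified place, so its powers below [q] are already
    a local basis: the terms of a polynomial in [Z] have valuations distinct modulo [q], and a pole
    order of at most [q r] is the same as a pole order of at most [r] in each coefficient. *)
Lemma infinite_type (f : F) : valuation P' f = -1 -> j f * Z ^+ q + Z = 1 ->
  exists P, [/\ over j P P', forall Q, over j Q P' -> Q = P, ram j P P' = q,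
    place_degree P = place_degree P' & valuation P Z = 1] /\
  forall p : {poly F}, (size p <= q)%N -> forall r : nat,
    vge P (- (q * r)%:Z) (ev j Z p) <-> forall i, vge P' (- r%:Z) p`_i.
Proof.
move=> vf eZ.
have f0 : f != 0 by apply/eqP => e; move: vf; rewrite e val0.
have jf0 : j f != 0 by rewrite fmorph_eq0.
have Z0 : Z != 0.
  by apply/eqP => e; move: eZ; rewrite e expr0n gtn_eqF ?(ltnW q1) // mulr0 addr0 => /esym/eqP; rewrite oner_eq0.
have Zq0 : Z ^+ q != 0 by rewrite expf_neq0.
have hZ P : over j P P' -> valuation P Z * q%:Z = valuation P (j f^-1).
  move=> PP; have [e0 ve] := ramP dep PP dP'.
  have vfq : valuation P (j f * Z ^+ q) = valuation P (j f) + valuation P Z * q%:Z.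
    by rewrite valM // valX // -mulr_natr natz.
  have vf' : valuation P (j f) < 0 by rewrite ve vf; move: e0; clear; lia.
  rewrite fmorphV valV //.
  have t0 : j f * Z ^+ q != 0 by rewrite mulf_neq0.
  have [vZ|vZ] := ltP 0 (valuation P Z).
    have h : vge P (valuation P 1 + 1) (- Z) by apply: vgeN => //; right; rewrite (val1 (dP P)); lia.
    have [_] := val_addl (dP P) (oner_neq0 _) h.
    have -> : 1 - Z = j f * Z ^+ q by rewrite -[in LHS]eZ addrK.
    by rewrite vfq (val1 (dP P)) => e; apply/eqP; rewrite -addr_eq0 addrC e.
  have h : vge P (valuation P (j f * Z ^+ q) + 1) Z.
    by right; rewrite vfq; move: vZ vf' q1; clear; nia.
  have [_] := val_addl (dP P) t0 h; rewrite eZ (val1 (dP P)) vfq.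
  by move: vZ vf' q1; clear; nia.
have vfi : valuation P' f^-1 = 1 by rewrite valV // vf.
have [P [PP uP eP dgP vP]] := totram (or_introl erefl) vfi hZ.
exists P; split=> // p sp r; have [e0 ve] := ramP dep PP dP'.
rewrite (evE _ _ sp).
have vl (l : nat) : p`_l != 0 -> valuation P (j p`_l * Z ^+ l) = valuation P' p`_l * q%:Z + l%:Z.
  move=> al; rewrite valM ?fmorph_eq0 ?expf_neq0 // ve eP valX // vP -mulr_natr natz mul1r.
  by [].
have nz (l : nat) : j p`_l * Z ^+ l != 0 -> p`_l != 0.
  by apply: contraNneq => ->; rewrite rmorph0 mul0r.
split=> [h i|h].
  have [qi|iq] := leqP q i; first by rewrite nth_default ?(leq_trans sp) //; apply: vge_0.
  have [->|pi] := eqVneq p`_i 0; first exact: vge_0.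
  have := distinct_vge (dP P) _ h (Ordinal iq).
  have term0 : j p`_i * Z ^+ i != 0 by rewrite mulf_neq0 ?fmorph_eq0 ?expf_neq0.
  rewrite (vge_val _ _ term0) /= vl // => h'; right.
  have {h'} : - (q * r)%:Z <= valuation P' p`_i * q%:Z + i%:Z.
    apply: h' => l1 l2 ne /nz n1 /nz n2; rewrite !vl //; apply: contra ne => /eqP e.
    apply/eqP/val_inj => /=; symmetry.
    apply: (@mod_inj (valuation P' p`_l1) (valuation P' p`_l2) q) => //.
    move: e; move: (valuation P' p`_l1 * q%:Z) (valuation P' p`_l2 * q%:Z).
    by clear; lia.
  by move: iq; move: (valuation P' _); clear; nia.
apply: vge_sum => // i _; have [->|pi] := eqVneq p`_i 0.
  by rewrite rmorph0 mul0r; apply: vge_0.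
right; rewrite vl //; have /(vge_val _ _ pi) := h i.
by move: (valuation P' _); clear; nia.
Qed.
End RamifiedTypes.

Section Generators.
Variables (F F' : fieldType) (j : {rmorphism F -> F'}) (q : nat).
Hypothesis (q0 : (0 < q)%N).

(** Division by [psi] makes the polynomials of degree below [q] in [w] a ring [S]. For a nonzero [u]
    in [S] the subspace [u S] has the dimension of [S], so it contains 1 and [u] is invertible in
    [S]; thus [S] is the whole field. In dimension [q], the [q] spanning powers are then
    independent. *)
Lemma generatorP (w : F') (psi : {poly F}) : generated_by j w -> has_degree j q ->
  psi \is monic -> size psi = q.+1 -> ev j w psi = 0 -> generator j q w.
Proof.
move=> gen deg mon sz epsi.
have sT : subspace j setT by split.
have /(qdimP _ sT (subspace_set0 j)) qT := deg.
pose S : set F' := [set z | exists2 p : {poly F}, (size p <= q)%N & ev j w p = z].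
have psi0 : psi != 0 by apply: monic_neq0.
have red p : S (ev j w p).
  exists (p %% psi); first by rewrite -ltnS -sz ltn_modp.
  by rewrite [in RHS](divp_eq p psi) evD /ev rmorphM hornerM -/(ev j w psi) epsi mulr0 add0r.
have sS : subspace j S.
  split=> [|c _ _ [p sp <-] [r sr <-]]; first by exists 0; rewrite ?size_poly0 // /ev rmorph0 horner0.
  by rewrite -evZ -evD; apply: red.
have SM u v : S u -> S v -> S (u * v).
  by move=> [p _ <-] [r _ <-]; rewrite /ev -hornerM -rmorphM; apply: red.
have SC c : S (j c) by have := red c%:P; rewrite /ev map_polyC hornerC.
have [n _ qS] := qdim_sub sT sS (@subsetT _ S) qT.
have SV u : S u -> S u^-1.
  move=> Su; have [->|u0] := eqVneq u 0; first by rewrite invr0; case: sS.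
  pose U : set F' := [set z | S (z / u)].
  have sU : subspace j U.
    split=> [|c x y hx hy]; first by rewrite /U /= mul0r; case: sS.
    by rewrite /U /= mulrDl -mulrA; case: sS => _; apply.
  have US : U `<=` S by move=> z hz; rewrite -[z](divfK u0); apply: SM.
  have qU : qdim j U [set 0] n.
    apply: (qdim_iso (theta := fun z => z / u) sU qS).
    - by move=> c x y _ _; rewrite mulrDl mulrA.
    - by [].
    - move=> v _; split=> [/eqP|->]; rewrite /= ?mul0r //.
      by rewrite mulf_eq0 invr_eq0 (negbTE u0) orbF => /eqP.
    - by move=> v Sv; exists (v * u); rewrite /U /= mulfK.
  have S1 : S 1 by rewrite -(rmorph1 j).
  have [||v Uv /=] := qdim_onto sS sU US _ _ qS qU S1; first by [].
    by move=> _ ->; case: sS.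
  by move=> /eqP; rewrite subr_eq0 => /eqP e; move: Uv; rewrite /U /= -e mul1r.
pose Sp : {pred F'} := fun z => `[< S z >].
have all z : S z.
  apply/asboolP; apply: (gen Sp) => [|c|].
  - split=> [|u v /asboolP hu /asboolP hv|u v /asboolP hu /asboolP hv]; apply/asboolP.
    + by rewrite -(rmorph1 j).
    + exact: (subspaceB sS).
    + by apply: SM => //; apply: SV.
  - exact/asboolP.
  - by apply/asboolP; have := red 'X; rewrite /ev map_polyX hornerX.
split=> // p sp ep; have [phi [lin ker onto]] := qT.
pose A := \matrix_(i < q) phi (w ^+ i).
have phiev (r : {poly F}) : (size r <= q)%N -> phi (ev j w r) = (\row_i r`_i) *m A.
  move=> sr; rewrite (evE _ _ sr) (coord_sum (fun i : 'I_q => r`_i) sT lin) // mulmx_sum_row.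
  by apply: eq_bigr => i _; rewrite rowK mxE.
have Afull : A \in unitmx.
  rewrite -row_full_unit -sub1mx; apply/row_subP => i.
  have [v _ <-] := onto (row i 1%:M); have [r sr <-] := all v.
  by rewrite phiev //; apply: submxMl.
have : (\row_(i < q) p`_i) *m A = 0.
  by rewrite -phiev // ep (coord0 sT lin).
move=> /(congr1 (mulmx^~ (invmx A))); rewrite mulmxK // mul0mx => /rowP e.
apply/polyP => i; rewrite coef0; have [qi|iq] := leqP q i.
  by rewrite nth_default // (leq_trans sp).
by have := e (Ordinal iq); rewrite !mxE.
Qed.
End Generators.

(** * The place where [x_n] vanishes *)

Section TameType.
Variables (k F F' : fieldType) (iota : {rmorphism k -> F}) (iota' : {rmorphism k -> F'}).
Variable (j : {rmorphism F -> F'}).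
Hypothesis (jc : forall c, j (iota c) = iota' c).
Variable (q : nat).
Hypothesis (q1 : (1 < q)%N).
Variables (P' : place iota) (dP' : discrete P') (fP' : finite_degree P').
Hypothesis (deg1 : place_degree P' = 1%N).
Variable (dP : forall P : place iota', discrete P).
Variables (Y : F') (gY : generator j q Y) (gZ : generator j q (Y + 1)^-1).
Variables (f : F) (S : nat).
Hypotheses (vf : valuation P' f = (q.-1 * S).+1%:Z) (Y1 : Y + 1 != 0).
Hypothesis (eY : Y * (Y + 1) ^+ q.-1 = j f).
Implicit Types (P Q : place iota').
Let dep := ev_dep gY.1.
Let Z := (Y + 1)^-1.

Local Lemma tame_f0 : f != 0.
Proof. by apply/eqP => e; move: vf; rewrite e val0. Qed.

Local Lemma tame_Y0 : Y != 0.
Proof.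
by apply/eqP => e; move: eY; rewrite e mul0r => /esym/eqP; rewrite fmorph_eq0 (negbTE tame_f0).
Qed.

Local Lemma tame_cases P : over j P P' ->
  (valuation P Y = (ram j P P' * (q.-1 * S).+1)%N%:Z /\ valuation P (Y + 1) = 0) \/
  (valuation P Y = 0 /\ q.-1%:Z * valuation P (Y + 1) = (ram j P P' * (q.-1 * S).+1)%N%:Z).
Proof.
move=> PP; have [e0 ve] := ramP dep PP dP'.
have e : valuation P Y + q.-1%:Z * valuation P (Y + 1) = (ram j P P' * (q.-1 * S).+1)%N%:Z.
  rewrite PoszM [RHS]mulrC -vf -ve -eY valM ?tame_Y0 ?expf_neq0 // valX //.
  by rewrite -mulr_natr natz [in RHS]mulrC.
have pos : 0 < (ram j P P' * (q.-1 * S).+1)%N%:Z by rewrite ltz_nat muln_gt0 e0.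
have [vY|vY|vY] := ltgtP (valuation P Y) 0.
- have h : vge P (valuation P Y + 1) 1 by right; rewrite (val1 (dP P)); move: vY; clear; lia.
  have [_ e1] := val_addl (dP P) tame_Y0 h.
  by move: e pos; rewrite e1; move: vY; clear; nia.
- have h : vge P (valuation P (1 : F') + 1) Y by right; rewrite (val1 (dP P)); move: vY; clear; lia.
  have [_ e1] := val_addr (dP P) (oner_neq0 _) h; rewrite (val1 (dP P)) in e1.
  by left; move: e; rewrite e1 mulr0 addr0.
- by right; move: e; rewrite vY add0r.
Qed.

(** The equation reduces to [Y (Y+1)^(q-1) = 0]. The root 0 gives an unramified place; at the root
    -1 the index is divisible by [q - 1], because [valuation P' f] is 1 plus a multiple of [q - 1].
    These two places exhaust the fundamental inequality. *)
Lemma tame_type : exists P1 P2, [/\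
  [/\ over j P1 P', ram j P1 P' = 1%N, place_degree P1 = 1%N & valuation P1 Y = (q.-1 * S).+1%:Z],
  [/\ over j P2 P', ram j P2 P' = q.-1, place_degree P2 = 1%N & valuation P2 (Y + 1) = (q.-1 * S).+1%:Z],
  forall P, over j P P' -> P = P1 \/ P = P2
  & top_values iota' j q Z P' (fun i => if i is 0%N then 0 else (i * S).+1%:Z)].
Proof.
have f0 := tame_f0; have Y0 := tame_Y0; have q_gt0 : (0 < q)%N := ltnW q1.
have q1' : (0 < q.-1)%N by move: q1; clear; lia.
have Of : vge P' 1 f by right; rewrite vf lez_nat.
have Of' : place_ring P' f by rewrite (val_ring dP') // vf.
pose psi : {poly F} := 'X * ('X + 1) ^+ q.-1 - f%:P.
have mX1 : ('X + 1 : {poly F}) \is monic by rewrite -polyC1 monicXaddC.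
have s1 : size ('X * ('X + 1) ^+ q.-1 : {poly F}) = q.+1.
  rewrite size_monicM ?monicX ?expf_neq0 ?monic_neq0 // size_polyX /=.
  have -> : size (('X + 1) ^+ q.-1 : {poly F}) = q.
    rewrite -(prednK (_ : 0 < size (('X + 1) ^+ q.-1 : {poly F})%R)%N) ?size_poly_gt0 ?expf_neq0 ?monic_neq0 //.
    by rewrite size_exp -polyC1 size_XaddC /= mul1n prednK.
  by [].
have s2 : (size (- f%:P : {poly F}) < q.+1)%N.
  by rewrite size_polyN (leq_ltn_trans (size_polyC_leq1 _)) // ltnS.
have mon : psi \is monic.
  rewrite monicE lead_coefDl ?s1 // lead_coef_monicM ?monicX //.
  by rewrite (eqP (monic_exp _ mX1 : lead_coef _ == 1)).
have sz : size psi = q.+1 by rewrite size_polyDl ?s1.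
have O1 : Ocoef P' ('X + 1).
  by apply: OcoefD; [apply: OcoefX | rewrite -polyC1; apply: OcoefC; apply: ring1].
have Opsi : Ocoef P' psi.
  by apply: OcoefB; [apply: OcoefM; [apply: OcoefX | apply: Ocoef_exp] | apply: OcoefC].
have ev1 : ev j Y ('X + 1) = Y + 1 by rewrite /ev rmorphD rmorph1 /= map_polyX !hornerE.
have evX : ev j Y 'X = Y by rewrite /ev map_polyX hornerX.
have epsi : ev j Y psi = 0 by rewrite evB evM evXn ev1 evX evC eY subrr.
(* Taking for [h] one of the two factors of the reduced equation yields a place where that factor is
   a unit, so that the other one vanishes. *)
have [||||P1 [PP1 u1]] := root_place jc dP' gY (h := 'X + 1) (a := 0) mon sz Opsi epsi.
- exact: ring0.
- have -> : psi.[0] = - f by rewrite /psi !hornerE ?mul0r ?sub0r.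
  exact: vgeN.
- exact: O1.
- have -> : ('X + 1 : {poly F}).[0] = 1 by rewrite !hornerE ?add0r.
  exact: unit1.
have [||||P2 [PP2 u2]] := root_place jc dP' gY (h := 'X) (a := - 1) mon sz Opsi epsi.
- by apply: ringN; apply: ring1.
- have -> : psi.[-1] = - f.
    by rewrite /psi !hornerE ?horner_exp ?hornerE addNr expr0n gtn_eqF // mulr0 sub0r.
  exact: vgeN.
- exact: OcoefX.
- by rewrite hornerX -(rmorphN1 iota); apply: unitC; rewrite oppr_eq0 oner_eq0.
rewrite evX in u2; rewrite ev1 in u1.
have [[vY1 vZ1]|[_ vZ1]] := tame_cases PP1; last first.
  exfalso; have [e0 _] := ramP dep PP1 dP'.
  by move: vZ1; rewrite (val_unit (dP P1) u1) mulr0; move: (ram _ _ _) e0; clear; nia.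
have [[vY2 _]|[vY2 vZ2]] := tame_cases PP2.
  have [e0 _] := ramP dep PP2 dP'; exfalso.
  by move: vY2; rewrite (val_unit (dP P2) u2); move: (ram _ _ _) e0; clear; nia.
have [e1 ve1] := ramP dep PP1 dP'; have [e2 ve2] := ramP dep PP2 dP'.
have e2m : exists2 m, (0 < m)%N & ram j P2 P' = (m * q.-1)%N.
  have vpos : 0 < valuation P2 (Y + 1).
    have : 0 < (ram j P2 P' * (q.-1 * S).+1)%N%:Z by rewrite ltz_nat muln_gt0 e2.
    by move: vZ2 q1'; clear; nia.
  have : (q.-1 %| ram j P2 P' * (q.-1 * S).+1)%N.
    apply/dvdnP; exists `|valuation P2 (Y + 1)|%N; move: vZ2 vpos.
    by move: (ram _ _ _ * _)%N; clear; nia.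
  rewrite -addn1 mulnDr muln1 dvdn_addr; last by apply: dvdn_mull; apply: dvdn_mulr.
  move=> /dvdnP[m em].
  by exists m => //; move: e2; rewrite em muln_gt0 => /andP[].
have ne12 : P1 != P2.
  apply/eqP => e; move: vY1; rewrite e vY2; move: (ram _ _ _) e2; clear; nia.
have dg P : over j P P' -> (0 < place_degree P)%N.
  by move=> PP; apply: (degree_pos (dP P)); apply: (over_deg_fin jc dP' fP' gY).
have ineq s : uniq s -> (forall P, P \in s -> over j P P') ->
    (\sum_(P <- s) ram j P P' * place_degree P <= q)%N.
  by move=> us so; have := over_ineq jc dP' fP' dP gY us so; rewrite deg1 muln1.
have [m m0 em] := e2m.
have := ineq [:: P1; P2]; rewrite big_cons big_seq1 /= mem_seq1 ne12 => /(_ isT) le12.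
have {le12} : (ram j P1 P' * place_degree P1 + ram j P2 P' * place_degree P2 <= q)%N.
  by apply: le12 => R; rewrite in_cons mem_seq1 => /orP[/eqP -> | /eqP ->].
have d1 := dg _ PP1; have d2 := dg _ PP2; move: (e1) (d1) (d2) (m0); rewrite em.
move=> h1 h2 h3 h4 le12.
have [r1 d1' r2 d2'] : [/\ ram j P1 P' = 1%N, place_degree P1 = 1%N, m = 1%N & place_degree P2 = 1%N].
  move: le12 h1 h2 h3 h4 q1; rewrite -[q in (_ <= q)%N]prednK //.
  move: (q.-1) q1' (ram j P1 P') (place_degree P1) (place_degree P2); clear.
  move=> Q Q1 a b c; rewrite mulnAC [(m * c * Q)%N]mulnC => le ha hb hc hm _.
  have x0 : (0 < a * b)%N by rewrite muln_gt0 ha.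
  have y0 : (0 < m * c)%N by rewrite muln_gt0 hm.
  have y1 : (m * c = 1)%N by move: le x0 y0 Q1; move: (a * b)%N (m * c)%N; clear; nia.
  have x1 : (a * b = 1)%N by move: le x0; rewrite y1 muln1; move: (a * b)%N; clear; lia.
  by move/eqP: y1; move/eqP: x1; rewrite !muln_eq1 => /andP[/eqP -> /eqP ->] /andP[/eqP -> /eqP ->].
have vY1' : valuation P1 Y = (q.-1 * S).+1%:Z by rewrite vY1 r1 mul1n.
rewrite r2 mul1n in em.
have vZ2' : valuation P2 (Y + 1) = (q.-1 * S).+1%:Z.
  by move: vZ2; rewrite em PoszM; apply: mulfI; move: q1'; clear; lia.
have both P : over j P P' -> P = P1 \/ P = P2.
  move=> PP; have [->|n1] := eqVneq P P1; first by left.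
  have [->|n2] := eqVneq P P2; first by right.
  have u3 : uniq [:: P; P1; P2] by rewrite /= !in_cons !orbF (negbTE n1) (negbTE n2) ne12.
  have := ineq _ u3; rewrite !big_cons big_nil addn0 r1 d1' em d2' !muln1 => h.
  have {h} : (ram j P P' * place_degree P + (1 + q.-1) <= q)%N.
    apply: h => R; rewrite !in_cons orbF.
    by case/orP => [/eqP ->|/orP[/eqP ->|/eqP ->]].
  have [e0 _] := ramP dep PP dP'.
  have : (0 < ram j P P' * place_degree P)%N by rewrite muln_gt0 e0 dg.
  by move: q1; clear; lia.
exists P1, P2; split=> //.
have [t t0 vt] := exists_val dP' 1.
(* At [P2] the power [Z^i] has a pole of order [i ((q-1) S + 1)] while [t] has a zero of order
   [q - 1]; for [0 < i < q] the least power of [t] that compensates it is [i S + 1]. *)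
pose kap (i : nat) := if i is 0%N then 0%N else (i * S).+1.
pose s (i : nat) : F := t ^+ kap i.
have s0 i : s i != 0 by rewrite expf_neq0.
have vs i : valuation P' (s i) = (kap i)%:Z by rewrite valX // vt -mulr_natr natz mul1r.
have -> : (fun i : nat => if i is 0%N then 0 else (i * S).+1%:Z) =
    (fun i : nat => valuation P' (s i) + i%:Z * valuation P' (1 : F)).
  by apply/funext => i; rewrite vs (val1 dP') mulr0 addr0; case: i.
have eZ : j 1 * (Z - j 0) = Z by rewrite rmorph1 rmorph0 subr0 mul1r.
have Z0 : Z != 0 by rewrite invr_eq0.
have v1Z : valuation P1 Z = 0 by rewrite valV // (val_unit (dP P1)) ?oppr0.
have v2Z : valuation P2 Z = - (q.-1 * S).+1%:Z by rewrite valV // vZ2'.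
have v1 (a : F) i : a != 0 -> valuation P1 (j a * Z ^+ i) = valuation P' a.
  by move=> a0; rewrite valM ?fmorph_eq0 ?expf_neq0 // valX // v1Z mul0rn addr0 ve1 r1 mulr1.
have v2 (a : F) (i : nat) : a != 0 ->
    valuation P2 (j a * Z ^+ i) = valuation P' a * q.-1%:Z - (i * (q.-1 * S).+1)%N%:Z.
  move=> a0; rewrite valM ?fmorph_eq0 ?expf_neq0 // valX // v2Z ve2 em -mulr_natr natz.
  by rewrite mulNr PoszM [X in _ - X = _]mulrC.
apply: (top_values_pow dP' (oner_neq0 F) s0 gZ (u := 0)); rewrite eZ.
- move=> i iq Q /both [] ->; rewrite (val_ring (dP _)) ?mulf_neq0 ?fmorph_eq0 ?expf_neq0 //.
    by rewrite v1 // vs.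
  rewrite v2 // vs; case: i iq => [|i] iq; rewrite /kap ?mul0r //.
  by move: iq; rewrite -[q in (_ < q)%N]prednK //; move: (q.-1); clear; nia.
- move=> a ia i iq; have [->|ai] := eqVneq (a i) 0; first exact: vge_0.
  have [i0 ai0 imax] := max_value P' (t := fun i : 'I_q => a i)
    (ex_intro (fun i : 'I_q => a i != 0) (Ordinal iq) ai).
  have minv (l : nat) : (l < q)%N -> a l != 0 -> valuation P' (a i0) <= valuation P' (a l).
    move=> lq al; have := imax (Ordinal lq); rewrite (val_ring dP') ?mulf_neq0 ?invr_eq0 // valF //=.
    by clear; lia.
  right; apply: le_trans (minv i iq ai); rewrite leNgt; apply/negP => neg.
  set mu := valuation P' (a i0) in neg minv.
  have as0 l : a l != 0 -> a l * s l != 0 by move=> al; rewrite mulf_neq0.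
  have vas l : a l != 0 -> valuation P' (a l * s l) = valuation P' (a l) + (kap l)%:Z.
    by move=> al; rewrite valM // vs.
  have g1 : vge P1 0 (\sum_(l < q) j (a l * s l) * Z ^+ l) by apply/(vge0 (dP P1)); apply: ia.
  have g2 : vge P2 0 (\sum_(l < q) j (a l * s l) * Z ^+ l) by apply/(vge0 (dP P2)); apply: ia.
  pose o0 : 'I_q := Ordinal q_gt0.
  have rest1 : vge P1 (mu + 1) (\sum_(l < q | l != o0) j (a l * s l) * Z ^+ l).
    apply: vge_sum => // l l0; have [->|al] := eqVneq (a l) 0.
      by rewrite mul0r rmorph0 mul0r; apply: vge_0.
    right; rewrite v1 ?as0 // vas //; have := minv l (ltn_ord l) al.
    have : (0 < kap l)%N by rewrite /kap; case: (l) l0 => -[|x] hx //; case/eqP; apply/val_inj.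
    by clear; lia.
  (* At [P1] the function [Z] is a unit and the factors [s l] push all terms except the constant one
     beyond [mu], so the constant coefficient cannot have the least valuation. *)
  have a00 : vge P' (mu + 1) (a 0%N).
    have [->|az] := eqVneq (a 0%N) 0; first exact: vge_0.
    right.
    have := minv 0%N q_gt0 az; rewrite le_eqVlt => /orP[/eqP e|]; last by clear; lia.
    exfalso; move: g1; rewrite (bigD1 o0) //= => g1.
    have t0' : j (a 0%N * s 0%N) * Z ^+ 0 != 0 by rewrite mulf_neq0 ?fmorph_eq0 ?as0 ?expf_neq0.
    have v0 : valuation P1 (j (a 0%N * s 0%N) * Z ^+ 0) = mu.
      by rewrite v1 ?as0 // vas // /kap addr0 -e.
    have [|nz e1'] := @val_addl _ _ _ P1 (dP P1) _ (\sum_(l < q | l != o0) j (a l * s l) * Z ^+ l) t0'.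
      by rewrite v0.
    by move: g1; rewrite (vge_val _ _ nz) e1' v0; move: neg; clear; lia.
  have i0n0 : i0 != o0.
    by apply/eqP => e; case: a00 => [e0|]; [move: ai0; rewrite e e0 eqxx | rewrite /mu e /=; move: (valuation P' (a 0%N)); clear; lia].
  have term0 : vge P2 ((mu + 1) * q.-1%:Z) (j (a 0%N * s 0%N) * Z ^+ 0).
    case: a00 => [->|h]; first by rewrite mul0r rmorph0 mul0r; apply: vge_0.
    have [->|az] := eqVneq (a 0%N) 0; first by rewrite mul0r rmorph0 mul0r; apply: vge_0.
    right; rewrite v2 ?as0 // vas // /kap addr0.
    by apply: ler_wpM2r => //; move: h; move: (valuation _ _); clear; lia.
  have hs : vge P2 ((mu + 1) * q.-1%:Z) (\sum_(l < q | l != o0) j (a l * s l) * Z ^+ l).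
    have -> : \sum_(l < q | l != o0) j (a l * s l) * Z ^+ l =
      \sum_(l < q) j (a l * s l) * Z ^+ l - j (a 0%N * s 0%N) * Z ^+ 0.
      by rewrite [in RHS](bigD1 o0) //= addrAC subrr add0r.
    apply: vgeB => //; apply: vge_le g2; move: neg q1'; clear; nia.
  pose tt (l : 'I_q) := if l == o0 then 0 else j (a l * s l) * Z ^+ l.
  have hs' : vge P2 ((mu + 1) * q.-1%:Z) (\sum_(l < q) tt l).
    move: hs; rewrite big_mkcond; congr vge; apply: eq_bigr => l _.
    by rewrite /tt; case: (eqVneq l o0).
  have ttn l : tt l != 0 -> l != o0 /\ a l != 0.
    rewrite /tt; case: (eqVneq l o0) => [_|l0 h]; first by rewrite eqxx.
    by split=> //; apply: contraNneq h => ->; rewrite mul0r rmorph0 mul0r.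
  have vtt l : l != o0 -> a l != 0 -> valuation P2 (tt l) = (valuation P' (a l) + 1) * q.-1%:Z - l%:Z.
    move=> l0 al; rewrite /tt (negbTE l0) v2 ?as0 // vas // /kap.
    case: l l0 al => -[|x] hx l0 al /=; first by case/eqP: l0; apply/val_inj.
    by move: (valuation P' _) (q.-1); clear; nia.
  have := distinct_vge (dP P2) _ hs' i0.
  have ti0 : tt i0 != 0 by rewrite /tt (negbTE i0n0) mulf_neq0 ?fmorph_eq0 ?as0 ?expf_neq0.
  rewrite (vge_val _ _ ti0) vtt // -/mu => h.
  have {h} : (mu + 1) * q.-1%:Z <= (mu + 1) * q.-1%:Z - i0%:Z.
    apply: h => l1 l2 ne /ttn[z1 n1] /ttn[z2 n2]; rewrite !vtt //; apply: contra ne => /eqP e.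
    have pos (l : 'I_q) : l != o0 -> (0 < l)%N.
      by move=> l0; rewrite lt0n; apply: contra l0 => /eqP e0; apply/eqP/val_inj.
    have lt (l : 'I_q) : l != o0 -> (l.-1 < q.-1)%N.
      by move=> /pos l0; have := ltn_ord l; move: l0 q1'; clear; lia.
    have : (l1.-1 = l2.-1)%N.
      apply: (@mod_inj (valuation P' (a l1) + 1) (valuation P' (a l2) + 1) q.-1) (lt _ z1) (lt _ z2) _.
      have := pos _ z1; have := pos _ z2; move: e; move: ((_ + 1) * _) ((_ + 1) * _); clear; lia.
    by have := pos _ z1; have := pos _ z2; move=> p2 p1 e'; apply/eqP/val_inj => /=; move: p1 p2 e'; clear; lia.
  have : (0 < i0)%N by rewrite lt0n; apply: contra i0n0 => /eqP e0; apply/eqP/val_inj.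
  by move: ((mu + 1) * _); clear; lia.
Qed.
End TameType.

(** * The rational function field *)

Section RationalFunctionField.
Variables (k F : fieldType) (iota : {rmorphism k -> F}).
Implicit Types (a b c p r : {poly k}) (P Q : place iota).

Definition transcendental (x : F) := forall p : {poly k}, ev iota x p = 0 -> p = 0.
Definition fractions (x : F) := forall z : F, exists a b : {poly k},
  b != 0 /\ z = ev iota x a / ev iota x b.

Lemma ev_mul x a b : ev iota x (a * b) = ev iota x a * ev iota x b.
Proof. by rewrite /ev rmorphM hornerM. Qed.

Lemma ev_exp x a n : ev iota x (a ^+ n) = ev iota x a ^+ n.
Proof. by rewrite /ev rmorphXn /= horner_exp. Qed.

Lemma evX_ x : ev iota x 'X = x.
Proof. by rewrite /ev map_polyX hornerX. Qed.

Lemma evC_ x (d : k) : ev iota x d%:P = iota d.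
Proof. by rewrite /ev map_polyC hornerC. Qed.

Lemma transcendentalP x : ~ algebraicOver iota x -> transcendental x.
Proof.
move=> h p ep; apply/eqP; apply: contraT => p0; exfalso; apply: h.
by exists p => //; apply/rootP.
Qed.

Lemma ev_neq0 x p : transcendental x -> p != 0 -> ev iota x p != 0.
Proof. by move=> tx; apply: contra => /eqP /tx ->. Qed.

Lemma fractionsP x : transcendental x -> generated_by iota x -> fractions x.
Proof.
move=> tx gen z; pose S : {pred F} := fun z => `[< exists a b : {poly k},
  b != 0 /\ z = ev iota x a / ev iota x b >].
apply/asboolP; apply: (gen S) => [|d|].
- split.
  + apply/asboolP; exists 1, 1; split; first exact: oner_neq0.
    by rewrite /ev rmorph1 hornerC divr1.
  + move=> u v /asboolP[a [b [b0 ->]]] /asboolP[c [d [d0 ->]]]; apply/asboolP.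
    exists (a * d - c * b), (b * d); split; first by rewrite mulf_neq0.
    have eb := ev_neq0 tx b0; have ed := ev_neq0 tx d0.
    by rewrite evB !ev_mul; field; rewrite eb ed.
  + move=> u v /asboolP[a [b [b0 ->]]] /asboolP[c [d [d0 ->]]]; apply/asboolP.
    have [->|c0] := eqVneq c 0.
      exists 0, 1; split; first exact: oner_neq0.
      by rewrite /ev rmorph0 horner0 mul0r invr0 mulr0 mul0r.
    exists (a * d), (b * c); split; first by rewrite mulf_neq0.
    have eb := ev_neq0 tx b0; have ed := ev_neq0 tx d0; have ec := ev_neq0 tx c0.
    by rewrite !ev_mul; field; rewrite eb ed ec.
- apply/asboolP; exists d%:P, 1; split; first exact: oner_neq0.
  by rewrite evC_ /ev rmorph1 hornerC divr1.
- apply/asboolP; exists 'X, 1; split; first exact: oner_neq0.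
  by rewrite evX_ /ev rmorph1 hornerC divr1.
Qed.

Lemma coprime_fractions x : transcendental x -> fractions x -> forall z, z != 0 ->
  exists a b, [/\ a != 0, b != 0, coprimep a b & z = ev iota x a / ev iota x b].
Proof.
move=> tx fx z z0; have [a [b [b0 ez]]] := fx z.
have a0 : a != 0 by apply: contraNneq z0 => a0; rewrite ez a0 /ev rmorph0 horner0 mul0r.
have g0 : gcdp a b != 0 by rewrite gcdp_eq0 negb_and a0.
exists (a %/ gcdp a b), (b %/ gcdp a b).
have ea : a = a %/ gcdp a b * gcdp a b by rewrite divpK // dvdp_gcdl.
have eb : b = b %/ gcdp a b * gcdp a b by rewrite divpK // dvdp_gcdr.
split.
- by apply: contraNneq a0 => h; rewrite ea h mul0r.
- by apply: contraNneq b0 => h; rewrite eb h mul0r.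
- by apply: coprimep_div_gcd; rewrite a0.
- rewrite ez; have := congr1 (ev iota x) ea; have := congr1 (ev iota x) eb.
  rewrite !ev_mul => -> ->; rewrite invfM mulrACA mulfV ?mulr1 //.
  exact: ev_neq0.
Qed.

Lemma ideal_mul P u v : place_ring P u -> place_ideal P v -> place_ideal P (u * v).
Proof.
move=> Ou [Ov nv]; split; first exact: ringM.
move=> [uv0 _ Ouv]; apply: nv; move: uv0; rewrite mulf_eq0 negb_or => /andP[u0 v0].
split=> //; have -> : v^-1 = u * (u * v)^-1 by rewrite invfM mulrA mulfV ?mul1r.
exact: ringM.
Qed.

Lemma ideal_sub P u v : place_ideal P u -> place_ideal P v -> place_ideal P (u - v).
Proof.
move=> Iu Iv; have [->|u0] := eqVneq u 0; first by rewrite sub0r -mulN1r; apply: ideal_mul => //; rewrite ringN ?ring1.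
have [->|v0] := eqVneq v 0; first by rewrite subr0.
case/orP: (place_valuation P (u / v)) => h.
  have -> : u - v = (u / v - 1) * v by rewrite mulrBl mul1r divfK.
  by apply: ideal_mul => //; apply: ringB => //; apply: ring1.
have -> : u - v = (1 - v / u) * u by rewrite mulrBl mul1r divfK.
by apply: ideal_mul => //; apply: ringB; [apply: ring1 | rewrite -[v / u]invf_div].
Qed.

Section FinitePlace.
Variables (x : F) (tx : transcendental x) (fx : fractions x).
Variables (P : place iota) (Ox : place_ring P x).

Lemma place_ring_ev a : place_ring P (ev iota x a).
Proof.
rewrite (evE _ _ (leqnn _)); apply: ring_sum => i _; apply: ringM; first exact: ringC.
exact: ringX.
Qed.


Let nonideal u : u != 0 -> place_ring P u -> ~ place_ideal P u -> place_unit P u.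
Proof. by move=> u0 Ou nu; apply: contrapT => h; apply: nu. Qed.

(** The polynomials in [x] that vanish at [P] form an ideal, generated by a monic one of least
    degree. The ideal is nonzero, since otherwise every nonzero denominator would be a unit and the
    ring of [P] would be all of [F]. *)
Lemma place_poly : exists pi : {poly k}, [/\ pi \is monic, pi %| 1 = false &
  forall a, place_ideal P (ev iota x a) <-> pi %| a].
Proof.
have ex : exists n, `[< exists a, [/\ a != 0, size a = n & place_ideal P (ev iota x a)] >].
  apply: contrapT => nex; have [z nz] := place_proper P.
  case/negP: nz; have [a [b [b0 ->]]] := fx z.
  apply: ringM; first exact: place_ring_ev.
  suff [] : place_unit P (ev iota x b) by [].
  apply: nonideal; rewrite ?ev_neq0 ?place_ring_ev // => h.
  by apply: nex; exists (size b); apply/asboolP; exists b.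
case: (ex_minnP ex) => n /asboolP[a0 [a00 sa0 Ia0]] nmin.
pose pi := (lead_coef a0)^-1 *: a0.
have lc0 : lead_coef a0 != 0 by rewrite lead_coef_eq0.
have mon : pi \is monic by rewrite monicE lead_coefZ mulVf.
have pi0 : pi != 0 by apply: monic_neq0.
have spi : size pi = n by rewrite size_scale ?invr_eq0.
have Ipi : place_ideal P (ev iota x pi).
  by rewrite evZ; apply: ideal_unit => //; apply: unitC; rewrite invr_eq0.
have dvd a : place_ideal P (ev iota x a) <-> pi %| a.
  split=> [Ia|/dvdpP[c ->]]; last first.
    by rewrite ev_mul; apply: ideal_mul => //; apply: place_ring_ev.
  apply/modp_eq0P; apply/eqP; apply: contraT => r0.
  have Ir : place_ideal P (ev iota x (a %% pi)).
    have -> : a %% pi = a - a %/ pi * pi by rewrite [X in X - _](divp_eq a pi) addrC addKr.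
    by rewrite evB ev_mul; apply: ideal_sub => //; apply: ideal_mul => //; apply: place_ring_ev.
  have : (n <= size (a %% pi)%R)%N by apply: nmin; apply/asboolP; exists (a %% pi).
  by rewrite leqNgt -spi ltn_modp pi0.
exists pi; split=> //; apply/negP => /dvd [_]; apply.
by rewrite -polyC1 evC_ rmorph1; exact: unit1.
Qed.

Section LocalParameter.
Variables (pi : {poly k}) (mon : pi \is monic) (pi1 : pi %| 1 = false)
  (dvd : forall a, place_ideal P (ev iota x a) <-> pi %| a).

Let pi0 : pi != 0. Proof. exact: monic_neq0. Qed.

Let unit_ev a : ~~ (pi %| a) -> place_unit P (ev iota x a).
Proof.
move=> na; apply: nonideal; [|exact: place_ring_ev|by move/dvd; apply/negP].
by apply: ev_neq0 => //; apply: contraNneq na => ->; rewrite dvdp0.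
Qed.

Let size_pi : (1 < size pi)%N.
Proof.
rewrite ltnNge; apply/negP => h; have : pi %| 1 by rewrite dvdp1 eqn_leq h size_poly_gt0.
by rewrite pi1.
Qed.

Let ev_power a : a != 0 -> exists (n : nat) b, ~~ (pi %| b) /\ a = b * pi ^+ n.
Proof.
elim: (size a) {-2}a (leqnn (size a)) => [|n IH] {}a.
  by rewrite leqn0 size_poly_eq0 => /eqP ->; rewrite eqxx.
move=> sa a0; case: (boolP (pi %| a)) => [/dvdpP[c ec]|na]; last by exists 0%N, a; rewrite expr0 mulr1.
have c0 : c != 0 by apply: contraNneq a0 => c0; rewrite ec c0 mul0r.
have [|m [b [nb eb]]] := IH c _ c0.
  move: sa; rewrite ec size_mul // => sa; rewrite -ltnS; apply: leq_trans sa.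
  by move: size_pi; case: (size pi) => [|[|l]] // _; rewrite !addnS ltnS leq_addr.
by exists m.+1, b; split=> //; rewrite ec eb exprSr mulrA.
Qed.

Lemma finite_discrete : discrete P.
Proof.
exists (ev iota x pi); split; first exact: ev_neq0.
  exact/dvd.
move=> f f0; have [a [b [a0 b0 _ ef]]] := coprime_fractions tx fx f0.
have [n [a' [na ea]]] := ev_power a0; have [m [b' [nb eb]]] := ev_power b0.
exists (n%:Z - m%:Z), (ev iota x a' / ev iota x b'); split.
  by apply: unitM; [|apply: unitV]; apply: unit_ev.
have t0 : ev iota x pi != 0 by exact: ev_neq0.
rewrite ef ea eb !ev_mul !ev_exp expfzDr // -exprnN -exprnP invfM.
by rewrite mulrACA.
Qed.

Lemma val_parameter : valuation P (ev iota x pi) = 1.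
Proof.
have dP := finite_discrete; have t0 : ev iota x pi != 0 by exact: ev_neq0.
have : vge P 1 (ev iota x pi) by apply/(vge_ideal dP)/dvd.
rewrite (vge_val _ _ t0) => v1.
have [f f0 vf] := exists_val dP 1.
have [a [b [a0 b0 _ ef]]] := coprime_fractions tx fx f0.
have [n [a' [na ea]]] := ev_power a0; have [m [b' [nb eb]]] := ev_power b0.
have v u n' : ~~ (pi %| u) -> ev iota x (u * pi ^+ n') != 0 ->
    valuation P (ev iota x (u * pi ^+ n')) = valuation P (ev iota x pi) *+ n'.
  rewrite ev_mul ev_exp mulf_eq0 negb_or => nu /andP[u0 p0].
  by rewrite valM // valX // (val_unit dP (unit_ev nu)) add0r.
have ea0 : ev iota x a != 0 by exact: ev_neq0.
have eb0 : ev iota x b != 0 by exact: ev_neq0.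
move: vf; rewrite ef valF // ea eb !v -?ea -?eb //.
move: (valuation _ _) v1 => w v1; rewrite -(mulr_natr w n) -(mulr_natr w m) !natz -mulrBr; move: (_ - _) => l e.
have w0 : 0 <= w by exact: le_trans ler01 v1.
have l1 : 1 <= l.
  by rewrite -gtz0_ge1 ltNge; apply/negP => /(mulr_ge0_le0 w0); rewrite e.
by apply/eqP; rewrite eq_le v1 andbT -e ler_peMr.
Qed.

Lemma finite_ring a b : coprimep a b -> b != 0 ->
  place_ring P (ev iota x a / ev iota x b) = ~~ (pi %| b).
Proof.
move=> cab b0; apply/idP/idP => [h|nb]; last first.
  by apply: ringM; [exact: place_ring_ev | have [] := unit_ev nb].
apply/negP => pb; have : place_ideal P (ev iota x a).
  have -> : ev iota x a = ev iota x a / ev iota x b * ev iota x b by rewrite divfK // ev_neq0.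
  by apply: ideal_mul => //; apply/dvd.
by move/dvd => pa; move: cab; rewrite coprimep_def size_poly_eq1 => /eqp_dvdr e; have := pi1; rewrite -e dvdp_gcd pa pb.
Qed.

Lemma parameter_coprime b : ~~ (pi %| b) -> coprimep b pi.
Proof.
move=> nb; have dP := finite_discrete.
have /dvdpP[g eg] := dvdp_gcdr b pi; have /dvdpP[c ec] := dvdp_gcdl b pi.
rewrite coprimep_def; case: (boolP (pi %| gcdp b pi)) => [h|h].
  by case/negP: nb; apply: dvdp_trans h (dvdp_gcdl b pi).
have : pi %| g.
  apply: contraT => ng; have [_ ] : place_ideal P (ev iota x pi) by apply/dvd.
  by rewrite eg ev_mul; case; apply: unitM; apply: unit_ev.
have g0 : g != 0 by apply: contraNneq pi0 => g0; rewrite eg g0 mul0r.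
have gc0 : gcdp b pi != 0 by rewrite gcdp_eq0 negb_and pi0 orbT.
move/(dvdp_leq g0); rewrite {1}eg size_mul //.
move: gc0; rewrite -size_poly_gt0; move: (size _) (size _) (size_poly_gt0 g); rewrite g0 => u w; lia.
Qed.

Lemma finite_residue : has_quotient_basis iota [set` place_ring P] (place_ideal P) (size pi).-1.
Proof.
have dP := finite_discrete.
exists (fun i : 'I_(size pi).-1 => x ^+ i); split=> [i|y Oy]; first exact: ringX.
have evp (c : {ffun 'I_(size pi).-1 -> k}) :
    \sum_i iota (c i) * x ^+ i = ev iota x (\sum_i c i *: 'X^i).
  rewrite /ev rmorph_sum /= horner_sum; apply: eq_bigr => i _.
  by rewrite linearZ_LR /= map_polyXn hornerZ hornerXn.
have sc (c : {ffun 'I_(size pi).-1 -> k}) : (size (\sum_i c i *: 'X^i)%R < size pi)%N.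
  rewrite -[X in (_ < X)%N]prednK ?size_poly_gt0 // ltnS.
  apply: (leq_trans (size_sum _ _ _)); apply/bigmax_leqP => i _.
  by apply: leq_trans (size_scale_leq _ _) _; rewrite size_polyXn.
have coefc (c : {ffun 'I_(size pi).-1 -> k}) (i : 'I_(size pi).-1) : (\sum_i c i *: 'X^i)`_i = c i.
  rewrite coef_sum (bigD1 i) //= coefZ coefXn eqxx mulr1 big1 ?addr0 // => l li.
  by rewrite coefZ coefXn eq_sym -[_ == _]/(l == i) (negbTE li) mulr0.
have [r sr Ir] : exists2 r : {poly k}, (size r < size pi)%N & place_ideal P (y - ev iota x r).
  have [->|y0] := eqVneq y 0.
    exists 0; first by rewrite size_poly0 size_poly_gt0.
    by rewrite /ev rmorph0 horner0 subr0 -(vge_ideal dP); apply: vge_0.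
  have [a [b [a0 b0 cab ey]]] := coprime_fractions tx fx y0.
  have nb : ~~ (pi %| b) by rewrite -(finite_ring cab b0) -ey.
  have /Bezout_eq1_coprimepP[[u w] /= euw] := parameter_coprime nb.
  exists ((u * a) %% pi); first by rewrite ltn_modp.
  have -> : y - ev iota x ((u * a) %% pi) = (ev iota x a / ev iota x b) * ev iota x (w * pi)
      - ev iota x (- (u * a %/ pi)) * ev iota x pi.
    have em : (u * a) %% pi = u * a - u * a %/ pi * pi.
      by rewrite [X in X - _](divp_eq (u * a) pi) addrC addKr.
    have ew : ev iota x (w * pi) = 1 - ev iota x u * ev iota x b.
      rewrite -ev_mul -[1 in RHS](rmorph1 iota) -(evC_ x) -evB; congr ev.
      by rewrite polyC1 -euw addrC addKr.
    have eb : ev iota x b != 0 by exact: ev_neq0.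
    rewrite em ew evB !ev_mul ey [ev iota x (- _)](_ : _ = - ev iota x (u * a %/ pi)); first by field.
    by rewrite -[RHS]sub0r -[0](rmorph0 iota) -(evC_ x) -evB sub0r.
  apply: ideal_sub; first by apply: ideal_mul; [rewrite -ey | apply/dvd; exact: dvdp_mulIr].
  by apply: ideal_mul; [exact: place_ring_ev | apply/dvd].
exists [ffun i : 'I_(size pi).-1 => r`_i]; split.
  rewrite /= evp (_ : \sum_i _ = r) //; apply/polyP => i.
  have [h|h] := ltnP i (size pi).-1.
    by rewrite (coefc _ (Ordinal h)) ffunE.
  have spi : (size pi <= i.+1)%N by rewrite -(prednK (ltnW size_pi)) ltnS.
  by rewrite !nth_default // -ltnS; [apply: leq_trans sr spi | apply: leq_trans (sc _) spi].
move=> c /= hc; apply/ffunP => i; rewrite ffunE -(coefc c); suff -> : \sum_i c i *: 'X^i = r by [].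
apply/eqP; rewrite -subr_eq0.
have : pi %| (\sum_i c i *: 'X^i - r).
  apply/dvd; rewrite evB -evp.
  have -> : \sum_i iota (c i) * x ^+ i - ev iota x r = (y - ev iota x r) - (y - \sum_i iota (c i) * x ^+ i) by ring.
  exact: ideal_sub.
apply: contraLR => h; apply/negP => /(dvdp_leq h); apply/negP; rewrite -ltnNge.
by apply: leq_ltn_trans (size_polyD _ _) _; rewrite size_polyN gtn_max sc sr.
Qed.

Lemma finite_place_degree : finite_degree P /\ place_degree P = (size pi).-1.
Proof.
have dP := finite_discrete; split; first by exists (size pi).-1; apply: finite_residue.
apply: (place_degreeE dP); rewrite -set_ideal // -set_ring //.
apply/qdimP; last exact: finite_residue.
  by rewrite set_ring //; apply: subspace_vge.
by rewrite set_ideal //; apply: subspace_vge.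
Qed.


Lemma place_unique Q : place_ring Q x -> place_ideal Q (ev iota x pi) -> Q = P.
Proof.
move=> OQ IQ; apply/esym; apply: (place_maximal (finite_discrete)) => z.
have [->|z0] := eqVneq z 0; first by move=> _; apply: ring0.
have [a [b [a0 b0 cab ez]]] := coprime_fractions tx fx z0.
rewrite ez finite_ring // => nb.
have /Bezout_eq1_coprimepP[[u w] /= euw] := parameter_coprime nb.
have OQev c : place_ring Q (ev iota x c).
  by rewrite (evE _ _ (leqnn _)); apply: ring_sum => i _; apply: ringM; [exact: ringC | exact: ringX].
have eb0 : ev iota x b != 0 by exact: ev_neq0.
apply: ringM => //; suff [] : place_unit Q (ev iota x b) by [].
apply: contrapT => nu; have : place_ideal Q (ev iota x 1).
  have -> : 1 = u * b - (- w) * pi by rewrite mulNr opprK.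
  rewrite evB !ev_mul; apply: ideal_sub.
    by apply: ideal_mul => //; split=> //; exact: OQev.
  exact: ideal_mul.
by rewrite -polyC1 evC_ rmorph1; case=> _; apply; apply: unit1.
Qed.
End LocalParameter.
End FinitePlace.

Section Inversion.
Variables (x : F) (tx : transcendental x) (fx : fractions x).

Lemma transcendental_neq0 : x != 0.
Proof.
apply/eqP => x0; have /tx /eqP : ev iota x 'X = 0 by rewrite evX_.
by rewrite polyX_eq0.
Qed.

Lemma ev_inv a n : (size a <= n.+1)%N -> exists b, (b = 0 -> a = 0) /\
  ev iota x^-1 a = ev iota x b / x ^+ n.
Proof.
move=> sa; exists (\poly_(i < n.+1) a`_(n - i)); split.
  move/polyP => h; apply/polyP => i; rewrite coef0.
  have [ni|ni] := ltnP n i; first by rewrite nth_default // (leq_trans sa).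
  by have := h (n - i)%N; rewrite coef_poly coef0 ltnS leq_subr subKn.
rewrite (evE _ _ sa) (evE _ _ (size_poly _ _)) (reindex_inj rev_ord_inj) /= mulr_suml.
apply: eq_bigr => i _; rewrite subSS coef_poly ltn_ord -mulrA; congr (iota _ * _).
have x0 := transcendental_neq0; have hi : (i <= n)%N by rewrite -ltnS.
have -> : x ^+ n = x ^+ i * x ^+ (n - i) by rewrite -exprD subnKC.
by rewrite invfM mulrA mulfV ?expf_neq0 // mul1r exprVn.
Qed.

Lemma transcendental_inv : transcendental x^-1.
Proof.
move=> a ea; have [b [b0 eb]] := ev_inv (leqSpred (size a)).
apply: b0; apply: tx; apply/eqP; move: ea; rewrite eb => /eqP.
by rewrite mulf_eq0 invr_eq0 expf_eq0 (negbTE transcendental_neq0) andbF orbF.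
Qed.
End Inversion.

Lemma fractions_inv x : transcendental x -> fractions x -> fractions x^-1.
Proof.
move=> tx fx z; have [a [b [b0 ez]]] := fx z.
have ti := transcendental_inv tx; have x0 := transcendental_neq0 tx.
pose n := maxn (size a) (size b).
have [a' [a'0 ea]] := @ev_inv _ ti a n (leqW (leq_maxl _ _)).
have [b' [b'0 eb]] := @ev_inv _ ti b n (leqW (leq_maxr _ _)).
rewrite invrK in ea eb; exists a', b'; split.
  by apply: contraNneq b0 => /b'0 ->.
have y0 : x^-1 ^+ n != 0 by rewrite expf_neq0 // invr_eq0.
by rewrite ez ea eb invfM mulrACA mulfV ?mulr1 // invr_eq0.
Qed.

Section InfinitePlace.
Variables (x : F) (tx : transcendental x) (fx : fractions x).
Let ti := transcendental_inv tx.
Let fi := fractions_inv tx fx.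
Let x0 := transcendental_neq0 tx.

Lemma exists_infinite : exists P : place iota, ~~ place_ring P x.
Proof.
have [|||P [_ nP]] := @exists_place k F iota [set z | exists p, z = ev iota x^-1 p] x; last by exists P.
- split=> [c|_ _ [a ->] [b ->]|_ _ [a ->] [b ->]] /=.
  + by exists c%:P; rewrite evC_.
  + by exists (a - b); rewrite evB.
  + by exists (a * b); rewrite ev_mul.
- by exists 'X; rewrite evX_.
- move=> [a ea]; have : ev iota x^-1 ('X * a - 1) = 0.
    by rewrite evB ev_mul evX_ -ea -polyC1 evC_ rmorph1 mulVf // subrr.
  move/ti/eqP; rewrite subr_eq0 => /eqP e.
  move/(congr1 (fun r : {poly k} => r.[0])): e; rewrite hornerM hornerX mul0r hornerC => /esym/eqP.
  by rewrite oner_eq0.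
Qed.

(** The pole of [x] is the zero of [x^-1], which generates the same field; everything is inherited
    from the finite place with parameter ['X] for [x^-1]. *)
Lemma infinite_place P : ~~ place_ring P x ->
  [/\ discrete P, valuation P x = -1, finite_degree P, place_degree P = 1%N &
   forall Q, ~~ place_ring Q x -> Q = P].
Proof.
move=> nP; have Oi Q : ~~ place_ring Q x -> place_ring Q x^-1.
  by move=> nQ; have := place_valuation Q x; rewrite -[x \in _]/(place_ring Q x) (negbTE nQ).
have Ii Q : ~~ place_ring Q x -> place_ideal Q (ev iota x^-1 'X).
  by move=> nQ; rewrite evX_; split; [apply: Oi | case=> _ _; rewrite invrK; apply/negP].
have [pi [mon pi1 dvd]] := place_poly ti fi (Oi _ nP).
have epi : pi = 'X.
  have /dvdpP[c ec] : pi %| 'X by apply/dvd; apply: Ii.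
  have c0 : c != 0 by apply/eqP => c0; move/eqP: ec; rewrite c0 mul0r polyX_eq0.
  have spi : (1 < size pi)%N.
    rewrite ltnNge; apply/negP => h; have : pi %| 1 by rewrite dvdp1 eqn_leq h size_poly_gt0 (monic_neq0 mon).
    by rewrite pi1.
  have sc : size c = 1%N.
    have : size (c * pi) = 2%N by rewrite -ec size_polyX.
    rewrite size_mul ?(monic_neq0 mon) //; move: spi c0; rewrite -size_poly_gt0.
    by case: (size c) => [|[|m]] //; case: (size pi) => [|[|l]] //= _ _; rewrite !addnS !addSn.
  have [u u0 eu] : exists2 u, u != 0 & c = u%:P by apply/size_poly1P; rewrite sc.
  have := congr1 lead_coef ec; rewrite lead_coefX eu lead_coefM lead_coefC (eqP mon) mulr1 => u1.
  by rewrite ec eu -u1 mul1r.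
rewrite epi in mon pi1 dvd; have dP := finite_discrete ti fi (Oi _ nP) mon pi1 dvd.
have [fP eP] := finite_place_degree ti fi (Oi _ nP) mon pi1 dvd.
split=> //; last first.
- by move=> Q nQ; apply: (place_unique ti fi (Oi _ nP) mon pi1 dvd (Oi _ nQ)); apply: Ii.
- by rewrite eP size_polyX.
- have := val_parameter ti fi (Oi _ nP) mon pi1 dvd; rewrite evX_ valV // => /eqP.
  by rewrite eqr_oppLR => /eqP.
Qed.

Lemma rational_disc P : discrete P /\ finite_degree P.
Proof.
have [Ox|nx] := boolP (place_ring P x); last by have [] := infinite_place nx.
have [pi [mon pi1 dvd]] := place_poly tx fx Ox.
split; first exact: (finite_discrete tx fx Ox mon pi1 dvd).
by have [] := finite_place_degree tx fx Ox mon pi1 dvd.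
Qed.

Lemma linear_place P (c : k) : 0 < valuation P (x - iota c) ->
  [/\ valuation P (x - iota c) = 1, place_degree P = 1%N &
   forall Q, 0 < valuation Q (x - iota c) -> Q = P].
Proof.
have xc0 : x - iota c != 0.
  by rewrite -(evX_ x) -(evC_ x) -evB ev_neq0 // polyXsubC_eq0.
have Ox Q : 0 < valuation Q (x - iota c) -> place_ring Q x.
  have [dQ _] := rational_disc Q.
  move=> v; rewrite -(subrK (iota c) x); apply: ringD; last exact: ringC.
  by rewrite (val_ring dQ) // ltW.
have Ic Q : 0 < valuation Q (x - iota c) -> place_ideal Q (ev iota x ('X - c%:P)).
  have [dQ _] := rational_disc Q.
  by move=> v; rewrite evB evX_ evC_ -vge_ideal //; right; move: v; case: (valuation _ _).
move=> vP; have [pi [mon pi1 dvd]] := place_poly tx fx (Ox _ vP).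
have epi : pi = 'X - c%:P.
  have d : pi %| 'X - c%:P by apply/dvd; apply: Ic.
  apply/eqP; rewrite -eqp_monic ?monicXsubC //.
  have spi : (1 < size pi)%N.
    rewrite ltnNge; apply/negP => h; have : pi %| 1 by rewrite dvdp1 eqn_leq h size_poly_gt0 (monic_neq0 mon).
    by rewrite pi1.
  rewrite -(dvdp_size_eqp d) size_XsubC eqn_leq spi andbT -(size_XsubC c).
  by rewrite dvdp_leq // polyXsubC_eq0.
rewrite epi in mon pi1 dvd; split.
- by have := val_parameter tx fx (Ox _ vP) mon pi1 dvd; rewrite evB evX_ evC_.
- by have [_ ->] := finite_place_degree tx fx (Ox _ vP) mon pi1 dvd; rewrite size_XsubC.
- by move=> Q vQ; apply: (place_unique tx fx (Ox _ vP) mon pi1 dvd (Ox _ vQ)); apply: Ic.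
Qed.


Lemma parameter_at P : place_ring P x -> exists t : {poly k},
  [/\ t != 0, valuation P (ev iota x t) = 1, (size t).-1 = place_degree P &
   forall Q, place_ring Q x -> Q != P -> valuation Q (ev iota x t) = 0].
Proof.
move=> Ox; have [pi [mon pi1 dvd]] := place_poly tx fx Ox.
have pi0 := monic_neq0 mon; exists pi; split=> //.
- exact: (val_parameter tx fx Ox mon pi1 dvd).
- by have [_ ->] := finite_place_degree tx fx Ox mon pi1 dvd.
- move=> Q OQ QP; have [dQ _] := rational_disc Q.
  apply/eqP; rewrite eq_le -(val_ring dQ) ?ev_neq0 // (place_ring_ev OQ) andbT.
  rewrite leNgt; apply/negP => v; case/eqP: QP.
  apply: (place_unique tx fx Ox mon pi1 dvd OQ); apply/(vge_ideal dQ); right.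
  by move: v; case: (valuation _ _).
Qed.

Lemma val_infinite P a : ~~ place_ring P x -> a != 0 ->
  valuation P (ev iota x a) = - (size a).-1%:Z.
Proof.
move=> nP a0; have [dP vx _ _ _] := infinite_place nP.
have lc : iota (lead_coef a) != 0 by rewrite fmorph_eq0 lead_coef_eq0.
have vl : valuation P (iota (lead_coef a) * x ^+ (size a).-1) = - (size a).-1%:Z.
  by rewrite valM ?expf_neq0 // valC // valX // vx add0r mulNrn natz.
rewrite (evE _ _ (leqSpred (size a))) big_ord_recr /= addrC -/(lead_coef a).
have x0' : iota (lead_coef a) * x ^+ (size a).-1 != 0 by rewrite mulf_neq0 ?expf_neq0.
suff hr : vge P (valuation P (iota (lead_coef a) * x ^+ (size a).-1) + 1)
    (\sum_(i < (size a).-1) iota a`_i * x ^+ i).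
  by have [_ ->] := val_addl dP x0' hr.
rewrite vl; apply: vge_sum => // i _; rewrite -[X in vge P X]add0r; apply: vgeM => //.
  exact: vgeC.
right; rewrite valX // vx mulNrn natz.
by have := ltn_ord i; move: (size a).-1 (nat_of_ord i); clear => m l; lia.
Qed.

Lemma ev_zeros a : a != 0 -> exists s, uniq s /\
  forall P, place_ring P x -> P \notin s -> valuation P (ev iota x a) = 0.
Proof.
elim: (size a) {-2}a (leqnn (size a)) => [|n IH] {}a.
  by rewrite leqn0 size_poly_eq0 => /eqP ->; rewrite eqxx.
move=> sa a0; have [[P [OP vP]]|nP] := pselect (exists P, place_ring P x /\ valuation P (ev iota x a) != 0);
    last first.
  by exists [::]; split=> // P OP _; apply/eqP; apply: contrapT => h; apply: nP; exists P; split=> //; apply/negP.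
have [pi [mon pi1 dvd]] := place_poly tx fx OP; have [dP _] := rational_disc P.
have pi0 := monic_neq0 mon.
have /dvdpP[c ec] : pi %| a.
  apply/dvd/(vge_ideal dP); right; move: (vP).
  have := place_ring_ev OP a; rewrite (val_ring dP) ?ev_neq0 //.
  by case: (valuation _ _) => [[|]|].
have c0 : c != 0 by apply: contraNneq a0 => c0; rewrite ec c0 mul0r.
have spi : (1 < size pi)%N.
  rewrite ltnNge; apply/negP => h; have : pi %| 1 by rewrite dvdp1 eqn_leq h size_poly_gt0 pi0.
  by rewrite pi1.
have [|s [us hs]] := IH c _ c0.
  move: sa; rewrite ec size_mul // => sa; rewrite -ltnS; apply: leq_trans sa.
  by move: spi; case: (size pi) => [|[|l]] // _; rewrite !addnS ltnS leq_addr.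
exists (undup (P :: s)); split; first exact: undup_uniq.
move=> Q OQ; rewrite mem_undup in_cons negb_or => /andP[QP Qs].
have [dQ _] := rational_disc Q.
rewrite ec ev_mul valM ?ev_neq0 // (hs _ OQ Qs) add0r.
apply/eqP; rewrite eq_le -(val_ring dQ) ?ev_neq0 // (place_ring_ev OQ) andbT.
rewrite leNgt; apply/negP => v; case/eqP: QP.
apply: (place_unique tx fx OP mon pi1 dvd OQ); apply/(vge_ideal dQ); right.
by move: v; case: (valuation _ _).
Qed.

Variables (Pinf : place iota) (nP : ~~ place_ring Pinf x).

Let finite_at P : P != Pinf -> place_ring P x.
Proof.
move=> ne; apply: contraT => nx; case/eqP: ne.
by have [_ _ _ _ h] := infinite_place nP; apply: h.
Qed.

Lemma rational_zeros f : exists s, uniq s /\ forall P, P \notin s -> valuation P f = 0.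
Proof.
have [->|f0] := eqVneq f 0.
  by exists [::]; split=> // P _; have [dP _] := rational_disc P; rewrite val0.
have [a [b [a0 b0 _ ef]]] := coprime_fractions tx fx f0.
have [s [us hs]] := ev_zeros a0; have [s' [us' hs']] := ev_zeros b0.
exists (undup (Pinf :: s ++ s')); split=> [|P]; first exact: undup_uniq.
rewrite mem_undup in_cons mem_cat negb_or => /andP[PP]; rewrite negb_or => /andP[Ps Ps'].
have [dP _] := rational_disc P.
have OP := finite_at PP.
by rewrite ef valF ?ev_neq0 // (hs _ OP Ps) (hs' _ OP Ps') subr0.
Qed.

Lemma Lf_polynomials (r : nat) f : Lf (single Pinf r%:Z) f -> exists2 a : {poly k}, (size a <= r.+1)%N & f = ev iota x a.
Proof.
move=> Lf; have [->|f0] := eqVneq f 0.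
  by exists 0; rewrite ?size_poly0 // /ev rmorph0 horner0.
have [a [b [a0 b0 cab ef]]] := coprime_fractions tx fx f0.
(* A nonconstant denominator vanishes somewhere: [b^-1] is not a polynomial in [x], so some place
   contains all polynomials in [x] and omits [b^-1]. *)
have sb : size b = 1%N.
  apply/eqP/negP => sb.
  have [|||P [OP nb]] := @exists_place k F iota [set z | exists p, z = ev iota x p] (ev iota x b)^-1.
  - split=> [c|_ _ [u ->] [w ->]|_ _ [u ->] [w ->]] /=.
    + by exists c%:P; rewrite evC_.
    + by exists (u - w); rewrite evB.
    + by exists (u * w); rewrite ev_mul.
  - by exists b; rewrite invrK.
  - move=> [c ec]; apply: sb; rewrite -dvdp1; apply/dvdpP; exists c.
    apply/eqP; rewrite -subr_eq0; apply/eqP/tx.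
    by rewrite evB ev_mul -ec mulVf ?ev_neq0 // -polyC1 evC_ rmorph1 subrr.
  have Ox : place_ring P x by apply: OP; exists 'X; rewrite evX_.
  have PP : P != Pinf by apply: contraNneq nP => <-.
  have [dP _] := rational_disc P.
  have vb : 0 < valuation P (ev iota x b).
    by move: nb; rewrite (val_ring dP) ?invr_eq0 ?ev_neq0 // valV ?ev_neq0 // oppr_ge0 -ltNge.
  have [pi [mon pi1 dvd]] := place_poly tx fx Ox.
  have : ~~ (pi %| b).
    rewrite -(finite_ring tx Ox pi1 dvd cab b0) -ef.
    by rewrite -[place_ring P f]/(f \in place_ring P) -vge0 //; have := Lf P; rewrite /single (negbTE PP) oppr0.
  case/negP; apply/dvd/(vge_ideal dP); right.
  by move: vb; case: (valuation _ _).
have [u u0 eu] : exists2 u, u != 0 & b = u%:P by apply/size_poly1P; rewrite sb.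
have ef' : f = ev iota x (u^-1 *: a) by rewrite evZ ef eu evC_ fmorphV mulrC.
exists (u^-1 *: a) => //.
have ne0 : ev iota x (u^-1 *: a) != 0 by rewrite -ef'.
have := Lf Pinf; rewrite ef' vge_val //.
rewrite val_infinite // ?scaler_eq0 ?invr_eq0 ?negb_or ?u0 // /single eqxx lerN2.
by rewrite lez_nat; move: (size _) => m; clear; lia.
Qed.

Lemma Lf_rational_qdim (r : nat) : qdim iota (Lf (single Pinf r%:Z)) [set 0] r.+1.
Proof.
have [dP vx _ _ _] := infinite_place nP.
have dA P : discrete P by have [] := rational_disc P.
apply/qdimP; first exact: subspace_Lf.
  exact: subspace_set0.
have evp (c : {ffun 'I_r.+1 -> k}) :
    \sum_i iota (c i) * x ^+ i = ev iota x (\sum_i c i *: 'X^i).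
  rewrite /ev rmorph_sum /= horner_sum; apply: eq_bigr => i _.
  by rewrite linearZ_LR /= map_polyXn hornerZ hornerXn.
exists (fun i : 'I_r.+1 => x ^+ i); split=> [i P|y Ly].
  have [->|PP] := eqVneq P Pinf.
    right; rewrite /single eqxx valX // vx mulNrn natz lerN2 lez_nat.
    by rewrite -ltnS.
  rewrite /single (negbTE PP) oppr0 vge0 //; apply: ringX; exact: finite_at.
have [a sa ea] := Lf_polynomials Ly.
exists [ffun i : 'I_r.+1 => a`_i]; split.
  rewrite /= (evE _ _ sa) in ea *; rewrite ea; apply/eqP; rewrite subr_eq0; apply/eqP.
  by apply: eq_bigr => i _; rewrite ffunE.
move=> c /= /eqP; rewrite subr_eq0 evp ea -subr_eq0 -evB => /eqP /tx /eqP.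
rewrite subr_eq0 => /eqP ->; apply/ffunP => i; rewrite ffunE coef_sum (bigD1 i) //=.
rewrite coefZ coefXn eqxx mulr1 big1 ?addr0 // => l li.
by rewrite coefZ coefXn eq_sym -[_ == _]/(l == i) (negbTE li) mulr0.
Qed.

(** Every divisor is equivalent to a multiple of [Pinf]: multiplication by a power of the parameter
    at [P] takes [P] out of the support and moves its share of the degree to [Pinf]. *)
Lemma rational_ineq s h : uniq s -> Pinf \notin s -> (forall P, P \notin Pinf :: s -> h P = 0) ->
  exists2 n, qdim iota (Lf h) [set 0] n & dg (Pinf :: s) h + 1 - n%:Z <= 0.
Proof.
have [dP vx _ degP _] := infinite_place nP.
have dA P : discrete P by have [] := rational_disc P.
elim: s h => [|P s IH] h us Ps hs.
  have eh : h = single Pinf (h Pinf).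
    by apply/funext => Q; rewrite /single; case: eqVneq => [->//|QP]; apply: hs; rewrite mem_seq1.
  have ed : dg [:: Pinf] h = h Pinf by rewrite /dg big_seq1 degP mulr1.
  rewrite ed; case eP : (h Pinf) => [r|r]; rewrite eh eP.
    by exists r.+1; [exact: Lf_rational_qdim | clear; lia].
  exists 0%N; last by rewrite NegzE; clear; lia.
  rewrite (_ : Lf _ = [set 0]); first by apply: qdim_refl; apply: subspace_set0.
  apply/seteqP; split=> f; last by move=> ->; apply: Lf0.
  move=> Lf'; have [a sa ea] : exists2 a : {poly k}, (size a <= 1)%N & f = ev iota x a.
    apply: (@Lf_polynomials 0); apply: Lf_sub Lf' => Q; rewrite /single.
    by case: ifP.
  have [//|f0] := eqVneq f 0.
  have a0 : a != 0 by apply: contraNneq f0 => a0; rewrite ea a0 /ev rmorph0 horner0.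
  have := Lf' Pinf; rewrite vge_val // ea val_infinite // /single eqxx NegzE.
  by move: (size a) sa; clear => m; lia.
move: us => /= /andP[nPs us]; move: Ps; rewrite in_cons negb_or => /andP[PiP Pis].
have PP : P != Pinf by rewrite eq_sym.
have [t [t0 vt st ot]] := parameter_at (finite_at PP).
have et0 : ev iota x t != 0 by exact: ev_neq0.
pose f := ev iota x t ^ h P.
have f0 : f != 0 by rewrite expfz_neq0.
have vf Q : valuation Q f = valuation Q (ev iota x t) * h P.
  rewrite /f; case: (h P) => n; rewrite ?NegzE -?exprnP -?exprnN ?valV ?expf_neq0 // valX // -mulr_natr natz //.
  by rewrite mulrN.
pose h' Q := h Q - valuation Q f.
have [Q|n qn dn] := IH h' us Pis.
  rewrite in_cons negb_or => /andP[QPi Qs]; rewrite /h' vf.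
  have [->|QP] := eqVneq Q P; first by rewrite vt mul1r subrr.
  rewrite (ot _ (finite_at QPi)) // mul0r subr0; apply: hs.
  by rewrite in_cons negb_or QPi /= in_cons negb_or QP.
exists n.
  have := Lf_mul dA f0 qn; congr (qdim _ (Lf _) _ _).
  by apply/funext => Q; rewrite /h' subrK.
apply: le_trans dn; rewrite lerD2r lerD2r.
rewrite /dg !big_cons /h' /= vf val_infinite // degP !mulr1 -st.
rewrite [X in _ <= _ + X](_ : _ = \sum_(Q <- s) h Q * (place_degree Q)%:Z).
  by rewrite mulNr opprK addrA [_%:Z * h P]mulrC.
apply: eq_big_seq => Q Qs; congr (_ * _); rewrite /h' vf ot ?mul0r ?subr0 //.
  by apply: finite_at; apply: contraNneq Pis => <-.
by apply: contraNneq nPs => <-.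
Qed.

Lemma rational_riemann : riemann Pinf 0.
Proof.
have [dP vx fP degP _] := infinite_place nP; split=> //.
- by move=> P; have [] := rational_disc P.
- by move=> P; have [] := rational_disc P.
- exact: rational_zeros.
- move=> s h us hs; pose s' := [seq P <- s | P != Pinf].
  have Pis : Pinf \notin s' by rewrite mem_filter eqxx.
  have hs' P : P \notin Pinf :: s' -> h P = 0.
    rewrite in_cons negb_or mem_filter => /andP[PP]; rewrite PP /=; exact: hs.
  have us' : uniq s' by rewrite filter_uniq.
  have [n qn dn] := rational_ineq us' Pis hs'.
  exists n => //; rewrite (dg_eq us (_ : uniq (Pinf :: s')) hs hs') //=.
  by rewrite Pis.
- by exists 0%N, 1%N; split=> //; exact: Lf_rational_qdim.
Qed.

End InfinitePlace.
End RationalFunctionField.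

(** * The recursive equation and its ramification *)

Section Chain.
Variables (k F : fieldType) (iota : {rmorphism k -> F}) (q : nat) (al : k).

Definition rel_eq (x y : F) : Prop :=
  y * (y + 1) ^+ q.-1 = x ^+ q / (iota al * (x + 1)) ^+ q.-1.

Definition chain (m : nat) (X : nat -> F) : Prop :=
  (forall i, (i <= m)%N -> X i != 0 /\ X i + 1 != 0) /\
  (forall i, (i < m)%N -> rel_eq (X i) (X i.+1)).

Hypotheses (q1 : (1 < q)%N) (al0 : al != 0).
Let n := q.-1%:Z.
Let n1 : 1 <= n. Proof. by rewrite /n; case: q q1 => [|[|]]. Qed.
Let qn : q%:Z = n + 1. Proof. by rewrite /n; case: q q1 => [|r _] //=; rewrite -addn1. Qed.

(* The two Artin-Schreier-like expressions of [W]: [x W^q + W = x/(al (x+1))] and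
   [W^q + y W = y/(al (y+1))] both follow from this one. *)
Lemma edge_power x y : x + 1 != 0 -> y + 1 != 0 -> rel_eq x y ->
  (x / (iota al * (x + 1) * (y + 1))) ^+ q = y / (iota al * (x + 1) * (y + 1)).
Proof.
move=> x1 y1 r; have ia : iota al != 0 by rewrite fmorph_eq0.
have u0 : iota al * (x + 1) != 0 by rewrite mulf_neq0.
rewrite expr_div_n exprMn; move: r; rewrite /rel_eq.
move: (iota al * (x + 1)) u0 => u u0; case: q q1 => [|r] //= _ e.
have -> : x ^+ r.+1 = y * (y + 1) ^+ r * u ^+ r by rewrite e divfK // expf_neq0.
rewrite !exprS; field; by rewrite !expf_neq0 // u0 y1.
Qed.

Variables (P : place iota) (dP : discrete P).
Local Notation v := (valuation P).

Lemma val_shift x : x != 0 -> x + 1 != 0 ->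
  [\/ v x < 0 /\ v (x + 1) = v x, 0 < v x /\ v (x + 1) = 0 | v x = 0 /\ 0 <= v (x + 1)].
Proof.
move=> x0 x1; have [h|h|h] := ltgtP (v x) 0.
- constructor 1; split=> //; have [|_ ->//] := val_addl dP x0 (_ : vge P (v x + 1) 1).
  by right; rewrite val1 //; move: h; case: (v x) => [[|?]|?] //= _; clear; lia.
- constructor 2; split=> //; have [|_ ] := val_addl dP (oner_neq0 F) (_ : vge P (v 1 + 1) x).
    by right; rewrite val1 // add0r; move: h; case: (v x) => [[|?]|?].
  by rewrite addrC val1.
- constructor 3; split=> //; rewrite -(val_ring dP x1); apply: ringD; last exact: ring1.
  by rewrite (val_ring dP x0) h.
Qed.

Lemma val_succ_gt0 x : x != 0 -> 0 < v (x + 1) -> v x = 0.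
Proof.
move=> x0 h; have x1 : x + 1 != 0 by apply/eqP => e; move: h; rewrite e val0.
by case: (val_shift x0 x1) => [] [? ?] //; exfalso; move: h; lia.
Qed.

(** The five outcomes compatible with [v y + (q-1) v (y+1) = q v x - (q-1) v (x+1)], given that each
    end is a pole, a zero or a unit. *)
Inductive edge_spec x y : Prop :=
  | EdgeInf of v x < 0 & v y < 0 & v x = q%:Z * v y
  | EdgeZero of 0 < v x & 0 < v y & v y = q%:Z * v x & v (y + 1) = 0
  | EdgeUp of 0 < v x & v y = 0 & 0 < v (y + 1) & n * v (y + 1) = q%:Z * v x
  | EdgeDown of v x = 0 & 0 < v (x + 1) & v y < 0 & q%:Z * v y = - (n * v (x + 1))
  | EdgeGeneric of v x = 0 & v (x + 1) = 0 & v y = 0 & v (y + 1) = 0.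

Lemma edge_cases x y : x != 0 -> x + 1 != 0 -> y != 0 -> y + 1 != 0 -> rel_eq x y ->
  edge_spec x y.
Proof.
move=> x0 x1 y0 y1 r; have ia : iota al != 0 by rewrite fmorph_eq0.
have u0 : iota al * (x + 1) != 0 by rewrite mulf_neq0.
have ev : v y + n * v (y + 1) = q%:Z * v x - n * v (x + 1).
  have := congr1 v r; rewrite valM ?expf_neq0 // valF ?expf_neq0 // !valX // valM // valC // add0r.
  by rewrite -(mulr_natl (v (y + 1))) -(mulr_natl (v x)) -(mulr_natl (v (x + 1))) !natz.
have sx := val_shift x0 x1; have sy := val_shift y0 y1.
move: ev; rewrite qn; have qn' := qn; move: n1 => N1.
case: sx => [] [a b]; case: sy => [] [a' b'] e.
- by constructor 1 => //; rewrite qn'; move: e; rewrite b b'; lia.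
- by exfalso; move: e; rewrite b b'; lia.
- exfalso; move: e; rewrite b a' => e.
  have : 0 <= n * v (y + 1) by rewrite mulr_ge0 //; apply: le_trans N1.
  by lia.
- exfalso; move: e; rewrite b b' => e.
  have : 0 < (n + 1) * v x by rewrite mulr_gt0 //; lia.
  have : (n + 1) * v y < 0 by rewrite pmulr_rlt0 //; lia.
  by lia.
- by constructor 2 => //; rewrite qn'; move: e; rewrite b b'; lia.
- move: e; rewrite b a' => e; have e' : n * v (y + 1) = (n + 1) * v x by lia.
  constructor 3 => //; last by rewrite qn' e'.
  rewrite lt_neqAle b' andbT; apply: contraTneq a => e0; rewrite -e0 mulr0 in e'.
  by rewrite -leNgt -(@pmulr_rle0 _ (n + 1)) -?e' //; lia.
- move: e; rewrite a b' => e; have e' : (n + 1) * v y = - (n * v (x + 1)) by lia.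
  constructor 4 => //; last by rewrite qn' e'.
  rewrite lt_neqAle b andbT; apply: contraTneq a' => e0; rewrite -e0 mulr0 oppr0 in e'.
  by rewrite -leNgt -(@pmulr_rge0 _ (n + 1)) ?e' //; lia.
- exfalso; move: e; rewrite a b' => e.
  have : 0 <= n * v (x + 1) by rewrite mulr_ge0 //; apply: le_trans N1.
  by lia.
- move: e; rewrite a a' => e.
  have h1 : 0 <= n * v (x + 1) by rewrite mulr_ge0 //; apply: le_trans N1.
  have h2 : 0 <= n * v (y + 1) by rewrite mulr_ge0 //; apply: le_trans N1.
  have n0 : n != 0 by lia.
  constructor 5 => //; apply: (mulfI n0); rewrite mulr0; move: h1 h2 e; rewrite mulr0 sub0r add0r;
    by move: (n * _) (n * _) => u w; clear; lia.
Qed.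

Variables (m : nat) (X : nat -> F) (cX : chain m X).

Lemma chain_edge i : (i < m)%N -> edge_spec (X i) (X i.+1).
Proof.
move=> im; have [h r] := cX; have [x0 x1] := h i (ltnW im); have [y0 y1] := h i.+1 im.
by apply: edge_cases => //; apply: r.
Qed.

Lemma peak_right p d : 0 < v (X p + 1) -> (p + d.+1 <= m)%N ->
  v (X (p + d.+1)%N) < 0 /\ (q ^ d.+1)%:Z * v (X (p + d.+1)%N) = - (n * v (X p + 1)).
Proof.
move=> pk; elim: d => [|d IH] h.
  have := chain_edge (_ : (p < m)%N); rewrite addn1 in h *; move=> /(_ h).
  have [x0 _] := cX.1 p (ltnW h); have e0 := val_succ_gt0 x0 pk.
  by case=> *; split=> //; rewrite ?expn1 //; exfalso; lia.
have [|n0 e] := IH; first by rewrite ltnW // -addnS.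
have := chain_edge (_ : (p + d.+1 < m)%N); rewrite -addnS => /(_ h).
case; rewrite ?addnS => ? ? *; try by (exfalso; move: n0; rewrite ?addnS; lia).
split=> //; rewrite -e expnSr PoszM -mulrA; congr (_ * _).
by rewrite addnS.
Qed.

Lemma peak_left p d : 0 < v (X p + 1) -> (p <= m)%N -> (d < p)%N ->
  0 < v (X (p - d.+1)%N) /\ (q ^ d.+1)%:Z * v (X (p - d.+1)%N) = n * v (X p + 1).
Proof.
move=> pk pm; elim: d => [|d IH] h.
  have := chain_edge (_ : (p - 1 < m)%N); rewrite subn1 prednK // => /(_ pm).
  have [x0 _] := cX.1 p pm; have e0 := val_succ_gt0 x0 pk.
  by case=> *; split=> //; rewrite ?expn1 //; exfalso; lia.
have [|n0 e] := IH; first exact: ltnW.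
have lm : (p - d.+2 < m)%N by apply: leq_trans pm; rewrite ltn_subrL (leq_trans _ h).
have := chain_edge lm; rewrite -subSn // subSS.
case=> ? ? *; try by (exfalso; lia).
by split=> //; rewrite -e expnSr PoszM -mulrA; congr (_ * _).
Qed.

Definition peak p := (p <= m)%N && (0 < v (X p + 1)).

(** Read from left to right, zeros can only be followed by zeros or by a value -1, a value -1 only
    by poles, and poles or generic values persist. So at most one index [p] is a peak. *)
Inductive chain_spec : Prop :=
  | ChainInf of (forall i, (i <= m)%N -> v (X i) < 0 /\ v (X i) = (q ^ (m - i))%:Z * v (X m))
  | ChainZero of (forall i, (i <= m)%N -> 0 < v (X i) /\ v (X i + 1) = 0)
  | ChainPeak p of peak p & (forall i, (i < p)%N -> 0 < v (X i) /\ v (X i + 1) = 0)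
      & (forall i, (p < i <= m)%N -> v (X i) < 0 /\ v (X i + 1) = v (X i))
  | ChainGeneric of (forall i, (i <= m)%N -> v (X i) = 0 /\ v (X i + 1) = 0).

End Chain.

Lemma chain_cases (k F : fieldType) (iota : {rmorphism k -> F}) (q : nat) (al : k)
    (q1 : (1 < q)%N) (al0 : al != 0) (P : place iota) (dP : discrete P) m X :
  chain iota q al m X -> chain_spec q P m X.
Proof.
elim: m => [|m IH] cX.
  have [x0 x1] := cX.1 0%N isT; case: (val_shift dP x0 x1) => [] [a b].
  - constructor 1 => i; rewrite leqn0 => /eqP ->; by rewrite expn0 mul1r.
  - by constructor 2 => i; rewrite leqn0 => /eqP ->.
  - have [b0|b0] := eqVneq (valuation P (X 0%N + 1)) 0.
      by constructor 4 => i; rewrite leqn0 => /eqP ->.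
    apply: (@ChainPeak _ _ _ _ _ _ _ 0%N) => //.
      by rewrite /peak leqnn lt_neqAle eq_sym b0.
    by move=> i /andP[h1 h2]; move: (leq_trans h1 h2).
have cm : chain iota q al m X.
  by split=> i h; [apply: cX.1; apply: leqW | apply: cX.2; apply: ltnW].
have sh i : (i <= m.+1)%N -> _ := fun h => val_shift dP (cX.1 i h).1 (cX.1 i h).2.
have e := chain_edge q1 al0 dP cX (ltnSn m).
have s := sh m.+1 (leqnn _).
have last_ i : (i <= m.+1)%N -> (i <= m)%N \/ i = m.+1.
  by rewrite leq_eqVlt => /orP[/eqP ->|h]; [right | left].
case: (IH cm) => [h|h|p pk h1 h2|h].
- have [a1 _] := h m (leqnn _); constructor 1 => i /last_ [im|->]; last first.
    by rewrite subnn mul1r; split=> //; case: e => *; lia.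
  have [ai ei] := h i im; split=> //; rewrite ei; case: e => *; try (exfalso; lia).
  by rewrite subSn // expnSr PoszM -mulrA; congr (_ * _).
- have [a1 b1] := h m (leqnn _); case: e => *; try (exfalso; lia).
    by constructor 2 => i /last_ [im|->] //; apply: h.
  apply: (@ChainPeak _ _ _ _ _ _ _ m.+1); first by rewrite /peak leqnn.
    by move=> i im; apply: h.
  by move=> i /andP[h1 h2]; move: (leq_trans h1 h2); rewrite ltnn.
- have pm : (p <= m)%N by case/andP: pk.
  have pp : 0 < valuation P (X p + 1) by case/andP: pk.
  have y0 : valuation P (X m.+1) < 0.
    have -> : m.+1 = (p + (m - p).+1)%N by rewrite addnS subnKC.
    by have [] := @peak_right _ _ _ _ _ q1 al0 _ dP _ _ cX p (m - p) pp; rewrite ?addnS ?subnKC.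
  apply: (@ChainPeak _ _ _ _ _ _ _ p) => //; first by rewrite /peak pp (leqW pm).
  move=> i /andP[pi /last_ [im|->]]; first by apply: h2; rewrite pi.
  split=> //; case: s => [[]//|[s1 _]|[s1 _]]; last by move: y0; rewrite s1 ltxx.
  by have := lt_trans s1 y0; rewrite ltxx.
- have [a1 b1] := h m (leqnn _); case: e => *; try (exfalso; lia).
  by constructor 4 => i /last_ [im|->] //; apply: h.
Qed.

(** * The mirror symmetry around a peak *)

Section LocalBounds.
Variables (k F : fieldType) (iota : {rmorphism k -> F}) (q : nat) (al : k).
Hypotheses (q1 : (1 < q)%N) (al0 : al != 0).
Hypothesis frob : forall a b : F, (a + b) ^+ q = a ^+ q + b ^+ q.
Variables (P : place iota) (dP : discrete P).
Local Notation v := (valuation P).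
Let ia : iota al != 0. Proof. by rewrite fmorph_eq0. Qed.

Definition witt (x y : F) := x / (iota al * (x + 1) * (y + 1)).

Lemma small_ring z : z != 0 -> 0 < v z -> place_ring P z /\ place_unit P (z + 1).
Proof.
move=> z0 vz; split; first by rewrite (val_ring dP) // ltW.
have [|h0 e] := val_addl dP (oner_neq0 F) (_ : vge P (v 1 + 1) z).
  by right; rewrite val1 // add0r; move: vz; case: (v z) => [[|?]|?].
by rewrite addrC; apply: unit_val => //; rewrite e val1.
Qed.

Lemma vge_ringM n f g : vge P n f -> place_ring P g -> vge P n (f * g).
Proof. by move=> hf hg; rewrite -[n]addr0; apply: vgeM => //; apply/(vge0 dP). Qed.

Lemma vge_unitM n f u : place_unit P u -> vge P n (f * u) -> vge P n f.
Proof.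
by move=> [u0 _ Ou] /vge_ringM => /(_ _ Ou); rewrite mulfK.
Qed.

Lemma al_unit : place_unit P (iota al).
Proof. exact: unitC. Qed.

(** The function [T = witt a1 a] satisfies [T^q + a T = a / (al (a + 1))], and for [a = 1/x] this is
    exactly the equation to be solved by [witt x y]. The error of [T] as a root is therefore
    [a - x^-1] times an integral factor. *)
Lemma mirror_delta (n : int) x a a1 : x != 0 -> x + 1 != 0 -> a != 0 -> a1 != 0 -> rel_eq iota q al a1 a ->
  0 < v x^-1 -> 0 < v a -> 0 < v a1 -> vge P n (a - x^-1) ->
  vge P n ((iota al * (x + 1))^-1 - witt a1 a / x - witt a1 a ^+ q).
Proof.
move=> x0 x10 a0 a10 r vx va va1 h.
have xi0 : x^-1 != 0 by rewrite invr_eq0.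
have [Oa ua] := small_ring a0 va; have [Oa1 ua1] := small_ring a10 va1.
have [Ox ux] := small_ring xi0 vx.
have [/eqP/eqP ua0 _ _] := ua; have [ua10 _ _] := ua1; have [ux0 _ _] := ux.
have ua0' : a + 1 != 0 by case: ua.
rewrite (edge_power q1 al0 ua10 ua0' r).
have -> : (iota al * (x + 1))^-1 - witt a1 a / x - a / (iota al * (a1 + 1) * (a + 1)) =
    (a - x^-1) * (witt a1 a - (iota al * (a + 1) * (x^-1 + 1))^-1).
  rewrite /witt.
  have -> : x^-1 + 1 = (x + 1) / x by rewrite mulrDl mulfV // mul1r addrC.
  field; by rewrite x10 ua0' x0 ua10 ia.
apply: vge_ringM => //; apply: ringB.
  apply: ringM => //; have [] // : place_unit P (iota al * (a1 + 1) * (a + 1)).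
  by apply: unitM => //; apply: unitM => //; apply: al_unit.
have [] // : place_unit P (iota al * (a + 1) * (x^-1 + 1)).
by apply: unitM => //; apply: unitM => //; apply: al_unit.
Qed.

(** At the peak the edge before it ends in [x] itself, which is near -1, and the equations for the
    two sides correspond under a change of sign. With [T = - witt a1 x] the denominators [x + 1]
    cancel and an integral error remains. *)
Lemma mirror_delta0 x a1 : x != 0 -> x + 1 != 0 -> a1 != 0 -> rel_eq iota q al a1 x ->
  v x = 0 -> 0 < v a1 ->
  vge P 0 ((iota al * (x + 1))^-1 - (- witt a1 x) / x - (- witt a1 x) ^+ q).
Proof.
move=> x0 x10 a10 r vx va1.
have fN (a : F) : (- a) ^+ q = - a ^+ q.
  apply/eqP; rewrite -addr_eq0 -frob addNr expr0n; by case: q q1.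
have [Oa1 ua1] := small_ring a10 va1; have [ua10 _ _] := ua1.
rewrite fN opprK (edge_power q1 al0 ua10 x10 r).
have -> : (iota al * (x + 1))^-1 - - witt a1 x / x + x / (iota al * (a1 + 1) * (x + 1)) =
   (a1 + x) / (iota al * (a1 + 1) * x).
  rewrite /witt; field; by rewrite x0 x10 ua10 ia.
have ux : place_unit P x by apply: unit_val.
apply/(vge0 dP); apply: ringM; first by apply: ringD => //; case: ux.
have [] // : place_unit P (iota al * (a1 + 1) * x).
by apply: unitM => //; apply: unitM => //; apply: al_unit.
Qed.

(** Given the inner end of an edge, the function [witt] determines the outer end; when the inner
    ends satisfy [a = 1/x], the two outer ends are related by the same inversion. *)
Lemma mirror_next (n : int) x a a1 y : x != 0 -> x + 1 != 0 -> a != 0 -> a1 != 0 -> y != 0 -> y + 1 != 0 ->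
  0 < v x^-1 -> 0 < v a -> 0 < v a1 -> 0 < v y^-1 -> vge P n (a - x^-1) ->
  vge P n (witt x y - witt a1 a) -> vge P n (a1 - y^-1).
Proof.
move=> x0 x10 a0 a10 y0 y10 vx va va1 vy h hW.
have xi0 : x^-1 != 0 by rewrite invr_eq0.
have yi0 : y^-1 != 0 by rewrite invr_eq0.
have [Oa ua] := small_ring a0 va; have [Oa1 ua1] := small_ring a10 va1.
have [Ox ux] := small_ring xi0 vx; have [Oy uy] := small_ring yi0 vy.
have [ua0 Oua _] := ua; have [ua10 Oua1 _] := ua1; have [ux0 Oux _] := ux; have [uy0 Ouy _] := uy.
apply: (vge_unitM ux).
have -> : (a1 - y^-1) * (x^-1 + 1) = (a - x^-1) * (y^-1 * (1 + a1)) -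
   (witt x y - witt a1 a) * (iota al * (x^-1 + 1) * (y^-1 + 1) * (a1 + 1) * (a + 1)).
  rewrite /witt.
  have -> : x^-1 + 1 = (x + 1) / x by rewrite mulrDl mulfV // mul1r addrC.
  have -> : y^-1 + 1 = (y + 1) / y by rewrite mulrDl mulfV // mul1r addrC.
  field; by rewrite x0 x10 y0 y10 ua0 ua10 ia.
apply: (vgeB dP); apply: vge_ringM => //.
  by apply: ringM => //; rewrite addrC.
by do !apply: ringM => //; apply: ringC.
Qed.

(** Both [witt] terms have the denominator [x + 1], so the mere integrality of their sum already
    determines the outer ends to the order of [x + 1]. This is where the high precision of the
    mirror originates. *)
Lemma mirror_next0 x a1 y : x + 1 != 0 -> a1 != 0 -> y != 0 -> y + 1 != 0 ->
  0 < v a1 -> 0 < v y^-1 -> place_ring P (witt x y + witt a1 x) -> vge P (v (x + 1)) (a1 - y^-1).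
Proof.
move=> x10 a10 y0 y10 va1 vy OW.
have yi0 : y^-1 != 0 by rewrite invr_eq0.
have [Oa1 ua1] := small_ring a10 va1; have [Oy uy] := small_ring yi0 vy.
have [ua10 Oua1 _] := ua1; have [uy0 Ouy Ouyi] := uy.
have -> : a1 - y^-1 = (x + 1) * ((iota al * (witt x y + witt a1 x) - y^-1 / (y^-1 + 1)) *
   ((a1 + 1) * (y^-1 + 1))).
  rewrite /witt.
  have -> : y^-1 + 1 = (y + 1) / y by rewrite mulrDl mulfV // mul1r addrC.
  field; by rewrite x10 y0 y10 ua10 ia.
apply: vge_ringM; first by right.
by do ?[apply: ringM => // | apply: ringB => //]; apply: ringC.
Qed.
End LocalBounds.

(** * Local extensions in one step of the tower *)

Section PeakStep.
Variables (k F F' : fieldType) (iota : {rmorphism k -> F}) (iota' : {rmorphism k -> F'})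
  (j : {rmorphism F -> F'}).
Hypothesis jc : forall c, j (iota c) = iota' c.
Variables (q : nat) (al : k).
Hypotheses (q1 : (1 < q)%N) (al0 : al != 0).
Hypothesis frob : forall a b : F', (a + b) ^+ q = a ^+ q + b ^+ q.
Variables (x : F) (Y : F').
Hypotheses (x0 : x != 0) (x10 : x + 1 != 0) (Y0 : Y != 0) (Y10 : Y + 1 != 0).
Let f := x ^+ q / (iota al * (x + 1)) ^+ q.-1.
Hypothesis rY : Y * (Y + 1) ^+ q.-1 = j f.
Local Notation Z := (Y + 1)^-1.
Hypothesis gZ : generator j q Z.
Let ia : iota al != 0. Proof. by rewrite fmorph_eq0. Qed.
Let u0 : iota al * (x + 1) != 0. Proof. by rewrite mulf_neq0. Qed.
Let f0 : f != 0. Proof. by rewrite mulf_neq0 ?invr_eq0 ?expf_neq0. Qed.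
Let cz := x / (iota al * (x + 1)).
Let cz0 : cz != 0. Proof. by rewrite mulf_neq0 ?invr_eq0. Qed.

Lemma Z_equation : j f * Z ^+ q + Z = 1.
Proof.
rewrite -rY; case: q q1 => [|r] //= _; rewrite exprVn exprS invfM.
have h : (Y + 1) ^+ r != 0 by rewrite expf_neq0.
by move: ((Y + 1) ^+ r) h => w h; field; rewrite Y10 h.
Qed.

Let W := j cz * Z.

Lemma W_power : W ^+ q = j (iota al * (x + 1))^-1 - W / j x.
Proof.
have e := Z_equation; have jx0 : j x != 0 by rewrite fmorph_eq0.
have ju0 : j (iota al * (x + 1)) != 0 by rewrite fmorph_eq0.
have -> : W ^+ q = j f * Z ^+ q / j (iota al * (x + 1)).
  rewrite /W exprMn -rmorphXn /= mulrAC -fmorphV -rmorphM; congr (j _ * _).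
  rewrite /cz /f expr_div_n -mulrA -invfM; congr (_ / _).
  by case: q q1 => [|r] //= _; rewrite exprSr.
have -> : j f * Z ^+ q = 1 - Z by apply/eqP; rewrite eq_sym subr_eq e.
rewrite /W /cz; move: (iota al * (x + 1)) ju0 => u ju0; rewrite rmorphM /= !fmorphV.
field; by rewrite Y10 jx0 ju0.
Qed.

Lemma W_witt : W = witt iota' al (j x) Y.
Proof. by rewrite /W /witt /cz rmorphM fmorphV rmorphM rmorphD rmorph1 jc /= -mulrA -invfM. Qed.

(** The substitution [W = T + eps y] preserves the additive shape of [W^q + W/x = 1/(al (x+1))]. The
    approximate root [T] reduces the constant term, and [eps] is to be chosen so that the new linear
    coefficient [1/(x eps^(q-1))] is a unit. *)
Lemma pole_form eps T : eps != 0 ->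
  (j (cz / eps) * (Z - j (T / cz))) ^+ q =
  j (((iota al * (x + 1))^-1 - T / x - T ^+ q) / eps ^+ q) -
  j (x * eps ^+ q.-1)^-1 * (j (cz / eps) * (Z - j (T / cz))).
Proof.
move=> e0; have je0 : j eps != 0 by rewrite fmorph_eq0.
have jcz0 : j cz != 0 by rewrite fmorph_eq0.
have jx0 : j x != 0 by rewrite fmorph_eq0.
have -> : j (cz / eps) * (Z - j (T / cz)) = (W - j T) / j eps.
  rewrite /W [j (cz / _)]rmorphM [j (T / _)]rmorphM !fmorphV /=; move: (j cz) jcz0 => c c0.
  field; by rewrite Y10 je0 c0.
have fB (a b : F') : (a - b) ^+ q = a ^+ q - b ^+ q.
  by apply/eqP; rewrite eq_sym subr_eq -frob subrK.
rewrite expr_div_n fB W_power !(rmorphM, rmorphB, fmorphV, rmorphXn) /=.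
move: (j (iota al) * j (x + 1)) => u.
have h : j eps ^+ q.-1 != 0 by rewrite expf_neq0.
have -> : j eps ^+ q = j eps * j eps ^+ q.-1 by case: q q1 => [|r] //= _; rewrite exprS.
move: (j eps ^+ q.-1) (j T ^+ q) h => er tq h.
by move: (u^-1) => ui; field; rewrite je0 jx0 h.
Qed.

Variables (P' : place iota) (dP' : discrete P') (fP' : finite_degree P')
  (dP : forall P : place iota', discrete P).
Local Notation v := (valuation P').
Let n := q.-1%:Z.
Let qn : q%:Z = n + 1. Proof. by rewrite /n; case: q q1 => [|r _] //=; rewrite -addn1. Qed.

Lemma val_rhs : v f = q%:Z * v x - n * v (x + 1).
Proof.
rewrite /f valF ?expf_neq0 // !valX // valM // valC // add0r.
by rewrite -(mulr_natl (v (x + 1))) -(mulr_natl (v x)) !natz.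
Qed.

(** Since [f = cz^(q-1) x] and [x] has the valuation of [eps^(1-q)], the choice of [eps] drops out.
    The slope is [v f / (q - 1)] at every such place, so slopes can be summed through the divisor of
    [f]. *)
Lemma val_eta eps : eps != 0 -> v x = - (n * v eps) -> n * v (cz / eps) = v f.
Proof.
move=> e0 h; rewrite val_rhs valF // /cz valF // valM // valC // add0r qn.
have -> : (n + 1) * v x = n * v x - n * v eps by rewrite mulrDl mul1r {2}h.
by rewrite !mulrBr; move: (n * v x) (n * v (x + 1)) (n * v eps) => a b c; clear; lia.
Qed.

Let val_c eps : eps != 0 -> v x = - (n * v eps) -> place_unit P' (x * eps ^+ q.-1)^-1.
Proof.
move=> e0 h; apply: unitV; apply: unit_val => //; first by rewrite mulf_neq0 ?expf_neq0.
rewrite valM ?expf_neq0 // valX // h -(mulr_natl (v eps)) natz; exact: addNr.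
Qed.

Lemma peak_unram eps T : eps != 0 -> v x = - (n * v eps) ->
  vge P' (q%:Z * v eps) ((iota al * (x + 1))^-1 - T / x - T ^+ q) ->
  exists e, [/\ n * e = v f, top_values iota' j q Z P' (fun i => i%:Z * e) &
    forall P : place iota', over j P P' -> ram j P P' = 1%N /\ vge (iota := iota') P (v eps) (witt iota' al (j x) Y - j T)].
Proof.
move=> e0 h d0; have eq := pole_form T e0.
have eta0 : cz / eps != 0 by rewrite mulf_neq0 ?invr_eq0.
have Od : place_ring P' (((iota al * (x + 1))^-1 - T / x - T ^+ q) / eps ^+ q).
  apply/(vge0 dP'); have := d0; have ei : (eps ^+ q)^-1 != 0 by rewrite invr_eq0 expf_neq0.
  move/(vge_shift dP' _ _ ei (erefl _)); rewrite valV ?expf_neq0 // valX //.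
  by rewrite -(mulr_natl (v eps)) natz subrr.
have [tv rm] := unram_type jc q1 dP' fP' dP gZ frob eta0 (val_c e0 h) Od eq.
exists (v (cz / eps)); split=> // [|P PP]; first exact: val_eta.
have dep := ev_dep gZ.1.
have [_ rv] := ramP dep PP dP'.
split; first exact: rm.
have Oy := unram_integral q1 dP (val_c e0 h) Od eq PP.
have je0 : j eps != 0 by rewrite fmorph_eq0.
have jcz0 : j cz != 0 by rewrite fmorph_eq0.
have -> : witt iota' al (j x) Y - j T = j (cz / eps) * (Z - j (T / cz)) * j eps.
  rewrite -W_witt /W [j (cz / _)]rmorphM [j (T / _)]rmorphM !fmorphV /=; move: (j cz) jcz0 => c c0.
  field; by rewrite Y10 je0 c0.
rewrite mulrC; apply: vge_ringM => //; right; rewrite rv rm //.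
by rewrite mulr1.
Qed.

Lemma peak_wild eps : eps != 0 -> v x = - (n * v eps) -> v (x + 1) = 1 - q%:Z * v eps ->
  exists e, [/\ n * e = v f, top_values iota' j q Z P' (fun i => (0 < i)%N%:Z + i%:Z * e) &
    forall P : place iota', over j P P' -> ram j P P' = q].
Proof.
move=> e0 h h1; have eq := pole_form 0 e0.
have eta0 : cz / eps != 0 by rewrite mulf_neq0 ?invr_eq0.
have q0 : (q == 0%N) = false by case: q q1.
have vd : v (((iota al * (x + 1))^-1 - 0 / x - 0 ^+ q) / eps ^+ q) = -1.
  rewrite mul0r expr0n q0 !subr0 valF ?invr_eq0 ?expf_neq0 // valV // valM // valC // add0r.
  rewrite h1 valX // -(mulr_natl (v eps)) natz; move: (_ * _) => a; clear; lia.
have [_ Oc _] := val_c e0 h.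
have [tv [P1 [_ un rm _]]] := wild_type jc q1 dP' fP' dP gZ eta0 Oc vd eq.
exists (v (cz / eps)); split=> // [|P PP]; first exact: val_eta.
by rewrite (un _ PP).
Qed.

(** Here [f] is a unit, and [f Z^q + Z = 1] divided by [f] already has the unramified shape with [Z]
    itself as integral generator. *)
Lemma generic_unram : v x = 0 -> v (x + 1) = 0 ->
  [/\ v f = 0, top_values iota' j q Z P' (fun i => 0), integral_at iota' j P' Z &
    forall P : place iota', over j P P' -> ram j P P' = 1%N].
Proof.
move=> h h1; have vf : v f = 0 by rewrite val_rhs h h1 !mulr0.
have uf : place_unit P' f^-1 by apply: unitV; apply: unit_val.
have jf0 : j f != 0 by rewrite fmorph_eq0.
have eq : (j 1 * (Z - j 0)) ^+ q = j f^-1 - j f^-1 * (j 1 * (Z - j 0)).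
  rewrite rmorph1 rmorph0 mul1r subr0 fmorphV; apply: (mulfI jf0).
  by rewrite mulrBr mulfV // mulVKf //; apply/eqP; rewrite eq_sym subr_eq Z_equation.
have [_ Of _] := uf.
have [tv rm] := unram_type jc q1 dP' fP' dP gZ frob (oner_neq0 F) uf Of eq.
split=> //.
  by move: tv; rewrite val1 //; congr (top_values _ _ _ _ _ _); apply/funext => i; rewrite mulr0.
move=> P PP; have := unram_integral q1 dP uf Of eq PP.
by rewrite rmorph1 rmorph0 mul1r subr0.
Qed.
End PeakStep.

(* [lv_mirror] expresses that [x_(p-j)] and [1/x_(p+j)] agree to high order at a place
   where [x_p = -1]. *)
Record level (k F : fieldType) (iota : {rmorphism k -> F}) (q : nat) (al : k) (m : nat)
    (X : nat -> F) (g : nat) (Pinf Q : place iota) : Prop := Level {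
  lv_chain : chain iota q al m X;
  lv_riemann : riemann Pinf g;
  lv_inf : valuation Pinf (X m) = -1;
  lv_inf0 : forall P : place iota, valuation P (X 0%N) < 0 <-> P = Pinf;
  lv_Q : valuation Q (X m) = (q ^ m)%:Z;
  lv_Qdeg : place_degree Q = 1%N;
  lv_Qu : forall P : place iota, 0 < valuation P (X m) -> P = Q;
  lv_peak : forall (P : place iota) p, (p <= m)%N -> 0 < valuation P (X p + 1) ->
    valuation P (X p + 1) = (q ^ maxn p (m - p))%:Z;
  lv_mirror : forall (P : place iota) p d, (0 < d <= p)%N -> m = (p + d)%N -> 0 < valuation P (X p + 1) ->
    vge P (q ^ (p - d).+1)%:Z (X (p - d)%N - (X m)^-1)
}.

Section LevelDegrees.
Variables (k F : fieldType) (iota : {rmorphism k -> F}) (q : nat) (al : k) (m : nat)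
  (X : nat -> F) (g : nat) (Pinf Q : place iota).
Hypotheses (q1 : (1 < q)%N) (al0 : al != 0) (lv : level q al m X g Pinf Q).
Let rg := lv_riemann lv.
Let dP := riemann_disc rg.
Let cX := lv_chain lv.
Let n := q.-1%:Z.
Let q0 : (0 < q)%N. Proof. exact: ltnW. Qed.
Let qn : q%:Z = n + 1. Proof. by rewrite /n; case: q q1 => [|r _] //=; rewrite -addn1. Qed.
Let qX0 i : (q ^ i)%:Z != 0 :> int. Proof. by rewrite eqz_nat expn_eq0; case: q q1. Qed.

Lemma level_cases (P : place iota) : chain_spec q P m X.
Proof. exact: (chain_cases q1 al0 (dP P) cX). Qed.

Lemma inf_values i : (i <= m)%N -> valuation Pinf (X i) = - (q ^ (m - i))%:Z /\
  valuation Pinf (X i + 1) = - (q ^ (m - i))%:Z.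
Proof.
move=> im; have n0 : valuation Pinf (X 0%N) < 0 by apply/(lv_inf0 lv).
have [x0 x1] := cX.1 i im.
have e : valuation Pinf (X i) = - (q ^ (m - i))%:Z.
  case: (level_cases Pinf) => [h|h|p /andP[pm pp] h _|h].
  - by have [_ ->] := h i im; rewrite (lv_inf lv) mulrN1.
  - by exfalso; have [] := h 0%N isT; move: n0; lia.
  - exfalso; case: p pm pp h => [|p] pm pp h.
      by move: n0; rewrite (val_succ_gt0 q1 al0 (dP Pinf) (cX.1 0%N isT).1 pp) ltxx.
    by have [] := h 0%N isT; move: n0; lia.
  - by exfalso; have [] := h 0%N isT; move: n0; lia.
split=> //; have neg : valuation Pinf (X i) < 0.
  by rewrite e oppr_lt0 ltz_nat expn_gt0 q0.
by case: (val_shift (dP Pinf) x0 x1) => [] [a b]; rewrite ?b //; exfalso; move: neg a; lia.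
Qed.

Lemma not_inf (P : place iota) : P != Pinf -> 0 <= valuation P (X 0%N).
Proof. by move=> PP; rewrite leNgt; apply: contra PP => /(lv_inf0 lv) ->. Qed.

Lemma zeros_list (fs : seq F) : exists s, [/\ uniq s, Pinf \notin s &
  forall P, P \notin s -> P != Pinf -> forall f, f \in fs -> valuation P f = 0].
Proof.
elim: fs => [|f fs [s [us Ps hs]]]; first by exists [::].
have [s' [us' hs']] := riemann_fin rg f.
exists (undup (s ++ [seq P <- s' | P != Pinf])); split; first exact: undup_uniq.
  by rewrite mem_undup mem_cat negb_or Ps mem_filter eqxx.
move=> P; rewrite mem_undup mem_cat negb_or mem_filter => /andP[nPs nPs'] PP h.
rewrite in_cons => /orP[/eqP ->|hf]; last exact: hs.
by apply: hs'; move: nPs'; rewrite PP.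
Qed.

Lemma chain_support : exists s, [/\ uniq s, Pinf \notin s & forall P, P \notin s -> P != Pinf ->
  forall i, (i <= m)%N -> valuation P (X i) = 0 /\ valuation P (X i + 1) = 0].
Proof.
have [s [us Ps hs]] := zeros_list
  (map X (index_iota 0 m.+1) ++ map (fun i => X i + 1) (index_iota 0 m.+1)).
exists s; split=> // P h PP i im.
have ii : i \in index_iota 0 m.+1 by rewrite mem_index_iota.
split; apply: (hs _ h PP); rewrite mem_cat.
  by rewrite map_f.
by apply/orP; right; apply/mapP; exists i.
Qed.

Variables (s : seq (place iota)) (us : uniq s) (Ps : Pinf \notin s)
  (hs : forall P, P \notin s -> P != Pinf ->
    forall i, (i <= m)%N -> valuation P (X i) = 0 /\ valuation P (X i + 1) = 0).

Definition peak_deg p : nat := (\sum_(P <- s) (0 < valuation P (X p + 1))%R * place_degree P)%N.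

Lemma peak_later (P : place iota) p i : (p < i <= m)%N -> 0 < valuation P (X p + 1) ->
  valuation P (X i + 1) = - (n * (q ^ (maxn p (m - p) - (i - p)))%:Z).
Proof.
move=> /andP[pi im] pp.
have ei : i = (p + (i - p).-1.+1)%N by rewrite prednK ?subn_gt0 // subnKC // ltnW.
have [x0 x1] := cX.1 i im.
have [|neg e] := @peak_right _ _ _ _ _ q1 al0 _ (dP P) _ _ cX p (i - p).-1 pp; rewrite -?ei //.
rewrite -ei in neg e; rewrite prednK ?subn_gt0 // in e.
have -> : valuation P (X i + 1) = valuation P (X i).
  by case: (val_shift (dP P) x0 x1) => [] [a b] //; exfalso; move: neg a; lia.
apply: (mulfI (qX0 (i - p))); rewrite e (lv_peak lv) //; last by rewrite ltnW // (leq_trans pi).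
rewrite mulrN; congr (- _); rewrite mulrCA -[in RHS]PoszM -expnD subnKC //.
by apply: leq_trans (leq_maxr _ _); apply: leq_sub2r.
Qed.

(** The valuation of [X p + 1] at a place whose peak is at [r <= p]: a zero if [r = p], otherwise
    the pole computed by [peak_later]. *)
Let co (p r : nat) : int := if r == p then (q ^ maxn p (m - p))%:Z else - (n * (q ^ (maxn r (m - r) - (p - r)))%:Z).

Let val_peaks (P : place iota) p : P != Pinf -> (p <= m)%N ->
  valuation P (X p + 1) = \sum_(r < p.+1) ((0 < valuation P (X r + 1))%R)%:R * co p r.
Proof.
move=> PP pm; have zero : (forall r, (r <= p)%N -> valuation P (X r + 1) = 0) ->
    valuation P (X p + 1) = \sum_(r < p.+1) ((0 < valuation P (X r + 1))%R)%:R * co p r.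
  move=> h; rewrite h // big1 // => r _; rewrite h ?ltxx ?mul0r //.
  by rewrite -ltnS.
case: (level_cases P) => [h|h|r0 /andP[rm rp] h1 h2|h].
- by exfalso; have := not_inf PP; have [] := h 0%N isT; lia.
- by apply: zero => r rp; have [] := h r (leq_trans rp pm).
- have [lt|ge] := ltnP p r0.
    by apply: zero => r rp'; have [] := h1 r (leq_ltn_trans rp' lt).
  rewrite (bigD1 (Ordinal (ge : (r0 < p.+1)%N))) //= rp mul1r big1 ?addr0 => [|r rr].
    rewrite /co; case: eqP => [e|/eqP ne]; first by rewrite (lv_peak lv) // -e.
    by apply: peak_later => //; rewrite ltn_neqAle ne ge.
  have {}rr : nat_of_ord r != r0 by [].
  suff -> : (0 < valuation P (X r + 1)) = false by rewrite mul0r.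
  have [lt|ge'] := ltnP r r0; first by have [_ ->] := h1 r lt; rewrite ltxx.
  have [|a ->] := h2 r; first by rewrite ltn_neqAle eq_sym rr ge' (leq_trans _ pm) // -ltnS.
  by apply/negbTE; rewrite -leNgt ltW.
- by apply: zero => r rp; have [] := h r (leq_trans rp pm).
Qed.

Lemma Posz_sum (I : Type) (r : seq I) (h : I -> nat) :
  (\sum_(i <- r) h i)%N%:Z = \sum_(i <- r) (h i)%:Z.
Proof. exact: (big_morph Posz PoszD (erefl 0)). Qed.

Lemma geometric p : (q ^ p)%:Z = 1 + n * \sum_(r < p) (q ^ r)%:Z.
Proof.
elim: p => [|p IH]; first by rewrite big_ord0 mulr0 addr0.
by rewrite big_ord_recr /= mulrDr addrA -IH expnS PoszM qn mulrDl mul1r addrC.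
Qed.

(** The divisor of [X p + 1] has degree 0. Its poles are [Pinf], of order [q^(m-p)], and the places
    with a peak [r < p], whose degrees are known by induction; these contribute [(q-1) q^(m-p+r)]
    each [r], a geometric sum. In other words [peak_deg p] is [q^(min p (m - p))]. *)
Lemma peak_degE p : (p <= m)%N -> (peak_deg p * q ^ maxn p (m - p) = q ^ m)%N.
Proof.
elim/ltn_ind: p => p IH pm.
have [x0 x1] := cX.1 p pm.
have := dg_val0 rg (s := Pinf :: s) x1; rewrite /= Ps us /= => /(_ isT).
rewrite /dg big_cons (riemann_inf rg) mulr1 (inf_values pm).2 => h.
have {}h : \sum_(P <- s) valuation P (X p + 1) * (place_degree P)%:Z = (q ^ (m - p))%:Z.
  apply/eqP; rewrite -subr_eq0 addrC; apply/eqP; apply: h => P; rewrite in_cons negb_or => /andP[PP nPs].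
  by have [] := hs nPs PP pm.
move: h; rewrite (eq_big_seq (fun P => \sum_(r < p.+1) (((0 < valuation P (X r + 1))%R * place_degree P)%N)%:Z * co p r)); last first.
  move=> P Ps'; rewrite val_peaks //; last by apply: contraNneq Ps => <-.
  rewrite mulr_suml; apply: eq_bigr => r _; rewrite PoszM mulrAC; congr (_ * _ * _).
  by case: (0 < _).
rewrite exchange_big /= big_ord_recr /=.
have e r : \sum_(P <- s) ((0 < valuation P (X r + 1))%R * place_degree P)%N%:Z * co p r = (peak_deg r)%:Z * co p r.
  by rewrite -mulr_suml -Posz_sum.
rewrite e [co p p]/co eqxx (eq_bigr (fun r : 'I_p => - ((q ^ (m - p))%:Z * (n * (q ^ r)%:Z)))); last first.
  move=> r _; have rp := ltn_ord r; rewrite e /co ltn_eqF // mulrN; congr (- _).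
  have rm : (r <= m)%N by rewrite ltnW // (leq_trans rp).
  have dr : (p - r <= maxn r (m - r))%N by apply: leq_trans (leq_maxr _ _); apply: leq_sub2r.
  have := IH r rp rm; rewrite -{1}(subnK dr) expnD mulnA.
  have -> : (q ^ m = q ^ (m - p) * q ^ r * q ^ (p - r))%N.
    by rewrite -!expnD -addnA subnKC ?subnK // ltnW.
  move/eqP; rewrite eqn_pmul2r ?expn_gt0 ?q0 // => /eqP h.
  by rewrite mulrCA -PoszM h PoszM mulrCA.
rewrite sumrN -mulr_sumr -mulr_sumr => h.
apply/eqP; rewrite -eqz_nat PoszM.
have -> : (peak_deg p)%:Z * (q ^ maxn p (m - p))%:Z = (q ^ (m - p))%:Z * (1 + n * \sum_(r < p) (q ^ r)%:Z).
  rewrite mulrDr mulr1; move: h; move: ((q ^ (m - p))%:Z * _) => u.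
  by move: ((peak_deg p)%:Z * _) => w; move: (q ^ (m - p))%:Z => z; clear; lia.
by rewrite -geometric -PoszM -expnD subnK.
Qed.

Lemma peak_degE_small p : (p.*2 <= m)%N -> peak_deg p = (q ^ p)%N.
Proof.
rewrite -addnn => h; have pm : (p <= m)%N by apply: leq_trans h; apply: leq_addr.
have := peak_degE pm; have /maxn_idPr -> : (p <= m - p)%N by rewrite leq_subRL.
move/eqP; rewrite -{2}(subnKC pm) expnD eqn_pmul2r ?expn_gt0 ?q0 //.
by move/eqP.
Qed.

Let f := X m ^+ q / (iota al * (X m + 1)) ^+ q.-1.
Let S := (\sum_(r < m.+1) q ^ r)%N.

(** At [Q] the valuation of [f] is [(q - 1) S + 1] with [S = 1 + q + ... + q^m], and the local basis
    has a different shape; that place is accounted for separately in [level_step]. *)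
Definition slope (P : place iota) : int := if P == Q then 0 else (valuation P f %/ n)%Z.

Let n0 : n != 0. Proof. by rewrite /n; case: q q1 => [|[|]]. Qed.

Lemma Q_neq_inf : Q != Pinf.
Proof.
apply/eqP => e; have := lv_Q lv; rewrite e (lv_inf lv).
by move: (q ^ m)%N => a; clear; lia.
Qed.

Lemma Q_in : Q \in s.
Proof.
apply: contraT => nQ; have [e _] := hs nQ Q_neq_inf (leqnn m).
by move: (lv_Q lv) (qX0 m); rewrite e => <-.
Qed.

Lemma Q_val_rhs : valuation Q f = (q.-1 * S).+1%:Z.
Proof.
have [x0 x1] := cX.1 m (leqnn m).
have vp : valuation Q (X m + 1) = 0.
  case: (val_shift (dP Q) x0 x1) => [] [a b] //; exfalso; move: a (qX0 m);
    by rewrite (lv_Q lv); move: (q ^ m)%N => z; clear; lia.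
rewrite /f val_rhs // ?vp ?(lv_Q lv) ?mulr0 ?subr0.
by rewrite -PoszM -expnS geometric -[(q.-1 * S).+1]addn1 PoszD addrC PoszM /S Posz_sum.
Qed.

(** The divisor of [f] has degree 0 and [f] has valuation -1 at [Pinf] and [(q - 1) S + 1] at [Q],
    both places of degree 1. What remains for the others is [-(q - 1) S]. *)
Lemma slope_sum : (forall P, P \in s -> P != Q -> n * slope P = valuation P f) ->
  \sum_(P <- s) slope P * (place_degree P)%:Z = - S%:Z.
Proof.
move=> hsl; have [x0 x1] := cX.1 m (leqnn m).
have f0 : f != 0 by rewrite mulf_neq0 ?invr_eq0 ?expf_neq0 // mulf_neq0 // fmorph_eq0.
have := dg_val0 rg (s := Pinf :: s) f0; rewrite /= Ps us => /(_ isT).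
have [vi vi1] := inf_values (leqnn m); rewrite subnn in vi vi1.
rewrite /dg big_cons (riemann_inf rg) mulr1 {1}/f val_rhs // ?vi ?vi1.
move=> h; have {}h := h (_ : forall P, P \notin Pinf :: s -> valuation P f = 0).
have {}h : \sum_(P <- s) valuation P f * (place_degree P)%:Z = 1.
  have := h _; rewrite -/n qn expn0 => {}h; apply: (addrI (-1)); rewrite subrr -[RHS]h.
    by congr (_ + _); move: n; clear; lia.
  move=> P; rewrite in_cons negb_or => /andP[PP nPs]; rewrite /f val_rhs //.
  by have [-> ->] := hs nPs PP (leqnn m); rewrite !mulr0 subr0.
apply: (mulfI n0); rewrite mulr_sumr.
rewrite (eq_big_seq (fun P => valuation P f * (place_degree P)%:Z - (if P == Q then valuation Q f else 0))); last first.
  move=> P Ps'; rewrite /= mulrA; have [->|PQ] := eqVneq P Q.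
    by rewrite /slope eqxx mulr0 mul0r (lv_Qdeg lv) mulr1 subrr.
  by rewrite subr0 hsl.
rewrite sumrB h (bigD1_seq Q Q_in us) /= eqxx big1 => [|P /negbTE -> //].
by rewrite addr0 Q_val_rhs -addn1 PoszD PoszM mulrN -/n; move: (n * _) => z; clear; lia.
Qed.

(** Equal to 1 if the place has a peak in the first half of the chain, where the next step is wildly
    ramified, and to 0 otherwise. The form of a sum over [p] allows the exchange with the sum over
    places. *)
Definition wildness (P : place iota) : nat := (\sum_(p < m./2.+1) (0 < valuation P (X p + 1))%R)%N.

Lemma wildness_sum :
  (\sum_(P <- s) wildness P * place_degree P = \sum_(p < m./2.+1) q ^ p)%N.
Proof.
rewrite (eq_bigr (fun P => \sum_(p < m./2.+1) (0 < valuation P (X p + 1))%R * place_degree P)%N).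
  rewrite exchange_big; apply: eq_bigr => p _; rewrite -[LHS]/(peak_deg p) peak_degE_small //.
  by have := ltn_ord p; rewrite ltnS => h; rewrite -[X in (_ <= X)%N]odd_double_half (leq_trans _ (leq_addl _ _)) // leq_double.
by move=> P _; rewrite big_distrl.
Qed.

Let half_le : (m./2 <= m)%N.
Proof. by rewrite -{2}[m]odd_double_half -addnn addnCA leq_addr. Qed.

Lemma wildness0 P : (forall i, (i <= m)%N -> valuation P (X i + 1) = 0) -> wildness P = 0%N.
Proof.
move=> h; rewrite /wildness big1 // => p _; rewrite h ?ltxx //.
by have := ltn_ord p; rewrite ltnS => /leq_trans; apply; exact: half_le.
Qed.

Lemma wildness_peak P p : (p <= m)%N -> 0 < valuation P (X p + 1) ->
  wildness P = (p.*2 <= m)%N.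
Proof.
move=> pm pp; have other r : (r <= m)%N -> r != p -> 0 < valuation P (X r + 1) = false.
  move=> rm rp; case: (level_cases P) => [h|h|r0 /andP[rm0 rp0] h1 h2|h]; apply/negbTE; rewrite -leNgt.
  - have [x0 x1] := cX.1 r rm; have [a _] := h r rm.
    by case: (val_shift (dP P) x0 x1) => [] [a' b']; rewrite ?b' ?ltW //; move: a a'; lia.
  - by have [_ ->] := h r rm.
  - have e : r0 = p.
      have [lt|lt|//] := ltngtP r0 p.
        by have [|a b] := h2 p; rewrite ?lt //; move: pp a; rewrite b; lia.
      by have [_ b] := h1 p lt; move: pp; rewrite b ltxx.
    have [lt|lt|rr] := ltngtP r r0.
    + by have [_ ->] := h1 r lt.
    + by have [|a ->] := h2 r; rewrite ?lt // ltW.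
    + by move: rp; rewrite rr e eqxx.
  - by have [_ ->] := h r rm.
have hm : (p < m./2.+1)%N = (p.*2 <= m)%N by rewrite ltnS geq_half_double.
have le r : (r < m./2.+1)%N -> (r <= m)%N.
  by rewrite ltnS => /leq_trans; apply; exact: half_le.
rewrite -hm /wildness; case: ltnP => h.
  rewrite (bigD1 (Ordinal h)) //= pp big1 ?addn0 // => r rp.
  by rewrite other // le.
rewrite big1 // => r _; rewrite other ?le //.
by rewrite neq_ltn (leq_trans (ltn_ord r) h).
Qed.
End LevelDegrees.

(** * From one level of the tower to the next *)

Section LevelStep.
Variables (k F F' : fieldType) (iota : {rmorphism k -> F}) (iota' : {rmorphism k -> F'})
  (j : {rmorphism F -> F'}).
Hypothesis jc : forall c, j (iota c) = iota' c.
Variables (q : nat) (al : k).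
Hypotheses (q1 : (1 < q)%N) (al0 : al != 0).
Hypothesis frob : forall a b : F', (a + b) ^+ q = a ^+ q + b ^+ q.
Variables (m : nat) (X : nat -> F) (g : nat) (Pinf Q : place iota).
Hypothesis lv : level q al m X g Pinf Q.
Variable X' : nat -> F'.
Hypotheses (hX : forall i, (i <= m)%N -> X' i = j (X i)) (cX' : chain iota' q al m.+1 X').
Local Notation Y := (X' m.+1).
Local Notation Z := (Y + 1)^-1.
Hypotheses (gY : generator j q Y) (gZ : generator j q Z).

Let rg := lv_riemann lv.
Let dP := riemann_disc rg.
Let fP := riemann_deg rg.
Let cX := lv_chain lv.
Let n := q.-1%:Z.
Let q0 : (0 < q)%N. Proof. exact: ltnW. Qed.
Let qn : q%:Z = n + 1. Proof. by rewrite /n; case: q q1 => [|r _] //=; rewrite -addn1. Qed.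
Let qX0 i : (q ^ i)%:Z != 0 :> int. Proof. by rewrite eqz_nat expn_eq0; case: q q1. Qed.
Let dep := ev_dep gZ.1.
Let x := X m.
Let x0 : x != 0. Proof. by have [] := cX.1 m (leqnn m). Qed.
Let x10 : x + 1 != 0. Proof. by have [] := cX.1 m (leqnn m). Qed.
Let Y0 : Y != 0. Proof. by have [] := cX'.1 m.+1 (leqnn _). Qed.
Let Y10 : Y + 1 != 0. Proof. by have [] := cX'.1 m.+1 (leqnn _). Qed.
Let f := x ^+ q / (iota al * (x + 1)) ^+ q.-1.

Let rY : Y * (Y + 1) ^+ q.-1 = j f.
Proof.
have := cX'.2 m (ltnSn m); rewrite /rel_eq (hX (leqnn m)) => ->.
by rewrite /f rmorphM fmorphV !rmorphXn rmorphM rmorphD rmorph1 jc.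
Qed.

Let frobF (a b : F) : (a + b) ^+ q = a ^+ q + b ^+ q.
Proof. by apply: (fmorph_inj j); rewrite rmorphXn !rmorphD !rmorphXn frob. Qed.

Let below (P : place iota') : exists P' : place iota, over j P P'.
Proof. exact: (exists_rest jc dep P). Qed.

Let dP' (P : place iota') : discrete P.
Proof. by have [P' PP] := below P; exact: (over_discrete dep PP (dP P')). Qed.

Let over_val (P : place iota') (P' : place iota) z : over j P P' -> valuation P (j z) = valuation P' z * (ram j P P')%:Z.
Proof. by move=> PP; have [_ ->] := ramP dep PP (dP P'). Qed.

Let over_gt0 (P : place iota') (P' : place iota) z : over j P P' -> (0 < valuation P (j z)) = (0 < valuation P' z).
Proof.
move=> PP; have [r0 _] := ramP dep PP (dP P'); rewrite (over_val _ PP).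
by rewrite pmulr_lgt0.
Qed.

Let over_lt0 (P : place iota') (P' : place iota) z : over j P P' -> (valuation P (j z) < 0) = (valuation P' z < 0).
Proof.
move=> PP; have [r0 _] := ramP dep PP (dP P'); rewrite (over_val _ PP).
by rewrite pmulr_llt0.
Qed.

Let jX1 p : (p <= m)%N -> X' p + 1 = j (X p + 1).
Proof. by move=> pm; rewrite hX // rmorphD rmorph1. Qed.

Let Yneg (P : place iota') p : (p <= m)%N -> 0 < valuation P (X' p + 1) -> 0 < valuation P Y^-1.
Proof.
move=> pm pp; rewrite (valV (dP' P)) // oppr_gt0.
have [|] := @peak_right _ _ _ _ _ q1 al0 _ (dP' P) _ _ cX' p (m - p) pp; rewrite addnS subnKC //.
Qed.

(** Put [d = m - p]. For [0 < d < p] the choice of [eps] with valuation [q^(p-d)] makes the linear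
    coefficient a unit and requires the precision [q^(p-d+1)], exactly what [lv_mirror] offers; the
    step returns the precision [q^(p-d)] for [d + 1]. The case [d = 0] starts the agreement. For
    [d >= p] the approximation is exhausted, and with [T = 0] the constant term has a simple
    pole. *)
Lemma local_peak (P' : place iota) p : (p <= m)%N -> 0 < valuation P' (X p + 1) ->
  exists e, [/\ n * e = valuation P' f,
    top_values iota' j q Z P' (fun i => ((0 < i) && (p.*2 <= m))%N%:Z + i%:Z * e),
    forall P : place iota', over j P P' -> ram j P P' = (if (p.*2 <= m)%N then q else 1%N) &
    forall P : place iota', over j P P' -> (m < p.*2)%N ->
      vge P (q ^ (p - (m.+1 - p)).+1)%:Z (X' (p - (m.+1 - p))%N - Y^-1)].
Proof.
move=> pm pp; pose d := (m - p)%N; have em : m = (p + d)%N by rewrite subnKC.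
have vs := lv_peak lv pm pp; rewrite -/d in vs.
have hw : (p.*2 <= m)%N = (p <= d)%N by rewrite em -addnn leq_add2l.
have vx : (0 < d)%N -> valuation P' x < 0 /\ (q ^ d)%:Z * valuation P' x = - (n * (q ^ maxn p d)%:Z).
  move=> d0; have [|] := @peak_right _ _ _ _ _ q1 al0 _ (dP P') _ _ cX p d.-1 pp; rewrite prednK // -em // => h.
  by rewrite vs.
have vX0 : valuation P' (X p) = 0 by apply: (val_succ_gt0 q1 al0 (dP P') (cX.1 p pm).1 pp).
have vinv : (0 < d)%N -> 0 < valuation P' x^-1.
  by move=> /vx [h _]; rewrite (valV (dP P')) // oppr_gt0.
have [h|h] := leqP p d.
  (* For [d > 0] the valuation of [x] is [-(q - 1)], hence [eps] of valuation 1. For [d = 0] also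
     [p = 0], and [x] is a unit. *)
  have [e e0 ve] : exists2 e : F, e != 0 & valuation P' e = (0 < d)%N%:Z.
    exact: exists_val (dP P') _.
  have c1 : valuation P' x = - (n * valuation P' e).
    rewrite ve; case: (posnP d) => [d0|d0]; last first.
      rewrite mulr1; have [_] := vx d0; rewrite (maxn_idPr h) mulrC -mulNr.
      by move/(mulIf (qX0 d)).
    by rewrite mulr0 oppr0 /x {1}em d0 addn0.
  have c2 : valuation P' (x + 1) = 1 - q%:Z * valuation P' e.
    rewrite ve; case: (posnP d) => [d0|d0]; last first.
      rewrite mulr1; case: (val_shift (dP P') x0 x10) => [] [a b]; rewrite ?b.
      + by rewrite c1 ve d0 mulr1 qn; clear; lia.
      + by exfalso; have [] := vx d0; move: a; lia.
      + by exfalso; have [] := vx d0; move: a; lia.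
    rewrite mulr0 subr0 /x {1}em d0 addn0 vs d0 maxn0.
    by move: h; rewrite d0 leqn0 => /eqP ->.
  have [s [hs tv rm]] := peak_wild jc q1 al0 frob x0 x10 Y10 rY gZ (dP P') (fP P') dP' e0 c1 c2.
  exists s; rewrite hw h; split=> //.
    by move: tv; congr top_values; apply/funext => i; rewrite andbT.
  by move=> P PP; rewrite ltnNge hw h.
have pos : (0 < p)%N by apply: leq_ltn_trans h.
rewrite (maxn_idPl (ltnW h)) in vs vx.
pose a1 := X (p - d.+1)%N.
have a1m : (p - d.+1 <= m)%N by apply: leq_trans pm; apply: leq_subr.
have [a10 a11] := cX.1 _ a1m.
have [va1 _] := peak_left q1 al0 (dP P') cX pp pm h.
rewrite -/a1 in a10 a11 va1.
have ja1 : X' (p - (m.+1 - p))%N = j a1.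
  by rewrite subSn // -/d hX.
have ex : (q ^ (p - (m.+1 - p)).+1 = q ^ (p - d))%N.
  by rewrite subSn // -/d subnSK.
have nw : (p.*2 <= m)%N = false by rewrite hw leqNgt h.
(* At [d = 0] the peak is [x] itself: no mirror is available yet and the version with precision 0 is
   used. *)
case: (posnP d) => [d0|d0].
  have exp : x = X p by rewrite /x {1}em d0 addn0.
  have vx0 : valuation P' x = 0 by rewrite exp.
  have r : rel_eq iota q al a1 x.
    rewrite exp /a1 d0 -[X in rel_eq _ _ _ _ (X p)]/X.
    have := cX.2 (p - 1)%N; rewrite subn1 prednK //; apply.
    exact: pm.
  have c1 : valuation P' x = - (n * valuation P' 1) by rewrite val1 // mulr0 oppr0.
  have dl : vge P' (q%:Z * valuation P' 1) ((iota al * (x + 1))^-1 - (- witt iota al a1 x) / x - (- witt iota al a1 x) ^+ q).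
    by rewrite val1 // mulr0; apply: (mirror_delta0 q1 al0 frobF (dP P')).
  have [s [hs tv rm]] := peak_unram jc q1 al0 frob x0 x10 Y10 rY gZ (dP P') (fP P') dP' (oner_neq0 F) c1 dl.
  exists s; rewrite nw; split=> //.
  - by move: tv; congr top_values; apply/funext => i; rewrite andbF add0r.
  - by move=> P PP; have [] := rm P PP.
  - move=> P PP _; have [r1] := rm P PP; rewrite val1 // => hw'.
    have vjx : valuation P (j x + 1) = (q ^ p)%:Z.
      by rewrite -[1](rmorph1 j) -rmorphD (over_val _ PP) r1 mulr1 exp vs.
    rewrite ja1 ex d0 subn0 -vjx.
    have yi : 0 < valuation P Y^-1 by apply: (Yneg pm); rewrite jX1 // (over_gt0 _ PP).
    apply: (mirror_next0 (al := al) al0 (dP' P)) => //.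
    + by rewrite -[1](rmorph1 j) -rmorphD fmorph_eq0.
    + by rewrite fmorph_eq0.
    + by rewrite (over_gt0 _ PP).
    + move/(vge0 (dP' P)): hw'; congr (place_ring _ _).
      rewrite rmorphN opprK; congr (_ + _).
      by rewrite /witt rmorphM fmorphV !rmorphM !rmorphD !rmorph1 jc.
have d1p : (d.-1 < p)%N by apply: leq_ltn_trans h; apply: leq_pred.
pose a := X (p - d)%N.
have am : (p - d <= m)%N by apply: leq_trans pm; apply: leq_subr.
have [a0 a11'] := cX.1 _ am.
have [va _] := peak_left q1 al0 (dP P') cX pp pm d1p.
rewrite prednK // -/a in va; rewrite -/a in a0 a11'.
have r : rel_eq iota q al a1 a.
  have := cX.2 (p - d.+1)%N; rewrite -subSn // subSS; apply; exact: am.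
have [e e0 ve] := exists_val (dP P') (q ^ (p - d))%:Z.
have c1 : valuation P' x = - (n * valuation P' e).
  apply: (mulfI (qX0 d)); have [_ ->] := vx d0; rewrite ve mulrN mulrCA -[in RHS]PoszM -expnD subnKC //.
  exact: ltnW.
have mir := lv_mirror lv (_ : (0 < d <= p)%N) em pp; rewrite d0 (ltnW h) /= in mir.
have {}mir := mir isT.
have dl : vge P' (q%:Z * valuation P' e) ((iota al * (x + 1))^-1 - witt iota al a1 a / x - witt iota al a1 a ^+ q).
  apply: (mirror_delta q1 al0 (dP P')) => //; first exact: vinv.
  by rewrite ve -PoszM -expnS.
have [s [hs tv rm]] := peak_unram jc q1 al0 frob x0 x10 Y10 rY gZ (dP P') (fP P') dP' e0 c1 dl.
exists s; rewrite nw; split=> //.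
- by move: tv; congr top_values; apply/funext => i; rewrite andbF add0r.
- by move=> P PP; have [] := rm P PP.
- move=> P PP _; have [r1] := rm P PP; rewrite ve => hw'.
  rewrite ja1 ex.
  have yi : 0 < valuation P Y^-1 by apply: (Yneg pm); rewrite jX1 // (over_gt0 _ PP).
  have jx10 : j x + 1 != 0 by rewrite -[1](rmorph1 j) -rmorphD fmorph_eq0.
  apply: (mirror_next (al := al) al0 (dP' P) (x := j x) (a := j a)) => //; rewrite ?fmorph_eq0 //.
  + by rewrite -fmorphV (over_gt0 _ PP); apply: vinv.
  + by rewrite (over_gt0 _ PP).
  + by rewrite (over_gt0 _ PP).
  + rewrite -fmorphV -rmorphB; have ax : vge P' (q ^ (p - d))%:Z (a - x^-1).
      by apply: vge_le mir; rewrite lez_nat leq_exp2l.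
    case: ax => [->|h']; first by rewrite rmorph0; left.
    by right; rewrite (over_val _ PP) r1 mulr1.
  + move: hw'; congr (vge _ _ (_ - _)).
    by rewrite /witt rmorphM fmorphV !rmorphM !rmorphD !rmorph1 jc.
Qed.

Local Notation slope := (slope q al m X Q).
Local Notation wildness := (wildness m X).

Lemma local_data (P' : place iota) : P' != Pinf -> P' != Q ->
  n * slope P' = valuation P' f /\
  top_values iota' j q Z P' (fun i => ((0 < i) * wildness P')%N%:Z + i%:Z * slope P').
Proof.
move=> Pi PQ; have n0 : n != 0 by rewrite /n; case: q q1 => [|[|]].
have se e : n * e = valuation P' f -> slope P' = e.
  by rewrite /slope (negbTE PQ) -/x -/f => <-; rewrite mulKz.
case: (level_cases q1 al0 lv P') => [h|h|p /andP[pm pp] _ _|h].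
- by exfalso; have := not_inf lv Pi; have [] := h 0%N isT; lia.
- by case/eqP: PQ; apply: (lv_Qu lv); have [] := h m (leqnn m).
- have [e [he tv _ _]] := local_peak pm pp.
  rewrite (se e he); split=> //; move: tv; congr top_values; apply/funext => i.
  have [s [us Ps _]] := chain_support lv.
  by rewrite (wildness_peak q1 al0 lv us Ps pm pp) mulnb.
- have [hm hm1] := h m (leqnn m).
  have [vf tv _ _] := generic_unram jc q1 al0 frob x0 x10 Y10 rY gZ (dP P') (fP P') dP' hm hm1.
  rewrite (se 0) ?mulr0 // -/x -/f vf; split=> //; move: tv; congr top_values; apply/funext => i.
  by rewrite wildness0 ?muln0 ?mulr0 // => l lm; have [] := h l lm.
Qed.

Let wildQ : wildness Q = 0%N.
Proof.
have vQ := lv_Q lv; have v0 : 0 < valuation Q (X m) by rewrite vQ ltz_nat expn_gt0 q0.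
case: (level_cases q1 al0 lv Q) => [h|h|p /andP[pm pp] h1 h2|h].
- by exfalso; have [] := h m (leqnn m); lia.
- by apply: wildness0 => i im; have [] := h i im.
- exfalso; move: pm; rewrite leq_eqVlt => /orP[/eqP e|pm].
    by move: v0; rewrite -e (val_succ_gt0 q1 al0 (dP Q) (cX.1 p _).1 pp) ?ltxx // e.
  by have [|a _] := h2 m; rewrite ?pm ?leqnn //; move: v0 a; lia.
- by exfalso; have [] := h m (leqnn m); lia.
Qed.

Let sum_pos r (c : int) : \sum_(i < r) (if (i : nat) == 0%N then 0 else c) = r.-1%:Z * c.
Proof.
case: r => [|r]; first by rewrite big_ord0 mul0r.
by rewrite big_ord_recl /= add0r sumr_const card_ord -mulr_natl natz.
Qed.

Let vQpow : (q.-1 * \sum_(r < m.+1) q ^ r).+1 = (q ^ m.+1)%N.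
Proof. by rewrite -predn_exp prednK // expn_gt0 q0. Qed.

Lemma level_step : exists Pinf' Q',
  level q al m.+1 X' (q * g + q.-1 * \sum_(p < m./2.+1) q ^ p)%N (Pinf' : place iota') Q'.
Proof.
have eZ : j f * Z ^+ q + Z = 1 by apply: Z_equation; [exact: q1 | exact: Y10 | exact: rY].
have vfi : valuation Pinf f = -1.
  have [vi vi1] := inf_values q1 al0 lv (leqnn m); rewrite subnn expn0 in vi vi1.
  by rewrite /f val_rhs // vi vi1 -/n qn; move: n; clear; lia.
have [Pi' [[ovi uni rmi dgi vZ] infv]] := infinite_type jc q1 (dP Pinf) (fP Pinf) dP' gZ vfi eZ.
have [P1 [P2 [[h1 r1 d1 v1] [h2 r2 d2 v2] ex tvQ]]] :=
  tame_type jc q1 (dP Q) (fP Q) (lv_Qdeg lv) dP' gY gZ (Q_val_rhs q1 al0 lv) Y10 rY.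
rewrite vQpow in v1 v2.
have edge P := chain_edge q1 al0 (dP' P) cX' (ltnSn m).
have overQ (P : place iota') : 0 < valuation P (X' m) -> P = P1 \/ P = P2.
  have [P' PP] := below P; rewrite hX // (over_gt0 _ PP) => /(lv_Qu lv) e.
  by apply: ex; rewrite -e.
have vpos : 0 < (q ^ m.+1)%:Z :> int by rewrite ltz_nat expn_gt0 q0.
exists Pi', P1; split=> //.
- have [s [us Ps hs]] := chain_support lv.
  pose S := (\sum_(r < m.+1) q ^ r)%N; pose W := (\sum_(p < m./2.+1) q ^ p)%N.
  (* Leading exponents of the local bases: the tame type at [Q], and elsewhere the slope plus the
     extra factor [t] of a wild place. *)
  pose tau (P : place iota) (i : nat) : int := if P == Q then (if i is 0 then 0 else (i * S).+1%:Z)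
    else ((0 < i) * wildness P)%N%:Z + i%:Z * slope P.
  have Qs := Q_in q1 lv hs.
  have inf_over (P : place iota') : over j P Pinf <-> P = Pi' by split=> [/uni //|->].
  have top_tau P' : P' != Pinf -> top_values iota' j q Z P' (tau P').
    move=> PP; have [->|PQ] := eqVneq P' Q; first by rewrite /tau eqxx.
    by have [_] := local_data PP PQ; rewrite /tau (negbTE PQ).
  have good P' : P' \notin s -> P' != Pinf -> (forall i, tau P' i = 0) /\ integral_at iota' j P' Z.
    move=> nPs PP; have h := hs P' nPs PP; have [hm hm1] := h m (leqnn m).
    have PQ : P' != Q by apply: contraNneq nPs => ->.
    have [vf _ hi _] := generic_unram jc q1 al0 frob x0 x10 Y10 rY gZ (dP P') (fP P') dP' hm hm1.
    split=> // i; rewrite /tau (negbTE PQ) wildness0; last by move=> l lm; have [] := h l lm.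
    by rewrite muln0 add0r /slope (negbTE PQ) -/x vf div0z mulr0.
  apply: (riemann_step jc gZ.1 gZ.2 rg inf_over rmi q0 infv us Ps top_tau good).
  (* The slopes sum to [-S], which cancels the [i S] contributed by [Q]. For [i > 0] there remain
     the 1 from [Q] and the total degree [W] of the wild places, independently of [i]. *)
  have lam i : loclam s tau i = if i == 0%N then 0 else 1 + W%:Z.
    rewrite /loclam; case: i => [|i] /=.
      rewrite big1 // => P _; rewrite /tau; case: (P == Q); rewrite ?mul0r //.
    rewrite (eq_bigr (fun P => (if P == Q then (i.+1 * S).+1%:Z else 0) +
        (wildness P * place_degree P)%N%:Z + i.+1%:Z * (slope P * (place_degree P)%:Z))).
      rewrite !big_split /= -mulr_sumr -Posz_sum (wildness_sum q1 al0 lv us Ps hs).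
      rewrite (slope_sum q1 al0 lv us Ps hs); last first.
        move=> P Ps' PQ; have PP : P != Pinf by apply: contraNneq Ps => <-.
        by have [] := local_data PP PQ.
      rewrite (bigD1_seq Q Qs us) /= eqxx big1 => [|P /negbTE -> //].
      by rewrite addr0 -addn1 PoszD PoszM -/S -/W mulrN; move: (_ * _) => z; clear; lia.
    move=> P _; rewrite /tau; have [->|PQ] := eqVneq P Q.
      by rewrite wildQ mul0n addr0 /slope eqxx mul0r mulr0 addr0 (lv_Qdeg lv) mulr1.
    by rewrite add0r mul1n mulrDl PoszM mulrA.
  rewrite (eq_bigr (fun i : 'I_q => if (i : nat) == 0%N then 0 else 1 + W%:Z)) => [|i _]; last exact: lam.
  rewrite sum_pos -/n PoszD !PoszM -/n -/W qn; ring.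
- have y1 : valuation Pi' (Y + 1) = -1.
    by move: vZ; rewrite valV // => h; apply/eqP; rewrite -eqr_opp h opprK.
  by case: (val_shift (dP' Pi') Y0 Y10) => [] [a b]; rewrite -?b //; move: b; rewrite y1.
- move=> P; rewrite hX //; split=> [h|->]; last by rewrite (over_lt0 _ ovi); apply/(lv_inf0 lv).
  have [P' PP] := below P; apply: uni; rewrite (over_lt0 _ PP) in h.
  by have <- := (lv_inf0 lv P').1 h.
(* A zero of the new generator lies above [Q], and the second place above [Q] is a zero of the
   generator plus 1 instead. *)
- move=> P h; case: (edge P) => *; try (exfalso; lia).
  have vp : 0 < valuation P (X' m) by [].
  have [//|e] := overQ P vp.
  exfalso; have y2 : 0 < valuation P (Y + 1) by rewrite e v2.
  by move: h; rewrite (val_succ_gt0 q1 al0 (dP' P) Y0 y2) ltxx.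
- move=> P p; rewrite leq_eqVlt => /orP[/eqP ->|]; last first.
    rewrite ltnS => pm pp; have [P' PP] := below P.
    have pp' : 0 < valuation P' (X p + 1) by move: pp; rewrite jX1 // (over_gt0 _ PP).
    have [e [_ _ rm _]] := local_peak pm pp'.
    rewrite jX1 // (over_val _ PP) rm // (lv_peak lv pm pp') -PoszM; congr Posz.
    (* A wild step multiplies the order of [X p + 1] by [q] and an unramified step keeps it; this
       changes [maxn p (m - p)] into [maxn p (m.+1 - p)]. *)
    have e1 : (p.*2 <= m)%N = (p <= m - p)%N by rewrite leq_subRL // addnn.
    rewrite e1; case: leqP => h.
      by rewrite subSn // (maxn_idPr (leqW h)) expnSr.
    by rewrite muln1 subSn // (maxn_idPl h).
  (* A new peak at the last index is the tame place [P2] above [Q], where the order is [q^(m+1)]. *)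
  move=> h; have yz := val_succ_gt0 q1 al0 (dP' P) Y0 h; case: (edge P) => *; try (exfalso; lia).
  have vp : 0 < valuation P (X' m) by [].
  have [e|->] := overQ P vp.
    by exfalso; move: yz vpos; rewrite e v1 => ->; rewrite ltxx.
  by rewrite v2 subnn maxn0.
- move=> P p d /andP[d0 dp] em pp.
  have pm : (p <= m)%N by rewrite -ltnS em -[X in (X < _)%N]addn0 ltn_add2l.
  have ed : d = (m.+1 - p)%N by rewrite em addKn.
  have [P' PP] := below P.
  have pp' : 0 < valuation P' (X p + 1) by move: pp; rewrite jX1 // (over_gt0 _ PP).
  have [e [_ _ _ mir]] := local_peak pm pp'.
  by rewrite ed; apply: mir PP _; rewrite -addnn em leq_add2l.
Qed.
End LevelStep.

Lemma generated_by_affine_inv (F F' : fieldType) (j : {rmorphism F -> F'}) (Y : F') :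
  Y + 1 != 0 -> generated_by j Y -> generated_by j (Y + 1)^-1.
Proof.
move=> Y10 gen S [S1 SB SV] Sc SZ; apply: gen => //.
have -> : Y = 1 / (Y + 1)^-1 - 1 by rewrite div1r invrK addrK.
by apply: SB => //; apply: SV.
Qed.

Fixpoint tower_genus (q m : nat) : nat :=
  if m is m'.+1 then (q * tower_genus q m' + q.-1 * \sum_(p < m'./2.+1) q ^ p)%N else 0%N.

Lemma tower_genusE q m : (1 < q)%N ->
  (q.-1 * tower_genus q m + q ^ m./2.+1 + q ^ uphalf m = q ^ m.+1 + 1)%N.
Proof.
move=> q1.
have geo h : (q.-1 * \sum_(p < h.+1) q ^ p = (q ^ h.+1).-1)%N by rewrite predn_exp.
elim: m => [|m IH] /=; first by rewrite muln0 add0n expn1.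
rewrite mulnDr geo.
have p1 : (0 < q ^ m./2.+1)%N by rewrite expn_gt0 ltnW.
move: IH p1; rewrite [(q ^ uphalf m.+1)%N]/= !expnS; case: q q1 {geo} => [|r] //= _.
move: (tower_genus r.+1 m) (r.+1 ^ m./2)%N (r.+1 ^ uphalf m)%N (r.+1 ^ m)%N => g h u w.
move=> e p1; rewrite -(prednK p1) /=; move: (_.-1) (prednK p1) => t et.
nia.
Qed.

(** * The local description holds at every level of the tower *)

Section TowerFacts.
Variables (k : fieldType) (q : nat) (al : k) (E : tower k) (x : forall n, E n).
Hypotheses (rc : recursively_defined q al x) (q1 : (1 < q)%N) (al0 : al != 0).
Hypothesis frob : forall m (a b : E m), (a + b) ^+ q = a ^+ q + b ^+ q.

(** The image of the [i]th generator in [E m]. Only [i <= m] is meaningful; for larger [i] the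
    recursion ends in [x 0]. *)
Fixpoint tower_var (m : nat) (i : nat) : E m :=
  match m return E m with
  | 0 => x 0%N
  | m'.+1 => if i == m'.+1 then x m'.+1 else tower_incl E m' (tower_var m' i)
  end.
Local Notation X := tower_var.

Lemma tower_var_top m : X m m = x m.
Proof. by case: m => [|m] //=; rewrite eqxx. Qed.

Lemma tower_var_incl m i : (i <= m)%N -> X m.+1 i = tower_incl E m (X m i).
Proof. by move=> im /=; rewrite ltn_eqF // ltnS. Qed.

Let tx := transcendentalP (rec_transcendental rc).
Let fx := fractionsP tx (rec_rational rc).
Let x00 := transcendental_neq0 tx.

Let x01 : x 0%N + 1 != 0.
Proof.
have -> : x 0%N + 1 = ev (tower_const E 0) (x 0%N) ('X - (-1)%:P).
  by rewrite evB evX_ evC_ rmorphN rmorph1 opprK.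
by apply: ev_neq0 => //; rewrite polyXsubC_eq0.
Qed.

Lemma chain_tower m : chain (tower_const E m) q al m (X m).
Proof.
elim: m => [|m [h r]].
  by split=> [i _|i //]; split=> /=.
have [xm0 xm1] := h m (leqnn m); have ia : tower_const E m al != 0 by rewrite fmorph_eq0.
have eY := rec_equation rc m.
have f0 : x m.+1 * (x m.+1 + 1) ^+ q.-1 != 0.
  rewrite eY fmorph_eq0 -tower_var_top mulf_neq0 ?invr_eq0 ?expf_neq0 // mulf_neq0 //.
have lt_ i : (i <= m.+1)%N -> (i <= m)%N \/ i = m.+1.
  by rewrite leq_eqVlt => /orP[/eqP ->|im]; [right | left].
split=> [i /lt_ [im|->]|i].
- have [a b] := h i im; rewrite tower_var_incl //; split; first by rewrite fmorph_eq0.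
  by rewrite -(rmorph1 (tower_incl E m)) -rmorphD fmorph_eq0.
- rewrite tower_var_top; move: f0; rewrite mulf_eq0 negb_or => /andP[-> h1]; split=> //.
  by move: h1; rewrite expf_eq0 negb_and; case: q q1 => [|[|]].
rewrite ltnS => im; rewrite /rel_eq (tower_var_incl im) -(tower_compat E) -{1}(rmorph1 (tower_incl E m)).
move: im; rewrite leq_eqVlt => /orP[/eqP ->|im].
  rewrite !tower_var_top rmorph1 eY rmorphM fmorphV !rmorphXn rmorphM rmorphD rmorph1.
  by [].
rewrite tower_var_incl // -[X in _ / (_ * (_ + X)) ^+ _](rmorph1 (tower_incl E m)).
rewrite -!rmorphD -!rmorphXn -!rmorphM -!rmorphXn -fmorphV -rmorphM; congr (tower_incl E m _).
exact: r.
Qed.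

Lemma generator_tower m : generator (tower_incl E m) q (x m.+1) /\
  generator (tower_incl E m) q (x m.+1 + 1)^-1.
Proof.
have [h _] := chain_tower m; have [h' _] := chain_tower m.+1.
have [xm0 xm1] := h m (leqnn m); have [y0 y1] := h' m.+1 (leqnn _).
rewrite tower_var_top in y0 y1; rewrite tower_var_top in xm0 xm1.
have ia : tower_const E m al != 0 by rewrite fmorph_eq0.
have q0 : (0 < q)%N by exact: ltnW.
have eY := rec_equation rc m; move: eY.
set f : E m := _ / _; move=> eY.
have f0 : f != 0 by rewrite mulf_neq0 ?invr_eq0 ?expf_neq0 // mulf_neq0.
split.
  have sA : size ('X * ('X - (-1)%:P) ^+ q.-1 : {poly E m}) = q.+1.
    rewrite mulrC size_mulX ?monic_neq0 ?monic_exp ?monicXsubC //.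
    by rewrite size_exp_XsubC prednK.
  have mA : 'X * ('X - (-1)%:P) ^+ q.-1 \is @monic (E m).
    by rewrite monicMl ?monicX // monic_exp ?monicXsubC.
  have lt : (size (- f%:P)%R < size ('X * ('X - (-1)%:P) ^+ q.-1 : {poly E m})%R)%N.
    by rewrite sA size_polyN (leq_ltn_trans (size_polyC_leq1 _)).
  apply: (@generatorP _ _ (tower_incl E m) q (x m.+1) ('X * ('X - (-1)%:P) ^+ q.-1 - f%:P) (@rec_generated _ _ _ _ _ rc m) (@rec_degree _ _ _ _ _ rc m)).
  - by rewrite monicE lead_coefDl // -monicE.
  - by rewrite size_polyDl.
  - by rewrite evB ev_mul ev_exp evB evX_ !evC_ rmorphN rmorph1 opprK eY subrr.
have lt : (size (f^-1 *: 'X - f^-1%:P)%R < size ('X^q : {poly E m}))%N.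
  rewrite size_polyXn ltnS; apply: leq_trans (size_polyD _ _) _; rewrite geq_max size_polyN.
  rewrite (leq_trans (size_scale_leq _ _)) ?size_polyX //=.
  by rewrite (leq_trans (size_polyC_leq1 _)) // ltnW.
apply: (@generatorP _ _ (tower_incl E m) q (x m.+1 + 1)^-1 ('X^q + (f^-1 *: 'X - f^-1%:P))
  (generated_by_affine_inv y1 (@rec_generated _ _ _ _ _ rc m)) (@rec_degree _ _ _ _ _ rc m)).
- by rewrite monicE lead_coefDl // lead_coefXn.
- by rewrite size_polyDl // size_polyXn.
- have eZ := Z_equation q1 y1 eY.
  rewrite evD evB evZ evX_ evC_ /ev map_polyXn hornerXn fmorphV.
  have jf0 : tower_incl E m f != 0 by rewrite fmorph_eq0.
  apply: (mulfI jf0); rewrite mulr0 mulrDr mulrBr mulVKf // mulfV //.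
  by rewrite addrA eZ subrr.
Qed.

Lemma level_tower m : exists Pinf Q,
  level q al m (X m) (tower_genus q m) (Pinf : place (tower_const E m)) Q.
Proof.
elim: m => [|m [Pinf [Q lv]]]; last first.
  have [gY gZ] := generator_tower m.
  have hX i : (i <= m)%N -> X m.+1 i = tower_incl E m (X m i) by exact: tower_var_incl.
  rewrite -[x m.+1]tower_var_top in gY gZ.
  exact: (level_step (tower_compat E m) q1 al0 (@frob m.+1) lv hX (chain_tower m.+1) gY gZ).
have [Pinf nP] := exists_infinite tx; have [Q nQ] := exists_infinite (transcendental_inv tx).
have dP P := (rational_disc tx fx P).1.
have [_ vi _ di ui] := infinite_place tx fx nP.
have neg (P : place (tower_const E 0)) : valuation P (x 0%N) < 0 -> ~~ place_ring P (x 0%N).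
  by move=> h; rewrite (val_ring (dP P)) // -ltNge.
have vQ : 0 < valuation Q (x 0%N - tower_const E 0 0).
  by rewrite rmorph0 subr0 -oppr_lt0 -valV // ltNge -(val_ring (dP Q)) // invr_eq0.
have [vQ1 dQ uQ] := linear_place tx fx vQ; rewrite rmorph0 subr0 in vQ1 uQ.
exists Pinf, Q; split=> //.
- exact: (rational_riemann tx fx nP).
- by move=> P; split=> [/neg|-> /=]; [exact: ui | rewrite vi].
- move=> P p; rewrite leqn0 => /eqP -> /= h.
  have e : x 0%N + 1 = x 0%N - tower_const E 0 (-1) by rewrite rmorphN rmorph1 opprK.
  by rewrite e in h *; have [-> _ _] := linear_place tx fx h.
- by move=> P [|p] d // /andP[]; case: d.
Qed.

Lemma genus_tower m : genus (tower_const E m) = tower_genus q m.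
Proof. by have [Pinf [Q lv]] := level_tower m; apply: (genusE (lv_riemann lv)). Qed.

End TowerFacts.

(** * Supersingular points *)

Section Supersingular.
Variables (Om : closedFieldType) (q : nat) (q1 : (1 < q)%N).
Hypothesis frob : forall a b : Om, (a + b) ^+ q = a ^+ q + b ^+ q.
Hypothesis qOm : q%:R = 0 :> Om.
Let q0 : (0 < q)%N. Proof. exact: ltnW. Qed.

Definition Fr (a : Om) : Om := a ^+ q.
Lemma Fr0 : Fr 0 = 0. Proof. by rewrite /Fr expr0n eqn0Ngt q0. Qed.
Lemma Fr1 : Fr 1 = 1. Proof. by rewrite /Fr expr1n. Qed.
Lemma FrD a b : Fr (a + b) = Fr a + Fr b. Proof. exact: frob. Qed.
Lemma FrM a b : Fr (a * b) = Fr a * Fr b. Proof. exact: exprMn. Qed.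
Lemma FrN a : Fr (- a) = - Fr a.
Proof. by apply/eqP; rewrite -addr_eq0 -FrD addNr Fr0. Qed.
Let FE := (FrD, FrN, FrM, Fr0, Fr1).
Local Notation Fi i := (iter i Fr).

Lemma FiE i a : Fi i a = a ^+ (q ^ i).
Proof. by elim: i => [|i IH]; rewrite ?expr1 //= IH /Fr -exprM -expnSr. Qed.
Lemma Fi0 i : Fi i 0 = 0. Proof. by elim: i => //= i ->; rewrite Fr0. Qed.
Lemma FiD i a b : Fi i (a + b) = Fi i a + Fi i b.
Proof. by elim: i => //= i ->; rewrite FrD. Qed.
Lemma FiN i a : Fi i (- a) = - Fi i a.
Proof. by elim: i => //= i ->; rewrite FrN. Qed.
Lemma FiM i a b : Fi i (a * b) = Fi i a * Fi i b.
Proof. by elim: i => //= i ->; rewrite FrM. Qed.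
Lemma FiX i a n : Fi i (a ^+ n) = Fi i a ^+ n.
Proof. by rewrite !FiE -!exprM mulnC. Qed.
Lemma Fr_sum (I : Type) (r : seq I) (h : I -> Om) : Fr (\sum_(l <- r) h l) = \sum_(l <- r) Fr (h l).
Proof. exact: (big_morph Fr FrD Fr0). Qed.
Lemma Fi_sum i (I : Type) (r : seq I) (h : I -> Om) : Fi i (\sum_(l <- r) h l) = \sum_(l <- r) Fi i (h l).
Proof. exact: (big_morph _ (FiD i) (Fi0 i)). Qed.

(* A skew polynomial [sum_i c_i tau^i], where [tau a = a^q tau], is the sequence [c].
   [lphi g] and [rphi g] are left and right multiplication by [al + g tau - tau^2],
   [liso u] and [riso u] by [tau - u]. *)
Definition shift (c : nat -> Om) (i : nat) : Om := if i is i'.+1 then c i' else 0.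
Definition ltau (c : nat -> Om) : nat -> Om := shift (fun l => Fr (c l)).
Definition rcst (c : nat -> Om) (a : Om) (i : nat) : Om := c i * Fi i a.

Variables (al : Om) (al0 : al != 0).

Definition lphi (g : Om) (c : nat -> Om) (i : nat) : Om := al * c i + g * ltau c i - ltau (ltau c) i.
Definition rphi (g : Om) (c : nat -> Om) (i : nat) : Om :=
  rcst c al i + shift (rcst c g) i - shift (shift c) i.
Definition liso (u : Om) (c : nat -> Om) (i : nat) : Om := ltau c i - u * c i.
Definition riso (u : Om) (c : nat -> Om) (i : nat) : Om := shift c i - rcst c u i.

Definition one_seq (i : nat) : Om := (i == 0%N)%:R.
(** The action of [T^k] under the Drinfeld module with [T] acting as [al + g tau - tau^2]. *)
Definition phi_pow (g : Om) (k : nat) : nat -> Om := iter k (lphi g) one_seq.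

Lemma lphi_rphi g h c : lphi g (rphi h c) = rphi h (lphi g c).
Proof.
apply/funext => i; rewrite /lphi /rphi /ltau /rcst.
by case: i => [|[|[|[|i]]]] /=; rewrite ?FE; ring.
Qed.

Lemma lphi_riso g u c : lphi g (riso u c) = riso u (lphi g c).
Proof.
apply/funext => i; rewrite /lphi /riso /ltau /rcst.
by case: i => [|[|[|[|i]]]] /=; rewrite ?FE; ring.
Qed.

(** [al + (mid u) tau - tau^2] is [-(tau + al/u) (tau - u)]. Exchanging the two factors gives the
    target of the isogeny [tau - u], with middle coefficient [u - (al/u)^q]. The hypothesis
    [mid u' = u - Fr (al / u)] below says that this target has in turn the right factor
    [tau - u']. *)
Definition mid (u : Om) : Om := Fr u - al / u.

Lemma liso_lphi u u' c : u != 0 -> mid u' = u - Fr (al / u) ->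
  liso u (lphi (mid u) c) = lphi (mid u') (liso u c).
Proof.
move=> u0 ->; have [b eb] : exists b, al = u * b by exists (al / u); rewrite mulrC divfK.
have -> : mid u = Fr u - b by rewrite /mid eb mulrC mulKf.
have -> : al / u = b by rewrite eb mulrC mulKf.
apply/funext => i; rewrite /lphi /liso /ltau eb.
by case: i => [|[|[|[|i]]]] /=; rewrite ?FE; ring.
Qed.

Variables (d : nat) (d0 : (0 < d)%N) (p : {poly Om}).
Hypotheses (Fp : forall k, Fr p`_k = p`_k) (mon : p \is monic) (sp : size p = d.+1)
  (rp : root p al) (dp : p^`().[al] != 0)
  (ald : Fi d al = al) (alne : forall i, (0 < i < d)%N -> Fi i al != al).

Definition comb (C : nat -> nat -> Om) (i : nat) : Om := \sum_(k < d.+1) p`_k * C k i.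
(** The action of [p(T)], a skew polynomial of degree [2 d]. *)
Definition phi (g : Om) : nat -> Om := comb (phi_pow g).

Lemma ltau_comb C : ltau (comb C) = comb (fun k => ltau (C k)).
Proof.
apply/funext => -[|i]; rewrite /comb /ltau /=; first by rewrite big1 // => k _; rewrite mulr0.
by rewrite Fr_sum; apply: eq_bigr => k _; rewrite FrM Fp.
Qed.

Lemma lphi_comb g C : lphi g (comb C) = comb (fun k => lphi g (C k)).
Proof.
apply/funext => i; rewrite /lphi !ltau_comb /comb !mulr_sumr -big_split -sumrB /=.
by apply: eq_bigr => k _; ring.
Qed.

Lemma rphi_comb g C : rphi g (comb C) = comb (fun k => rphi g (C k)).
Proof.
apply/funext => i; rewrite /rphi /rcst.
have sh (D : nat -> nat -> Om) l : shift (comb D) l = comb (fun k => shift (D k)) l.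
  by case: l => [|l] //=; rewrite /comb big1 // => k _; rewrite /= mulr0.
have shs l : shift (fun i => comb C i * Fi i g) l = comb (fun k => shift (fun i => C k i * Fi i g)) l.
  case: l => [|l] /=; rewrite /comb ?mulr_suml; first by rewrite big1 // => k _; rewrite mulr0.
  by apply: eq_bigr => k _; rewrite mulrA.
have -> : shift (comb C) = comb (fun k => shift (C k)) by apply/funext => l; exact: sh.
rewrite shs sh /comb mulr_suml -big_split -sumrB /=.
by apply: eq_bigr => k _; ring.
Qed.

Lemma riso_comb u C : riso u (comb C) = comb (fun k => riso u (C k)).
Proof.
apply/funext => i; rewrite /riso /rcst.
have -> : shift (comb C) i = comb (fun k => shift (C k)) i.
  by case: i => [|l] //=; rewrite /comb big1 // => k _; rewrite /= mulr0.
rewrite /comb mulr_suml -sumrB; apply: eq_bigr => k _; ring.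
Qed.

Lemma liso_comb u C : liso u (comb C) = comb (fun k => liso u (C k)).
Proof.
apply/funext => i; rewrite /liso ltau_comb /comb mulr_sumr -sumrB.
by apply: eq_bigr => k _; ring.
Qed.

Lemma phi_comm g : lphi g (phi g) = rphi g (phi g).
Proof.
have h k : lphi g (phi_pow g k) = rphi g (phi_pow g k).
  elim: k => [|k IH] /=; last by rewrite -lphi_rphi -IH.
  apply/funext => i; rewrite /lphi /rphi /rcst /ltau /one_seq.
  by case: i => [|[|[|i]]] /=; rewrite ?FE ?Fi0; ring.
by rewrite /phi lphi_comb rphi_comb; congr comb; apply/funext => k; exact: h.
Qed.

Lemma phi_iso u u' : u != 0 -> mid u' = u - Fr (al / u) ->
  liso u (phi (mid u)) = riso u (phi (mid u')).
Proof.
move=> u0 e; have h k : liso u (phi_pow (mid u) k) = riso u (phi_pow (mid u') k).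
  elim: k => [|k IH] /=; last by rewrite (liso_lphi _ u0 e) -lphi_riso -IH.
  apply/funext => i; rewrite /liso /riso /rcst /ltau /one_seq.
  by case: i => [|[|i]] /=; rewrite ?FE; ring.
by rewrite /phi liso_comb riso_comb; congr comb; apply/funext => k; exact: h.
Qed.

Lemma phi_pow_high g k i : (k.*2 < i)%N -> phi_pow g k i = 0.
Proof.
elim: k i => [|k IH] [|[|i]] //= h; rewrite /lphi /ltau /=.
have h' : (k.*2 < i)%N by move: h; rewrite doubleS !ltnS.
by rewrite (IH _ h') (IH _ (leqW h')) (IH _ (leqW (leqW h'))) !Fr0 !mulr0 addr0 subr0.
Qed.

Lemma phi_pow_top g k : phi_pow g k k.*2 = (-1) ^+ k.
Proof.
elim: k => [|k IH] /=; first by rewrite /one_seq.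
have h1 := phi_pow_high g (ltnSn k.*2); have h2 := phi_pow_high g (leqW (ltnSn k.*2)).
rewrite doubleS /lphi /ltau /= h1 h2 IH Fr0 !mulr0 !add0r exprS mulN1r.
congr (- _); rewrite -[RHS]mul1r; elim: k {IH h1 h2} => [|k IH]; rewrite ?expr0 ?mulr1 ?FE //.
by rewrite exprS mulN1r !FE IH mulrN.
Qed.

Lemma phi_top g : phi g d.*2 = (-1) ^+ d.
Proof.
rewrite /phi /comb big_ord_recr /= phi_pow_top big1 ?add0r.
  by move: mon; rewrite monicE /lead_coef sp /= => /eqP ->; rewrite mul1r.
by move=> k _; rewrite phi_pow_high ?mulr0 // ltn_double.
Qed.

Lemma phi_pow0 g k : phi_pow g k 0 = al ^+ k.
Proof.
by elim: k => [|k IH] //=; rewrite /lphi /ltau /= IH mulr0 addr0 subr0 exprS.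
Qed.

Lemma phi0 g : phi g 0 = 0.
Proof.
have /rootP e := rp; rewrite -[RHS]e horner_coef sp; apply: eq_bigr => k _.
by rewrite phi_pow0.
Qed.

(** If all lower coefficients vanish, comparing degree [i] in the commutation with the action of [T]
    gives [al c_i = c_i al^(q^i)]. *)
Lemma phi_low g i : (forall l, (l < i)%N -> phi g l = 0) -> Fi i al != al -> phi g i = 0.
Proof.
move=> low ne; have := congr1 (fun c => c i) (phi_comm g).
rewrite /lphi /rphi /rcst /ltau; set c := phi g in low *.
have -> : shift (fun l => Fr (c l)) i = 0 by case: i low {ne} => //= i low; rewrite low ?Fr0.
have -> : shift (fun l => Fr (shift (fun l => Fr (c l)) l)) i = 0.
  by case: i low {ne} => [|[|i]] //= low; rewrite ?Fr0 // low ?Fr0 // ltnW.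
have -> : shift (fun i => c i * Fi i g) i = 0 by case: i low {ne} => //= i low; rewrite low ?mul0r.
have -> : shift (shift c) i = 0 by case: i low {ne} => [|[|i]] //= low; rewrite low // ltnW.
rewrite mulr0 !addr0 !subr0 mulrC => e; apply/eqP; apply: contraT => c0.
by case/eqP: ne; apply: (mulfI c0).
Qed.

(** By [phi_low] the first nonzero coefficient has an index divisible by [d]. When the one in degree
    [d] vanishes, only the top coefficient in degree [2 d] is left. *)
Lemma phi_supersingular g : phi g d = 0 -> forall i, (i < d.*2)%N -> phi g i = 0.
Proof.
move=> gd i; elim/ltn_ind: i => i IH id.
have [->|i0] := posnP i; first exact: phi0.
have low l : (l < i)%N -> phi g l = 0 by move=> li; apply: IH => //; apply: ltn_trans id.
have [lt|gt|->//] := ltngtP i d.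
  by apply: phi_low => //; apply: alne; rewrite i0.
apply: phi_low => //; rewrite -(subnK (ltnW gt)) iterD ald; apply: alne.
by rewrite subn_gt0 gt -(ltn_add2r d) subnK ?addnn // ltnW.
Qed.

Lemma phi_small g i : (i < d)%N -> phi g i = 0.
Proof.
elim/ltn_ind: i => i IH id; have [->|i0] := posnP i; first exact: phi0.
by apply: phi_low; [move=> l li; apply: IH => //; apply: ltn_trans id | apply: alne; rewrite i0].
Qed.

Section Logarithm.
Variables (g : Om) (l : nat -> Om).
Hypotheses (l0 : l 0%N = 1) (lE : forall m, (m < d)%N -> rphi g l m = al * l m) (ld : l d = 0).

(** The coefficient of [tau^d] in the skew product of [l] and [c]. *)
Let Lam (c : nat -> Om) : Om := \sum_(i < d.+1) l i * Fi i (c (d - i)%N).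

(** Associativity, [a (tau c) = (a tau) c], read in degree [d]. *)
Lemma shift_sum (a c : nat -> Om) : \sum_(i < d.+1) a i * Fi i (ltau c (d - i)%N) =
  \sum_(i < d.+1) shift a i * Fi i (c (d - i)%N).
Proof.
rewrite big_ord_recr /= subnn Fi0 mulr0 addr0 [RHS]big_ord_recl /= mul0r add0r.
apply: eq_bigr => i _; rewrite /= /bump /= add1n subnS.
have : (0 < d - i)%N by rewrite subn_gt0.
by case: (d - i)%N => //= m _; rewrite -iterSr.
Qed.

Lemma Lam_lphi c : Lam (lphi g c) = al * Lam c + rphi g l d * Fi d (c 0%N).
Proof.
have -> : Lam (lphi g c) = \sum_(i < d.+1) rphi g l i * Fi i (c (d - i)%N).
  rewrite /Lam /rphi; transitivity (\sum_(i < d.+1) rcst l al i * Fi i (c (d - i)%N) +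
    \sum_(i < d.+1) rcst l g i * Fi i (ltau c (d - i)%N) - \sum_(i < d.+1) l i * Fi i (ltau (ltau c) (d - i)%N)).
    rewrite -big_split -sumrB /=; apply: eq_bigr => i _.
    rewrite /lphi /rcst !(FiD, FiN, FiM); ring.
  rewrite !shift_sum -big_split -sumrB /=; apply: eq_bigr => i _; ring.
rewrite big_ord_recr /= subnn; congr (_ + _).
rewrite /Lam big_ord_recr /= ld mul0r addr0 mulr_sumr; apply: eq_bigr => i _.
by rewrite lE // mulrA.
Qed.

(** [l] is the logarithm cut off before degree [d]: it turns the action of [T] into multiplication
    by [al] below that degree, and the recursion cannot go on because [al^(q^d) = al]. The
    obstruction in degree [d] enters the product with the action of [T^k] with the factor
    [k al^(k-1)], altogether [p'(al)]. On the other side that product for [p(T)] has only the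
    coefficient of [tau^d], the lower ones being 0. *)
Lemma phi_log : phi g d = rphi g l d * p^`().[al].
Proof.
have Lp k : Lam (phi_pow g k) = rphi g l d * (al ^+ k.-1 *+ k).
  elim: k => [|k IH] /=.
    rewrite /Lam mulr0n mulr0 big_ord_recr /= ld mul0r addr0 big1 // => i _.
    by rewrite /one_seq subn_eq0 leqNgt ltn_ord /= Fi0 mulr0.
  rewrite Lam_lphi IH phi_pow0 FiX ald; case: k {IH} => [|k] /=.
    by rewrite mulr0n !mulr0 add0r expr0 mulr1n.
  rewrite [al ^+ k.+1 *+ k.+2]mulrSr mulrDr; congr (_ + _).
  by rewrite mulrCA mulrnAr -exprS.
transitivity (Lam (phi g)).
  rewrite /Lam big_ord_recl /= subn0 l0 mul1r big1 ?addr0 // => i _.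
  by rewrite phi_small ?Fi0 ?Fr0 ?mulr0 // /bump leq0n add1n ltn_subrL d0.
transitivity (\sum_(k < d.+1) p`_k * Lam (phi_pow g k)).
  rewrite /Lam /phi /comb.
  under eq_bigr do rewrite Fi_sum mulr_sumr.
  rewrite exchange_big; apply: eq_bigr => k _; rewrite mulr_sumr; apply: eq_bigr => i _ /=.
  have ek : Fi i p`_k = p`_k by elim: (nat_of_ord i) => //= m ->; rewrite Fp.
  by rewrite FiM ek mulrCA.
under eq_bigr do rewrite Lp mulrCA.
rewrite -mulr_sumr; congr (_ * _).
rewrite big_ord_recl /= mulr0n mulr0 add0r.
rewrite (horner_coef_wide _ (_ : (size p^`() <= d)%N)); last by rewrite -ltnS -sp lt_size_deriv // -size_poly_gt0 sp.
by apply: eq_bigr => i _; rewrite coef_deriv /bump /= add1n /= mulrnAl mulrnAr.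
Qed.
End Logarithm.

Section LogarithmPolynomials.

Let a i := al - Fi i al.

(* [(log_pair i).2] is the [i]th coefficient of the logarithm of [phi (mid u)], up to a power
   of [u], as a polynomial in [t = u^(q+1)]. *)
Fixpoint log_pair (i : nat) : {poly Om} * {poly Om} :=
  if i is i'.+1 then let AB := log_pair i' in
    (AB.2, (a i)^-1 *: (AB.2 * ('X - al%:P) ^+ (q ^ i') - AB.1 * 'X^(q ^ i'.-1)))
  else (0, 1).
(** The numerator of the next coefficient before division by [al - al^(q^(i+1))]. For [i = d - 1]
    that divisor is 0, and the numerator itself is the obstruction. *)
Definition log_num (i : nat) : {poly Om} :=
  (log_pair i).2 * ('X - al%:P) ^+ (q ^ i) - (log_pair i).1 * 'X^(q ^ i.-1).

Let e i := (\sum_(r < i) q ^ r)%N.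
Let eS i : e i.+1 = (e i + q ^ i)%N. Proof. by rewrite /e big_ord_recr. Qed.

Let a0 i : (0 < i < d)%N -> a i != 0.
Proof. by move=> /alne; rewrite /a subr_eq0 eq_sym. Qed.

Lemma log_num_size i : (i < d)%N -> size (log_pair i).2 = (e i).+1 /\
  (size (log_pair i).1 <= (e i.-1).+1)%N /\ size (log_num i) = (e i.+1).+1.
Proof.
have main j : size (log_pair j).2 = (e j).+1 -> (size (log_pair j).1 <= (e j.-1).+1)%N ->
    ((log_pair j).1 = 0 \/ (0 < j)%N) -> size (log_num j) = (e j.+1).+1.
  move=> s2 s1 hj; have s : size ((log_pair j).2 * ('X - al%:P) ^+ (q ^ j)) = (e j.+1).+1.
    rewrite size_Mmonic ?monic_exp ?monicXsubC -?size_poly_gt0 ?s2 //.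
    by rewrite size_exp_XsubC addnS /= eS addSn.
  rewrite /log_num size_polyDl // s size_polyN; case: hj => [->|j0].
    by rewrite mul0r size_poly0.
  apply: leq_ltn_trans (size_polyMleq _ _) _; rewrite size_polyXn addnS /=.
  apply: (@leq_ltn_trans (e j).+1); last by rewrite ltnS eS -[X in (X < _)%N]addn0 ltn_add2l expn_gt0 q0.
  case: j j0 s1 {s2 s} => // j _ s1; rewrite eS -addSn leq_add2r; exact: s1.
elim: i => [|i IH] id.
  have h1 : size (log_pair 0).2 = (e 0).+1 by rewrite /= size_poly1 /e big_ord0.
  have h2 : (size (log_pair 0).1 <= (e 0%N.-1).+1)%N by rewrite /= size_poly0.
  by split=> //; split=> //; apply: main => //; left.
have [s2 [s1 s3]] := IH (ltnW id).
have h1 : size (log_pair i.+1).2 = (e i.+1).+1.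
  by rewrite /= size_scale ?invr_eq0 ?a0 // -/(log_num i).
have h2 : (size (log_pair i.+1).1 <= (e i.+1.-1).+1)%N by rewrite /= s2.
by split=> //; split=> //; apply: main => //; right.
Qed.

Lemma log_pairS1 i : (log_pair i.+1).1 = (log_pair i).2. Proof. by []. Qed.
Lemma log_pairS2 i : (log_pair i.+1).2 = (a i.+1)^-1 *: log_num i. Proof. by []. Qed.

Lemma log_num0 i : (i < d)%N -> (log_num i).[0] != 0.
Proof.
elim: i => [|i IH] id.
  by rewrite /log_num /= mul1r mul0r subr0 expn0 expr1 !hornerE oppr_eq0.
rewrite {1}/log_num log_pairS1 log_pairS2 hornerD hornerN !hornerM horner_exp hornerXn.
rewrite expr0n expn_eq0 [q == 0%N]eqn0Ngt q0 /= mulr0 subr0 hornerZ hornerXsubC sub0r.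
by rewrite !mulf_neq0 ?invr_eq0 ?a0 ?IH ?expf_neq0 ?oppr_eq0 // ltnW.
Qed.

(** Derivatives of [q]th powers vanish, so each step of the recursion multiplies the Wronskian of
    consecutive coefficients by a nonzero constant and a power of [t]. Consequently a nonzero root
    of [log_num] is simple. *)
Lemma log_wronskian i t : (i < d)%N -> t != 0 ->
  (log_num i * (log_pair i).2^`() - (log_num i)^`() * (log_pair i).2).[t] != 0.
Proof.
move=> + t0; elim: i => [|i IH] id.
  rewrite /log_num /= mul1r mul0r subr0 expn0 expr1 derivC mulr0 sub0r mulr1.
  by rewrite derivXsubC !hornerE oppr_eq0 oner_eq0.
have qi : (q ^ i.+1)%:R = 0 :> Om by rewrite expnS natrM qOm mul0r.
have dU : (('X - al%:P) ^+ (q ^ i.+1))^`() = 0.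
  by rewrite deriv_exp -mulr_natr -polyC_natr qi mulr0.
have ring_id (A B U V A' B' V' : {poly Om}) :
    (B * U - A * V) * B' - (B' * U - (A' * V + A * V')) * B = V * (B * A' - B' * A) + A * B * V' by ring.
have wE : (log_pair i.+1).2 * (log_pair i.+1).1^`() - (log_pair i.+1).2^`() * (log_pair i.+1).1 =
    (a i.+1)^-1 *: (log_num i * (log_pair i).2^`() - (log_num i)^`() * (log_pair i).2).
  by rewrite log_pairS1 log_pairS2 derivZ -!scalerAl scalerBr.
rewrite {1 2}/log_num derivB !derivM dU mulr0 addr0 ring_id wE log_pairS1 log_pairS2 {wE ring_id}.
case: i id IH qi {dU} => [|i] id IH qi.
  rewrite expn0 derivX mulr1 expr1 /log_num /= mul1r mul0r subr0 expn0 !expr1 derivC mulr0 sub0r mulr1 mul1r.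
  have h1 : (1 : {poly Om}).[t] = 1 by rewrite -polyC1 hornerC.
  rewrite derivXsubC hornerD hornerM !hornerZ hornerN hornerX hornerXsubC h1.
  have -> : t * ((a 1%N)^-1 * -1) + (a 1%N)^-1 * (t - al) = - ((a 1%N)^-1 * al) by ring.
  by rewrite oppr_eq0 mulf_neq0 ?invr_eq0 ?a0.
have dV : 'X^(q ^ i.+1)^`() = 0 :> {poly Om}.
  by rewrite derivXn expnS -mulr_natr -polyC_natr natrM qOm mul0r mulr0.
rewrite [i.+2.-1]/= dV mulr0 addr0 hornerM hornerXn hornerZ.
by rewrite !mulf_neq0 ?expf_neq0 ?invr_eq0 ?a0 ?IH // ltnW.
Qed.

(** As [mid u = (t - al)/u], the recursion of the logarithm becomes that of [log_pair] after
    multiplication by [u^(e i)] with [e i = 1 + q + ... + q^(i-1)]; the step back by two indices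
    leaves the factor [t^(q^(i-2))]. *)
Lemma log_coefficients u : u != 0 -> let t := u ^+ q.+1 in
  phi (mid u) d = (log_num d.-1).[t] / u ^+ e d * p^`().[al].
Proof.
move=> u0 t; pose l i := if (i < d)%N then (log_pair i).2.[t] / u ^+ e i else 0.
have key i : (i < d)%N -> l i * Fi i (mid u) - shift l i = (log_num i).[t] / u ^+ e i.+1.
  move=> id; rewrite /l id /mid FiD FiN.
  have -> : Fi i (Fr u) - Fi i (al / u) = (t - al) ^+ (q ^ i) / u ^+ (q ^ i).
    rewrite -FiN -FiD !FiE -expr_div_n; congr (_ ^+ _).
    by rewrite /Fr /t exprS mulrBl mulrAC mulfV // mul1r.
  have uE : u ^+ e i.+1 = u ^+ e i * u ^+ (q ^ i) by rewrite -exprD eS.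
  have ue j : u ^+ j != 0 by rewrite expf_neq0.
  rewrite /log_num hornerD hornerN !hornerM horner_exp hornerXsubC hornerXn uE.
  case: i id uE => [|i] id uE /=.
    have -> : (1 : {poly Om}).[t] = 1 by rewrite -polyC1 hornerC.
    by rewrite horner0 mul0r !subr0 !mul1r invfM mulrCA.
  rewrite (ltnW id); have -> : t ^+ (q ^ i) = u ^+ (q ^ i) * u ^+ (q ^ i.+1).
    by rewrite /t -exprM -exprD mulSn expnS.
  rewrite [e i.+1]eS exprD; move: (u ^+ e i) (u ^+ (q ^ i)) (u ^+ (q ^ i.+1)) (ue (e i)) (ue (q ^ i)%N) (ue (q ^ i.+1)%N).
  by move=> x y z x0 y0 z0; field; rewrite x0 y0 z0.
have l0 : l 0%N = 1 by rewrite /l d0 /= hornerC /e big_ord0 expr0 divr1.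
have ld : l d = 0 by rewrite /l ltnn.
have rE i : rphi (mid u) l i.+1 = l i.+1 * Fi i.+1 al + (l i * Fi i (mid u) - shift l i).
  by rewrite /rphi /rcst /= addrA.
rewrite (phi_log l0 _ ld) => [|[|m] md].
- by rewrite -[in rphi _ _ d](prednK d0) rE prednK // ld mul0r add0r key ?prednK.
- by rewrite /rphi /rcst /= l0 addr0 subr0 mul1r mulr1.
- have lm : l m.+1 = (a m.+1)^-1 * (log_num m).[t] / u ^+ e m.+1 by rewrite /l md log_pairS2 hornerZ.
  have am := a0 (_ : (0 < m.+1 < d)%N); rewrite md in am; have {}am := am isT.
  rewrite rE key ?(ltnW md) // lm -[X in _ = X * _](subrK (Fi m.+1 al)) -/(a m.+1).
  have ue : u ^+ e m.+1 != 0 by rewrite expf_neq0.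
  by move: (a m.+1) am (Fi m.+1 al) (u ^+ e m.+1) ue => b b0 w z z0; field; rewrite z0 b0.
Qed.

(** The isogeny relation transports the vanishing of coefficients below degree [2 d] to the target.
    In degree [2 d] it then says that [tau - u] commutes with [tau^(2d)], that is,
    [u^(q^(2d)) = u]. *)
Lemma supersingular_step u u' : u != 0 -> mid u' = u - Fr (al / u) -> phi (mid u) d = 0 ->
  phi (mid u') d = 0 /\ Fi d.*2 u = u.
Proof.
move=> u0 eu ss; have low := phi_supersingular ss.
have eq i : ltau (phi (mid u)) i - u * phi (mid u) i = shift (phi (mid u')) i - phi (mid u') i * Fi i u.
  exact: (congr1 (fun c => c i) (phi_iso u0 eu)).
have Fu i : Fi i u != 0 by rewrite FiE expf_neq0.
have low' i : (i < d.*2)%N -> phi (mid u') i = 0.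
  elim: i => [|i IH] id; first exact: phi0.
  have := eq i.+1; rewrite /ltau /= low ?(ltnW id) // low // IH ?(ltnW id) // Fr0 mulr0 subr0 sub0r.
  by move=> /esym/eqP; rewrite oppr_eq0 mulf_eq0 -[Fr _]/(Fi i.+1 u) (negbTE (Fu i.+1)) orbF => /eqP.
have dd : (d < d.*2)%N by rewrite -addnn -[X in (X < _)%N]addn0 ltn_add2l.
split; first exact: low'.
have := eq d.*2; rewrite !phi_top.
have -> : ltau (phi (mid u)) d.*2 = 0.
  by rewrite /ltau; case: d.*2 low (dd) => //= i lw _; rewrite lw ?Fr0.
have -> : shift (phi (mid u')) d.*2 = 0.
  by case: d.*2 low' (dd) => //= i lw _; rewrite lw.
rewrite !sub0r mulrC => /oppr_inj /mulfI h; apply/esym/h.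
by rewrite expf_neq0 // oppr_eq0 oner_eq0.
Qed.

(** The dictionary between the equation and isogenies: if [u^(q+1) = jpoly.[x]] and [u u' = al x],
    then [u'^(q+1) = jpoly.[y]] exactly for the [y] following [x]. *)
Definition jpoly : {poly Om} := al ^+ q *: ('X * ('X - (-1)%:P) ^+ q.-1).

Lemma jpolyE y : jpoly.[y] = al ^+ q * (y * (y + 1) ^+ q.-1).
Proof. by rewrite hornerZ hornerM hornerX horner_exp hornerXsubC opprK. Qed.

Lemma jpoly_size : size jpoly = q.+1.
Proof.
rewrite size_scale ?expf_neq0 // mulrC size_mulX ?monic_neq0 ?monic_exp ?monicXsubC //.
by rewrite size_exp_XsubC prednK.
Qed.

Lemma jpoly_deriv y : jpoly^`().[y] = al ^+ q * (y + 1) ^+ q.-2.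
Proof.
rewrite derivZ hornerZ derivM derivX mul1r deriv_exp derivXsubC mul1r.
rewrite hornerD hornerM hornerMn !horner_exp hornerX !hornerXsubC opprK; congr (_ * _).
have : q.-1%:R = -1 :> Om by apply/eqP; rewrite -addr_eq0 -(natrD _ _ 1) addn1 prednK // qOm.
case: q q1 => [|[|r]] //= _ e1; rewrite -mulr_natr e1 exprS; ring.
Qed.

Lemma supersingular_set : exists s : seq Om, [/\ uniq s, size s = (q * \sum_(r < d) q ^ r)%N,
  forall x, x \in s -> [/\ x != 0, x + 1 != 0 & Fi d.*2 x = x] &
  forall x y, x \in s -> y * (y + 1) ^+ q.-1 = x ^+ q / (al * (x + 1)) ^+ q.-1 -> y \in s].
Proof.
pose N := log_num d.-1; pose H := N \Po jpoly.
have d1 : (d.-1 < d)%N by rewrite prednK.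
have [_ [_ sN]] := log_num_size d1; rewrite prednK // in sN.
have sH1 : (size H).-1 = (e d * q)%N by rewrite size_comp_poly sN jpoly_size.
have ed0 : (0 < e d)%N by rewrite -(prednK d0) eS addn_gt0 expn_gt0 q0 orbT.
have H0 : H != 0.
  apply/eqP => H0; have : (0 < e d * q)%N by rewrite muln_gt0 ed0.
  by rewrite -sH1 H0 size_poly0.
have sH : size H = (e d * q).+1 by rewrite -sH1 prednK // size_poly_gt0.
have [s es] := closed_field_poly_normal H.
have lc : lead_coef H != 0 by rewrite lead_coef_eq0.
have rootH y : (y \in s) = (N.[jpoly.[y]] == 0).
  by rewrite -root_prod_XsubC -(rootZ _ _ lc) -es /root horner_comp.
have nz y : y \in s -> [/\ y != 0, y + 1 != 0 & jpoly.[y] != 0].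
  rewrite rootH jpolyE => hy; have N0 := log_num0 d1.
  have q10 : (0 < q.-1)%N by case: q q1 => [|[|]].
  have y0 : y != 0 by apply: contraTneq hy => ->; rewrite mul0r mulr0.
  have y1 : y + 1 != 0.
    by apply: contraTneq hy => ->; rewrite expr0n eqn0Ngt q10 /= !mulr0.
  by rewrite !mulf_neq0 ?expf_neq0.
have ssP u : u != 0 -> N.[u ^+ q.+1] = 0 <-> phi (mid u) d = 0.
  move=> u0; rewrite (log_coefficients u0) -/N; split=> [->|/eqP]; first by rewrite !mul0r.
  by rewrite !mulf_eq0 invr_eq0 expf_eq0 (negbTE u0) andbF (negbTE dp) !orbF => /eqP.
(* An edge from [x] to [y] lifts to an isogeny whose target again has a known right factor, with
   [u' = al x / u]. *)
have next x y u : x \in s -> u ^+ q.+1 = jpoly.[x] ->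
    y * (y + 1) ^+ q.-1 = x ^+ q / (al * (x + 1)) ^+ q.-1 ->
    [/\ u != 0, phi (mid u) d = 0, mid (al * x / u) = u - Fr (al / u) & (al * x / u) ^+ q.+1 = jpoly.[y]].
  move=> xs eu ey; have [x0 x1 jx0] := nz x xs.
  have u0 : u != 0 by apply: contraNneq jx0 => u0; rewrite -eu u0 expr0n.
  have ss : phi (mid u) d = 0 by apply/ssP => //; rewrite eu; apply/eqP; rewrite -rootH.
  rewrite jpolyE in eu; have x1q : (x + 1) ^+ q.-1 != 0 by rewrite expf_neq0.
  have aq : al ^+ q != 0 by rewrite expf_neq0.
  have eu' : u ^+ q = al ^+ q * x * (x + 1) ^+ q.-1 / u.
    by rewrite -[al ^+ q * x * _]mulrA -eu exprSr mulfK.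
  split=> //.
    rewrite /mid /Fr !expr_div_n exprMn eu'.
    have exq : x ^+ q = (x + 1) * (x + 1) ^+ q.-1 - 1 by rewrite -exprS prednK // frob expr1n addrK.
    rewrite exq; move: ((x + 1) ^+ q.-1) (al ^+ q) x1q aq => z w z0 w0.
    by field; rewrite u0 x0 al0 z0 w0.
  rewrite jpolyE ey expr_div_n eu exprMn !exprMn.
  have -> : al ^+ q = al * al ^+ q.-1 by rewrite -exprS prednK.
  have aq1 : al ^+ q.-1 != 0 by rewrite expf_neq0.
  rewrite [al ^+ q.+1]exprS [x ^+ q.+1]exprS.
  have -> : al ^+ q = al * al ^+ q.-1 by rewrite -exprS prednK.
  move: ((x + 1) ^+ q.-1) (al ^+ q.-1) (x ^+ q) x1q aq1 => z w v z0 w0.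
  by field; rewrite x0 al0 z0 w0.
have exu x : exists u, u ^+ q.+1 = jpoly.[x].
  have [u] : exists u, root ('X^(q.+1) - (jpoly.[x])%:P) u by apply/closed_rootP; rewrite size_XnsubC.
  by rewrite /root hornerD hornerN hornerXn hornerC subr_eq0 => /eqP; exists u.
have exy x : exists y, y * (y + 1) ^+ q.-1 = x ^+ q / (al * (x + 1)) ^+ q.-1.
  have aq0 : al ^+ q != 0 by rewrite expf_neq0.
  pose c := al ^+ q * (x ^+ q / (al * (x + 1)) ^+ q.-1).
  have [y] : exists y, root (jpoly - c%:P) y.
    apply/closed_rootP; rewrite size_polyDl jpoly_size ?eqSS -?lt0n // size_polyN.
    exact: leq_ltn_trans (size_polyC_leq1 _) _.
  by rewrite /root hornerD hornerN hornerC jpolyE subr_eq0 => /eqP /(mulfI aq0); exists y.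
have Fal i : Fi (i * d) al = al by elim: i => // i IH; rewrite mulSn addnC iterD ald.
exists s; split.
(* [N] has simple nonzero roots by the Wronskian, and [jpoly] is unramified over them because its
   derivative vanishes at most at -1. *)
- have : separable_poly H.
    rewrite unlock; apply: Pdiv.ClosedField.root_coprimep => y.
    rewrite es rootZ // root_prod_XsubC => ys; rewrite -es deriv_comp hornerM horner_comp jpoly_deriv.
    have [y0 y1 jy0] := nz y ys; rewrite !mulf_neq0 ?expf_neq0 //.
    have := log_wronskian d1 jy0; rewrite -/N hornerD hornerN !hornerM.
    move: ys; rewrite rootH => /eqP ->; rewrite mul0r sub0r oppr_eq0 mulf_eq0 negb_or.
    by case/andP.
  by rewrite es (eqp_separable (eqp_scale _ lc)) separable_prod_XsubC.
- have := sH; rewrite es size_scale // size_prod_XsubC => -[->].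
  by rewrite mulnC.
(* Two consecutive steps show that both [u] and [u' = al x / u] are fixed by the [2d]th power of
   Frobenius, hence so is [x = u u' / al]. *)
- move=> x xs; have [x0 x1 _] := nz x xs; split=> //.
  have [u eu] := exu x; have [y ey] := exy x.
  have [u0 ss eu' ej] := next x y u xs eu ey; have [ss' fu] := supersingular_step u0 eu' ss.
  have u'0 : al * x / u != 0 by rewrite !mulf_neq0 ?invr_eq0.
  have ys : y \in s by rewrite rootH -ej; apply/eqP/ssP.
  have [z ez] := exy y.
  have [_ _ eu'' _] := next y z _ ys ej ez.
  have [_ fu'] := supersingular_step u'0 eu'' ss'.
  have ex : x = u * (al * x / u) / al by field; rewrite u0 al0.
  have e2 : Fi d.*2 al = al by rewrite -muln2 mulnC Fal.
  by rewrite {1}ex FiM FiM fu fu' FiE exprVn -FiE e2 -ex.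
- move=> x y xs ey; have [u eu] := exu x.
  have [u0 ss eu' ej] := next x y u xs eu ey; have [ss' _] := supersingular_step u0 eu' ss.
  by rewrite rootH -ej; apply/eqP/ssP => //; have [x0 _ _] := nz x xs; rewrite !mulf_neq0 ?invr_eq0.
Qed.
End LogarithmPolynomials.
End Supersingular.

(** * Rational places as walks *)

Lemma sum_count_const (V : Type) (s : seq V) (P : pred V) (c : nat) :
  (\sum_(i <- s | P i) c = count P s * c)%N.
Proof. by rewrite big_const_seq iter_addn_0 mulnC. Qed.

Lemma prod_count_const (F : fieldType) (V : Type) (s : seq V) (P : pred V) (c : F) :
  \prod_(i <- s | P i) c = c ^+ count P s.
Proof.
elim: s => [|x s IH]; first by rewrite big_nil expr0.
by rewrite big_cons IH /=; case: (P x); rewrite ?add0n // exprD expr1.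
Qed.

Section Walks.
Variables (V : eqType) (en : seq V) (e : rel V) (q : nat).
Hypotheses (q1 : (1 < q)%N) (en_all : forall x, x \in en) (out_le : forall x, (count (e x) en <= q)%N).

Fixpoint walks_from (m : nat) (x : V) : nat :=
  if m is m'.+1 then (\sum_(y <- en | e x y) walks_from m' y)%N else 1%N.
Fixpoint walks_to (m : nat) (y : V) : nat :=
  if m is m'.+1 then (\sum_(x <- en | e x y) walks_to m' x)%N else 1%N.

Lemma walks_from_le m x : (walks_from m x <= q ^ m)%N.
Proof.
elim: m x => [|m IH] x //=; apply: leq_trans (leq_sum _ (fun y _ => IH y)) _.
by rewrite sum_count_const expnS leq_mul2r out_le orbT.
Qed.

Lemma walks_from_S m x : (walks_from m.+1 x <= q * walks_from m x)%N.
Proof.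
elim: m x => [|m IH] x.
  by rewrite /= muln1 sum1_count.
rewrite -[walks_from m.+2 x]/(\sum_(y <- en | e x y) walks_from m.+1 y)%N.
rewrite -[walks_from m.+1 x]/(\sum_(y <- en | e x y) walks_from m y)%N.
by rewrite big_distrr; apply: leq_sum => y _; apply: IH.
Qed.

Lemma walks_concat n m :
  (\sum_(x <- en) walks_to (n + m) x = \sum_(x <- en) walks_to n x * walks_from m x)%N.
Proof.
elim: m n => [|m IH] n; first by rewrite addn0; apply: eq_bigr => x _; rewrite muln1.
rewrite addnS -addSn IH /=.
under eq_bigr do rewrite big_distrl.
rewrite (exchange_big_dep predT) //=; apply: eq_bigr => x _.
by rewrite big_distrr.
Qed.

(** The vertices from which the number of walks is maximal for every length form a set closed under
    successors, each with [q] of them. If that set is empty, a loss occurs from every vertex,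
    persists for greater lengths, and one length works for the finitely many vertices. *)
Lemma walks_decay :
  (forall C : pred V, (exists x, C x) ->
    (forall x, C x -> count (fun y => e x y && C y) en = q) -> False) ->
  exists M, forall x, (walks_from M x < q ^ M)%N.
Proof.
move=> noC; have ex x : exists m, (walks_from m x < q ^ m)%N.
  apply: contrapT => nx; pose C (y : V) := `[< forall m, walks_from m y = (q ^ m)%N >].
  apply: (noC C); first exists x.
    apply/asboolP => m; apply/eqP; rewrite eqn_leq walks_from_le leqNgt.
    by apply/negP => h; apply: nx; exists m.
  move=> y /asboolP hy; have o : count (e y) en = q by have := hy 1%N; rewrite /= sum1_count expn1.
  rewrite -[RHS]o; apply: eq_count => z; case ez: (e y z) => //=; apply/asboolP => m.
  have := hy m.+1; rewrite /= => s.
  have : (\sum_(z <- en | e y z) (q ^ m - walks_from m z) == 0)%N.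
    rewrite sumnB => [|w _]; last exact: walks_from_le.
    by rewrite s sum_count_const o expnS subnn.
  rewrite sum_nat_seq_eq0 => /allP /(_ z (en_all z)); rewrite ez /= subn_eq0 => h.
  by apply/eqP; rewrite eqn_leq walks_from_le.
have up m x : (walks_from m x < q ^ m)%N -> forall m', (m <= m')%N -> (walks_from m' x < q ^ m')%N.
  move=> h m' /subnK <-; elim: (m' - m)%N => //= l IH.
  rewrite addSn expnS; apply: leq_ltn_trans (walks_from_S _ _) _.
  by rewrite ltn_pmul2l // ltnW.
suff [M hM] : exists M, forall x, x \in en -> (walks_from M x < q ^ M)%N.
  by exists M => x; apply: hM.
elim: en => [|x s [M hM]]; first by exists 0%N.
have [m hm] := ex x; exists (maxn m M) => y; rewrite in_cons => /orP[/eqP ->|/hM h].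
  by apply: up hm _ (leq_maxl _ _).
by apply: up h _ (leq_maxr _ _).
Qed.
End Walks.

(** * The graph of the equation over the constants and its full sets *)

Section EdgeGraph.
Variables (k : fieldType) (q : nat) (al : k).
Hypotheses (q1 : (1 < q)%N) (al0 : al != 0) (qk : q%:R = 0 :> k).
Let q0 : (0 < q)%N. Proof. exact: ltnW. Qed.

Definition rhs (c : k) : k := c ^+ q / (al * (c + 1)) ^+ q.-1.
Definition lhs (c : k) : k := c * (c + 1) ^+ q.-1.
Definition edge (c c' : k) : bool :=
  [&& c != 0, c + 1 != 0, c' != 0, c' + 1 != 0 & lhs c' == rhs c].

Definition out_poly (v : k) : {poly k} := 'X * ('X - (-1)%:P) ^+ q.-1 - v%:P.
Definition in_poly (v : k) : {poly k} := 'X^q - v%:P * (al%:P * ('X - (-1)%:P)) ^+ q.-1.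

Lemma out_polyE v z : (out_poly v).[z] = lhs z - v.
Proof. by rewrite /out_poly hornerD hornerN hornerC hornerM hornerX horner_exp hornerXsubC opprK. Qed.

Lemma in_polyE v z : (in_poly v).[z] = z ^+ q - v * (al * (z + 1)) ^+ q.-1.
Proof. by rewrite /in_poly hornerD hornerN hornerXn hornerM horner_exp hornerM !hornerC hornerXsubC opprK. Qed.

Lemma out_poly_monic v : size (out_poly v) = q.+1 /\ out_poly v \is monic.
Proof.
have sA : size ('X * ('X - (-1)%:P) ^+ q.-1 : {poly k}) = q.+1.
  rewrite mulrC size_mulX ?monic_neq0 ?monic_exp ?monicXsubC //.
  by rewrite size_exp_XsubC prednK.
have mA : 'X * ('X - (-1)%:P) ^+ q.-1 \is @monic k.
  by rewrite monicMl ?monicX // monic_exp ?monicXsubC.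
have lt : (size (- v%:P)%R < size ('X * ('X - (-1)%:P) ^+ q.-1 : {poly k})%R)%N.
  by rewrite sA size_polyN (leq_ltn_trans (size_polyC_leq1 _)).
by rewrite /out_poly size_polyDl // monicE lead_coefDl // -monicE.
Qed.

Lemma in_poly_monic v : size (in_poly v) = q.+1 /\ in_poly v \is monic.
Proof.
have lt : (size (- (v%:P * (al%:P * ('X - (-1)%:P)) ^+ q.-1))%R < size ('X^q : {poly k})%R)%N.
  rewrite size_polyXn size_polyN ltnS !mul_polyC; apply: leq_trans (size_scale_leq _ _) _.
  by rewrite exprZn; apply: leq_trans (size_scale_leq _ _) _; rewrite size_exp_XsubC prednK.
by rewrite /in_poly size_polyDl // size_polyXn monicE lead_coefDl // lead_coefXn.
Qed.

Lemma edge_out c c' : edge c c' -> root (out_poly (rhs c)) c'.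
Proof. by case/and5P=> _ _ _ _ /eqP h; rewrite /root out_polyE h subrr. Qed.

Lemma edge_in c c' : edge c c' -> root (in_poly (lhs c')) c.
Proof.
case/and5P=> _ c1 _ _ /eqP h; rewrite /root in_polyE h divfK ?subrr // expf_neq0 //.
by rewrite mulf_neq0.
Qed.

Lemma count_out c (s : seq k) : uniq s -> (count (edge c) s <= q)%N.
Proof.
move=> us; have [sz mon] := out_poly_monic (rhs c).
rewrite -size_filter -ltnS -sz; apply: max_poly_roots; first exact: monic_neq0.
  by apply/allP => c'; rewrite mem_filter => /andP[/edge_out].
by rewrite filter_uniq.
Qed.

Lemma count_in c' (s : seq k) : uniq s -> (count (edge^~ c') s <= q)%N.
Proof.
move=> us; have [sz mon] := in_poly_monic (lhs c').
rewrite -size_filter -ltnS -sz; apply: max_poly_roots; first exact: monic_neq0.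
  by apply/allP => c; rewrite mem_filter => /andP[/edge_in].
by rewrite filter_uniq.
Qed.

Definition full (cs : seq k) := forall c, c \in cs -> count (edge c) cs = q.

(** Double counting of edges: out-degrees within [cs] are [q] and in-degrees are at most [q], so
    none can be smaller. *)
Lemma full_in cs : uniq cs -> full cs -> forall c', c' \in cs -> count (edge^~ c') cs = q.
Proof.
move=> us fl c' c's; apply/eqP; rewrite eqn_leq count_in //= leqNgt; apply/negP => lt.
have : (\sum_(y <- cs) count (edge^~ y) cs < \sum_(y <- cs) q)%N.
  rewrite !(bigD1_seq c' c's us) /= -addSn leq_add //.
  by apply: leq_sum => y _; apply: count_in.
rewrite (eq_bigr (fun y => \sum_(x <- cs) edge x y)%N) => [|y _]; last first.
  by rewrite -sum1_count big_mkcond; apply: eq_bigr => x _; case: (edge x y).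
rewrite exchange_big /= (eq_big_seq (fun=> q)) ?ltnn // => x xs.
have h := fl x xs; rewrite -[RHS]h -sum1_count [RHS]big_mkcond.
by apply: eq_bigr => y _; case: (edge x y).
Qed.

Lemma full_forward cs : uniq cs -> full cs -> forall c c', c \in cs -> edge c c' -> c' \in cs.
Proof.
move=> us fl c c' cs_ ecc; apply: contraT => nc.
have : (count (edge c) (c' :: cs) <= q)%N by apply: count_out; rewrite /= nc.
by rewrite /= ecc (fl c cs_) add1n ltnn.
Qed.

Section FunctionField.
Variables (F : fieldType) (iota : {rmorphism k -> F}).
Hypothesis frob : forall a b : F, (a + b) ^+ q = a ^+ q + b ^+ q.
Variables (X Y : F) (X1 : X + 1 != 0) (rXY : rel_eq iota q al X Y).

Definition vanish (cs : seq k) (z : F) : F := \prod_(c <- cs) (z - iota c).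

Lemma monic_roots_ev (P : {poly k}) (s : seq k) z : size P = q.+1 -> P \is monic -> uniq s ->
  all (root P) s -> size s = q -> ev iota z P = vanish s z.
Proof.
move=> sP mP us rs ss; have ur : uniq_roots s by rewrite uniq_rootsE.
have := all_roots_prod_XsubC _ rs ur; rewrite sP ss => /(_ erefl).
rewrite (eqP mP) scale1r => ->; rewrite /ev rmorph_prod /= horner_prod; apply: eq_bigr => c _.
by rewrite rmorphB /= map_polyX map_polyC /= hornerXsubC.
Qed.

(** The product of all [f - rhs c] contains each [Y - iota y] exactly [q] times, and that of all
    [f - lhs c], with denominators cleared, each [X - iota x] exactly [q] times. Since
    [lhs c' = rhs c] along edges, the two products have the same [q]th power. *)
Lemma full_identity cs : uniq cs -> full cs ->
  vanish cs X ^+ (q * q) = (iota al * (X + 1)) ^+ (q.-1 * size cs * q) * vanish cs Y ^+ (q * q).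
Proof.
move=> us fl; pose u := iota al * (X + 1); pose f := X ^+ q / u ^+ q.-1.
have u0 : u ^+ q.-1 != 0 by rewrite expf_neq0 // mulf_neq0 // fmorph_eq0.
have evo c z : c \in cs -> vanish [seq y <- cs | edge c y] z = z * (z + 1) ^+ q.-1 - iota (rhs c).
  move=> cc; have [sP mP] := out_poly_monic (rhs c).
  rewrite -(monic_roots_ev z sP mP) ?filter_uniq ?size_filter ?fl //.
    by rewrite /out_poly evB ev_mul ev_exp evB evX_ !evC_ rmorphN rmorph1 opprK.
  by apply/allP => y; rewrite mem_filter => /andP[/edge_out].
have evi c z : c \in cs -> vanish [seq x <- cs | edge x c] z = z ^+ q - iota (lhs c) * (iota al * (z + 1)) ^+ q.-1.
  move=> cc; have [sP mP] := in_poly_monic (lhs c).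
  rewrite -(monic_roots_ev z sP mP) ?filter_uniq ?size_filter ?(full_in us fl cc) //.
    by rewrite /in_poly evB !ev_exp !ev_mul ev_exp ev_mul evB evX_ !evC_ rmorphN rmorph1 opprK.
  by apply/allP => y; rewrite mem_filter => /andP[/edge_in].
have vf (P : pred k) z : vanish [seq y <- cs | P y] z = \prod_(y <- cs | P y) (z - iota y).
  by rewrite /vanish big_filter.
have vY : vanish cs Y ^+ q = \prod_(c <- cs) (f - iota (rhs c)).
  rewrite [RHS](eq_big_seq (fun c => \prod_(y <- cs | edge c y) (Y - iota y))); last first.
    by move=> c cc; rewrite -vf evo // rXY.
  rewrite (exchange_big_dep predT) //= -prodrXl; apply: eq_big_seq => y yy.
  by rewrite prod_count_const (full_in us fl yy).
have vX : vanish cs X ^+ q = u ^+ (q.-1 * size cs) * \prod_(c <- cs) (f - iota (lhs c)).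
  have -> : u ^+ (q.-1 * size cs) = \prod_(c <- cs) u ^+ q.-1 by rewrite prod_count_const count_predT exprM.
  rewrite -big_split /=.
  rewrite [RHS](eq_big_seq (fun c => \prod_(x <- cs | edge x c) (X - iota x))); last first.
    by move=> c cc; rewrite -vf evi // mulrBr mulrCA mulfV // mulr1 mulrC.
  rewrite (exchange_big_dep predT) //= -prodrXl; apply: eq_big_seq => x xx.
  by rewrite prod_count_const (fl x xx).
rewrite [vanish cs X ^+ _]exprM [vanish cs Y ^+ _]exprM vX vY exprMn -exprM; congr (_ * _).
rewrite -!prodrXl; transitivity (\prod_(c <- cs) \prod_(x <- cs | edge x c) (f - iota (lhs c))).
  by apply: eq_big_seq => c cc; rewrite prod_count_const (full_in us fl cc).
rewrite (exchange_big_dep predT) //=; apply: eq_big_seq => x xx.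
transitivity (\prod_(c <- cs | edge x c) (f - iota (rhs x))).
  by apply: eq_bigr => c /and5P[_ _ _ _ /eqP ->].
by rewrite prod_count_const (fl x xx).
Qed.

Lemma vanish_congr cs (P : place iota) (dP : discrete P) : 0 \notin cs -> 0 < valuation P X ->
  X != 0 -> valuation P (vanish cs X) = 0 /\ vanish cs X != 0.
Proof.
move=> n0 vX X0; elim: cs n0 => [|c cs IH].
  by move=> _; rewrite /vanish big_nil val1 ?oner_neq0.
rewrite in_cons negb_or eq_sym => /andP[c0 /IH [v0 h0]].
have ic : iota c != 0 by rewrite fmorph_eq0.
have nic : - iota c != 0 by rewrite oppr_eq0.
have [|h1 e1] := val_addl dP nic (_ : vge P (valuation P (- iota c) + 1) X).
  by right; rewrite (valN dP) (valC dP) add0r; move: vX; case: (valuation P X) => [[|?]|?].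
rewrite addrC in h1 e1; rewrite /vanish big_cons -/(vanish cs X).
by rewrite mulf_neq0 // (valM dP) // v0 e1 (valN dP) (valC dP).
Qed.
End FunctionField.

(* The zero of [x_0] and [x_1], where [x_1] vanishes to a higher order than [x_0], separates
   two disjoint full sets. *)
Lemma full_unique (F : fieldType) (iota : {rmorphism k -> F})
    (frob : forall a b : F, (a + b) ^+ q = a ^+ q + b ^+ q) (X Y : F)
    (P : place iota) (dP : discrete P) (ss cs : seq k) :
  rel_eq iota q al X Y -> X != 0 -> Y != 0 -> 0 < valuation P X -> valuation P Y = q%:Z * valuation P X ->
  uniq ss -> uniq cs -> full ss -> full cs -> 0 \notin ss -> 0 \notin cs ->
  ss != [::] -> (forall c, c \in ss -> c \notin cs) -> cs = [::].
Proof.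
move=> r X0 Y0 vX vY us uc fs fc ns nc ss0 dis; apply/eqP; apply: contraT => cs0.
have vY0 : 0 < valuation P Y by rewrite vY pmulr_rgt0.
have [_ [X1 _ _]] := small_ring dP X0 vX.
have frobI (a b : F) : a ^+ q = b ^+ q -> a = b.
  move=> e; apply/eqP; rewrite -subr_eq0; have : (a - b) ^+ q == 0.
    have := frob (a - b) b; rewrite subrK e => /eqP.
    by rewrite -[X in X == _]add0r eq_sym => /eqP/addIr ->.
  by rewrite expf_eq0 => /andP[].
(* The exponents make the factors [iota al * (X + 1)] of the two identities equal, so that they
   cancel in the quotient of [A] by [B]. *)
pose A : {poly k} := (\prod_(c <- ss) ('X - c%:P)) ^+ size cs.
pose B : {poly k} := (\prod_(c <- cs) ('X - c%:P)) ^+ size ss.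
have evv s z : ev iota z (\prod_(c <- s) ('X - c%:P)) = vanish iota s z.
  rewrite /ev rmorph_prod /= horner_prod; apply: eq_bigr => c _.
  by rewrite rmorphB /= map_polyX map_polyC /= hornerXsubC.
have eA z : ev iota z A = vanish iota ss z ^+ size cs by rewrite ev_exp evv.
have eB z : ev iota z B = vanish iota cs z ^+ size ss by rewrite ev_exp evv.
have i1 := full_identity X1 r us fs; have i2 := full_identity X1 r uc fc.
have main : ev iota X A * ev iota Y B = ev iota Y A * ev iota X B.
  apply: (frobI _ _ (frobI _ _ _)); rewrite -!exprM !exprMn !eA !eB -!exprM.
  have sw m (z : F) : z ^+ (m * (q * q)) = (z ^+ (q * q)) ^+ m by rewrite mulnC exprM.
  rewrite !sw i1 i2 !exprMn -!exprM.
  have -> : (q.-1 * size ss * q * size cs = q.-1 * size cs * q * size ss)%N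
    by rewrite -!mulnA; congr (_ * _)%N; rewrite mulnCA (mulnC (size ss)) mulnCA.
  ring.
(* Up to a constant, [R / B] is [A / B] minus its value at 0. It vanishes at 0 to some order
   [m > 0], so equal values at [X] and [Y] would require [m v X = m q v X]. *)
pose R : {poly k} := B.[0]%:P * A - A.[0]%:P * B.
have nz0 (s : seq k) : 0 \notin s -> (\prod_(c <- s) ('X - c%:P) : {poly k}).[0] != 0.
  by move=> h; rewrite -[_ == 0]/(root _ 0) root_prod_XsubC.
have A0 : A.[0] != 0 by rewrite horner_exp expf_neq0 // nz0.
have B0 : B.[0] != 0 by rewrite horner_exp expf_neq0 // nz0.
have scs : (0 < size cs)%N by rewrite lt0n size_eq0.
have R0 : R != 0.
  case es : ss ss0 => [|s0 ss'] // _; have s0s : s0 \in ss by rewrite es mem_head.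
  apply/eqP => R0; have : R.[s0] = 0 by rewrite R0 horner0.
  rewrite /R hornerD hornerN !hornerM !hornerC.
  have -> : A.[s0] = 0.
    by apply/eqP; rewrite horner_exp expf_eq0 scs -[_ == 0]/(root _ s0) root_prod_XsubC.
  rewrite mulr0 sub0r => /eqP; rewrite oppr_eq0 mulf_eq0 (negbTE A0) horner_exp expf_eq0.
  by rewrite -[_ == 0]/(root _ s0) root_prod_XsubC (negbTE (dis _ s0s)) andbF.
have RE : ev iota X R * ev iota Y B = ev iota Y R * ev iota X B.
  rewrite /R !evB !ev_mul !evC_ !mulrBl -!mulrA main; congr (_ - _); ring.
have R00 : R.[0] = 0 by rewrite /R hornerD hornerN !hornerM !hornerC mulrC subrr.
have [m [D nD eR]] : exists m, exists2 D : {poly k}, ~~ root D 0 & R = D * 'X^m.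
  by have [m [D nD ->]] := multiplicity_XsubC R 0; exists m, D; rewrite ?subr0 // R0 in nD *.
have m0 : (0 < m)%N.
  by case: m eR => [eR|//]; move: nD; rewrite /root -[D]mulr1 -(expr0 'X) -eR R00 eqxx.
have vD z : 0 < valuation P z -> z != 0 -> valuation P (ev iota z D) = 0 /\ ev iota z D != 0.
  move=> vz z0; have Oz : place_ring P z by rewrite (val_ring dP) // ltW.
  have [D' eD] : exists D' : {poly k}, D = D' * 'X + D.[0]%:P.
    have /factor_theorem [D' e] : root (D - D.[0]%:P) 0 by rewrite /root hornerD hornerN hornerC subrr.
    by exists D'; apply/eqP; rewrite -subr_eq -[X in _ == _ * X]subr0 -e.
  have d0 : iota D.[0] != 0 by rewrite fmorph_eq0.
  have [|h e] := val_addl dP d0 (_ : vge P (valuation P (iota D.[0]) + 1) (ev iota z D' * z)).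
    rewrite (valC dP); apply: (vgeM dP); first by apply/(vge0 dP); exact: place_ring_ev.
    by right; move: vz; case: (valuation P z) => [[|?]|?].
  by rewrite eD evD ev_mul evX_ evC_ addrC h e valC.
have vB z : 0 < valuation P z -> z != 0 -> valuation P (ev iota z B) = 0 /\ ev iota z B != 0.
  move=> vz z0; have [v0 h0] := vanish_congr dP nc vz z0.
  by rewrite eB expf_neq0 // valX // v0 mul0rn.
have [vDX DX] := vD X vX X0; have [vDY DY] := vD Y vY0 Y0.
have [vBX BX] := vB X vX X0; have [vBY BY] := vB Y vY0 Y0.
have eRz z : ev iota z R = ev iota z D * z ^+ m by rewrite eR ev_mul ev_exp evX_.
have := congr1 (valuation P) RE; rewrite !eRz.
rewrite !valM ?mulf_neq0 ?expf_neq0 // !valX // vDX vDY vBX vBY !add0r !addr0 vY.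
rewrite -(mulr_natr (valuation P X)) -(mulr_natr (_ * _)) !natz.
move: (valuation P X) vX m0 q1; clear => v vX m0 q1 h.
suff : 0 < (q%:Z - 1) * v * m%:Z by lia.
by rewrite !mulr_gt0 // subr_gt0.
Qed.
End EdgeGraph.

(** * Residues in the constant field *)

Section Congruence.
Variables (k F : fieldType) (iota : {rmorphism k -> F}) (P : place iota) (dP : discrete P).

Definition cong (z : F) (c : k) : Prop := vge P 1 (z - iota c).

Lemma cong_ring z c : cong z c -> place_ring P z.
Proof.
move=> h; rewrite -(subrK (iota c) z); apply: ringD; last exact: ringC.
by apply/(vge0 dP); apply: vge_le h.
Qed.

Lemma congC c : cong (iota c) c. Proof. by rewrite /cong subrr; apply: vge_0. Qed.

Lemma congD y z b c : cong y b -> cong z c -> cong (y + z) (b + c).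
Proof.
rewrite /cong => hy hz; have -> : y + z - iota (b + c) = (y - iota b) + (z - iota c) by rewrite rmorphD; ring.
exact: (vgeD dP).
Qed.

Lemma congM y z b c : cong y b -> cong z c -> cong (y * z) (b * c).
Proof.
move=> hy hz; have Oz := cong_ring hz; move: hy hz; rewrite /cong => hy hz.
have -> : y * z - iota (b * c) = (y - iota b) * z + (z - iota c) * iota b by rewrite rmorphM; ring.
by apply: (vgeD dP); apply: (vge_ringM dP) => //; apply: ringC.
Qed.

Lemma congX z c n : cong z c -> cong (z ^+ n) (c ^+ n).
Proof.
move=> h; elim: n => [|n IH]; first by rewrite !expr0 -(rmorph1 iota); apply: congC.
by rewrite !exprS; apply: congM.
Qed.

Lemma cong_inj z b c : cong z b -> cong z c -> b = c.
Proof.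
move=> hb hc; apply/eqP; rewrite -subr_eq0; apply: contraT => bc.
have : vge P 1 (iota (b - c)).
  have -> : iota (b - c) = (z - iota c) - (z - iota b) by rewrite rmorphB; ring.
  exact: (vgeB dP).
have b0 : iota (b - c) != 0 by rewrite fmorph_eq0.
by move=> /(vge_val P 1 b0); rewrite (valC dP).
Qed.

Lemma cong_unit z c : c != 0 -> cong z c -> place_unit P z.
Proof.
move=> c0 h; have ic : iota c != 0 by rewrite fmorph_eq0.
have [z0 e] : z != 0 /\ valuation P z = 0.
  have [|] := val_addl dP ic (_ : vge P (valuation P (iota c) + 1) (z - iota c)).
    by rewrite (valC dP).
  by rewrite addrC subrK (valC dP).
exact: unit_val.
Qed.

Lemma cong0_val z : z != 0 -> cong z 0 -> 0 < valuation P z.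
Proof. by move=> z0; rewrite /cong rmorph0 subr0 gtz0_ge1 => /(vge_val P 1 z0). Qed.

Lemma congV z c : c != 0 -> cong z c -> cong z^-1 c^-1.
Proof.
move=> c0 h; have [z0 Oz Ozi] := cong_unit c0 h; have ic : iota c != 0 by rewrite fmorph_eq0.
rewrite /cong fmorphV; have -> : z^-1 - (iota c)^-1 = (z - iota c) * (- (z^-1 * (iota c)^-1)).
  by field; rewrite z0 ic.
apply: (vge_ringM dP) => //; apply: ringN; apply: ringM => //.
by rewrite -fmorphV; apply: ringC.
Qed.

Lemma cong_val z c : z != 0 -> c != 0 -> cong z c -> valuation P z = 0.
Proof. by move=> z0 c0 /(cong_unit c0) /(val_unit dP). Qed.

Lemma residue : finite_degree P -> place_degree P = 1%N -> forall z, place_ring P z -> exists c, cong z c.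
Proof.
move=> fP d1 z Oz; have := qdim_residue dP fP; rewrite d1 => -[phi [lin ker _]].
have O1 : vge P 0 1 by apply/(vge0 dP); apply: ring1.
have p1 : phi 1 0 0 != 0.
  apply: contraT; rewrite negbK => /eqP e; have : vge P 1 1.
    by apply/(ker _ O1); apply/rowP => i; rewrite ord1 mxE.
  by move=> /(vge_val P 1 (oner_neq0 _)); rewrite (val1 dP).
have Oz' : vge P 0 z by apply/(vge0 dP).
pose c := phi z 0 0 / phi 1 0 0; exists c; rewrite /cong -[iota c]mulr1.
have -> : z - iota c * 1 = iota (- c) * 1 + z by rewrite rmorphN; ring.
apply/ker; first by apply: (vgeD dP) => //; rewrite -[0]addr0; apply: vgeM => //; apply: vgeC.
rewrite lin //; apply/rowP => i; rewrite ord1 !mxE /c mulNr divfK //; exact: addNr.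
Qed.
End Congruence.

(** * The fibre over a place where [x] and [x + 1] are units *)

Section GenericFibre.
Variables (k F F' : fieldType) (iota : {rmorphism k -> F}) (iota' : {rmorphism k -> F'})
  (j : {rmorphism F -> F'}).
Hypothesis jc : forall c, j (iota c) = iota' c.
Variables (q : nat) (al : k).
Hypotheses (q1 : (1 < q)%N) (al0 : al != 0).
Hypothesis frob : forall a b : F', (a + b) ^+ q = a ^+ q + b ^+ q.
Variables (x : F) (Y : F').
Hypotheses (x0 : x != 0) (x10 : x + 1 != 0) (Y0 : Y != 0) (Y10 : Y + 1 != 0).
Let f := x ^+ q / (iota al * (x + 1)) ^+ q.-1.
Hypothesis rY : Y * (Y + 1) ^+ q.-1 = j f.
Local Notation Z := (Y + 1)^-1.
Hypotheses (gY : generator j q Y) (gZ : generator j q Z).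
Variables (P' : place iota) (dP' : discrete P') (fP' : finite_degree P')
  (dP : forall P : place iota', discrete P).
Variables (c0 : k) (c00 : c0 != 0) (c01 : c0 + 1 != 0) (xc : cong P' x c0).
Let q0 : (0 < q)%N. Proof. exact: ltnW. Qed.
Let dep := ev_dep gZ.1.

Let x1c : cong P' (x + 1) (c0 + 1).
Proof. by apply: congD => //; rewrite -(rmorph1 iota); apply: congC. Qed.
Let vx : valuation P' x = 0. Proof. exact: (cong_val dP' x0 c00 xc). Qed.
Let vx1 : valuation P' (x + 1) = 0. Proof. exact: (cong_val dP' x10 c01 x1c). Qed.

Let fc : cong P' f (rhs q al c0).
Proof.
have h : cong P' ((iota al * (x + 1)) ^+ q.-1) ((al * (c0 + 1)) ^+ q.-1).
  by apply: congX => //; apply: congM => //; apply: congC.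
apply: congM => //; first exact: congX.
by apply: congV => //; rewrite expf_neq0 // mulf_neq0.
Qed.

Lemma over_cong (P : place iota') z c : over j P P' -> cong P' z c -> cong P (j z) c.
Proof.
move=> PP; rewrite /cong -jc -rmorphB; have [r0 rv] := ramP dep PP dP'.
move=> [->|h]; first by rewrite rmorph0; left.
right; rewrite rv; move: (valuation P' _) (ram j P P') h r0; clear => v r h r0.
by rewrite -[1]mulr1 ler_pM.
Qed.

Lemma generic_edge (P : place iota') c : over j P P' -> c != 0 -> c + 1 != 0 -> cong P Y c -> edge q al c0 c.
Proof.
move=> PP h0 h1 Yc; rewrite /edge c00 c01 h0 h1 /=; apply/eqP.
apply: (cong_inj (dP P) (z := j f)); last exact: over_cong.
rewrite -rY; apply: congM => //; apply: congX => //; apply: congD => //.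
by rewrite -(rmorph1 iota'); apply: congC.
Qed.

(** The leading exponents are all 0 and [Z] is integral, so the leading term of an integral
    polynomial can be split off repeatedly. *)
Lemma generic_integral_coef z : integral_at iota' j P' z ->
  exists2 p : {poly F}, (forall i, place_ring P' p`_i) & ev j Z p = z.
Proof.
have [_ [tv _] iZ _] := generic_unram jc q1 al0 frob x0 x10 Y10 rY gZ dP' fP' dP vx vx1.
have [p sp <-] := gZ.1 z => ip; exists p => //.
have [m] := ubnP (size p); elim: m p sp ip => // m IH p sp ip.
rewrite ltnS => sm i; have [->|p0] := eqVneq p 0; first by rewrite coef0; apply: ring0.
have sp1 : (size p <= (size p).-1.+1)%N by exact: leqSpred.
have Ol : place_ring P' (lead_coef p) by apply/(vge0 dP'); apply: (tv p).
pose r := p - lead_coef p *: 'X^((size p).-1).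
have sr : (size r < size p)%N.
  rewrite -[X in (_ < X)%N](prednK (_ : 0 < size p)%N) ?size_poly_gt0 // ltnS; apply/leq_sizeP => l hl.
  rewrite coefB coefZ coefXn; case: eqP => [->|/eqP ne]; first by rewrite mulr1 subrr.
  rewrite mulr0 subr0; apply: nth_default; move: sp1 => /leq_trans; apply.
  by rewrite ltn_neqAle eq_sym ne hl.
have ir : integral_at iota' j P' (ev j Z r).
  move=> P PP; rewrite /r evB; apply: ringB; first exact: ip.
  rewrite evZ; apply: ringM; first by rewrite PP.
  by rewrite /ev map_polyXn hornerXn; apply: ringX; apply: iZ.
have := IH r (leq_trans (ltnW sr) sp) ir (leq_trans sr sm) i.
rewrite /r coefB coefZ coefXn => h.
rewrite -(subrK (lead_coef p * (i == (size p).-1)%:R) p`_i); apply: ringD => //.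
by apply: ringM => //; case: (i == _); [apply: ring1 | apply: ring0].
Qed.

(** Integral functions are polynomials in [Z] with integral coefficients from below, so their values
    modulo a place are governed by the residue of [Z]. Two places above [P'] with the same residue
    could not be separated, against weak approximation. *)
Lemma generic_unique (P R : place iota') c : over j P P' -> over j R P' -> c + 1 != 0 ->
  cong P Y c -> cong R Y c -> P = R.
Proof.
move=> PP RR h1 Pc Rc; apply/eqP; apply: contraT => PR.
have [s [us hs]] := finite_over jc dep dP' fP' dP.
have Ps : P \in s by apply/hs. have Rs : R \in s by apply/hs.
have nP : P \notin rem P s by rewrite mem_rem_uniqF.
have [w [wP wo]] := approx1 dP 1 nP.
have wR : vge R 1 (w - 1) by apply: wo; rewrite mem_rem_uniq // inE eq_sym PR.
have iw : integral_at iota' j P' w.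
  move=> S SS; apply/(vge0 (dP S)); have [->|SP] := eqVneq S P; first exact: vge_le wP.
  rewrite -(subrK 1 w); apply: (vgeD (dP S)); last by apply/(vge0 (dP S)); apply: ring1.
  apply: (vge_le (n := 1)) => //; apply: wo; rewrite mem_rem_uniq // inE SP.
  exact/hs.
have [p Op ep] := generic_integral_coef iw.
pose zt := (c + 1)^-1; pose W := p.[iota zt].
have Zc (S : place iota') : cong S Y c -> cong S Z zt.
  move=> h; apply: congV => //; apply: congD => //; rewrite -(rmorph1 iota'); exact: congC.
have diff (S : place iota') : over j S P' -> cong S Y c -> vge S 1 (w - j W).
  move=> SS Sc; have hz := Zc S Sc.
  rewrite -ep (evE _ _ (leqnn _)) /W horner_coef rmorph_sum -sumrB; apply: (vge_sum (dP S)) => i _.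
  rewrite rmorphM rmorphXn jc -mulrBr mulrC; apply: (vge_ringM (dP S)); last by rewrite SS.
  by rewrite -rmorphXn; apply: (congX (dP S)).
have jW (S : place iota') : over j S P' -> (vge S 1 (j W) <-> vge P' 1 W).
  move=> SS; have [r0 rv] := ramP dep SS dP'.
  have [->|W0] := eqVneq W 0; first by rewrite rmorph0; split=> _; left.
  have jW0 : j W != 0 by rewrite fmorph_eq0.
  by split=> [/(vge_val S 1 jW0)|/(vge_val P' 1 W0)] h; apply/vge_val => //; move: h; rewrite rv -!gtz0_ge1 pmulr_lgt0.
have WP : vge P' 1 W.
  apply/(jW P PP); have -> : j W = w - (w - j W) by ring.
  by apply: (vgeB (dP P)) => //; apply: diff.
have : vge R 1 1.
  have -> : 1 = (w - j W) + j W - (w - 1) by ring.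
  apply: (vgeB (dP R)) => //; apply: (vgeD (dP R)); first exact: diff.
  exact/(jW R RR).
by move=> /(vge_val R 1 (oner_neq0 _)); rewrite (val1 (dP R)).
Qed.

(** Modulo [P'] the equation splits into distinct factors [Y - c']; [root_place] supplies a place
    where all of them except the one of [c] are units. *)
Lemma generic_exists (outs : seq k) (qk : q%:R = 0 :> k) : uniq outs -> size outs = q ->
  all (edge q al c0) outs -> forall c, c \in outs -> exists P : place iota', over j P P' /\ cong P Y c.
Proof.
move=> uo so eo c co; have [sP mP] := out_poly_monic q1 (rhs q al c0).
have ro : all (root (out_poly q (rhs q al c0))) outs.
  by apply/allP => c' /(allP eo); apply: edge_out.
have evo (G : fieldType) (io : {rmorphism k -> G}) z :
    z * (z + 1) ^+ q.-1 - io (rhs q al c0) = \prod_(c' <- outs) (z - io c').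
  rewrite -[RHS]/(vanish io outs z) -(monic_roots_ev io z sP mP uo ro so).
  by rewrite /out_poly evB ev_mul ev_exp evB evX_ !evC_ rmorphN rmorph1 opprK.
have Of : place_ring P' f by apply: cong_ring fc.
pose psi : {poly F} := 'X * ('X - (-1)%:P) ^+ q.-1 - f%:P.
have sA : size ('X * ('X - (-1)%:P) ^+ q.-1 : {poly F}) = q.+1.
  rewrite mulrC size_mulX ?monic_neq0 ?monic_exp ?monicXsubC //.
  by rewrite size_exp_XsubC prednK.
have mA : 'X * ('X - (-1)%:P) ^+ q.-1 \is @monic F.
  by rewrite monicMl ?monicX // monic_exp ?monicXsubC.
have lt : (size (- f%:P)%R < size ('X * ('X - (-1)%:P) ^+ q.-1 : {poly F})%R)%N.
  by rewrite sA size_polyN (leq_ltn_trans (size_polyC_leq1 _)).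
have spsi : size psi = q.+1 by rewrite size_polyDl.
have mpsi : psi \is monic by rewrite monicE lead_coefDl // -monicE.
have epsi : ev j Y psi = 0 by rewrite evB ev_mul ev_exp evB evX_ !evC_ rmorphN rmorph1 opprK rY subrr.
have OXc (d : F) : place_ring P' d -> Ocoef P' ('X - d%:P).
  by move=> Od; apply: OcoefB; [apply: OcoefX | apply: OcoefC].
have Opsi : Ocoef P' psi.
  by apply: OcoefB; [apply: OcoefM; [apply: OcoefX | apply: Ocoef_exp; apply: OXc; apply: ringN; apply: ring1] | apply: OcoefC].
pose h : {poly F} := \prod_(c' <- rem c outs) ('X - (iota c')%:P).
have Oh : Ocoef P' h.
  rewrite /h; elim: (rem c outs) => [|c' s IH]; rewrite ?big_nil ?big_cons; first by rewrite -polyC1; apply: OcoefC; apply: ring1.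
  by apply: OcoefM => //; apply: OXc; apply: ringC.
have va : vge P' 1 psi.[iota c].
  rewrite /psi hornerD hornerN hornerC hornerM hornerX horner_exp hornerXsubC opprK.
  have -> : iota c * (iota c + 1) ^+ q.-1 = iota (rhs q al c0).
    have := allP eo c co; case/and5P=> _ _ _ _ /eqP <-.
    by rewrite /lhs rmorphM rmorphXn rmorphD rmorph1.
  by rewrite -opprB; apply: (vgeN dP').
have uh : place_unit P' h.[iota c].
  rewrite /h horner_prod; have ex : {in rem c outs, forall c', c' != c}.
    by move=> c'; rewrite mem_rem_uniq // inE => /andP[].
  elim: (rem c outs) ex => [|c' s IH] ex; rewrite ?big_nil ?big_cons; first exact: unit1.
  apply: unitM; last by apply: IH => c'' hc; apply: ex; rewrite in_cons hc orbT.
  by rewrite hornerXsubC -rmorphB; apply: unitC; rewrite subr_eq0 eq_sym ex ?mem_head.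
have [P [PP up]] := root_place jc dP' gY mpsi spsi Opsi epsi (ringC P' c) va Oh uh.
exists P; split=> //.
have := evo F' iota' Y; rewrite rY (perm_big _ (perm_to_rem co)) big_cons /= => e.
have eh : ev j Y h = \prod_(c' <- rem c outs) (Y - iota' c').
  rewrite /h /ev rmorph_prod horner_prod; apply: eq_bigr => c' _ /=.
  by rewrite rmorphB /= map_polyX map_polyC /= hornerXsubC jc.
rewrite -eh in e; apply: (vge_unitM (dP P) up); rewrite -e.
exact: over_cong.
Qed.

(** [q] places already exhaust the fundamental inequality, so each contributes exactly 1. *)
Lemma generic_degree (Ps : seq (place iota')) : place_degree P' = 1%N -> uniq Ps -> size Ps = q ->
  (forall P, P \in Ps -> over j P P') -> forall P, P \in Ps -> place_degree P = 1%N.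
Proof.
move=> d1 us sz ov P Pin; have fP R : R \in Ps -> finite_degree R by move=> /ov; apply: (over_deg_fin jc dP' fP' gZ).
have le := over_ineq jc dP' fP' dP gZ us ov; rewrite d1 muln1 in le.
have ge1 R : R \in Ps -> (1 <= ram j R P' * place_degree R)%N.
  by move=> Ri; have [r0 _] := ramP dep (ov R Ri) dP'; rewrite muln_gt0 r0 degree_pos //; apply: fP.
apply/eqP; rewrite eqn_leq degree_pos ?andbT //; last exact: fP.
rewrite leqNgt; apply/negP => gt.
have : (q < \sum_(R <- Ps) ram j R P' * place_degree R)%N.
  have e1 : size Ps = (1 + \sum_(R <- Ps | R != P) 1)%N by rewrite -sum1_size (bigD1_seq P Pin us).
  have [r0 _] := ramP dep (ov P Pin) dP'.
  rewrite (bigD1_seq P Pin us) /= -sz e1 -addSn leq_add //; first by rewrite (leq_trans gt) // leq_pmull.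
  by rewrite big_seq_cond [leqRHS]big_seq_cond; apply: leq_sum => R /andP[/ge1].
by rewrite ltnNge le.
Qed.
End GenericFibre.

(** * Places and their walks of residues *)

Section PlaceCounting.
Variables (k : fieldType) (q : nat) (al : k) (E : tower k) (x : forall n, E n).
Hypotheses (rc : recursively_defined q al x) (q1 : (1 < q)%N) (al0 : al != 0).
Hypothesis frob : forall m (a b : E m), (a + b) ^+ q = a ^+ q + b ^+ q.
Variable en : seq k.
Hypotheses (uen : uniq en) (en_all : forall c, c \in en).
Local Notation cst := (tower_const E).
Local Notation inc := (tower_incl E).

Let dE n (P : place (cst n)) : discrete P.
Proof. by have [Pinf [Q lv]] := level_tower rc q1 al0 frob n; apply: (riemann_disc (lv_riemann lv)). Qed.
Let fE n (P : place (cst n)) : finite_degree P.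
Proof. by have [Pinf [Q lv]] := level_tower rc q1 al0 frob n; apply: (riemann_deg (lv_riemann lv)). Qed.
Let nz n : x n != 0 /\ x n + 1 != 0.
Proof. by have [h _] := chain_tower rc q1 al0 n; have := h n (leqnn n); rewrite tower_var_top. Qed.
Let gZ n : generator (inc n) q (x n.+1 + 1)^-1.
Proof. by have [] := generator_tower rc q1 al0 n. Qed.
Let gY n : generator (inc n) q (x n.+1).
Proof. by have [] := generator_tower rc q1 al0 n. Qed.

Definition good n (c : k) (P : place (cst n)) : Prop :=
  [/\ place_degree P = 1%N, c != 0, c + 1 != 0 & cong P (x n) c].

Lemma edge_above n (P : place (cst n.+1)) :
  edge_spec q P (inc n (x n)) (x n.+1).
Proof.
have := chain_edge q1 al0 (dE P) (chain_tower rc q1 al0 n.+1) (ltnSn n).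
by rewrite tower_var_top tower_var_incl // tower_var_top.
Qed.

Lemma good_step n c (P : place (cst n.+1)) : good c P -> exists P' c',
  [/\ over (inc n) P P', good c' P' & edge q al c' c].
Proof.
move=> [d1 c0 c1 Pc]; have [P' PP] := exists_rest (tower_compat E n) (ev_dep (gZ n).1) P.
have [[x0 x1] [y0 y1]] := (nz n, nz n.+1).
have Pc1 : cong P (x n.+1 + 1) (c + 1) by apply: congD => //; rewrite -(rmorph1 (cst n.+1)); apply: congC.
have vy := cong_val (dE P) y0 c0 Pc; have vy1 := cong_val (dE P) y1 c1 Pc1.
have [vx vx1] : valuation P (inc n (x n)) = 0 /\ valuation P (inc n (x n) + 1) = 0.
  by case: (edge_above P); rewrite ?vy ?vy1 ?ltxx.
have d1' : place_degree P' = 1%N.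
  apply/eqP; rewrite eqn_leq degree_pos // andbT -d1.
  exact: (over_degree_le (tower_compat E n) (dE P') (fE P') (@dE _) (gZ n) PP).
have Ox : place_ring P' (x n) by rewrite -PP (val_ring (dE P)) ?fmorph_eq0 // vx.
have [c' xc] := residue (dE P') (fE P') d1' Ox.
have jxc := over_cong (tower_compat E n) (gZ n) (dE P') PP xc.
have c'0 : c' != 0.
  apply/eqP => e; rewrite e in jxc; have := cong0_val (_ : inc n (x n) != 0) jxc.
  by rewrite vx fmorph_eq0 x0 => /(_ isT).
have c'1 : c' + 1 != 0.
  apply/eqP => e; have : cong P (inc n (x n) + 1) (c' + 1).
    by apply: congD => //; rewrite -(rmorph1 (cst n.+1)); apply: congC.
  rewrite e => /(cong0_val (_ : inc n (x n) + 1 != 0)).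
  by rewrite vx1 -(rmorph1 (inc n)) -rmorphD fmorph_eq0 x1 => /(_ isT).
exists P', c'; split=> //.
by apply: (generic_edge (tower_compat E n) al0 (rec_equation rc n) (gZ n) (dE P') (@dE _) c'0 c'1 xc PP).
Qed.

Lemma over_rest n (P : place (cst n.+1)) (P1 P2 : place (cst n)) : over (inc n) P P1 -> over (inc n) P P2 -> P1 = P2.
Proof. by move=> h1 h2; apply: (place_maximal (dE P1)) => z; rewrite -h1 -h2. Qed.

(** By [generic_unique] a good place is determined by the place below it and the residue of the last
    generator, and consecutive residues are joined by an edge; so places inject into walks. *)
Lemma good_count n c (s : seq (place (cst n))) : uniq s -> (forall P, P \in s -> good c P) ->
  (size s <= walks_to en (edge q al) n c)%N.
Proof.
have tx := transcendentalP (rec_transcendental rc); have fx := fractionsP tx (rec_rational rc).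
elim: n c s => [|n IH] c s us hs.
  case: s us hs => [|P [|R s]] // /andP[nP _] hs; have x0c : x 0%N - cst 0 c != 0.
    by rewrite -(evX_ (cst 0) (x 0%N)) -(evC_ (cst 0) (x 0%N)) -evB ev_neq0 // polyXsubC_eq0.
  have lin P' : P' \in [:: P, R & s] -> 0 < valuation P' (x 0%N - cst 0 c).
    by move=> /hs [_ _ _] /(vge_val P' 1 x0c).
  have [_ _ u] := linear_place tx fx (lin P (mem_head _ _)).
  by case/negP: nP; rewrite (u R) ?mem_head // lin // !inE eqxx orbT.
have [f hf] : exists f : place (cst n.+1) -> place (cst n) * k, forall P, P \in s ->
    [/\ over (inc n) P (f P).1, good (f P).2 (f P).1 & edge q al (f P).2 c].
  apply: (ex_choice (P := fun (P : place (cst n.+1)) (b : place (cst n) * k) => P \in s ->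
    [/\ over (inc n) P b.1, good b.2 b.1 & edge q al b.2 c])) => P.
  have [/hs /good_step [P' [c' h]]|nP] := boolP (P \in s); first by exists (P', c').
  by have [P0 _] := level_tower rc q1 al0 frob n; exists (P0, 0).
have cnt c' : (count (fun P => (f P).2 == c') s <= (edge q al c' c) * walks_to en (edge q al) n c')%N.
  case ec: (edge q al c' c); last first.
    rewrite mul0n leqn0 -leqn0 leqNgt -has_count; apply/negP => /hasP[P Ps /eqP e].
    by have [_ _] := hf P Ps; rewrite e ec.
  rewrite mul1n -size_filter -(size_map (fun P => (f P).1)); apply: IH.
    rewrite map_inj_in_uniq ?filter_uniq // => P R; rewrite !mem_filter.
    move=> /andP[/eqP eP Ps] /andP[/eqP eR Rs] ePR.
    have [h1 [_ a0 a1 a2] _] := hf P Ps; have [h2 _ _] := hf R Rs.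
    have [_ _ c1 Pc] := hs P Ps; have [_ _ _ Rc] := hs R Rs.
    have [[x0 x1] [y0 y1]] := (nz n, nz n.+1); rewrite -ePR in h2.
    exact: (generic_unique (tower_compat E n) q1 al0 (@frob n.+1) x0 x1 y1 (rec_equation rc n)
      (gZ n) (dE _) (fE _) (@dE _) a0 a1 a2 h1 h2 c1 Pc Rc).
  by move=> R /mapP[P]; rewrite mem_filter => /andP[/eqP <- Ps] ->; have [] := hf P Ps.
have -> : size s = (\sum_(c' <- en) count (fun P => (f P).2 == c') s)%N.
  under eq_bigr do rewrite -sum1_count big_mkcond.
  rewrite exchange_big -sum1_size; apply: eq_bigr => P _ /=.
  rewrite -big_mkcond /= sum1_count; transitivity (count_mem (f P).2 en); first by rewrite count_uniq_mem ?en_all.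
  by apply: eq_count => c'; rewrite eq_sym.
rewrite /= [leqRHS]big_mkcond; apply: leq_sum => c' _; apply: leq_trans (cnt c') _.
by case: (edge q al c' c); rewrite ?mul1n.
Qed.

(** Without a zero, the divisor of [x_0 - c], which has a simple pole at infinity, would have
    negative degree. *)
Lemma good_base c : c != 0 -> c + 1 != 0 -> exists P : place (cst 0), good c P.
Proof.
have tx := transcendentalP (rec_transcendental rc); have fx := fractionsP tx (rec_rational rc).
move=> c0 c1; have [Pinf [Q lv]] := level_tower rc q1 al0 frob 0%N.
have x0c : x 0%N - cst 0 c != 0.
  by rewrite -(evX_ (cst 0) (x 0%N)) -(evC_ (cst 0) (x 0%N)) -evB ev_neq0 // polyXsubC_eq0.
suff [P vP] : exists P : place (cst 0), 0 < valuation P (x 0%N - cst 0 c).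
  have [v1 d1 _] := linear_place tx fx vP; exists P; split=> //.
  by right; rewrite v1.
apply: contrapT => nP; have le (P : place (cst 0)) : valuation P (x 0%N - cst 0 c) <= 0.
  by rewrite leNgt; apply/negP => h; apply: nP; exists P.
have [s [us hs]] := riemann_fin (lv_riemann lv) (x 0%N - cst 0 c).
have vi : valuation Pinf (x 0%N - cst 0 c) = -1.
  have [x0 _] := nz 0; have := val_addl (dE Pinf) x0 (_ : vge Pinf (valuation Pinf (x 0%N) + 1) (- cst 0 c)).
  rewrite (lv_inf lv : valuation Pinf (x 0%N) = -1) => h; have [] := h _ => //.
  by rewrite -rmorphN; apply: (vgeC (dE Pinf)).
have is_ : Pinf \in s by apply: contraT => /hs; rewrite vi.
have := dg_val0 (lv_riemann lv) x0c us hs; rewrite /dg (bigD1_seq Pinf is_ us) /= vi (riemann_inf (lv_riemann lv)).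
have : \sum_(P <- s | P != Pinf) valuation P (x 0%N - cst 0 c) * (place_degree P)%:Z <= 0.
  by apply: sumr_le0 => P _; rewrite mulr_le0_ge0.
by move: (\sum_(P <- s | _) _) => z; clear; lia.
Qed.

Section Split.
Variable S : seq k.
Hypotheses (uS : uniq S) (fS : full q al S) (qk : q%:R = 0 :> k).

Lemma full_nz c : c \in S -> c != 0 /\ c + 1 != 0.
Proof.
move=> /fS h; have : has (edge q al c) S by rewrite has_count h ltnW.
by case/hasP => c' _ /and5P[].
Qed.

Lemma good_above n c (P' : place (cst n)) : c \in S -> good c P' -> exists Ps : seq (place (cst n.+1)),
  [/\ uniq Ps, size Ps = q & forall P, P \in Ps -> over (inc n) P P' /\ exists2 c', c' \in S & good c' P].
Proof.
move=> cS [d1 c0 c1 Pc]; pose outs := [seq c' <- S | edge q al c c'].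
have so : size outs = q by rewrite size_filter fS.
have [[x0 x1] [y0 y1]] := (nz n, nz n.+1).
have exP c' : c' \in outs -> exists P : place (cst n.+1), over (inc n) P P' /\ cong P (x n.+1) c'.
  apply: (generic_exists (tower_compat E n) q1 al0 (rec_equation rc n) (gY n) (gZ n) (dE P') (@dE _) c1 Pc qk) => //; first exact: filter_uniq.
  by apply/allP => z; rewrite mem_filter => /andP[].
have [Ps0 [uPs sPs hPs]] : exists Ps : seq (place (cst n.+1)), [/\ uniq Ps, size Ps = size outs &
    forall P, P \in Ps -> over (inc n) P P' /\ exists2 c', c' \in outs & cong P (x n.+1) c'].
  have : uniq outs by apply: filter_uniq.
  elim: (outs) exP => [|c' o IH] exP; first by exists [::].
  move=> /andP[nc uo]; have [P [PP Pc']] := exP c' (mem_head _ _).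
  have [z zo|Ps [uP sP hP]] := IH _ uo; first by apply: exP; rewrite in_cons zo orbT.
  exists (P :: Ps); split=> [||R].
  - rewrite /= uP andbT; apply/negP => /hP [_ [c'' co Rc]].
    by case/negP: nc; rewrite (cong_inj (dE P) Pc' Rc).
  - by rewrite /= sP.
  - rewrite in_cons => /orP[/eqP ->|/hP [RR [c'' co Rc]]].
      by split=> //; exists c'; rewrite ?mem_head.
    by split=> //; exists c''; rewrite // in_cons co orbT.
rewrite so in sPs; exists Ps0; split=> // P Pin; have [PP [c' co Pc']] := hPs P Pin; split=> //.
have c'S : c' \in S by move: co; rewrite mem_filter => /andP[].
have [h0 h1] := full_nz c'S; exists c' => //; split=> //.
by apply: (generic_degree (tower_compat E n) (gZ n) (dE P') (fE P') (@dE _) d1 uPs sPs) => // R /hPs [].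
Qed.

(** The residues stay in the full set, so each place is replaced by [q] rational ones at every step,
    and the fibres over different places are disjoint. *)
Lemma good_list n : exists A : seq (place (cst n)), [/\ uniq A, size A = (q ^ n * size S)%N &
  forall P, P \in A -> exists2 c, c \in S & good c P].
Proof.
elim: n => [|n [A [uA sA hA]]].
  have hS c : c \in S -> exists P : place (cst 0), good c P by move=> /full_nz [h0 h1]; apply: good_base.
  rewrite mul1n; elim: (S) uS hS => [|c s IH] /=; first by exists [::].
  move=> /andP[nc us] hS; have [z zs|A [uA sA hA]] := IH us; first by apply: hS; rewrite in_cons zs orbT.
  have [P gP] := hS c (mem_head _ _); exists (P :: A); split=> [||R].
  - rewrite /= uA andbT; apply/negP => /hA [c' cs [_ _ _ h]]; have [_ _ _ h'] := gP.
    by case/negP: nc; rewrite (cong_inj (dE P) h' h).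
  - by rewrite /= sA.
  - rewrite in_cons => /orP[/eqP ->|/hA [c' cs h]]; first by exists c; rewrite ?mem_head.
    by exists c'; rewrite // in_cons cs orbT.
suff [B [uB sB hB _]] : exists B : seq (place (cst n.+1)), [/\ uniq B, size B = (q * size A)%N,
    (forall P, P \in B -> exists2 c, c \in S & good c P) & forall P (R : place (cst n)), P \in B -> over (inc n) P R -> R \in A].
  by exists B; split=> //; rewrite sB sA expnS mulnA.
elim: A uA hA {sA} => [|P' A IH] /=; first by exists [::]; rewrite muln0.
move=> /andP[nP uA] hA; have [R RA|B [uB sB hB oB]] := IH uA; first by apply: hA; rewrite in_cons RA orbT.
have [c cS gc] := hA P' (mem_head _ _); have [Ps [uP sP hP]] := good_above cS gc.
exists (Ps ++ B); split.
- rewrite cat_uniq uP uB andbT; apply/hasPn => P PB; apply/negP => /hP [PP _].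
  by case/negP: nP; apply: oB PB PP.
- by rewrite size_cat sP sB mulnS.
- by move=> P; rewrite mem_cat => /orP[/hP []|/hB].
- move=> P R; rewrite mem_cat in_cons => /orP[/hP [PP _] RR|PB RR]; first by rewrite (over_rest RR PP) eqxx.
  by rewrite (oB _ _ PB RR) orbT.
Qed.
End Split.
End PlaceCounting.

(** [fset_set] gives the cardinality that is meant only for a finite set, so the bound on lists is
    first turned into finiteness. *)
Lemma rational_places_bounds (k F : fieldType) (iota : {rmorphism k -> F}) (B : nat) :
  (forall s : seq (place iota), uniq s -> (forall P, P \in s -> place_degree P = 1%N) -> (size s <= B)%N) ->
  (num_rational_places iota <= B)%N /\
  forall s : seq (place iota), uniq s -> (forall P, P \in s -> place_degree P = 1%N) ->
    (size s <= num_rational_places iota)%N.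
Proof.
move=> bnd; pose A := [set P : place iota | place_degree P = 1%N].
pose C n := `[< exists s : seq (place iota), [/\ uniq s, size s = n & forall P, P \in s -> place_degree P = 1%N] >].
have C0 : exists n, C n by exists 0%N; apply/asboolP; exists [::].
have CB n : C n -> (n <= B)%N by move=> /asboolP [s [us <- hs]]; apply: bnd.
have fA : finite_set A.
  case: (ex_maxnP C0 CB) => n /asboolP [s [us sn hs]] mx; apply/finite_seqP; exists s.
  rewrite predeqE => P; split=> [dP|/hs //]; apply: contraT => nP; have := mx n.+1; rewrite ltnn => -> //.
  apply/asboolP; exists (P :: s); split=> [||R]; rewrite /= ?nP ?sn //.
  by rewrite in_cons => /orP[/eqP ->|/hs].
have inA P : (P \in fset_set A) = `[< place_degree P = 1%N >].
  by rewrite in_fset_set // mem_setE.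
split=> [|s us hs].
  by apply: bnd; [exact: fset_uniq | move=> P; rewrite -[P \in _]/(P \in fset_set A) inA => /asboolP].
apply: uniq_leq_size => // P Ps; rewrite -[P \in _]/(P \in fset_set A) inA; apply/asboolP; exact: hs.
Qed.

(** The sum bounds the number of rational places with a peak, and the added 2 stands for [Pinf] and
    [Q]. Removing the two ends turns the case of [n] into [q] times that of [n - 2]. *)
Lemma peak_geometric q n : (1 < q)%N ->
  (\sum_(p < n.+1) q ^ minn p (n - p) + 2 <= 2 * q ^ n./2.+1)%N.
Proof.
move=> q1; have [m] := ubnP n; elim: m n => // m IH [|[|n]].
- by move=> _; rewrite big_ord1 /= min0n expn0 expn1; move: q1; clear; lia.
- by move=> _; rewrite !big_ord_recl big_ord0 /= min0n ?minn0 ?subnn ?minn0 !expn0 expn1; move: q1; clear; lia.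
rewrite ltnS => nm; have {}IH := IH n (ltnW nm).
rewrite big_ord_recl big_ord_recr /= subnn minn0 min0n /= expn0.
rewrite (eq_bigr (fun p : 'I_n.+1 => q * q ^ minn p (n - p))%N); last first.
  by move=> p _; rewrite /bump /= !add1n -expnS subSS subSn ?leq_ord // minnSS.
rewrite -big_distrr /= (expnS q n./2.+1).
move: (\sum_(p < n.+1) _)%N (q ^ n./2.+1)%N IH => a b; clear -q1; nia.
Qed.

(** * Bounds for the number of rational places *)

Section RationalPlaces.
Variables (k : fieldType) (q : nat) (al : k) (E : tower k) (x : forall n, E n).
Hypotheses (rc : recursively_defined q al x) (q1 : (1 < q)%N) (al0 : al != 0).
Hypothesis frob : forall m (a b : E m), (a + b) ^+ q = a ^+ q + b ^+ q.
Variable en : seq k.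
Hypotheses (uen : uniq en) (en_all : forall c, c \in en).
Local Notation cst := (tower_const E).
Local Notation X := (tower_var x).

Lemma rational_place_cases n (Pinf Q P : place (cst n)) : level q al n (X n) (tower_genus q n) Pinf Q ->
  place_degree P = 1%N ->
  [\/ P = Pinf, P = Q, exists2 p, (p <= n)%N & 0 < valuation P (X n p + 1) | exists c, good x c P].
Proof.
move=> lv d1; have dP := riemann_disc (lv_riemann lv).
have [x0 x1] := (lv_chain lv).1 n (leqnn n).
case: (chain_cases q1 al0 (dP P) (lv_chain lv)) => [h|h|p /andP[pn pp] _ _|h].
- by constructor 1; apply/(lv_inf0 lv); have [] := h 0%N isT.
- by constructor 2; apply: (lv_Qu lv); have [] := h n (leqnn n).
- by constructor 3; exists p.
have [vx vx1] := h n (leqnn n).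
have Ox : place_ring P (X n n) by rewrite (val_ring (dP P)) // vx.
have [c xc] := residue (dP P) (riemann_deg (lv_riemann lv) P) d1 Ox.
constructor 4; exists c; split=> //; last by rewrite -tower_var_top.
  by apply/eqP => e; rewrite e in xc; have := cong0_val x0 xc; rewrite vx.
apply/eqP => e; have : cong P (X n n + 1) (c + 1).
  by apply: (congD (dP P)) => //; rewrite -(rmorph1 (cst n)); apply: congC.
by rewrite e => /(cong0_val x1); rewrite vx1.
Qed.

Lemma peak_count n (Pinf Q : place (cst n)) : level q al n (X n) (tower_genus q n) Pinf Q ->
  forall (s : seq (place (cst n))) p, uniq s -> (p <= n)%N ->
  (count (fun P => (0 < valuation P (X n p + 1))%R) s <= q ^ minn p (n - p))%N.
Proof.
move=> lv s p us pn; have [s0 [us0 Pi0 hs0]] := chain_support lv.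
have rg := lv_riemann lv.
have := peak_degE q1 al0 lv us0 Pi0 hs0 pn.
have e : (q ^ n = q ^ minn p (n - p) * q ^ maxn p (n - p))%N by rewrite -expnD addn_min_max subnKC.
rewrite {}e => /eqP; rewrite eqn_pmul2r ?expn_gt0 ?(ltnW q1) // => /eqP <-.
apply: (@leq_trans (count (fun P => (0 < valuation P (X n p + 1))%R) s0)).
  rewrite -!size_filter; apply: uniq_leq_size; first exact: filter_uniq.
  move=> P; rewrite !mem_filter => /andP[vP Ps]; rewrite vP /=; apply: contraT => nP.
  have [e|ne] := eqVneq P Pinf.
    have [_ v] := inf_values q1 al0 lv pn; rewrite e v in vP.
    by move: vP; rewrite oppr_gt0 ltNge le0z_nat.
  by have [_ v] := hs0 P nP ne p pn; rewrite v in vP.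
rewrite -sum1_count big_mkcond; apply: leq_sum => P _; case: (0 < _) => //.
by rewrite mul1n degree_pos //; [apply: (riemann_disc rg) | apply: (riemann_deg rg)].
Qed.

Lemma rational_places_le n (s : seq (place (cst n))) : uniq s ->
  (forall P, P \in s -> place_degree P = 1%N) ->
  (size s <= 2 * q ^ n./2.+1 + \sum_(c <- en) walks_to en (edge q al) n c)%N.
Proof.
move=> us hs; have [Pinf [Q lv]] := level_tower rc q1 al0 frob n.
have ub : (size s <= \sum_(P <- s) ((P == Pinf) + (P == Q) + \sum_(p < n.+1) (0 < valuation P (X n p + 1))%R
    + \sum_(c <- en) `[< good x c P >])%N)%N.
  rewrite -sum1_size [leqLHS]big_seq_cond [leqRHS]big_seq_cond; apply: leq_sum => P /andP[Ps _].
  case: (rational_place_cases lv (hs P Ps)) => [->|->|[p pn vp]|[c gc]].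
  - by rewrite eqxx.
  - by rewrite eqxx addn1 !addSn.
  - rewrite (bigD1 (Ordinal (pn : (p < n.+1)%N))) //= vp /= !addnA addn1 !addSn //.
  - rewrite (bigD1_seq c (en_all c) uen) /=.
    have -> : `[< good x c P >] = true by apply/asboolP.
    by rewrite addnA addn1 !addSn.
apply: leq_trans ub _; rewrite !big_split /=.
have one (R : place (cst n)) : (\sum_(P <- s) (P == R) <= 1)%N.
  have -> : (\sum_(P <- s) (P == R) = count_mem R s)%N.
    by rewrite -sum1_count [RHS]big_mkcond; apply: eq_bigr => P _ /=; case: (P == R).
  by rewrite count_uniq_mem // leq_b1.
have pk : (\sum_(P <- s) \sum_(p < n.+1) (0 < valuation P (X n p + 1))%R <= \sum_(p < n.+1) q ^ minn p (n - p))%N.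
  rewrite exchange_big; apply: leq_sum => p _ /=.
  have -> : (\sum_(P <- s) (0 < valuation P (X n p + 1))%R = count (fun P => (0 < valuation P (X n p + 1))%R) s)%N.
    by rewrite -sum1_count [RHS]big_mkcond; apply: eq_bigr => P _ /=; case: (0 < _).
  by apply: (peak_count lv) => //; rewrite -ltnS.
have gd : (\sum_(P <- s) \sum_(c <- en) `[< good x c P >] <= \sum_(c <- en) walks_to en (edge q al) n c)%N.
  rewrite exchange_big; apply: leq_sum => c _ /=.
  have -> : (\sum_(P <- s) `[< good x c P >] = size [seq P <- s | `[< good x c P >]])%N.
    by rewrite size_filter -sum1_count [RHS]big_mkcond; apply: eq_bigr => P _ /=; case: `[< _ >].
  apply: (good_count rc q1 al0 frob uen en_all); first exact: filter_uniq.
  by move=> P; rewrite mem_filter => /andP[/asboolP].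
apply: leq_add gd; apply: leq_trans (peak_geometric n q1).
by rewrite addnC leq_add // (leq_add (one _) (one _)).
Qed.

Lemma rational_places_ge (S : seq k) : uniq S -> full q al S -> q%:R = 0 :> k -> forall n,
  (q ^ n * size S <= num_rational_places (cst n))%N.
Proof.
move=> uS fS qk n; have [A [uA <- hA]] := good_list rc q1 al0 frob uS fS qk n.
apply: (rational_places_bounds (@rational_places_le n)).2 => // P /hA [c _ []] //.
Qed.
End RationalPlaces.

Lemma walks_to_le (V : eqType) (en : seq V) (e : rel V) (q : nat) :
  (forall y, (count (e^~ y) en <= q)%N) -> forall m y, (walks_to en e m y <= q ^ m)%N.
Proof.
move=> in_le; elim=> [|m IH] y //=; apply: leq_trans (leq_sum _ (fun x _ => IH x)) _.
by rewrite sum_count_const expnS leq_mul2r in_le orbT.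
Qed.

Section WalkBound.
Variables (k : fieldType) (q : nat) (al : k).
Hypotheses (q1 : (1 < q)%N) (al0 : al != 0).
Variable en : seq k.
Hypotheses (uen : uniq en) (en_all : forall c, c \in en).
Variable S : seq k.
Hypotheses (uS : uniq S) (fS : full q al S) (S0 : S != [::]) (nS : 0 \notin S).
Variables (F : fieldType) (iota : {rmorphism k -> F}).
Hypothesis frob : forall a b : F, (a + b) ^+ q = a ^+ q + b ^+ q.
Variables (X Y : F) (P : place iota) (dP : discrete P).
Hypotheses (rXY : rel_eq iota q al X Y) (X0 : X != 0) (Y0 : Y != 0).
Hypotheses (vX : 0 < valuation P X) (vY : valuation P Y = q%:Z * valuation P X).
Local Notation e := (edge q al).

Let eT : rel k := fun c c' => [&& c \notin S, c' \notin S & e c c'].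

(** No edge leaves the full set [S], so a walk that ends outside [S] has never visited it. *)
Lemma walks_outside n c : c \notin S -> walks_to en e n c = walks_to en eT n c.
Proof.
elim: n c => //= n IH c cS; rewrite big_mkcond [RHS]big_mkcond; apply: eq_bigr => c' _.
rewrite /eT cS /=; have [c'S|c'S] := boolP (c' \in S); last by rewrite /= IH.
by case h: (e c' c) => //; rewrite (full_forward q1 uS fS c'S h) in cS.
Qed.

(** A set in which every vertex keeps [q] successors outside [S] would be a full set disjoint from
    [S], which [full_unique] excludes. *)
Lemma walks_outside_decay : exists M, forall c, (walks_from en eT M c < q ^ M)%N.
Proof.
have out c : (count (eT c) en <= q)%N.
  have h : (count (e c) en <= q)%N by apply: count_out.
  apply: leq_trans h; apply: sub_count => c' /=.
  by rewrite /eT => /and3P[].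
apply: (walks_decay q1 en_all out) => C [c Cc] fC.
pose cs := [seq c <- en | C c]; have ics z : (z \in cs) = C z by rewrite mem_filter en_all andbT.
have fcs : full q al cs.
  move=> z; rewrite ics => Cz; apply/eqP; rewrite eqn_leq count_out ?filter_uniq //=.
  rewrite -{1}(fC z Cz) count_filter; apply: sub_count => z' /=.
  by rewrite /eT => /andP[/and3P[_ _ ->] ->].
have edC z : C z -> z \notin S /\ z != 0.
  move=> /fC h; have : has (fun y => eT z y && C y) en by rewrite has_count h ltnW.
  by case/hasP=> y _ /andP[/and3P[zS _ /and5P[z0 _ _ _ _]] _].
have : cs = [::].
  apply: (full_unique q1 al0 frob dP rXY X0 Y0 vX vY uS _ fS fcs nS _ S0); first exact: filter_uniq.
    by rewrite ics; apply/negP => /edC [_]; rewrite eqxx.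
  by move=> z zS; rewrite ics; apply/negP => /edC []; rewrite zS.
by move=> e0; have := ics c; rewrite Cc e0.
Qed.

(** In-degrees are at most [q], which bounds the walks ending in [S]. For the walks outside [S],
    each block of [M] steps multiplies the count by at most [q^M - 1]. *)
Lemma walks_bound : exists M, (0 < M)%N /\ forall n,
  (\sum_(c <- en) walks_to en e n c <= size S * q ^ n + size en * (q ^ (n %% M) * (q ^ M).-1 ^ (n %/ M)))%N.
Proof.
have [M hM] := walks_outside_decay; exists M; split.
  by case: M hM => // /(_ 0); rewrite expn0 /= ltnn.
have in_le c' : (count (e^~ c') en <= q)%N by apply: count_in.
have inT c' : (count (eT^~ c') en <= q)%N.
  by apply: leq_trans (in_le c'); apply: sub_count => c /and3P[].
have dec n j : (\sum_(c <- en) walks_to en eT (n + j * M) c <= size en * (q ^ n * (q ^ M).-1 ^ j))%N.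
  elim: j => [|j IH].
    rewrite mul0n addn0 expn0 muln1 -(count_predT en) -(sum_count_const en predT).
    by apply: leq_sum => c _; apply: walks_to_le.
  rewrite mulSn addnCA addnC walks_concat expnS.
  apply: (@leq_trans (\sum_(c <- en) walks_to en eT (n + j * M) c * (q ^ M).-1)%N).
    by apply: leq_sum => c _; rewrite leq_mul2l -ltnS prednK ?hM ?orbT // expn_gt0 ltnW.
  by rewrite -big_distrl /= (mulnC (_.-1)) !mulnA leq_mul2r -mulnA IH orbT.
move=> n; rewrite (bigID (mem S)) /=; apply: leq_add.
  apply: leq_trans (leq_sum _ (fun c _ => walks_to_le in_le n c)) _.
  rewrite sum_count_const leq_mul2r; apply/orP; right; rewrite -size_filter uniq_leq_size ?filter_uniq //.
  by move=> c; rewrite mem_filter => /andP[].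
rewrite (eq_bigr (walks_to en eT n)) => [|c cS]; last exact: walks_outside.
apply: leq_trans (_ : (_ <= \sum_(c <- en) walks_to en eT n c)%N) _.
  by rewrite [leqRHS](bigID (mem S)) leq_addl.
by rewrite {1}(divn_eq n M) addnC.
Qed.
End WalkBound.

(** * Descent of the supersingular points to the constant field *)

Section SupersingularList.
Variables (k : finFieldType) (Om : closedFieldType) (iota : {rmorphism k -> Om}) (q d : nat).
Hypotheses (q1 : (1 < q)%N) (d0 : (0 < d)%N) (ck : #|k| = (q ^ d.*2)%N).
Hypothesis frobO : forall a b : Om, (a + b) ^+ q = a ^+ q + b ^+ q.
Hypothesis qO : q%:R = 0 :> Om.
Variables (al : k) (p : {poly k}).
Hypotheses (al0 : al != 0) (fp : forall i, p`_i ^+ q = p`_i) (mon : p \is monic) (sp : size p = d.+1).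
Hypotheses (rp : root p al) (dp : p^`().[al] != 0) (ald : al ^+ (q ^ d) = al).
Hypothesis alne : forall i, (0 < i < d)%N -> al ^+ (q ^ i) != al.

(* The derivative of [y (y + 1)^(q-1) - v] is [(y + 1)^(q-2)]. *)
Lemma out_poly_roots (v : Om) : v != 0 -> exists rs : seq Om,
  [/\ uniq rs, size rs = q & forall r, r \in rs -> r * (r + 1) ^+ q.-1 = v].
Proof.
move=> v0; have [sg mg] := out_poly_monic q1 v.
have [rs ers] := closed_field_poly_normal (out_poly q v).
rewrite (eqP mg) scale1r in ers; exists rs; split; last first.
- move=> r rrs; apply/eqP; rewrite -subr_eq0 -[_ - v](out_polyE q v r) ers -[_ == 0]/(root _ r).
  by rewrite root_prod_XsubC.
- by move: sg; rewrite ers size_prod_XsubC => -[].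
rewrite -separable_prod_XsubC -ers unlock.
have qP : (q.-1)%:R = -1 :> {poly Om}.
  apply/eqP; rewrite -addr_eq0 natr1 prednK ?(ltnW q1) //.
  by rewrite -polyC_natr qO polyC0.
have -> : (out_poly q v)^`() = ('X - (-1)%:P) ^+ q.-2.
  rewrite /out_poly derivB derivC subr0 derivM derivX mul1r deriv_exp derivXsubC ?mulr1 ?mul1r.
  rewrite -mulr_natr qP.
  case: (q) q1 => [|[|n]] //= _; rewrite exprS rmorphN rmorph1; ring.
apply: coprimep_expr; rewrite coprimep_XsubC /root out_polyE /lhs addNr expr0n.
by case: (q) q1 => [|[|n]] //= _; rewrite mulr0 sub0r oppr_eq0.
Qed.

Lemma rational_of_fixed (z : Om) : z ^+ (q ^ d.*2) = z -> exists c, z = iota c.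
Proof.
move=> hz; have := congr1 (fun P : {poly k} => (map_poly iota P).[z]) (finField_genPoly k).
rewrite rmorphB /= map_polyXn map_polyX hornerD hornerN hornerXn hornerX ck hz subrr rmorph_prod /=.
rewrite horner_prod => /esym /eqP; rewrite prodf_seq_eq0 => /hasP[c _ /=].
by rewrite rmorphB /= map_polyX map_polyC /= hornerXsubC subr_eq0 => /eqP ->; exists c.
Qed.

(** Being fixed by the [2d]th power of Frobenius, the points over the closed field come from [k].
    The set is full because the [q] solutions for each of its points are distinct and belong to
    it. *)
Lemma supersingular_list : exists S : seq k,
  [/\ uniq S, size S = (q * \sum_(r < d) q ^ r)%N, 0 \notin S & full q al S].
Proof.
have Fp i : Fr q (map_poly iota p)`_i = (map_poly iota p)`_i by rewrite coef_map /Fr -rmorphXn fp.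
have mi : map_poly iota p \is monic by rewrite map_monic.
have si : size (map_poly iota p) = d.+1 by rewrite size_map_poly.
have ri : root (map_poly iota p) (iota al) by rewrite fmorph_root.
have di : (map_poly iota p)^`().[iota al] != 0 by rewrite deriv_map horner_map fmorph_eq0.
have ai0 : iota al != 0 by rewrite fmorph_eq0.
have adi : iter d (Fr q) (iota al) = iota al by rewrite FiE -rmorphXn ald.
have ani i : (0 < i < d)%N -> iter i (Fr q) (iota al) != iota al.
  by move=> h; rewrite FiE -rmorphXn fmorph_eq alne.
have [s [us ss hs cl]] := supersingular_set q1 frobO qO ai0 d0 Fp mi si ri di adi ani.
have [S eS] : exists S, s = map iota S.
  have : forall x, x \in s -> exists c, x = iota c.
    by move=> x /hs [_ _]; rewrite FiE => /rational_of_fixed.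
  elim: (s) => [|x s' IH] h; first by exists [::].
  have [c ->] := h x (mem_head _ _); have [z zs|S ->] := IH; first by apply: h; rewrite in_cons zs orbT.
  by exists (c :: S).
have uS : uniq S by move: us; rewrite eS map_inj_uniq //; exact: fmorph_inj.
have memS c : (c \in S) = (iota c \in s) by rewrite eS mem_map //; exact: fmorph_inj.
exists S; split=> //; first by rewrite -ss eS size_map.
  by rewrite memS rmorph0; apply/negP => /hs []; rewrite eqxx.
move=> c; rewrite memS => cs; have [c0 c1 _] := hs _ cs.
apply/eqP; rewrite eqn_leq count_out //=.
pose v := iota c ^+ q / (iota al * (iota c + 1)) ^+ q.-1.
have v0 : v != 0 by rewrite mulf_neq0 ?invr_eq0 ?expf_neq0 ?mulf_neq0.
have [rs [urs srs hrs]] := out_poly_roots v0.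
rewrite -{1}srs -size_filter -(size_map iota); apply: uniq_leq_size => // r rin.
have er := hrs r rin; have := cl _ _ cs er; rewrite eS => /mapP[c' c'S e]; rewrite e.
apply: map_f; rewrite mem_filter c'S andbT.
have rs' : iota c' \in s by rewrite -memS.
have [r0 r1 _] := hs _ rs'; rewrite /edge -(fmorph_eq0 iota) c0.
rewrite -(fmorph_eq0 iota (c + 1)) -(fmorph_eq0 iota c') -(fmorph_eq0 iota (c' + 1)) !rmorphD !rmorph1 c1 r0 r1 /=; apply/eqP; apply: (fmorph_inj iota).
by move: er; rewrite e /lhs /rhs /v !(rmorphM, rmorphXn, rmorphD, rmorph1, fmorphV).
Qed.
End SupersingularList.

Lemma card_frobenius (Fq : finFieldType) (F : fieldType) (h : {rmorphism Fq -> F}) :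
  (forall a b : F, (a + b) ^+ #|Fq| = a ^+ #|Fq| + b ^+ #|Fq|) /\ #|Fq|%:R = 0 :> F.
Proof.
have [p0 pp pc] := finPcharP Fq; have pF : p0 \in [pchar F] by apply: rmorph_pchar pc.
have cq := card_pprimeChar pc; have n0 : (0 < logn p0 #|Fq|)%N.
  by have := finNzRing_gt1 Fq; rewrite {1}cq; case: (logn _ _).
split=> [a b|].
  apply: exprDn_pchar; rewrite (eq_pnat _ (pcharf_eq pF)) [X in pnat _ X]cq pnatX.
  by rewrite pnat_id.
by apply/eqP; rewrite -(dvdn_pcharf pF) [X in (_ %| X)%N]cq dvdn_exp.
Qed.

Lemma frobenius_horner (Fq : finFieldType) (F : fieldType) (h : {rmorphism Fq -> F}) (r : {poly Fq}) (z : F) i :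
  (map_poly h r).[z] ^+ (#|Fq| ^ i) = (map_poly h r).[z ^+ (#|Fq| ^ i)].
Proof.
have [frob _] := card_frobenius h.
elim: i => [|i IH]; first by rewrite !expr1.
rewrite expnSr !exprM IH; move: (z ^+ _) => {IH}z.
elim/poly_ind: r => [|r c IH].
  by rewrite rmorph0 !horner0 expr0n; have := finNzRing_gt1 Fq; case: #|_|.
rewrite rmorphD rmorphM /= map_polyX map_polyC /= !hornerMXaddC frob exprMn IH.
by rewrite -rmorphXn /= expf_card.
Qed.

(** * The constant field and the Frobenius period of [alpha] *)

Section ConstantField.
Variables (Fq : finFieldType) (p : {poly Fq}) (d : nat) (K : fieldExtType Fq) (alpha : K).
Hypotheses (p_monic : p \is monic) (p_irr : irreducible_poly p) (p_deg : size p = d.+1).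
Hypotheses (p_neqT : p <> 'X) (p_alpha : root (map_poly (in_alg K) p) alpha).
Hypothesis K_quad : (\dim_(<<1; alpha>>%VS) {:K} = 2)%N.
Local Notation q := #|Fq|.
Let q1 : (1 < q)%N. Proof. exact: finNzRing_gt1. Qed.
Let frob := (card_frobenius (in_alg K)).1.

Let d0 : (0 < d)%N. Proof. by have := p_irr.1; rewrite p_deg ltnS. Qed.

Lemma generator_neq0 : alpha != 0.
Proof.
apply/eqP => a0; move: p_alpha; rewrite a0 -(rmorph0 (in_alg K)) fmorph_root => r0.
have xp : 'X %| p by rewrite -['X]subr0 -polyC0 dvdp_XsubCl.
have := p_irr.2 'X _ xp; rewrite size_polyX => /(_ isT); rewrite eqp_monic ?monicX // => /eqP e.
by apply: p_neqT.
Qed.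

Lemma dim_generated : \dim <<1; alpha>> = d.
Proof.
have /polyOver1P [m em] := minPolyOver 1 alpha.
have sm : size m = (adjoin_degree 1 alpha).+1 by rewrite -(size_minPoly 1 alpha) em size_map_poly.
have mp : m %| p.
  rewrite -(dvdp_map (in_alg K)) -em; apply: minPoly_dvdp => //; apply/polyOver1P; by exists p.
have sm1 : size m != 1%N.
  apply/eqP => s1; have := root_minPoly 1 alpha; rewrite em.
  have /size_poly1P [c c0 ->] : size m == 1%N by apply/eqP.
  by rewrite map_polyC /= rootC scaler_eq0 oner_eq0 orbF (negbTE c0).
have := eqp_size (p_irr.2 m sm1 mp); rewrite sm p_deg => -[e].
by rewrite dim_Fadjoin e dimv1 muln1.
Qed.

Lemma dim_constant : \dim {:K} = d.*2.
Proof.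
have /divnK <- : (\dim <<1; alpha>> %| \dim {:K})%N by apply: field_dimS; apply: subvf.
by rewrite K_quad dim_generated mul2n.
Qed.

Lemma card_constant : #|finvect_type K| = (q ^ d.*2)%N.
Proof. by rewrite -dim_constant -(card_vspace (fullv : {vspace finvect_type K})) card_vspacef. Qed.

(** If the [i]th power of Frobenius fixes [alpha], it fixes the whole field generated by [alpha],
    and the [q^d] elements of this field are roots of a polynomial of degree [q^i]. *)
Lemma generator_period_ge i : (0 < i)%N -> alpha ^+ (q ^ i) = alpha -> (d <= i)%N.
Proof.
move=> i0 ai; pose rs := enum (<<1; alpha>>%VS : {vspace finvect_type K}).
have srs : size rs = (q ^ d)%N by rewrite -cardE card_vspace dim_generated.
pose g : {poly finvect_type K} := 'X^(q ^ i) - 'X.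
have qi : (1 < q ^ i)%N by rewrite -(exp1n i) ltn_exp2r.
have sg : size g = (q ^ i).+1 by rewrite size_polyDl size_polyXn // size_polyN size_polyX ltnS.
have := @max_poly_roots _ g rs; rewrite -size_poly_eq0 sg srs ltnS leq_exp2l // => -> //; last exact: enum_uniq.
apply/allP => z; rewrite mem_enum => zL; rewrite /root hornerD hornerN hornerXn hornerX subr_eq0.
have ez : z = (Fadjoin_poly 1 alpha z).[alpha] :> K by rewrite Fadjoin_poly_eq.
have /polyOver1P [r er] := Fadjoin_polyOver 1 alpha (z : K).
rewrite er in ez; apply/eqP; change ((z : K) ^+ (q ^ i) = z).
by rewrite [X in X ^+ _]ez frobenius_horner ai -ez.
Qed.

Lemma generator_root i : root (map_poly (in_alg K) p) (alpha ^+ (q ^ i)).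
Proof. by rewrite /root -frobenius_horner (eqP (p_alpha : _ == 0)) expr0n expn_eq0; case: q q1. Qed.

Lemma frob_inj i (a b : K) : a ^+ (q ^ i) = b ^+ (q ^ i) -> a = b.
Proof.
elim: i => [|i IH]; first by rewrite !expr1.
rewrite expnSr !exprM => h; apply: IH; apply/eqP; rewrite -subr_eq0.
have h2 (u v : K) : (u - v) ^+ q = u ^+ q - v ^+ q.
  by apply/eqP; rewrite eq_sym subr_eq -frob subrK.
by have := h2 (a ^+ (q ^ i)) (b ^+ (q ^ i)); rewrite h subrr => /eqP; rewrite expf_eq0 => /andP[].
Qed.

(** The conjugates of [alpha] in one period are distinct roots of [p], so the period is at most [d],
    hence equal to [d]. Then [p] is a product of [d] distinct linear factors, and [alpha] is a
    simple root. *)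
Lemma generator_period : alpha ^+ (q ^ d) = alpha /\ (map_poly (in_alg K) p)^`().[alpha] != 0.
Proof.
have ex : exists e, (0 < e)%N && (alpha ^+ (q ^ e) == alpha).
  exists d.*2; rewrite double_gt0 d0 -card_constant; apply/eqP.
  exact: (expf_card (alpha : finvect_type K)).
case: (ex_minnP ex) => e /andP[e0 /eqP ae] mn.
pose rs := [seq alpha ^+ (q ^ i) | i <- seq.iota 0 e].
have urs : uniq rs.
  rewrite map_inj_in_uniq ?iota_uniq // => i j; rewrite !mem_iota !add0n /=.
  wlog ij : i j / (i <= j)%N => [hw|] ie je eij.
    by have [h|h] := leqP i j; [apply: hw | apply/esym/hw => //; apply: ltnW].
  move: ij; rewrite leq_eqVlt => /orP[/eqP //|ij]; exfalso.
  have := mn (j - i)%N; rewrite subn_gt0 ij /= => h.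
  have : alpha ^+ (q ^ (j - i)) == alpha.
    by apply/eqP; apply: (@frob_inj i); rewrite -exprM -expnD subnK // ltnW.
  by move=> /h; rewrite leqNgt (leq_ltn_trans (leq_subr _ _) je).
have rrs : all (root (map_poly (in_alg K) p)) rs.
  by apply/allP => z /mapP[i _ ->]; apply: generator_root.
have p0 : map_poly (in_alg K) p != 0 by rewrite map_poly_eq0 monic_neq0.
have srs : size rs = e by rewrite size_map size_iota.
have := max_poly_roots p0 rrs urs; rewrite size_map_poly p_deg srs ltnS => ed.
have {}ed : e = d by apply/eqP; rewrite eqn_leq ed generator_period_ge.
split; first by rewrite -ed.
have := all_roots_prod_XsubC _ rrs; rewrite size_map_poly p_deg srs ed uniq_rootsE urs => /(_ erefl isT) ep.
have : separable_poly (map_poly (in_alg K) p).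
  by rewrite ep (eqP (_ : _ \is monic)) ?map_monic // scale1r separable_prod_XsubC.
by rewrite unlock => /coprimep_root; apply.
Qed.

Lemma supersingular_points : exists S : seq K,
  [/\ uniq S, size S = (q * \sum_(r < d) q ^ r)%N, 0 \notin S & full q alpha S].
Proof.
have [Om [iota _]] := countable_algebraic_closure (finvect_type K).
pose h : Fq -> Om := iota \o (in_alg (finvect_type K)).
have [frobO qO] := card_frobenius (iota \o in_alg (finvect_type K) : {rmorphism Fq -> Om}).
have [ad dp] := generator_period.
apply: (@supersingular_list (finvect_type K) Om iota q d q1 d0 card_constant frobO qO alpha
  (map_poly (in_alg (finvect_type K)) p) generator_neq0 _ _ _ p_alpha dp ad) => //.
- by move=> i; rewrite coef_map -rmorphXn expf_card.
- by rewrite map_monic.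
- by rewrite size_map_poly.
- move=> i /andP[i0 id]; apply/eqP => /(generator_period_ge i0); by rewrite leqNgt id.
Qed.
End ConstantField.

(** * The limit *)

Section RatioLimit.
Variables (R : realType) (q : nat).
Hypothesis q1 : (1 < q)%N.
Local Notation Q := (q%:R : R).

Let Q0 : Q != 0. Proof. by rewrite pnatr_eq0; case: q q1. Qed.
Let Qn n : Q ^+ n != 0. Proof. exact: expf_neq0. Qed.
Let half_sum n : (n./2.+1 + uphalf n)%N = n.+1.
Proof.
move: (odd_double_half n); rewrite uphalf_half -addnn.
by move: n./2 (odd n : nat) => a b; clear; lia.
Qed.

Lemma geometric_cvg (r : R) (f : nat -> nat) : 0 <= r < 1 ->
  (forall A, exists B, forall n, (B <= n)%N -> (A <= f n)%N) -> (fun n => r ^+ f n) @ \oo --> (0 : R).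
Proof.
move=> /andP[r0 r1] hf; have f_oo : f @ \oo --> \oo.
  by apply/cvgnyPge => A; have [B hB] := hf A; exists B.
apply: (@cvg_comp _ _ _ f (fun n => r ^+ n) _ _ _ f_oo); apply: cvg_expr; by rewrite ger0_norm.
Qed.

Lemma half_cvg : (fun n => Q^-1 ^+ n./2) @ \oo --> (0 : R).
Proof.
apply: geometric_cvg => [|A]; first by rewrite invr_ge0 ler0n invf_lt1 ?ltr1n ?ltr0n // ltnW.
by exists A.*2 => n h; rewrite -[A]doubleK half_leq.
Qed.

Lemma uphalf_cvg : (fun n => Q^-1 ^+ uphalf n) @ \oo --> (0 : R).
Proof.
apply: geometric_cvg => [|A]; first by rewrite invr_ge0 ler0n invf_lt1 ?ltr1n ?ltr0n // ltnW.
exists A.*2 => n h; apply: (@leq_trans n./2); first by rewrite -[A]doubleK half_leq.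
by rewrite uphalf_half leq_addl.
Qed.

(** Because [n/2 + 1] and the upper half of [n] add up to [n + 1], the two half powers of [q]
    divided by [q^n] are [q] times an inverse power and an inverse power, both tending to 0. *)
Lemma genus_ratio_cvg (g : nat -> nat) :
  (forall n, q.-1 * g n + q ^ n./2.+1 + q ^ uphalf n = q ^ n.+1 + 1)%N ->
  (fun n => (q.-1)%:R * (g n)%:R / Q ^+ n) @ \oo --> Q.
Proof.
move=> hg; have -> : (fun n => (q.-1)%:R * (g n)%:R / Q ^+ n) =
    (fun n => Q + Q^-1 ^+ n - Q * Q^-1 ^+ uphalf n - Q^-1 ^+ n./2).
  apply: funext => n; have := congr1 (fun m => m%:R : R) (hg n); rewrite !natrD natrM !natrX => h.
  have en : n = (uphalf n + n./2)%N by apply: succn_inj; rewrite -half_sum addSn addnC.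
  have -> : (q.-1)%:R * (g n)%:R = Q ^+ n.+1 + 1 - Q ^+ n./2.+1 - Q ^+ uphalf n by rewrite -h; ring.
  have eQ : Q ^+ n = Q ^+ uphalf n * Q ^+ n./2 by rewrite -exprD -en.
  by rewrite !exprVn !exprS eQ; field; rewrite !Qn.
rewrite -[X in _ --> X]addr0 -[X in _ --> X]subr0 -[X in _ --> X - _]subr0 -{2}(mulr0 Q).
apply: cvgB; last exact: half_cvg.
apply: cvgB; last by apply: cvgMr; exact: uphalf_cvg.
apply: cvgD; first exact: cvg_cst.
by apply: (@geometric_cvg _ id) => [|A]; [rewrite invr_ge0 ler0n invf_lt1 ?ltr1n ?ltr0n // ltnW | exists A].
Qed.

(** Divided by [q^n], the error terms are of order [q^(-n/2)], from the ramified places, and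
    [(1 - q^(-M))^(n/M)], from the walks outside [S]. *)
Lemma count_ratio_cvg (s e M : nat) (N : nat -> nat) : (0 < M)%N ->
  (forall n, (q ^ n * s <= N n)%N) ->
  (forall n, (N n <= 2 * q ^ n./2.+1 + (s * q ^ n + e * (q ^ (n %% M) * (q ^ M).-1 ^ (n %/ M))))%N) ->
  (fun n => (N n)%:R / Q ^+ n) @ \oo --> (s%:R : R).
Proof.
move=> M0 lo up; pose rho : R := ((q ^ M).-1)%:R / Q ^+ M.
have rho01 : 0 <= rho < 1.
  rewrite divr_ge0 ?ler0n ?exprn_ge0 //= ltr_pdivrMr ?exprn_gt0 ?ltr0n 1?ltnW //.
  by rewrite mul1r -natrX ltr_nat prednK // expn_gt0 ltnW.
apply: (@squeeze_cvgr _ _ _ _ (fun _ => s%:R) (fun n => 2 * (Q * Q^-1 ^+ uphalf n) + (s%:R + e%:R * rho ^+ (n %/ M)))).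
- near=> n; apply/andP; split.
    by rewrite ler_pdivlMr ?exprn_gt0 ?ltr0n 1?ltnW // -natrX -natrM ler_nat mulnC.
  rewrite ler_pdivrMr ?exprn_gt0 ?ltr0n 1?ltnW //.
  have -> : (2 * (Q * Q^-1 ^+ uphalf n) + (s%:R + e%:R * rho ^+ (n %/ M))) * Q ^+ n =
    (2 * q ^ n./2.+1 + (s * q ^ n + e * (q ^ (n %% M) * (q ^ M).-1 ^ (n %/ M))))%N%:R.
    have mD (a b c z : R) : (a + (b + c)) * z = a * z + (b * z + c * z) by ring.
    have eN (a b c : nat) : (2 * a + (b + c))%N%:R = 2 * a%:R + (b%:R + c%:R) :> R.
      by rewrite natrD [X in X + _ = _]natrM [in LHS](natrD _ b c).
    rewrite eN !natrM !natrX mD; congr (_ + (_ + _)).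
      rewrite -!mulrA; congr (_ * _); rewrite mulrCA -exprS -half_sum exprD exprVn mulrC mulfK //.
    have eQ : Q ^+ n = (Q ^+ M) ^+ (n %/ M) * Q ^+ (n %% M) by rewrite -exprM -exprD mulnC -divn_eq.
    by rewrite -mulrA; congr (_ * _); rewrite /rho expr_div_n eQ mulrA divfK ?expf_neq0 // mulrC.
  by rewrite ler_nat.
- exact: cvg_cst.
- rewrite -[X in _ --> X]add0r -{1}(mulr0 2) -{1}(mulr0 Q) -[X in _ --> _ + X]addr0 -{2}(mulr0 e%:R).
  apply: cvgD; first by apply: cvgMr; apply: cvgMr; exact: uphalf_cvg.
  apply: cvgD; first exact: cvg_cst.
  apply: cvgMr; apply: geometric_cvg => // A; exists (A * M)%N => n h.
  by rewrite leq_divRL.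
Unshelve. all: by end_near.
Qed.

Lemma ratio_limit (s e M d : nat) (N g : nat -> nat) : (0 < M)%N -> (q.-1 * s = q * (q ^ d).-1)%N ->
  (forall n, (q ^ n * s <= N n)%N) ->
  (forall n, (N n <= 2 * q ^ n./2.+1 + (s * q ^ n + e * (q ^ (n %% M) * (q ^ M).-1 ^ (n %/ M))))%N) ->
  (forall n, q.-1 * g n + q ^ n./2.+1 + q ^ uphalf n = q ^ n.+1 + 1)%N ->
  (fun n => (N n)%:R / (g n)%:R : R) @ \oo --> ((q ^ d)%:R - 1 : R).
Proof.
move=> M0 hs lo up hg; have q'0 : (q.-1)%:R != 0 :> R by rewrite pnatr_eq0; case: q q1 => [|[|]].
have -> : (fun n => (N n)%:R / (g n)%:R : R) =
    (fun n => (q.-1)%:R * ((N n)%:R / Q ^+ n) * ((q.-1)%:R * (g n)%:R / Q ^+ n)^-1).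
  apply: funext => n; rewrite !invfM invrK; move: (Qn n) => h.
  (* The genus may be 0, as it is for the rational function field; both sides are then 0 by the
     convention on inverses. *)
  have [->|g0] := eqVneq ((g n)%:R : R) 0; first by rewrite invr0 !(mulr0, mul0r).
  by field; rewrite h g0 q'0.
have -> : (q ^ d)%:R - 1 = (q.-1)%:R * s%:R * Q^-1 :> R.
  have -> : (q ^ d)%:R = (q ^ d).-1%:R + 1 :> R by rewrite natr1 prednK // expn_gt0 ltnW.
  by rewrite addrK -natrM hs natrM mulrC mulKf.
apply: cvgM; first by apply: cvgMr; apply: (count_ratio_cvg M0 lo up).
by apply: cvgV => //; apply: genus_ratio_cvg.
Qed.
End RatioLimit.

Theorem proposition4p3 (R : realType) (q d : nat) (Fq : finFieldType)
  (hq : #|Fq| = q)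
  (p : {poly Fq}) (p_monic : p \is monic) (p_irr : irreducible_poly p)
  (p_deg : size p = d.+1) (p_neqT : p <> 'X)
  (* K is a quadratic extension of Fq(alpha) *)
  (K : fieldExtType Fq) (alpha : K)
  (p_alpha : root (map_poly (in_alg K) p) alpha)
  (K_quad : (\dim_(<<1; alpha>>%VS) {:K} = 2)%N)
  (E : tower K) (x : forall n, E n)
  (E_rec : recursively_defined q alpha x) :
  tower_limit E ((q ^ d)%:R - 1 : R).
Proof.
subst q; set q := #|Fq| in E_rec *.
have q1 : (1 < q)%N by exact: finNzRing_gt1.
have al0 := generator_neq0 p_monic p_irr p_neqT p_alpha.
have [_ qk] := card_frobenius (in_alg K).
have frob m (a b : E m) : (a + b) ^+ q = a ^+ q + b ^+ q.
  exact: (card_frobenius (tower_const E m \o in_alg K)).1.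
have [S [uS sS nS fS]] := supersingular_points p_monic p_irr p_deg p_neqT p_alpha K_quad.
pose en : seq K := enum (finvect_type K).
have uen : uniq en by exact: enum_uniq.
have en_all c : c \in en by rewrite (mem_enum (finvect_type K)).
have d0 : (0 < d)%N by have := p_irr.1; rewrite p_deg ltnS.
have S0 : S != [::].
  rewrite -size_eq0 sS -lt0n muln_gt0 (ltnW q1) -(prednK d0) big_ord_recl expn0 /=.
  by rewrite addn_gt0.
(* In [E 1] the zero [Q] of the second generator is also a zero of the first, and the order is [q]
   times as large for the second: this is the place on which the comparison of full sets rests. *)
have [Pinf [Q lv]] := level_tower E_rec q1 al0 frob 1%N.
have dQ := riemann_disc (lv_riemann lv) Q; have [nz r] := lv_chain lv.
have [[x0 _] [y0 _]] := (nz 0%N isT, nz 1%N isT).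
have vQ : 0 < valuation Q (tower_var x 1 1) by rewrite (lv_Q lv) expn1 ltz_nat ltnW.
have [vX vY] : 0 < valuation Q (tower_var x 1 0) /\
    valuation Q (tower_var x 1 1) = q%:Z * valuation Q (tower_var x 1 0).
  case: (chain_edge q1 al0 dQ (lv_chain lv) (isT : (0 < 1)%N)) => //.
  - by move=> _ h; move: vQ; rewrite ltNge (ltW h).
  - by move=> _ h; rewrite h ltxx in vQ.
  - by move=> _ _ h; move: vQ; rewrite ltNge (ltW h).
  - by move=> _ _ h; rewrite h ltxx in vQ.
have [M [M0 bM]] := walks_bound q1 al0 uen en_all uS fS S0 nS (frob 1%N) dQ (r 0%N isT) x0 y0 vX vY.
have up n := rational_places_bounds (@rational_places_le _ _ _ _ _ E_rec q1 al0 frob en uen en_all n).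
rewrite /tower_limit; under eq_fun do rewrite (genus_tower E_rec q1 al0 frob).
apply: (@ratio_limit _ q q1 (size S) (size en) M d _ _ M0) => [|n|n|n].
- by rewrite sS mulnCA -predn_exp.
- exact: (rational_places_ge E_rec q1 al0 frob uen en_all uS fS qk).
- by apply: leq_trans (up n).1 _; rewrite leq_add2l.
- exact: tower_genusE.
Qed.
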